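(* Let $\xi\in(0,1)$ and let $\nu$ be either a real number with $0\le\nu<\frac12$ or a purely imaginary number. Let $\mathsf{K}_{\nu,\xi}$ be the correlation kernel of the point process $\mathbf{P}_{\nu,\xi}$ on $\mathbb{Z}_{>0}$ (see context). Then for all $x,y\in\mathbb{Z}_{>0}$ $$\begin{aligned}\frac{\mathsf{g}(x)}{\mathsf{g}(y)}\mathsf{K}_{\nu,\xi}(x,y)={}&\frac{2\sqrt{xy}}{x+y}\,\frac1{(2\pi i)^2}\oint_{\{w_1\}}\oint_{\{w_2\}}\big(1-w_1\sqrt\xi\big)^{-\frac12+\nu}\Big(1-\frac{\sqrt\xi}{w_1}\Big)^{\frac12+\nu}\\&\times\big(1-w_2\sqrt\xi\big)^{-\frac12-\nu}\Big(1-\frac{\sqrt\xi}{w_2}\Big)^{\frac12-\nu}\frac{w_1^{-x}w_2^{-y}}{w_1w_2-1}\,dw_1dw_2\\&-\frac{\sqrt{xy}}{x+y}\,\frac{1-\xi}{(2\pi i)^2}\oint_{\{w_1\}}\oint_{\{w_2\}}\big(1-w_1\sqrt\xi\big)^{-\frac12+\nu}\Big(1-\frac{\sqrt\xi}{w_1}\Big)^{-\frac12+\nu}\\&\times\big(1-w_2\sqrt\xi\big)^{-\frac12-\nu}\Big(1-\frac{\sqrt\xi}{w_2}\Big)^{-\frac12-\nu}\frac{dw_1dw_2}{w_1^{x+1}w_2^{y+1}}.\end{aligned}$$ Here the contours $\{w_1\}$ and $\{w_2\}$ go around $0$ and $\sqrt\xi$ in the positive direction leaving $1/\sqrt\xi$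 outside. Moreover, in the first integral the contours satisfy the extra condition that the contour $\{w_1^{-1}\}$ lies in the interior of the contour $\{w_2\}$.
   Context: $\mathbb{Z}_{>0}=\{1,2,\dots\}$. $\mathbf{P}_{\nu,\xi}$ is the probability measure on finite subsets of $\mathbb{Z}_{>0}$ given by $$\mathbf{P}_{\nu,\xi}(\{x_1,\dots,x_N\})=\mathit{const}\cdot\prod_{1\le i<j\le N}\Big(\frac{x_i-x_j}{x_i+x_j}\Big)^2\prod_{i=1}^N\psi_{\nu,\xi}(x_i),\qquad \psi_{\nu,\xi}(x)=\frac{\xi^x\cos(\pi\nu)}{2\pi}\frac{\Gamma(\frac12-\nu+x)\Gamma(\frac12+\nu+x)}{(x!)^2},$$ where $\mathit{const}$ is the normalizing constant (empty products equal $1$). This process is determinantal, i.e. the probability that the random configuration contains a given finite set $\{x_1,\dots,x_n\}$ of distinct points is $\det[\mathsf{K}_{\nu,\xi}(x_i,x_j)]_{i,j=1}^n$, with correlation kernel $\mathsf{K}_{\nu,\xi}=\mathsf{L}_{\nu,\xi}(1+\mathsf{L}_{\nu,\xi})^{-1}$, where $\mathsf{L}_{\nu,\xi}$ is the trace class operator in $\ell^2(\mathbb{Z}_{>0})$ with matrix $\mathsf{L}_{\nu,\xi}(x,y)=\frac{2\sqrt{xy\,\psi_{\nu,\xi}(x)\psi_{\nu,\xi}(y)}}{x+y}$. For $x\in\mathbb{Z}$, $\mathsf{g}(x)=\frac{\sqrt{\Gamma(\frac12+\nu+x)\Gamma(\frac12-\nu+x)}}{\Gamma(\frac12+\nu+x)}$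 (the expression under the square root is positive). All complex powers are principal branches: $(1-w\sqrt\xi)^a$ is holomorphic off the cut $[1/\sqrt\xi,+\infty)$ and $(1-\sqrt\xi/w)^a$ is holomorphic off the cut $[0,\sqrt\xi]$. The contours are simple closed curves avoiding both cuts. *)

(* Defs.v *)
From Stdlib Require Export Reals Factorial.
From Stdlib Require Import ClassicalEpsilon.
From Coquelicot Require Export Coquelicot.

Local Open Scope C_scope.

Definition Cexp (z : C) : C := (exp (Re z) * cos (Im z), exp (Re z) * sin (Im z))%R.

Definition Ccos (z : C) : C := (Cexp (Ci * z) + Cexp (- (Ci * z))) / 2.

(** Principal argument, in (-PI, PI]; the value at 0 is irrelevant. *)
Definition Carg (z : C) : R :=
  if Rle_dec 0 (Im z) then acos (Re z / Cmod z) else (- acos (Re z / Cmod z))%R.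

Definition Clog (z : C) : C := (ln (Cmod z), Carg z).

(** Principal branch of [z ^ a]: holomorphic in [z] off the closed negative real axis. *)
Definition Cpower (z a : C) : C := Cexp (a * Clog z).

(** [rising z n = z (z + 1) ... (z + n)], with [n + 1] factors. *)
Fixpoint rising (z : C) (n : nat) : C :=
  match n with
  | O => z
  | S m => rising z m * (z + INR n)
  end.

(** The complex Gamma function, by the Euler-Gauss limit
    [n! n^z / (z (z + 1) ... (z + n))], which converges at every [z] that is not
    a pole. *)
Definition Gauss_seq (z : C) (n : nat) : C :=
  INR (fact n) * Cpower (INR n) z / rising z n.

Definition CGamma (z : C) : C :=
  (real (Lim_seq (fun n => Re (Gauss_seq z n))),
   real (Lim_seq (fun n => Im (Gauss_seq z n)))).

(** Curves are functions [R -> C] of which only the restriction to [[0, 1]] matters. *)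

Definition C1_path (h : R -> C) : Prop :=
  forall t : R,
    (ex_derive (fun s => Re (h s)) t /\ continuous (Derive (fun s => Re (h s))) t) /\
    (ex_derive (fun s => Im (h s)) t /\ continuous (Derive (fun s => Im (h s))) t).

(** Each piece is C^1 up to its end points, i.e. extends to a C^1 path on [R]. *)
Definition piecewise_C1 (gam : R -> C) : Prop :=
  exists (n : nat) (t : nat -> R),
    t 0%nat = 0%R /\ t n = 1%R /\
    (forall i, (i < n)%nat -> (t i < t (S i))%R) /\
    (forall i, (i < n)%nat ->
       exists h : R -> C, C1_path h /\
         forall s : R, (t i <= s <= t (S i))%R -> gam s = h s).

Definition simple_closed (gam : R -> C) : Prop :=
  gam 0%R = gam 1%R /\
  forall s t : R, (0 <= s < 1)%R -> (0 <= t < 1)%R -> gam s = gam t -> s = t.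

Definition path_velocity (gam : R -> C) (t : R) : C :=
  (Derive (fun s => Re (gam s)) t, Derive (fun s => Im (gam s)) t).

(** The values of the velocity at the finitely many break points do not affect
    the Riemann integral. *)
Definition contour_int (gam : R -> C) (f : C -> C) : C :=
  RInt (V := C_R_CompleteNormedModule) (fun t => f (gam t) * path_velocity gam t) 0 1.

Definition off_curve (gam : R -> C) (z : C) : Prop :=
  forall s : R, (0 <= s <= 1)%R -> gam s <> z.

(** [z] and [z'] lie in the same (path-)component of the complement of the curve. *)
Definition same_component (gam : R -> C) (z z' : C) : Prop :=
  exists p : R -> C,
    (forall t : R, continuous (T := R_UniformSpace) (U := C_UniformSpace) p t) /\
    p 0%R = z /\ p 1%R = z' /\
    (forall t : R, (0 <= t <= 1)%R -> off_curve gam (p t)).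

Definition bounded_component (gam : R -> C) (z : C) : Prop :=
  exists M : R, forall z' : C, same_component gam z z' -> (Cmod z' <= M)%R.

Definition inside (gam : R -> C) (z : C) : Prop :=
  off_curve gam z /\ bounded_component gam z.

Definition outside (gam : R -> C) (z : C) : Prop :=
  off_curve gam z /\ ~ bounded_component gam z.

Definition winding_number (gam : R -> C) (z : C) : C :=
  contour_int gam (fun w => / (w - z)) / (2 * PI * Ci).

Definition positively_oriented (gam : R -> C) : Prop :=
  forall z : C, inside gam z -> winding_number gam z = 1.

Definition avoids_cuts (xi : R) (gam : R -> C) : Prop :=
  forall a : R, (0 <= a <= sqrt xi)%R \/ (1 / sqrt xi <= a)%R -> off_curve gam a.

Definition admissible_contour (xi : R) (gam : R -> C) : Prop :=
  piecewise_C1 gam /\ simple_closed gam /\ positively_oriented gam /\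
  avoids_cuts xi gam /\
  inside gam 0 /\ inside gam (sqrt xi) /\ outside gam (1 / sqrt xi)%R.

(** The contour [{1 / w1}] lies in the interior of the contour [{w2}]. *)
Definition inverse_inside (gam1 gam2 : R -> C) : Prop :=
  forall t : R, (0 <= t <= 1)%R -> inside gam2 (/ gam1 t).

(** The Hilbert space of square summable complex functions on the positive
    integers; [Pos.of_succ_nat] enumerates [positive] increasingly from 1. *)

Definition sum_pos (f : positive -> C) : C :=
  (Series (fun n => Re (f (Pos.of_succ_nat n))),
   Series (fun n => Im (f (Pos.of_succ_nat n)))).

Definition ell2 (u : positive -> C) : Prop :=
  ex_series (fun n => (Cmod (u (Pos.of_succ_nat n)) ^ 2)%R).

Definition ell2_norm (u : positive -> C) : R :=
  sqrt (Series (fun n => (Cmod (u (Pos.of_succ_nat n)) ^ 2)%R)).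

Definition delta (y : positive) : positive -> C :=
  fun x => if Pos.eqb x y then 1 else 0.

(** Operators are total maps of which only the restriction to [ell2] matters. *)
Definition operator : Type := (positive -> C) -> positive -> C.

Definition bounded_linear (A : operator) : Prop :=
  (forall u, ell2 u -> ell2 (A u)) /\
  (forall (a : C) u v, ell2 u -> ell2 v ->
     forall x, A (fun y => a * u y + v y) x = a * A u x + A v x) /\
  (exists M : R, forall u, ell2 u -> (ell2_norm (A u) <= M * ell2_norm u)%R).

Definition matrix_op (M : positive -> positive -> C) : operator :=
  fun u x => sum_pos (fun y => M x y * u y).

Definition one_plus (A : operator) : operator := fun u x => u x + A u x.

Definition is_inverse (A B : operator) : Prop :=
  bounded_linear B /\
  forall u, ell2 u -> forall x, B (A u) x = u x /\ A (B u) x = u x.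

(** The inverse is unique on [ell2] when it exists. *)
Definition op_inverse (A : operator) : operator :=
  epsilon (inhabits (fun u => u)) (is_inverse A).

Definition matrix_entry (A : operator) (x y : positive) : C := A (delta y) x.

(** [psi] is real and positive for admissible parameters, so that taking its
    real part in [L_kernel] only changes the type; likewise for the radicand in
    [g_factor]. *)
Definition psi (nu : C) (xi : R) (x : positive) : C :=
  xi ^ Pos.to_nat x * Ccos (PI * nu) / (2 * PI) *
  (CGamma (/ 2 - nu + IZR (Zpos x)) * CGamma (/ 2 + nu + IZR (Zpos x)) /
   INR (fact (Pos.to_nat x)) ^ 2).

Definition L_kernel (nu : C) (xi : R) (x y : positive) : R :=
  (2 * sqrt (IZR (Zpos x) * IZR (Zpos y) * Re (psi nu xi x) * Re (psi nu xi y)) /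
   (IZR (Zpos x) + IZR (Zpos y)))%R.

Definition L_op (nu : C) (xi : R) : operator :=
  matrix_op (fun x y => RtoC (L_kernel nu xi x y)).

Definition K_op (nu : C) (xi : R) : operator :=
  fun u => L_op nu xi (op_inverse (one_plus (L_op nu xi)) u).

(** The correlation kernel [L (1 + L)^(-1)] of the L-ensemble on finite subsets
    of the positive integers whose weights are [det [L(x_i, x_j)]]; by the Cauchy
    determinant identity these are
    [prod_(i < j) ((x_i - x_j) / (x_i + x_j))^2 * prod_i psi x_i]. *)
Definition K_kernel (nu : C) (xi : R) (x y : positive) : C :=
  matrix_entry (K_op nu xi) x y.

Definition g_factor (nu : C) (x : Z) : C :=
  sqrt (Re (CGamma (/ 2 + nu + IZR x) * CGamma (/ 2 - nu + IZR x))) /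
  CGamma (/ 2 + nu + IZR x).

(* Main.v *)
Require Import Defs.
From Stdlib Require Import Reals Lra Lia FunctionalExtensionality ClassicalEpsilon Classical.
From Coquelicot Require Import Coquelicot.

Local Open Scope C_scope.

(** Put [c = 1/2 - nu], [d = 1/2 + nu], [s = sqrt xi], and let [p_n], [q_n] be the coefficients of
    [(1 - z)^(-c)] and [(1 - z)^(-d)] ([binc]). The functional equation of Gamma and the reflection
    formula [Gamma (c) Gamma (d) cos (pi nu) = pi] give [psi x = xi^x p_x q_x / 2]. Hence conjugation
    by [g] turns [L] into the matrix
      [sqrt (x y) s^(x + y) p_x q_y / (x + y)],
    and the theorem asserts that the same conjugation turns [K] into
      [sqrt (x y) s^(x + y) T (x, y) / (x + y)],   [T = 2 S - (1 - xi) a_x b_y].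
    Here [s^x a_x] and [s^y b_y] are the single contour integrals, which are Fourier coefficients, so
    that [a_x] is the power series [sum p_(x + i) p_i xi^i] ([lcoef]); and the double integral is
    [s^(x + y) S] with
      [S = sum_(m >= 0) xi^m A_(x + m) B_(y + m)],   [A_x = a_x - xi a_(x + 1)],
    and [B] defined likewise from [b].

    The matrix identity [L = K + L K] is proved coefficientwise in the ring of formal power series in
    [xi]. Two facts carry it. Differentiation in [s] makes the candidate kernel a product:
    [s d/ds] of [s^(x + y) T] is [(x + y) (1 - xi) s^(x + y) a_x b_y] ([kerT_weight]), because the sum
    over [m] telescopes. And the vector [a] solves a linear equation with the kernel [L]
    ([lcoef_equation]), which coefficientwise is a partial fraction expansion. Applied to the
    differentiated equation, they show that the defect of [L = K + L K] solves a homogeneous linear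
    equation in which each coefficient depends on those of lower order; so it vanishes
    ([defect_zero]). Absolute convergence transfers the identity to numbers. By the symmetry
    [nu -> - nu] also [L = K + K L], hence [1 - K] is the bounded inverse of [1 + L], and the
    operator [L (1 + L)^(-1)] has the matrix [K] ([matrix_entry_resolvent]).

    The reflection formula comes from the integrals of [cos (2 nu t) cos^m t] over [[0, pi/2]]: their
    recursion in [m] expresses them by the products in the Euler-Gauss limits, and for large [m]
    they are asymptotic to the Wallis integrals ([gamma_reflection]).

    For the contour integrals, the integrands are of the form [phi (w) psi (1 / w)] with [phi] and [psi]
    holomorphic off the ray [[1 / s, +oo)]. Such a product is [P (w) + N (1 / w) / w] with [P] and [N]
    again holomorphic off the ray ([laurent_decomposition]): the Laurent series defines them in a
    disc and the product continues them. The complement of the ray is star-shaped about [0], so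
    holomorphic functions have primitives on it ([star_primitive_cderiv]). Together with the removable
    singularities of difference quotients this evaluates residues ([cint_residue]) and Cauchy
    integrals ([cint_cauchy]) on every closed path with the right winding numbers. In the double
    integral the inner one is a Cauchy integral at [1 / w1], and the outer one is then a residue. *)

(** * Finite and absolutely convergent sums of complex numbers *)

Fixpoint csum (f : nat -> C) (n : nat) : C :=
  match n with O => 0 | S m => csum f m + f m end.

Fixpoint rsum (f : nat -> R) (n : nat) : R :=
  match n with O => 0%R | S m => (rsum f m + f m)%R end.

Lemma csum_ext f g n : (forall k, (k < n)%nat -> f k = g k) -> csum f n = csum g n.
Proof.
  induction n as [|n IH]; intros H; simpl; [reflexivity|].
  rewrite IH, H by (intros; try apply H; lia). reflexivity.
Qed.

Lemma csum_S f n : csum f (S n) = csum f n + f n.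
Proof. reflexivity. Qed.

Lemma csum_plus f g n : csum (fun k => f k + g k) n = csum f n + csum g n.
Proof. induction n as [|n IH]; simpl; [ring|]. rewrite IH; ring. Qed.

Lemma csum_minus f g n : csum (fun k => f k - g k) n = csum f n - csum g n.
Proof. induction n as [|n IH]; simpl; [ring|]. rewrite IH; ring. Qed.

Lemma csum_scal c f n : csum (fun k => c * f k) n = c * csum f n.
Proof. induction n as [|n IH]; simpl; [ring|]. rewrite IH; ring. Qed.

Lemma csum_scal_r c f n : csum (fun k => f k * c) n = csum f n * c.
Proof. induction n as [|n IH]; simpl; [ring|]. rewrite IH; ring. Qed.

Lemma csum_zero (f : nat -> C) n : (forall k, (k < n)%nat -> f k = 0) -> csum f n = 0.
Proof.
  induction n as [|n IH]; intros H; simpl; [reflexivity|].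
  rewrite IH, H by (intros; try apply H; lia). ring.
Qed.

Lemma csum_S_l f n : csum f (S n) = f O + csum (fun k => f (S k)) n.
Proof.
  induction n as [|n IH]; [simpl; ring|].
  change (csum f (S (S n))) with (csum f (S n) + f (S n)).
  rewrite IH. simpl. ring.
Qed.

Lemma csum_app f n m : csum f (n + m) = csum f n + csum (fun k => f (n + k)%nat) m.
Proof.
  induction m as [|m IH]; [rewrite Nat.add_0_r; simpl; ring|].
  rewrite Nat.add_succ_r. simpl. rewrite IH. ring.
Qed.

Lemma csum_swap (f : nat -> nat -> C) n m :
  csum (fun i => csum (fun j => f i j) m) n = csum (fun j => csum (fun i => f i j) n) m.
Proof.
  induction n as [|n IH]; simpl.
  - rewrite csum_zero; [reflexivity|auto].
  - rewrite IH, csum_plus. reflexivity.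
Qed.

Lemma csum_rev f n : csum f n = csum (fun k => f (n - 1 - k)%nat) n.
Proof.
  induction n as [|n IH]; [reflexivity|].
  rewrite (csum_S_l (fun k => f (S n - 1 - k)%nat)). cbn [csum]. rewrite IH, Cplus_comm. f_equal.
  - f_equal. lia.
  - apply csum_ext. intros k Hk. f_equal. lia.
Qed.

Lemma csum_triangle (f : nat -> nat -> C) n :
  csum (fun i => csum (fun j => f i j) (n - i)) n =
  csum (fun j => csum (fun i => f i j) (n - j)) n.
Proof.
  assert (E : forall g : nat -> nat -> C,
    csum (fun i => csum (fun j => g i j) (n - i)) n =
    csum (fun i => csum (fun j => if Nat.ltb (i + j) n then g i j else 0) n) n).
  { intros g. apply csum_ext. intros i Hi.
    transitivity (csum (fun j => if Nat.ltb (i + j) n then g i j else 0) ((n - i) + i));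
      [|f_equal; lia].
    rewrite csum_app.
    rewrite (csum_zero (fun k => if Nat.ltb (i + (n - i + k)) n
      then g i (n - i + k)%nat else RtoC 0)).
    - rewrite Cplus_0_r. apply csum_ext. intros k Hk.
      replace (Nat.ltb (i + k) n) with true; [reflexivity|].
      symmetry. apply Nat.ltb_lt. lia.
    - intros k Hk. replace (Nat.ltb _ n) with false; [reflexivity|].
      symmetry. apply Nat.ltb_ge. lia. }
  rewrite E, (E (fun j i => f i j)), csum_swap.
  apply csum_ext. intros j _. apply csum_ext. intros i _. rewrite Nat.add_comm. reflexivity.
Qed.

Lemma rsum_ext f g n : (forall k, (k < n)%nat -> f k = g k) -> rsum f n = rsum g n.
Proof.
  induction n as [|n IH]; intros H; simpl; [reflexivity|].
  rewrite IH, H by (intros; try apply H; lia). reflexivity.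
Qed.

Lemma rsum_le f g n :
  (forall k, (k < n)%nat -> (f k <= g k)%R) -> (rsum f n <= rsum g n)%R.
Proof.
  induction n as [|n IH]; intros H; simpl; [lra|].
  apply Rplus_le_compat; [apply IH; intros|]; apply H; lia.
Qed.

Lemma rsum_pos f n : (forall k, (0 <= f k)%R) -> (0 <= rsum f n)%R.
Proof. intros H. induction n; simpl; [lra|]. specialize (H n). lra. Qed.

Lemma rsum_scal c f n : rsum (fun k => c * f k)%R n = (c * rsum f n)%R.
Proof. induction n as [|n IH]; simpl; [ring|]. rewrite IH; ring. Qed.

Lemma rsum_plus f g n : rsum (fun k => f k + g k)%R n = (rsum f n + rsum g n)%R.
Proof. induction n as [|n IH]; simpl; [ring|]. rewrite IH; ring. Qed.

Lemma rsum_app f n m : rsum f (n + m) = (rsum f n + rsum (fun k => f (n + k)%nat) m)%R.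
Proof.
  induction m as [|m IH]; [rewrite Nat.add_0_r; simpl; ring|].
  rewrite Nat.add_succ_r. simpl. rewrite IH. ring.
Qed.

Lemma rsum_mono f n m :
  (forall k, (0 <= f k)%R) -> (n <= m)%nat -> (rsum f n <= rsum f m)%R.
Proof.
  intros H L. replace m with (n + (m - n))%nat by lia. rewrite rsum_app.
  pose proof (rsum_pos (fun k => f (n + k)%nat) (m - n) (fun k => H _)). lra.
Qed.

Lemma rsum_swap (f : nat -> nat -> R) n m :
  rsum (fun i => rsum (fun j => f i j) m) n = rsum (fun j => rsum (fun i => f i j) n) m.
Proof.
  induction n as [|n IH]; simpl.
  - induction m as [|m IHm]; simpl; [reflexivity|]. rewrite <- IHm. ring.
  - rewrite IH, rsum_plus. reflexivity.
Qed.

Lemma Cmod_csum f n : (Cmod (csum f n) <= rsum (fun k => Cmod (f k)) n)%R.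
Proof.
  induction n as [|n IH]; simpl; [rewrite Cmod_0; lra|].
  eapply Rle_trans; [apply Cmod_triangle|]. lra.
Qed.

Definition csums (f : nat -> C) (l : C) : Prop :=
  forall eps : R, (0 < eps)%R ->
  exists N, forall n, (N <= n)%nat -> (Cmod (csum f n - l) < eps)%R.

Definition CSum (f : nat -> C) : C :=
  (Series (fun n => Re (f n)), Series (fun n => Im (f n))).

Definition summable (f : nat -> C) : Prop :=
  exists M, forall n, (rsum (fun k => Cmod (f k)) n <= M)%R.

Lemma im_le_Cmod (z : C) : (Rabs (Im z) <= Cmod z)%R.
Proof. eapply Rle_trans; [|apply Rmax_Cmod]. apply Rmax_r. Qed.

Lemma Cmod_le_re_im (z : C) : (Cmod z <= Rabs (Re z) + Rabs (Im z))%R.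
Proof.
  destruct z as [a b]. simpl.
  replace (a, b) with (RtoC a + Ci * RtoC b).
  - eapply Rle_trans; [apply Cmod_triangle|].
    rewrite Cmod_mult, Cmod_Ci, !Cmod_R. lra.
  - unfold Cplus, Cmult, Ci, RtoC; simpl. f_equal; ring.
Qed.

Lemma Re_csum f n : Re (csum f n) = rsum (fun k => Re (f k)) n.
Proof. induction n as [|n IH]; simpl; [reflexivity|]. rewrite <- IH. reflexivity. Qed.

Lemma Im_csum f n : Im (csum f n) = rsum (fun k => Im (f k)) n.
Proof. induction n as [|n IH]; simpl; [reflexivity|]. rewrite <- IH. reflexivity. Qed.

Lemma sum_n_rsum (f : nat -> R) n : sum_n f n = rsum f (S n).
Proof.
  induction n as [|n IH].
  - rewrite sum_O. simpl. ring.
  - rewrite sum_Sn, IH. reflexivity.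
Qed.

Lemma is_series_rsum (f : nat -> R) (l : R) :
  is_series f l <->
  (forall eps : R, (0 < eps)%R ->
   exists N, forall n, (N <= n)%nat -> (Rabs (rsum f n - l) < eps)%R).
Proof.
  split.
  - intros H eps He.
    assert (H' : is_lim_seq (sum_n f) l) by exact H.
    apply is_lim_seq_spec in H'. destruct (H' (mkposreal _ He)) as [N HN].
    exists (S N). intros [|n] Hn; [lia|]. rewrite <- sum_n_rsum. apply HN. lia.
  - intros H.
    assert (H' : is_lim_seq (sum_n f) l).
    { apply is_lim_seq_spec. intros eps. destruct (H eps (cond_pos eps)) as [N HN].
      exists N. intros n Hn. rewrite sum_n_rsum. apply HN. lia. }
    exact H'.
Qed.

Lemma csums_CSum f l : csums f l -> CSum f = l.
Proof.
  intros H. unfold CSum. rewrite (surjective_pairing l). f_equal; apply is_series_unique;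
    apply is_series_rsum; intros eps He; destruct (H eps He) as [N HN]; exists N;
    intros n Hn; (eapply Rle_lt_trans; [|apply (HN n Hn)]).
  - rewrite <- Re_csum. apply (re_le_Cmod (csum f n - l)).
  - rewrite <- Im_csum. apply (im_le_Cmod (csum f n - l)).
Qed.

Lemma ex_series_bounded (f : nat -> R) M :
  (forall k, (0 <= f k)%R) -> (forall n, (rsum f n <= M)%R) -> ex_series f.
Proof.
  intros H B.
  destruct (ex_finite_lim_seq_incr (sum_n f) M) as [l Hl].
  - intros n. rewrite !sum_n_rsum. simpl. specialize (H (S n)). lra.
  - intros n. rewrite sum_n_rsum. apply B.
  - exists l. exact Hl.
Qed.

Lemma summable_csums f : summable f -> csums f (CSum f).
Proof.
  intros [M HM] eps He.
  assert (ex : forall g : nat -> R, (forall k, (Rabs (g k) <= Cmod (f k))%R) -> ex_series g).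
  { intros g Hg. apply ex_series_Rabs. apply (ex_series_bounded _ M).
    - intros k. apply Rabs_pos.
    - intros n. eapply Rle_trans; [|apply (HM n)]. apply rsum_le. intros; apply Hg. }
  pose proof (Series_correct _ (ex (fun k => Re (f k)) (fun k => re_le_Cmod _))) as H1.
  pose proof (Series_correct _ (ex (fun k => Im (f k)) (fun k => im_le_Cmod _))) as H2.
  destruct (proj1 (is_series_rsum _ _) H1 (eps / 2)%R ltac:(lra)) as [N1 HN1].
  destruct (proj1 (is_series_rsum _ _) H2 (eps / 2)%R ltac:(lra)) as [N2 HN2].
  exists (N1 + N2)%nat. intros n Hn.
  eapply Rle_lt_trans; [apply Cmod_le_re_im|].
  specialize (HN1 n ltac:(lia)). specialize (HN2 n ltac:(lia)).
  rewrite <- Re_csum in HN1. rewrite <- Im_csum in HN2.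
  change (Re (csum f n - CSum f)) with (Re (csum f n) - Series (fun k => Re (f k)))%R.
  change (Im (csum f n - CSum f)) with (Im (csum f n) - Series (fun k => Im (f k)))%R.
  lra.
Qed.

Lemma csums_unique f l l' : csums f l -> csums f l' -> l = l'.
Proof. intros H H'. rewrite <- (csums_CSum _ _ H). apply csums_CSum. exact H'. Qed.

Lemma CSum_ext f g : (forall n, f n = g n) -> CSum f = CSum g.
Proof. intros H. f_equal. apply functional_extensionality. exact H. Qed.

Lemma csums_plus f g l m : csums f l -> csums g m -> csums (fun k => f k + g k) (l + m).
Proof.
  intros Hf Hg eps He.
  destruct (Hf (eps / 2)%R ltac:(lra)) as [N1 H1].
  destruct (Hg (eps / 2)%R ltac:(lra)) as [N2 H2].
  exists (N1 + N2)%nat. intros n Hn. rewrite csum_plus.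
  replace (csum f n + csum g n - (l + m)) with ((csum f n - l) + (csum g n - m)) by ring.
  eapply Rle_lt_trans; [apply Cmod_triangle|].
  specialize (H1 n ltac:(lia)). specialize (H2 n ltac:(lia)). lra.
Qed.

Lemma csums_scal c f l : csums f l -> csums (fun k => c * f k) (c * l).
Proof.
  intros Hf eps He.
  assert (Hc : (0 < Cmod c + 1)%R) by (pose proof (Cmod_ge_0 c); lra).
  destruct (Hf (eps / (Cmod c + 1))%R) as [N H].
  { apply Rdiv_lt_0_compat; lra. }
  exists N. intros n Hn. rewrite csum_scal.
  replace (c * csum f n - c * l) with (c * (csum f n - l)) by ring.
  rewrite Cmod_mult. specialize (H n Hn).
  apply Rle_lt_trans with ((Cmod c + 1) * Cmod (csum f n - l))%R.
  - pose proof (Cmod_ge_0 (csum f n - l)). nra.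
  - apply (Rmult_lt_compat_l (Cmod c + 1)) in H; [|lra].
    replace ((Cmod c + 1) * (eps / (Cmod c + 1)))%R with eps in H by (field; lra). exact H.
Qed.

Lemma csums_shift f l k : csums f l -> csums (fun n => f (k + n)%nat) (l - csum f k).
Proof.
  intros H eps He. destruct (H eps He) as [N HN]. exists N. intros n Hn.
  specialize (HN (k + n)%nat ltac:(lia)). rewrite csum_app in HN.
  replace (csum (fun n => f (k + n)%nat) n - (l - csum f k))
    with (csum f k + csum (fun n => f (k + n)%nat) n - l) by ring. exact HN.
Qed.

Lemma csums_finite (f : nat -> C) N : (forall n, (N <= n)%nat -> f n = 0) -> csums f (csum f N).
Proof.
  intros H eps He. exists N. intros n Hn.
  replace n with (N + (n - N))%nat by lia. rewrite csum_app.
  rewrite (csum_zero (fun k => f (N + k)%nat)) by (intros; apply H; lia).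
  replace (csum f N + 0 - csum f N) with (RtoC 0) by ring. rewrite Cmod_0. exact He.
Qed.

Lemma Cmod_lim_le f l B :
  csums f l -> (forall n, (Cmod (csum f n) <= B)%R) -> (Cmod l <= B)%R.
Proof.
  intros H HB. apply Rnot_lt_le. intros Hlt.
  destruct (H (Cmod l - B)%R ltac:(lra)) as [N HN]. specialize (HN N (le_n _)).
  specialize (HB N).
  pose proof (Cmod_triangle (csum f N) (l - csum f N)) as T.
  replace (csum f N + (l - csum f N)) with l in T by ring.
  replace (csum f N - l) with (- (l - csum f N)) in HN by ring.
  rewrite Cmod_opp in HN. lra.
Qed.

Lemma Cmod_CSum_le f M :
  (forall n, (rsum (fun k => Cmod (f k)) n <= M)%R) -> (Cmod (CSum f) <= M)%R.
Proof.
  intros H. apply (Cmod_lim_le f); [apply summable_csums; exists M; exact H|].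
  intros n. eapply Rle_trans; [apply Cmod_csum|apply H].
Qed.

Lemma summable_le f g :
  (forall k, (Cmod (f k) <= Cmod (g k))%R) -> summable g -> summable f.
Proof.
  intros H [M HM]. exists M. intros n. eapply Rle_trans; [|apply HM].
  apply rsum_le. intros; apply H.
Qed.

Lemma summable_plus f g : summable f -> summable g -> summable (fun k => f k + g k).
Proof.
  intros [M HM] [N HN]. exists (M + N)%R. intros n.
  eapply Rle_trans; [|apply Rplus_le_compat; [apply HM|apply HN]].
  rewrite <- rsum_plus. apply rsum_le. intros. apply Cmod_triangle.
Qed.

Lemma summable_scal c f : summable f -> summable (fun k => c * f k).
Proof.
  intros [M HM]. exists (Cmod c * M)%R. intros n.
  rewrite (rsum_ext _ (fun k => Cmod c * Cmod (f k))%R) by (intros; apply Cmod_mult).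
  rewrite rsum_scal. apply Rmult_le_compat_l; [apply Cmod_ge_0|apply HM].
Qed.

Lemma summable_S f : summable f -> summable (fun k => f (S k)).
Proof.
  intros [M HM]. exists M. intros n. eapply Rle_trans; [|apply (HM (1 + n)%nat)].
  rewrite rsum_app. cbn [rsum]. pose proof (Cmod_ge_0 (f O)). simpl (_ + _)%nat. lra.
Qed.

Lemma CSum_plus f g :
  summable f -> summable g -> CSum (fun k => f k + g k) = CSum f + CSum g.
Proof. intros Hf Hg. apply csums_CSum, csums_plus; apply summable_csums; assumption. Qed.

Lemma CSum_scal c f : summable f -> CSum (fun k => c * f k) = c * CSum f.
Proof. intros Hf. apply csums_CSum, csums_scal, summable_csums. exact Hf. Qed.

Lemma rsum_geom_le (r : R) n : (0 <= r < 1)%R -> (rsum (fun k => r ^ k)%R n <= / (1 - r))%R.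
Proof.
  intros Hr.
  assert (E : rsum (fun k => r ^ k)%R n = ((1 - r ^ n) * / (1 - r))%R).
  { induction n as [|n IH]; simpl; [field; lra|]. rewrite IH. field. lra. }
  rewrite E. rewrite <- (Rmult_1_l (/ (1 - r))) at 2.
  apply Rmult_le_compat_r; [left; apply Rinv_0_lt_compat; lra|].
  pose proof (pow_le r n (proj1 Hr)). lra.
Qed.

Lemma summable_geom (r : R) : (0 <= r < 1)%R -> summable (fun k => RtoC (r ^ k)).
Proof.
  intros Hr. exists (/ (1 - r))%R. intros n.
  eapply Rle_trans; [|apply (rsum_geom_le r n Hr)]. right.
  apply rsum_ext. intros k _. rewrite Cmod_R. apply Rabs_pos_eq, pow_le, Hr.
Qed.

(** ** Double series *)

Definition summable2 (f : nat -> nat -> C) : Prop :=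
  exists M, forall I J, (rsum (fun i => rsum (fun j => Cmod (f i j)) J) I <= M)%R.

Lemma summable2_swap f : summable2 f -> summable2 (fun j i => f i j).
Proof. intros [M H]. exists M. intros I J. rewrite rsum_swap. apply H. Qed.

Lemma summable2_row f i : summable2 f -> summable (f i).
Proof.
  intros [M H]. exists M. intros J. eapply Rle_trans; [|apply (H (S i) J)]. simpl.
  pose proof (rsum_pos (fun i => rsum (fun j => Cmod (f i j)) J) i
    (fun i => rsum_pos _ J (fun j => Cmod_ge_0 _))). lra.
Qed.

Lemma summable2_col f j : summable2 f -> summable (fun i => f i j).
Proof. intros H. apply (summable2_row (fun j i => f i j)), summable2_swap, H. Qed.

Lemma rsum_CSum_le f M I :
  (forall I J, (rsum (fun i => rsum (fun j => Cmod (f i j)) J) I <= M)%R) ->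
  (rsum (fun i => Cmod (CSum (f i))) I <= M)%R.
Proof.
  intros HM.
  assert (R : forall i, summable (f i)) by (intros i; apply summable2_row; exists M; exact HM).
  apply Rnot_lt_le. intros Hlt.
  set (e := ((rsum (fun i => Cmod (CSum (f i))) I - M) / INR (S I))%R).
  assert (He : (0 < e)%R).
  { apply Rdiv_lt_0_compat; [lra|]. apply lt_0_INR. lia. }
  assert (A : forall I, exists J, (rsum (fun i => Cmod (CSum (f i))) I <=
     rsum (fun i => rsum (fun j => Cmod (f i j)) J) I + INR I * e)%R).
  { clear Hlt. intros I'. clearbody e. induction I' as [|n IH].
    - exists O. simpl. lra.
    - destruct IH as [J HJ]. destruct (summable_csums _ (R n) e He) as [N HN].
      exists (J + N)%nat. specialize (HN (J + N)%nat ltac:(lia)).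
      cbn [rsum].
      assert (H1 : (Cmod (CSum (f n)) <= rsum (fun j => Cmod (f n j)) (J + N) + e)%R).
      { pose proof (Cmod_csum (f n) (J + N)) as T1.
        pose proof (Cmod_triangle (csum (f n) (J + N)) (CSum (f n) - csum (f n) (J + N))) as T.
        replace (csum (f n) (J + N) + (CSum (f n) - csum (f n) (J + N))) with (CSum (f n)) in T by ring.
        replace (csum (f n) (J + N) - CSum (f n)) with (- (CSum (f n) - csum (f n) (J + N))) in HN by ring.
        rewrite Cmod_opp in HN. lra. }
      assert (H2 : (rsum (fun i => rsum (fun j => Cmod (f i j)) J) n <=
         rsum (fun i => rsum (fun j => Cmod (f i j)) (J + N)) n)%R).
      { apply rsum_le. intros k _. apply rsum_mono; [intros; apply Cmod_ge_0|lia]. }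
      rewrite S_INR. lra. }
  destruct (A I) as [J HJ]. specialize (HM I J).
  assert (INR I * e < rsum (fun i => Cmod (CSum (f i))) I - M)%R; [|lra].
  unfold e. apply Rmult_lt_reg_r with (INR (S I)); [apply lt_0_INR; lia|].
  unfold Rdiv. rewrite Rmult_assoc, Rmult_assoc, Rinv_l, S_INR by (apply not_0_INR; lia).
  nra.
Qed.

Lemma summable2_sums f : summable2 f -> summable (fun i => CSum (f i)).
Proof. intros [M HM]. exists M. intros I. apply rsum_CSum_le. exact HM. Qed.

(** Larger rectangles add only terms whose moduli sum to at most [e]; the bound then survives the
    two limits that lead to the iterated sum. *)
Lemma rect_close f M I0 J0 e :
  (forall I J, (rsum (fun i => rsum (fun j => Cmod (f i j)) J) I <= M)%R) ->
  (M - e <= rsum (fun i => rsum (fun j => Cmod (f i j)) J0) I0)%R ->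
  forall I J, (I0 <= I)%nat -> (J0 <= J)%nat ->
  (Cmod (csum (fun i => csum (fun j => f i j) J) I -
         csum (fun i => csum (fun j => f i j) J0) I0) <= e)%R.
Proof.
  intros HM H0 I J HI HJ.
  apply Rle_trans with (rsum (fun i => rsum (fun j => Cmod (f i j)) J) I -
     rsum (fun i => rsum (fun j => Cmod (f i j)) J0) I0)%R; [|specialize (HM I J); lra].
  replace I with (I0 + (I - I0))%nat by lia. rewrite csum_app, rsum_app.
  set (X := csum _ (I - I0)). set (Y := rsum _ (I - I0)).
  assert (HX : (Cmod X <= Y)%R).
  { unfold X, Y. eapply Rle_trans; [apply Cmod_csum|]. apply rsum_le. intros. apply Cmod_csum. }
  rewrite (csum_ext (fun i => csum (fun j => f i j) J)
    (fun i => csum (fun j => f i j) J0 + csum (fun j => f i (J0 + j)%nat) (J - J0))).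
  2:{ intros k _. rewrite <- csum_app. f_equal. lia. }
  rewrite (rsum_ext (fun i => rsum (fun j => Cmod (f i j)) J)
    (fun i => rsum (fun j => Cmod (f i j)) J0 + rsum (fun j => Cmod (f i (J0 + j)%nat)) (J - J0))%R).
  2:{ intros k _. rewrite <- (rsum_app (fun j => Cmod (f k j))). f_equal. lia. }
  rewrite csum_plus, rsum_plus.
  set (U := csum (fun i => csum (fun j => f i (J0 + j)%nat) (J - J0)) I0).
  set (V := rsum (fun i => rsum (fun j => Cmod (f i (J0 + j)%nat)) (J - J0)) I0).
  assert (HU : (Cmod U <= V)%R).
  { unfold U, V. eapply Rle_trans; [apply Cmod_csum|]. apply rsum_le. intros. apply Cmod_csum. }
  match goal with |- (Cmod (?A + U + X - ?A) <= ?B + V + Y - ?B)%R =>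
    replace (A + U + X - A) with (U + X) by ring end.
  eapply Rle_trans; [apply Cmod_triangle|]. lra.
Qed.

Lemma rows_close f M I0 J0 e :
  (forall I J, (rsum (fun i => rsum (fun j => Cmod (f i j)) J) I <= M)%R) ->
  (M - e <= rsum (fun i => rsum (fun j => Cmod (f i j)) J0) I0)%R ->
  (Cmod (CSum (fun i => CSum (f i)) - csum (fun i => csum (fun j => f i j) J0) I0) <= e)%R.
Proof.
  intros HM H0.
  assert (S2 : summable2 f) by (exists M; exact HM).
  set (Q := csum (fun i => csum (fun j => f i j) J0) I0).
  assert (A : forall I, (I0 <= I)%nat -> (Cmod (csum (fun i => CSum (f i)) I - Q) <= e)%R).
  { intros I HI.
    assert (L : csums (fun j => csum (fun i => f i j) I) (csum (fun i => CSum (f i)) I)).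
    { clear - S2. induction I as [|n IH]; simpl.
      - intros eps He. exists O. intros n _. rewrite csum_zero by auto.
        replace (0 - 0) with (RtoC 0) by ring. rewrite Cmod_0. exact He.
      - apply csums_plus; [exact IH|]. apply summable_csums, summable2_row, S2. }
    apply Rnot_lt_le. intros Hlt.
    destruct (L (Cmod (csum (fun i => CSum (f i)) I - Q) - e)%R ltac:(lra)) as [N HN].
    specialize (HN (J0 + N)%nat ltac:(lia)). rewrite <- csum_swap in HN.
    pose proof (rect_close f M I0 J0 e HM H0 I (J0 + N)%nat HI ltac:(lia)) as B. fold Q in B.
    set (u := csum (fun i => CSum (f i)) I) in *.
    set (v := csum (fun i => csum (fun j => f i j) (J0 + N)) I) in *.
    pose proof (Cmod_triangle (v - Q) (u - v)) as T.
    replace (v - Q + (u - v)) with (u - Q) in T by ring.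
    replace (v - u) with (- (u - v)) in HN by ring. rewrite Cmod_opp in HN. lra. }
  apply Rnot_lt_le. intros Hlt.
  destruct (summable_csums _ (summable2_sums f S2)
    (Cmod (CSum (fun i => CSum (f i)) - Q) - e)%R ltac:(lra)) as [N HN].
  specialize (HN (I0 + N)%nat ltac:(lia)). specialize (A (I0 + N)%nat ltac:(lia)).
  set (u := CSum _) in *. set (v := csum _ (I0 + N)) in *.
  pose proof (Cmod_triangle (v - Q) (u - v)) as T.
  replace (v - Q + (u - v)) with (u - Q) in T by ring.
  replace (v - u) with (- (u - v)) in HN by ring. rewrite Cmod_opp in HN. lra.
Qed.

(** Both iterated sums stay within [e] of every rectangular partial sum that misses less than
    [e] of the total mass of the moduli. *)
Theorem CSum_swap f :
  summable2 f -> CSum (fun i => CSum (fun j => f i j)) = CSum (fun j => CSum (fun i => f i j)).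
Proof.
  intros [M0 HM0].
  destruct (completeness (fun v => exists I J, v = rsum (fun i => rsum (fun j => Cmod (f i j)) J) I))
    as [M [HM1 HM2]].
  - exists M0. intros v (I & J & ->). apply HM0.
  - exists 0%R. exists O, O. reflexivity.
  - assert (HM : forall I J, (rsum (fun i => rsum (fun j => Cmod (f i j)) J) I <= M)%R).
    { intros I J. apply HM1. exists I, J. reflexivity. }
    apply Ceq_minus. apply Cmod_eq_0. apply Rle_antisym; [|apply Cmod_ge_0].
    apply Rnot_lt_le. intros Hlt.
    set (d := Cmod (CSum (fun i => CSum (fun j => f i j)) - CSum (fun j => CSum (fun i => f i j)))) in *.
    assert (exists I J, (M - d / 3 <= rsum (fun i => rsum (fun j => Cmod (f i j)) J) I)%R)
      as (I & J & HIJ).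
    { apply NNPP. intros N. assert (M <= M - d / 3)%R; [|lra].
      apply HM2. intros v (I & J & ->). apply Rnot_lt_le. intros H. apply N.
      exists I, J. lra. }
    pose proof (rows_close f M I J (d / 3) HM HIJ) as A.
    pose proof (rows_close (fun j i => f i j) M J I (d / 3)
      ltac:(intros; rewrite rsum_swap; apply HM) ltac:(rewrite rsum_swap; exact HIJ)) as B.
    rewrite csum_swap in B.
    set (Q := csum _ I) in *.
    set (u := CSum (fun i => CSum (fun j => f i j))) in *.
    set (v := CSum (fun j => CSum (fun i => f i j))) in *.
    change (CSum (fun i => CSum (f i))) with u in A.
    pose proof (Cmod_triangle (u - Q) (- (v - Q))) as T. rewrite Cmod_opp in T.
    replace (u - Q + - (v - Q)) with (u - v) in T by ring. fold d in T. lra.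
Qed.

Lemma summable2_le f g :
  (forall i j, (Cmod (f i j) <= Cmod (g i j))%R) -> summable2 g -> summable2 f.
Proof.
  intros H [M HM]. exists M. intros I J. eapply Rle_trans; [|apply (HM I J)].
  apply rsum_le. intros. apply rsum_le. intros. apply H.
Qed.

Lemma summable2_prod f g : summable f -> summable g -> summable2 (fun i j => f i * g j).
Proof.
  intros [M HM] [N HN]. exists (M * N)%R. intros I J.
  rewrite (rsum_ext _ (fun i => rsum (fun j => Cmod (g j)) J * Cmod (f i))%R).
  - rewrite rsum_scal, Rmult_comm.
    apply Rmult_le_compat; try apply rsum_pos; try (intros; apply Cmod_ge_0); [apply HM|apply HN].
  - intros i _. rewrite Rmult_comm, <- rsum_scal. apply rsum_ext. intros. apply Cmod_mult.
Qed.

Definition shear (f : nat -> nat -> C) (i n : nat) : C :=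
  if Nat.leb i n then f i (n - i)%nat else 0.

Lemma shear_lt f i n : (n < i)%nat -> shear f i n = 0.
Proof. intros H. unfold shear. apply Nat.leb_gt in H. rewrite H. reflexivity. Qed.

Lemma shear_ge f i n : (i <= n)%nat -> shear f i n = f i (n - i)%nat.
Proof. intros H. unfold shear. apply Nat.leb_le in H. rewrite H. reflexivity. Qed.

Lemma rsum_shear_le f i n :
  (rsum (fun m => Cmod (shear f i m)) n <= rsum (fun j => Cmod (f i j)) n)%R.
Proof.
  assert (Z : forall m, (m <= i)%nat -> rsum (fun m => Cmod (shear f i m)) m = 0%R).
  { intros m Hm. rewrite (rsum_ext _ (fun _ => 0 * 0)%R), rsum_scal; [ring|].
    intros k Hk. rewrite shear_lt by lia. rewrite Cmod_0. ring. }
  destruct (Compare_dec.le_lt_dec i n) as [H|H].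
  - replace n with (i + (n - i))%nat at 1 by lia. rewrite rsum_app, Z, Rplus_0_l by lia.
    rewrite (rsum_ext _ (fun j => Cmod (f i j))).
    + apply rsum_mono; [intros; apply Cmod_ge_0|lia].
    + intros k _. rewrite shear_ge by lia. do 2 f_equal. lia.
  - rewrite Z by lia. apply rsum_pos. intros; apply Cmod_ge_0.
Qed.

Lemma summable2_shear f : summable2 f -> summable2 (shear f).
Proof.
  intros [M HM]. exists M. intros I J. eapply Rle_trans; [|apply (HM I J)].
  apply rsum_le. intros i _. apply rsum_shear_le.
Qed.

Lemma rsum_diag_le f n :
  (rsum (fun m => Cmod (csum (fun i => f i (m - i)%nat) (S m))) n <=
   rsum (fun i => rsum (fun j => Cmod (f i j)) n) n)%R.
Proof.
  apply Rle_trans with (rsum (fun m => rsum (fun i => Cmod (shear f i m)) n) n).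
  - apply rsum_le. intros m Hm. eapply Rle_trans; [apply Cmod_csum|].
    eapply Rle_trans; [|apply (rsum_mono _ (S m)); [intros; apply Cmod_ge_0|exact Hm]].
    right. apply rsum_ext. intros i Hi. rewrite shear_ge by lia. reflexivity.
  - rewrite rsum_swap. apply rsum_le. intros i _. apply rsum_shear_le.
Qed.

Lemma CSum_shear_row f i : summable (f i) -> CSum (shear f i) = CSum (f i).
Proof.
  intros H. apply csums_CSum.
  intros eps He. destruct (summable_csums _ H eps He) as [N HN].
  exists (i + N)%nat. intros n Hn.
  replace n with (i + (n - i))%nat by lia. rewrite csum_app.
  rewrite csum_zero, Cplus_0_l by (intros k Hk; apply shear_lt, Hk).
  rewrite (csum_ext _ (f i)); [apply HN; lia|].
  intros k _. rewrite shear_ge by lia. f_equal. lia.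
Qed.

Lemma CSum_shear_col f n :
  CSum (fun i => shear f i n) = csum (fun i => f i (n - i)%nat) (S n).
Proof.
  rewrite (csum_ext (fun i => f i (n - i)%nat) (fun i => shear f i n)).
  - apply csums_CSum, csums_finite. intros i Hi. apply shear_lt. lia.
  - intros i Hi. symmetry. apply shear_ge. lia.
Qed.

(** Shearing turns the diagonals into columns, so that this is an instance of [CSum_swap]. *)
Lemma CSum_diag f :
  summable2 f ->
  CSum (fun n => csum (fun i => f i (n - i)%nat) (S n)) = CSum (fun i => CSum (f i)).
Proof.
  intros H. rewrite (CSum_ext _ (fun n => CSum (fun i => shear f i n)))
    by (intros; symmetry; apply CSum_shear_col).
  rewrite <- (CSum_swap (shear f)) by (apply summable2_shear, H).
  apply CSum_ext. intros i. apply CSum_shear_row, summable2_row, H.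
Qed.

(** * Formal power series *)

Lemma Cmult_cancel (a b c : C) : a * b = a * c -> a <> 0 -> b = c.
Proof.
  intros H Ha. replace b with (/ a * (a * b)) by (field; exact Ha).
  rewrite H. field. exact Ha.
Qed.

Definition natC (n : nat) : C := RtoC (INR n).

Lemma natC_S n : natC (S n) = natC n + 1.
Proof. unfold natC. rewrite S_INR, RtoC_plus. reflexivity. Qed.

Lemma natC_plus n m : natC (n + m) = natC n + natC m.
Proof. unfold natC. rewrite plus_INR, RtoC_plus. reflexivity. Qed.

Lemma natC_neq n : (n <> 0)%nat -> natC n <> 0.
Proof. intros H E. apply RtoC_inj in E. apply (not_0_INR n H E). Qed.

Lemma natC_0 : natC 0 = 0.
Proof. reflexivity. Qed.

Definition fps : Type := nat -> C.
Definition fconst (c : C) : fps := fun n => match n with O => c | _ => 0 end.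
Definition fzero : fps := fun _ => 0.
Definition fone : fps := fconst 1.
Definition fX : fps := fun n => match n with 1%nat => 1 | _ => 0 end.
Definition fadd (f g : fps) : fps := fun n => f n + g n.
Definition fsub (f g : fps) : fps := fun n => f n - g n.
Definition fopp (f : fps) : fps := fun n => - f n.
Definition fscal (c : C) (f : fps) : fps := fun n => c * f n.
Definition fmul (f g : fps) : fps := fun n => csum (fun i => f i * g (n - i)%nat) (S n).

(** The operator [X d/dX]. *)
Definition ftheta (f : fps) : fps := fun n => natC n * f n.

(** The formal sum of [X^z * F z] over all [z]. *)
Definition zsum (F : nat -> fps) : fps := fun n => csum (fun z => F z (n - z)%nat) (S n).

Lemma zsum_ext F G : (forall z, F z = G z) -> zsum F = zsum G.
Proof. intros H. f_equal. apply functional_extensionality, H. Qed.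

Lemma zsum_add F G : zsum (fun z => fadd (F z) (G z)) = fadd (zsum F) (zsum G).
Proof. apply functional_extensionality. intros n. apply csum_plus. Qed.

Lemma zsum_sub F G : zsum (fun z => fsub (F z) (G z)) = fsub (zsum F) (zsum G).
Proof. apply functional_extensionality. intros n. apply csum_minus. Qed.

Lemma zsum_scal c F : zsum (fun z => fscal c (F z)) = fscal c (zsum F).
Proof. apply functional_extensionality. intros n. apply csum_scal. Qed.

Lemma zsum_swap (F : nat -> nat -> fps) :
  zsum (fun z => zsum (fun w => F z w)) = zsum (fun w => zsum (fun z => F z w)).
Proof.
  apply functional_extensionality. intros n. unfold zsum.
  transitivity (csum (fun z => csum (fun w => F z w (n - z - w)%nat) (S n - z)) (S n)).
  - apply csum_ext. intros z Hz. replace (S n - z)%nat with (S (n - z)) by lia. reflexivity.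
  - rewrite csum_triangle. apply csum_ext. intros w Hw.
    replace (S n - w)%nat with (S (n - w)) by lia. apply csum_ext. intros z Hz.
    f_equal. lia.
Qed.

Lemma fmul_zsum_def f g : fmul f g = zsum (fun z => fscal (f z) g).
Proof. reflexivity. Qed.

Lemma fmul_comm f g : fmul f g = fmul g f.
Proof.
  apply functional_extensionality. intros n. unfold fmul. rewrite csum_rev.
  apply csum_ext. intros k Hk. rewrite Cmult_comm. f_equal; f_equal; lia.
Qed.

Lemma fmul_zsum g F : fmul g (zsum F) = zsum (fun z => fmul g (F z)).
Proof.
  rewrite fmul_zsum_def.
  rewrite (zsum_ext _ (fun w => zsum (fun z => fscal (g w) (F z))))
    by (intros; symmetry; apply zsum_scal).
  rewrite zsum_swap. reflexivity.
Qed.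

Lemma fmul_scal_r c f g : fmul f (fscal c g) = fscal c (fmul f g).
Proof.
  apply functional_extensionality. intros n. unfold fmul, fscal. rewrite <- csum_scal.
  apply csum_ext. intros; ring.
Qed.

Lemma fmul_scal_l c f g : fmul (fscal c f) g = fscal c (fmul f g).
Proof. rewrite fmul_comm, fmul_scal_r, fmul_comm. reflexivity. Qed.

Lemma fmul_assoc f g h : fmul f (fmul g h) = fmul (fmul f g) h.
Proof.
  rewrite (fmul_comm (fmul f g)), (fmul_zsum_def g h), fmul_zsum.
  rewrite (zsum_ext _ (fun z => fscal (g z) (fmul f h))) by (intros; apply fmul_scal_r).
  rewrite <- fmul_zsum_def, (fmul_comm f h), (fmul_comm f g).
  rewrite !(fmul_zsum_def g), fmul_zsum. apply zsum_ext. intros z.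
  rewrite fmul_scal_r. reflexivity.
Qed.

Lemma fmul_add_l f g h : fmul (fadd f g) h = fadd (fmul f h) (fmul g h).
Proof.
  apply functional_extensionality. intros n. unfold fmul, fadd. rewrite <- csum_plus.
  apply csum_ext. intros; ring.
Qed.

Lemma fscal_const c f : fscal c f = fmul (fconst c) f.
Proof.
  apply functional_extensionality. intros n. unfold fmul. rewrite csum_S_l, csum_zero.
  - unfold fscal. rewrite Nat.sub_0_r. simpl. ring.
  - intros k _. simpl. ring.
Qed.

Lemma fps_ring_theory : ring_theory fzero fone fadd fmul fsub fopp eq.
Proof.
  constructor; intros; try (apply functional_extensionality; intros n;
    unfold fzero, fadd, fsub, fopp; ring).
  - unfold fone. rewrite <- fscal_const. apply functional_extensionality. intros n.
    unfold fscal. ring.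
  - apply fmul_comm.
  - apply fmul_assoc.
  - apply fmul_add_l.
Qed.

Add Ring fps_ring : fps_ring_theory.

Lemma fconst_add c d : fconst (c + d) = fadd (fconst c) (fconst d).
Proof.
  apply functional_extensionality. intros [|n]; unfold fconst, fadd; ring.
Qed.

Lemma fconst_mul c d : fconst (c * d) = fmul (fconst c) (fconst d).
Proof.
  rewrite <- fscal_const. apply functional_extensionality.
  intros [|n]; unfold fconst, fscal; ring.
Qed.

Lemma fX_S f n : fmul fX f (S n) = f n.
Proof.
  unfold fmul. rewrite !csum_S_l, csum_zero.
  - simpl. rewrite ?Nat.sub_0_r. ring.
  - intros k _. simpl. ring.
Qed.

Lemma fX_0 f : fmul fX f 0%nat = 0.
Proof. unfold fmul. simpl. ring. Qed.

Lemma zsum_S F : zsum F = fadd (F 0%nat) (fmul fX (zsum (fun z => F (S z)))).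
Proof.
  apply functional_extensionality. intros [|n]; unfold fadd.
  - rewrite fX_0. unfold zsum. simpl. ring.
  - rewrite fX_S. unfold zsum. rewrite csum_S_l, Nat.sub_0_r. reflexivity.
Qed.

Lemma ftheta_add f g : ftheta (fadd f g) = fadd (ftheta f) (ftheta g).
Proof. apply functional_extensionality. intros n. unfold ftheta, fadd. ring. Qed.

Lemma ftheta_sub f g : ftheta (fsub f g) = fsub (ftheta f) (ftheta g).
Proof. apply functional_extensionality. intros n. unfold ftheta, fsub. ring. Qed.

Lemma ftheta_const c : ftheta (fconst c) = fzero.
Proof.
  apply functional_extensionality. intros [|n]; unfold ftheta, fzero, fconst; [|ring].
  rewrite natC_0. ring.
Qed.

Lemma ftheta_X : ftheta fX = fX.
Proof.
  apply functional_extensionality. intros [|[|n]]; unfold ftheta; simpl; try ring.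
  unfold natC; simpl. ring.
Qed.

Lemma ftheta_mul f g : ftheta (fmul f g) = fadd (fmul (ftheta f) g) (fmul f (ftheta g)).
Proof.
  apply functional_extensionality. intros n. unfold ftheta, fmul, fadd.
  rewrite <- csum_plus, <- csum_scal. apply csum_ext. intros k Hk.
  replace (natC n) with (natC k + natC (n - k)).
  - ring.
  - rewrite <- natC_plus. f_equal. lia.
Qed.

(** [weight N f] is [X^(-N/2) * 2 theta (X^(N/2) * f)], that is [s d/ds] acting on [s^N f(s^2)]. *)
Definition weight (N : nat) (f : fps) : fps := fun n => natC (N + 2 * n) * f n.

Lemma weight_theta N f :
  weight N f = fadd (fmul (fconst (natC N)) f) (fmul (fadd fone fone) (ftheta f)).
Proof.
  apply functional_extensionality. intros n. unfold weight, fadd at 1.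
  rewrite <- fscal_const. replace (fadd fone fone) with (fconst (1 + 1)).
  - rewrite <- fscal_const. unfold fscal, ftheta. rewrite natC_plus.
    simpl (2 * n)%nat. rewrite Nat.add_0_r, natC_plus. ring.
  - apply fconst_add.
Qed.

Lemma weight_sub N f g : weight N (fsub f g) = fsub (weight N f) (weight N g).
Proof. apply functional_extensionality. intros n. unfold weight, fsub. ring. Qed.

Lemma weight_scal N c f : weight N (fscal c f) = fscal c (weight N f).
Proof. apply functional_extensionality. intros n. unfold weight, fscal. ring. Qed.

Lemma weight_fone N : weight N fone = fscal (natC N) fone.
Proof.
  apply functional_extensionality. intros [|n]; unfold weight, fscal, fone, fconst; [|ring].
  f_equal. f_equal. lia.
Qed.

Lemma weight_zsum N F : weight N (zsum F) = zsum (fun z => weight (N + 2 * z) (F z)).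
Proof.
  apply functional_extensionality. intros n. unfold weight, zsum. rewrite <- csum_scal.
  apply csum_ext. intros z Hz. f_equal. f_equal. lia.
Qed.

Lemma weight_X N f : weight N (fmul fX f) = fmul fX (weight (N + 2) f).
Proof.
  apply functional_extensionality. intros [|n]; unfold weight.
  - rewrite !fX_0. ring.
  - rewrite !fX_S. f_equal. f_equal. lia.
Qed.

(** * Binomial coefficients *)

(** The coefficient of [z^n] in [(1 - z)^(-c)]. *)
Fixpoint binc (c : C) (n : nat) : C :=
  match n with O => 1 | S m => binc c m * ((c + natC m) / natC (S m)) end.

Lemma binc_S c n : natC (S n) * binc c (S n) = (c + natC n) * binc c n.
Proof. cbn [binc]. field. apply natC_neq. lia. Qed.

Section Vandermonde.

Variables (c d : C) (Hcd : c + d = 1).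

(** The identity [(1 - z)^(-c) (1 - z)^(-d) = (1 - z)^(-1)]. Distributing the factor [n + 1] as
    [z + (n + 1 - z)] over the two coefficients gives a first order recursion. *)
Lemma binc_vandermonde n : csum (fun z => binc d z * binc c (n - z)%nat) (S n) = 1.
Proof.
  induction n as [|n IH]; [simpl; ring|].
  apply (Cmult_cancel (natC (S n))); [|apply natC_neq; lia].
  rewrite <- csum_scal.
  rewrite (csum_ext _ (fun z => (natC z * binc d z) * binc c (S n - z)%nat +
     binc d z * (natC (S n - z) * binc c (S n - z)%nat))).
  2:{ intros z Hz. replace (natC (S n)) with (natC z + natC (S n - z)); [ring|].
      rewrite <- natC_plus. f_equal. lia. }
  rewrite csum_plus. rewrite csum_S_l at 1.
  rewrite natC_0.
  cbn [csum]. fold (csum (fun k => binc d k * (natC (S n - k) * binc c (S n - k)%nat)) (S n)).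
  change (csum (fun z => binc d z * (natC (S n - z) * binc c (S n - z)%nat)) n +
    binc d n * (natC (S n - n) * binc c (S n - n)%nat)) with
    (csum (fun z => binc d z * (natC (S n - z) * binc c (S n - z)%nat)) (S n)).
  change (csum (fun k => natC (S k) * binc d (S k) * binc c (S n - S k)%nat) n +
    natC (S n) * binc d (S n) * binc c (S n - S n)%nat) with
    (csum (fun k => natC (S k) * binc d (S k) * binc c (S n - S k)%nat) (S n)).
  rewrite Nat.sub_diag, natC_0.
  transitivity (csum (fun z => natC (S n) * (binc d z * binc c (n - z)%nat)) (S n)).
  2:{ rewrite csum_scal, IH. reflexivity. }
  transitivity (csum (fun k => natC (S k) * binc d (S k) * binc c (S n - S k)%nat) (S n) +
    csum (fun z => binc d z * (natC (S n - z) * binc c (S n - z)%nat)) (S n)); [ring|].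
  rewrite <- csum_plus. apply csum_ext. intros z Hz.
  rewrite binc_S. replace (S n - S z)%nat with (n - z)%nat by lia.
  replace (S n - z)%nat with (S (n - z)) by lia. rewrite binc_S.
  replace (natC (S n)) with (c + d + natC z + natC (n - z)); [ring|].
  rewrite Hcd, <- Cplus_assoc, <- natC_plus, natC_S.
  replace (z + (n - z))%nat with n by lia. ring.
Qed.

(** The partial fraction expansion of [(c + x)_n / (x + 1)_n] as a function of [x]; both sides
    obey the same first order recursion in [n]. *)
Lemma binc_partial_fractions x n : (0 < x)%nat ->
  binc c x * csum (fun z => natC x * binc d z * binc c (n - z)%nat / natC (x + z)) (S n)
  = binc c (x + n).
Proof.
  intros Hx. induction n as [|n IH].
  - simpl csum. rewrite !Nat.add_0_r. simpl. field. apply natC_neq. lia.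
  - apply (Cmult_cancel (natC (S (x + n)))); [|apply natC_neq; lia].
    rewrite Nat.add_succ_r, binc_S, <- IH.
    set (h := fun m => csum (fun z => binc d z * binc c (m - z)%nat / natC (x + z)) (S m)).
    assert (E : forall m, csum (fun z => natC x * binc d z * binc c (m - z)%nat / natC (x + z)) (S m)
       = natC x * h m).
    { intros m. unfold h. rewrite <- csum_scal. apply csum_ext. intros. unfold Cdiv. ring. }
    rewrite !E.
    enough (R : natC (S (x + n)) * h (S n) = (c + natC (x + n)) * h n).
    { transitivity (binc c x * natC x * (natC (S (x + n)) * h (S n))); [ring|].
      rewrite R. ring. }
    pose proof (binc_vandermonde (S n)) as V1. pose proof (binc_vandermonde n) as V0.
    transitivity (csum (fun z => binc d z * binc c (S n - z)%nat) (S (S n)) +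
      csum (fun z => (binc d z / natC (x + z)) * (natC (S n - z) * binc c (S n - z)%nat)) (S (S n))).
    { unfold h. rewrite <- csum_scal, <- csum_plus. apply csum_ext. intros z Hz.
      replace (natC (S (x + n))) with (natC (x + z) + natC (S n - z)).
      - field. apply natC_neq. lia.
      - rewrite <- natC_plus. f_equal. lia. }
    rewrite V1, csum_S, Nat.sub_diag, natC_0, Cmult_0_l, Cmult_0_r, Cplus_0_r, <- V0.
    unfold h. rewrite <- csum_scal, <- csum_plus. apply csum_ext. intros z Hz.
    replace (S n - z)%nat with (S (n - z)) by lia. rewrite binc_S.
    replace (natC (x + n)) with (natC (x + z) + natC (n - z)).
    + field. apply natC_neq. lia.
    + rewrite <- natC_plus. f_equal. lia.
Qed.

End Vandermonde.

(** * The kernel identity for formal power series *)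

Definition bser (c : C) : fps := fun i => binc c i.

(** [s^x * lcoef c x (s^2)] is the coefficient of [w^x] in
    [(1 - s w)^(-c) (1 - s / w)^(-c)]. *)
Definition lcoef (c : C) (x : nat) : fps := fun i => binc c (x + i) * binc c i.

(** Likewise for [(1 - s w)^(-c) (1 - s / w)^(1 - c)]. *)
Definition lcoef1 (c : C) (x : nat) : fps := fsub (lcoef c x) (fmul fX (lcoef c (S x))).

(** [s^(x + y) * kerT c d x y (s^2)] is [2 S - (1 - s^2) a b], with [S] the double and [a], [b] the
    single contour integrals of the kernel formula. *)
Definition kerT (c d : C) (x y : nat) : fps :=
  fsub (fmul (fadd fone fone) (zsum (fun m => fmul (lcoef1 c (x + m)) (lcoef1 d (y + m)))))
       (fmul (fsub fone fX) (fmul (lcoef c x) (lcoef d y))).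

Definition kerK (c d : C) (x y : nat) : fps := fscal (/ natC (x + y)) (kerT c d x y).

Lemma kerT_sym c d x y : kerT c d x y = kerT d c y x.
Proof.
  unfold kerT. rewrite (fmul_comm (lcoef c x)). do 2 f_equal.
  apply zsum_ext. intros. apply fmul_comm.
Qed.

Lemma kerK_sym c d x y : kerK c d x y = kerK d c y x.
Proof. unfold kerK. rewrite kerT_sym, (Nat.add_comm x y). reflexivity. Qed.

(** This and the next lemma are the contiguity relations of the hypergeometric series [lcoef c x]:
    they determine the derivatives of two consecutive series from the series themselves. *)
Lemma lcoef_theta c x :
  ftheta (lcoef c x) =
  fmul fX (fadd (ftheta (lcoef c (S x))) (fmul (fconst c) (lcoef c (S x)))).
Proof.
  apply functional_extensionality. intros [|i].
  - rewrite fX_0. unfold ftheta. rewrite natC_0. ring.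
  - rewrite fX_S. rewrite <- fscal_const. unfold fadd, fscal, ftheta, lcoef.
    rewrite Nat.add_succ_r. simpl (S x + i)%nat.
    transitivity (binc c (S (x + i)) * (natC (S i) * binc c (S i))); [ring|].
    rewrite binc_S. ring.
Qed.

Lemma lcoef_succ_theta c x :
  ftheta (lcoef c (S x)) =
  fsub (fadd (ftheta (lcoef c x)) (fmul (fadd (fconst (natC x)) (fconst c)) (lcoef c x)))
       (fmul (fadd (fconst (natC x)) fone) (lcoef c (S x))).
Proof.
  replace (fadd (fconst (natC x)) fone) with (fconst (natC x + 1)) by apply fconst_add.
  rewrite <- fconst_add, <- !fscal_const.
  apply functional_extensionality. intros i. unfold fadd, fsub, fscal, ftheta, lcoef.
  simpl (S x + i)%nat.
  assert (H : natC (S (x + i)) * binc c (S (x + i)) = (c + natC (x + i)) * binc c (x + i))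
    by apply binc_S.
  rewrite natC_S, natC_plus in H.
  transitivity ((natC x + natC i + 1) * binc c (S (x + i)) * binc c i -
    (natC x + 1) * (binc c (S (x + i)) * binc c i)); [ring|].
  rewrite H. ring.
Qed.

Section KernelIdentity.

Variables (c d : C) (Hcd : c + d = 1).

Let dE : fconst d = fsub fone (fconst c).
Proof.
  replace d with (1 - c) by (rewrite <- Hcd; ring).
  apply functional_extensionality. intros [|n]; unfold fsub, fone, fconst; ring.
Qed.

(** The difference of [kerT] and of its diagonal successor: the sum over [m] telescopes. *)
Definition kerStep (x y : nat) : fps :=
  let A := lcoef c x in let A' := lcoef c (S x) in
  let B := lcoef d y in let B' := lcoef d (S y) in
  fadd (fsub (fmul (fadd fone fX) (fmul A B))
             (fmul (fmul (fadd fone fone) fX) (fadd (fmul A B') (fmul A' B))))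
       (fmul (fmul fX (fadd fone fX)) (fmul A' B')).

Lemma kerT_step x y :
  kerT c d x y = fadd (kerStep x y) (fmul fX (kerT c d (S x) (S y))).
Proof.
  unfold kerT, kerStep. rewrite zsum_S, !Nat.add_0_r.
  rewrite (zsum_ext (fun z => fmul (lcoef1 c (x + S z)) (lcoef1 d (y + S z)))
    (fun m => fmul (lcoef1 c (S x + m)) (lcoef1 d (S y + m)))).
  - unfold lcoef1 at 1 2. ring.
  - intros m. rewrite !Nat.add_succ_r. reflexivity.
Qed.

(** Once the contiguity relations have eliminated all but two derivatives, this is an identity between
    polynomials over the ring of formal series. *)
Lemma kerStep_weight x y :
  weight (x + y) (kerStep x y) =
  fsub (fmul (fconst (natC (x + y))) (fmul (fsub fone fX) (fmul (lcoef c x) (lcoef d y))))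
    (fmul (fconst (natC (S x + S y)))
      (fmul fX (fmul (fsub fone fX) (fmul (lcoef c (S x)) (lcoef d (S y)))))).
Proof.
  rewrite weight_theta. unfold kerStep.
  repeat rewrite ?ftheta_add, ?ftheta_sub, ?ftheta_mul.
  unfold fone at 5 6 7 8 9 10 11 12. change (fconst 1) with fone.
  assert (T1 : ftheta fone = fzero) by apply ftheta_const.
  rewrite ?T1, ?ftheta_X.
  replace (fconst (natC (S x + S y)))
    with (fadd (fadd (fconst (natC x)) (fconst (natC y))) (fadd fone fone)).
  2:{ unfold fone. rewrite <- !fconst_add. f_equal. rewrite natC_plus, !natC_S. ring. }
  rewrite natC_plus, fconst_add.
  pose proof (lcoef_theta c x) as R1. pose proof (lcoef_succ_theta c x) as R2.
  pose proof (lcoef_theta d y) as R3. pose proof (lcoef_succ_theta d y) as R4.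
  rewrite dE in R3, R4.
  set (A := lcoef c x) in *. set (A' := lcoef c (S x)) in *.
  set (B := lcoef d y) in *. set (B' := lcoef d (S y)) in *.
  set (tA := ftheta A) in *. set (tB := ftheta B) in *.
  rewrite R2 in R1 |- *. rewrite R4 in R3 |- *.
  set (X := fX) in *. set (k := fconst c) in *.
  set (nx := fconst (natC x)) in *. set (ny := fconst (natC y)) in *.
  clearbody A A' B B' tA tB X k nx ny.
  assert (Q1 : fmul (fsub fone X) tA =
    fmul X (fadd (fmul (fadd nx k) A) (fmul (fsub k (fadd nx fone)) A'))).
  { transitivity (fsub tA (fmul X tA)); [ring|]. rewrite R1 at 1. ring. }
  assert (Q2 : fmul (fsub fone X) tB =
    fmul X (fadd (fmul (fadd ny (fsub fone k)) B)
                 (fmul (fsub (fsub fone k) (fadd ny fone)) B'))).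
  { transitivity (fsub tB (fmul X tB)); [ring|]. rewrite R3 at 1. ring. }
  clear R1 R2 R3 R4.
  (* the two sides differ by a linear combination of the relations Q1 and Q2 *)
  match goal with |- ?L = ?R => transitivity (fadd R (fadd
    (fmul (fmul (fadd fone fone) (fsub B (fmul X B'))) (fsub (fmul (fsub fone X) tA)
      (fmul X (fadd (fmul (fadd nx k) A) (fmul (fsub k (fadd nx fone)) A')))))
    (fmul (fmul (fadd fone fone) (fsub A (fmul X A'))) (fsub (fmul (fsub fone X) tB)
      (fmul X (fadd (fmul (fadd ny (fsub fone k)) B)
                 (fmul (fsub (fsub fone k) (fadd ny fone)) B'))))))) end.
  - clear Q1 Q2. ring.
  - rewrite Q1, Q2. ring.
Qed.

(** Differentiating in [s] makes the kernel a product: by [kerStep_weight] the difference of the two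
    sides is invariant under [(x, y) -> (x + 1, y + 1)] up to a factor [X], so it vanishes to
    every order. *)
Lemma kerT_weight x y :
  weight (x + y) (kerT c d x y) =
  fmul (fconst (natC (x + y))) (fmul (fsub fone fX) (fmul (lcoef c x) (lcoef d y))).
Proof.
  set (D := fun x y => fsub (weight (x + y) (kerT c d x y))
    (fmul (fconst (natC (x + y))) (fmul (fsub fone fX) (fmul (lcoef c x) (lcoef d y))))).
  assert (E : forall x y, D x y = fmul fX (D (S x) (S y))).
  { intros x' y'. unfold D. rewrite kerT_step at 1.
    replace (weight (x' + y') (fadd (kerStep x' y') (fmul fX (kerT c d (S x') (S y')))))
      with (fadd (weight (x' + y') (kerStep x' y'))
        (fmul fX (weight (S x' + S y') (kerT c d (S x') (S y'))))).
    - rewrite kerStep_weight. ring.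
    - replace (S x' + S y')%nat with (x' + y' + 2)%nat by lia. rewrite <- weight_X.
      apply functional_extensionality. intros n. unfold weight, fadd. ring. }
  assert (Z : forall n x y, D x y n = 0).
  { induction n as [|n IH]; intros x' y'; rewrite E; [apply fX_0|rewrite fX_S; apply IH]. }
  apply functional_extensionality. intros n. specialize (Z n x y). unfold D, fsub at 1 in Z.
  apply Ceq_minus. exact Z.
Qed.

Lemma kerK_weight x y : (0 < x + y)%nat ->
  weight (x + y) (kerK c d x y) = fmul (fsub fone fX) (fmul (lcoef c x) (lcoef d y)).
Proof.
  intros H. unfold kerK. rewrite weight_scal, kerT_weight, <- fscal_const.
  apply functional_extensionality. intros n. unfold fscal. field. apply natC_neq. lia.
Qed.

(** The vector [lcoef c] solves the linear equation with the kernel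
    [binc c x * binc d z * z / (x + z)]: coefficientwise this is [binc_partial_fractions]. *)
Lemma lcoef_equation x : (0 < x)%nat ->
  fadd (lcoef c x)
    (fscal (binc c x) (zsum (fun z => fscal (natC z * binc d z / natC (x + z)) (lcoef c z))))
  = fscal (binc c x) (bser c).
Proof.
  intros Hx. apply functional_extensionality. intros i. unfold fadd, fscal, lcoef, zsum, bser.
  rewrite (csum_ext _ (fun z => binc c i * (binc d z * binc c (i - z)%nat -
     natC x * binc d z * binc c (i - z)%nat / natC (x + z)))).
  2:{ intros z Hz. replace (z + (i - z))%nat with i by lia.
      replace (natC z / natC (x + z)) with (1 - natC x / natC (x + z)).
      - assert (natC (x + z) <> 0) by (apply natC_neq; lia).
        transitivity (binc d z * binc c i * binc c (i - z)%nat * (1 - natC x / natC (x + z)));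
          [|field; assumption].
        replace (1 - natC x / natC (x + z)) with (natC z / natC (x + z)); [field; assumption|].
        apply (Cmult_cancel (natC (x + z))); [|assumption].
        rewrite natC_plus in *. field. assumption.
      - assert (H : natC (x + z) <> 0) by (apply natC_neq; lia).
        apply (Cmult_cancel (natC (x + z))); [|assumption].
        rewrite natC_plus in *. field. assumption. }
  rewrite csum_scal, csum_minus, (binc_vandermonde c d Hcd).
  pose proof (binc_partial_fractions c d Hcd x i Hx) as P.
  set (Q := csum (fun k => natC x * binc d k * binc c (i - k)%nat / natC (x + k)) (S i)) in *.
  rewrite <- P. ring.
Qed.

Lemma binc_series_mul :
  fmul (fsub fone fX) (fmul (bser c) (bser d)) = fone.
Proof.
  assert (V : fmul (bser c) (bser d) = fun _ => 1).
  { apply functional_extensionality. intros n. rewrite fmul_comm. apply binc_vandermonde, Hcd. }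
  rewrite V. transitivity (fsub (fun _ => RtoC 1) (fmul fX (fun _ => RtoC 1))).
  - ring.
  - apply functional_extensionality. intros [|n]; unfold fsub.
    + rewrite fX_0. unfold fone, fconst. ring.
    + rewrite fX_S. unfold fone, fconst. ring.
Qed.

End KernelIdentity.

Section KernelEquation.

Variables (c d : C) (Hcd : c + d = 1).

(** The defect of the equation [L = K + L K]; the matrices are conjugated and the factors
    [sqrt (x y) s^(x + y)], which all the terms share, are removed. *)
Definition defect (y x : nat) : fps :=
  fsub (fsub (fscal (binc c x * binc d y / natC (x + y)) fone) (kerK c d x y))
    (fscal (binc c x)
      (zsum (fun z => fscal (natC z * binc d z / natC (x + z)) (kerK c d z y)))).

Definition defect_rhs (y : nat) : fps :=
  fsub (fsub (fscal (binc d y) fone) (zsum (fun z => fscal (natC z * binc d z) (kerK c d z y))))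
    (fmul (fsub fone fX) (fmul (bser c) (lcoef d y))).

(** Differentiation in [s] turns each kernel into a product, so that [lcoef_equation] applies. The
    remaining weights [x + z] cancel the denominators, and the result depends on [x] only through the
    factor [binc c x]. *)
Lemma defect_weight x y : (0 < x)%nat -> (0 < y)%nat ->
  weight (x + y) (defect y x) = fscal (binc c x) (defect_rhs y).
Proof.
  intros Hx Hy. unfold defect. rewrite !weight_sub, !weight_scal, weight_fone, weight_zsum.
  rewrite (kerK_weight c d Hcd) by lia.
  rewrite (zsum_ext (fun z => weight (x + y + 2 * z) _) (fun z =>
    fadd (fscal (natC z * binc d z) (kerK c d z y))
      (fmul (fmul (fsub fone fX) (lcoef d y))
        (fscal (natC z * binc d z / natC (x + z)) (lcoef c z))))).
  2:{ intros z. rewrite weight_scal.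
      assert (E : weight (x + y + 2 * z) (kerK c d z y) =
        fadd (fscal (natC (x + z)) (kerK c d z y)) (weight (z + y) (kerK c d z y))).
      { apply functional_extensionality. intros n. unfold weight, fadd, fscal.
        replace (x + y + 2 * z + 2 * n)%nat with (x + z + (z + y + 2 * n))%nat by lia.
        rewrite natC_plus. ring. }
      rewrite E, (kerK_weight c d Hcd) by lia. rewrite fmul_scal_r.
      assert (natC (x + z) <> 0) by (apply natC_neq; lia).
      replace (fmul (fmul (fsub fone fX) (lcoef d y)) (lcoef c z))
        with (fmul (fsub fone fX) (fmul (lcoef c z) (lcoef d y))) by ring.
      apply functional_extensionality. intros n. unfold fadd, fscal. field. assumption. }
  rewrite zsum_add, <- fmul_zsum.
  pose proof (lcoef_equation c d Hcd x Hx) as I.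
  set (Z := zsum (fun z => fscal (natC z * binc d z / natC (x + z)) (lcoef c z))) in *.
  unfold defect_rhs. set (G := zsum (fun z => fscal (natC z * binc d z) (kerK c d z y))) in *.
  replace (fscal (binc c x * binc d y / natC (x + y)) (fscal (natC (x + y)) fone))
    with (fscal (binc c x) (fscal (binc d y) fone)).
  2:{ assert (natC (x + y) <> 0) by (apply natC_neq; lia).
      apply functional_extensionality. intros n. unfold fscal. field. assumption. }
  rewrite !fscal_const in *.
  transitivity (fsub (fsub (fmul (fconst (binc c x)) (fmul (fconst (binc d y)) fone))
      (fmul (fconst (binc c x)) G))
    (fmul (fmul (fsub fone fX) (lcoef d y)) (fadd (lcoef c x) (fmul (fconst (binc c x)) Z)))).
  - ring.
  - rewrite I. ring.
Qed.

(** The definition of the defect is inserted on the right-hand side and the two summations are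
    exchanged; then [lcoef_equation] for the exponent [d] evaluates the inner sums. *)
Lemma defect_rhs_eq y : (0 < y)%nat ->
  fmul (bser d) (defect_rhs y) =
  zsum (fun z => fscal (natC z) (fmul (lcoef d z) (defect y z))).
Proof.
  intros Hy.
  assert (Hdc : d + c = 1) by (rewrite <- Hcd; ring).
  set (Q := bser d).
  set (Zb := zsum (fun z => fscal (natC z) (fmul (lcoef d z) (kerK c d z y)))).
  set (G := zsum (fun w => fscal (natC w * binc d w) (kerK c d w y))).
  (* [lcoef_equation] with the two exponents exchanged *)
  assert (I : forall w, (0 < w)%nat ->
    fscal (binc d w) (zsum (fun z => fscal (natC z * binc c z / natC (z + w)) (lcoef d z)))
    = fsub (fscal (binc d w) Q) (lcoef d w)).
  { intros w Hw. pose proof (lcoef_equation d c Hdc w Hw) as H. fold Q in H.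
    rewrite <- H. rewrite (zsum_ext (fun z => fscal (natC z * binc c z / natC (z + w)) (lcoef d z))
      (fun z => fscal (natC z * binc c z / natC (w + z)) (lcoef d z)))
      by (intros; rewrite Nat.add_comm; reflexivity).
    ring. }
  assert (E : zsum (fun z => fscal (natC z) (fmul (lcoef d z) (defect y z))) =
    fsub (fsub (zsum (fun z => fscal (natC z * binc c z * binc d y / natC (z + y)) (lcoef d z))) Zb)
      (zsum (fun z => zsum (fun w => fscal (natC w)
        (fmul (kerK c d w y)
          (fscal (binc d w) (fscal (natC z * binc c z / natC (z + w)) (lcoef d z)))))))).
  { unfold Zb. rewrite <- !zsum_sub. apply zsum_ext. intros z. unfold defect.
    set (kz := kerK c d z y).
    replace (zsum (fun w => fscal (natC w) _)) with (fmul (fscal (natC z * binc c z) (lcoef d z))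
      (zsum (fun w => fscal (natC w * binc d w / natC (z + w)) (kerK c d w y)))).
    - set (W := zsum _). rewrite !fscal_const.
      assert (K : forall u v w t, fconst (u * v * w / t) =
        fmul (fmul (fconst u) (fconst v)) (fmul (fconst w) (fconst (/ t)))).
      { intros. unfold Cdiv. rewrite <- !fconst_mul. f_equal. ring. }
      assert (K2 : forall u v t, fconst (u * v / t) =
        fmul (fmul (fconst u) (fconst v)) (fconst (/ t))).
      { intros. unfold Cdiv. rewrite <- !fconst_mul. reflexivity. }
      rewrite K, K2, fconst_mul. ring.
    - rewrite fmul_zsum. apply zsum_ext. intros w.
      rewrite !fmul_scal_r, !fmul_scal_l, (fmul_comm (lcoef d z)).
      destruct (Nat.eq_dec w 0) as [->|Hw].
      + apply functional_extensionality. intros n. unfold fscal. rewrite natC_0.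
        unfold Cdiv. ring.
      + assert (natC (z + w) <> 0) by (apply natC_neq; lia).
        apply functional_extensionality. intros n. unfold fscal. field. assumption. }
  rewrite E, zsum_swap.
  rewrite (zsum_ext (fun w => zsum (fun z => fscal (natC w) _)) (fun w => fsub
    (fmul Q (fscal (natC w * binc d w) (kerK c d w y)))
    (fscal (natC w) (fmul (lcoef d w) (kerK c d w y))))).
  2:{ intros w. rewrite zsum_scal, <- fmul_zsum, zsum_scal.
      destruct (Nat.eq_dec w 0) as [->|Hw].
      - rewrite !fmul_scal_r, natC_0. apply functional_extensionality. intros n.
        unfold fsub, fscal. ring.
      - rewrite I by lia. rewrite !fscal_const, fconst_mul. ring. }
  rewrite zsum_sub, <- fmul_zsum. fold Zb G.
  rewrite (zsum_ext _ (fun z => fscal (binc d y)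
    (fscal (natC z * binc c z / natC (z + y)) (lcoef d z)))).
  2:{ intros z. apply functional_extensionality. intros n. unfold fscal, Cdiv. ring. }
  rewrite zsum_scal, I by exact Hy.
  unfold defect_rhs. fold G.
  pose proof (binc_series_mul c d Hcd) as PQ. fold Q in PQ.
  transitivity (fsub (fsub (fmul Q (fscal (binc d y) fone)) (fmul Q G))
    (fmul (fmul (fsub fone fX) (fmul (bser c) Q)) (lcoef d y))); [ring|].
  rewrite PQ, !fscal_const. ring.
Qed.

(** The two preceding lemmas give a homogeneous linear equation for the defect. On its right-hand side
    the summand of index [z] carries the factors [X^z] and [z], so that only coefficients of lower
    order occur. *)
Theorem defect_zero x y : (0 < x)%nat -> (0 < y)%nat -> defect y x = fzero.
Proof.
  intros Hx Hy.
  assert (Z : forall n, forall k, (k < n)%nat -> forall x, (0 < x)%nat -> defect y x k = 0).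
  { induction n as [|n IH]; [lia|]. intros k Hk x' Hx'.
    assert (k < n \/ k = n)%nat as [H|H] by lia; [apply IH; assumption|]. subst k. clear Hk.
    pose proof (defect_weight x' y Hx' Hy) as W.
    apply (f_equal (fmul (bser d))) in W.
    rewrite fmul_scal_r, (defect_rhs_eq y Hy) in W.
    apply (f_equal (fun f => f n)) in W. revert W.
    unfold fscal at 1, zsum. rewrite csum_zero.
    - unfold fmul. rewrite csum_S_l, csum_zero.
      + unfold weight, bser. rewrite Nat.sub_0_r. cbn [binc]. intros W.
        apply (Cmult_cancel (natC (x' + y + 2 * n))); [|apply natC_neq; lia].
        transitivity (binc c x' * 0); [rewrite <- W|]; ring.
      + intros i Hi. unfold weight. rewrite (IH (n - S i)%nat) by (assumption || lia). ring.
    - intros z Hz. unfold fscal. destruct z as [|z]; [rewrite natC_0; ring|].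
      unfold fmul. rewrite csum_zero; [ring|]. intros i Hi.
      rewrite IH by lia. ring. }
  apply functional_extensionality. intros n. apply (Z (S n)); [lia|exact Hx].
Qed.

End KernelEquation.

(** * Evaluation of formal power series *)

Definition fterm (xi : R) (f : fps) (n : nat) : C := f n * RtoC (xi ^ n).
Definition fev (xi : R) (f : fps) : C := CSum (fterm xi f).

(** [fle xi f M]: the norm [sum |f_n| xi^n] is at most [M]. *)
Definition fle (xi : R) (f : fps) (M : R) : Prop :=
  forall n, (rsum (fun k => Cmod (fterm xi f k)) n <= M)%R.

Section Evaluation.

Variables (xi : R) (Hxi : (0 < xi < 1)%R).

Lemma fle_summable f M : fle xi f M -> summable (fterm xi f).
Proof. intros H. exists M. exact H. Qed.

Lemma fle_pos f M : fle xi f M -> (0 <= M)%R.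
Proof. intros H. exact (H O). Qed.

Lemma fle_fev f M : fle xi f M -> (Cmod (fev xi f) <= M)%R.
Proof. intros H. apply Cmod_CSum_le, H. Qed.

Lemma fle_weaken f M N : fle xi f M -> (M <= N)%R -> fle xi f N.
Proof. intros H L n. eapply Rle_trans; [apply H|exact L]. Qed.

Lemma fterm_add f g n : fterm xi (fadd f g) n = fterm xi f n + fterm xi g n.
Proof. unfold fterm, fadd. ring. Qed.

Lemma fterm_sub f g n : fterm xi (fsub f g) n = fterm xi f n - fterm xi g n.
Proof. unfold fterm, fsub. ring. Qed.

Lemma fterm_scal c f n : fterm xi (fscal c f) n = c * fterm xi f n.
Proof. unfold fterm, fscal. ring. Qed.

Lemma fle_add f g M N : fle xi f M -> fle xi g N -> fle xi (fadd f g) (M + N).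
Proof.
  intros Hf Hg n. eapply Rle_trans; [|apply Rplus_le_compat; [apply (Hf n)|apply (Hg n)]].
  rewrite <- rsum_plus. apply rsum_le. intros. rewrite fterm_add. apply Cmod_triangle.
Qed.

Lemma fle_sub f g M N : fle xi f M -> fle xi g N -> fle xi (fsub f g) (M + N).
Proof.
  intros Hf Hg n. eapply Rle_trans; [|apply Rplus_le_compat; [apply (Hf n)|apply (Hg n)]].
  rewrite <- rsum_plus. apply rsum_le. intros. rewrite fterm_sub.
  eapply Rle_trans; [apply Cmod_triangle|]. rewrite Cmod_opp. lra.
Qed.

Lemma fle_scal c f M : fle xi f M -> fle xi (fscal c f) (Cmod c * M).
Proof.
  intros Hf n. eapply Rle_trans; [|apply Rmult_le_compat_l; [apply Cmod_ge_0|apply (Hf n)]].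
  rewrite <- rsum_scal. right. apply rsum_ext. intros. rewrite fterm_scal. apply Cmod_mult.
Qed.

Lemma fev_add f g M N :
  fle xi f M -> fle xi g N -> fev xi (fadd f g) = fev xi f + fev xi g.
Proof.
  intros Hf Hg. unfold fev. rewrite (CSum_ext _ _ (fterm_add f g)).
  apply CSum_plus; eapply fle_summable; eassumption.
Qed.

Lemma fev_scal c f M : fle xi f M -> fev xi (fscal c f) = c * fev xi f.
Proof.
  intros Hf. unfold fev. rewrite (CSum_ext _ _ (fterm_scal c f)).
  apply CSum_scal. eapply fle_summable; eassumption.
Qed.

Lemma fev_sub f g M N :
  fle xi f M -> fle xi g N -> fev xi (fsub f g) = fev xi f - fev xi g.
Proof.
  intros Hf Hg.
  replace (fsub f g) with (fadd f (fscal (- (1)) g)).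
  - rewrite (fev_add _ _ M (Cmod (- (1)) * N)); [|assumption|apply fle_scal; assumption].
    rewrite (fev_scal _ _ N) by assumption. ring.
  - apply functional_extensionality. intros n. unfold fadd, fsub, fscal. ring.
Qed.

Lemma fterm_zsum F n :
  fterm xi (zsum F) n =
  csum (fun z => (fun z j => RtoC (xi ^ z) * fterm xi (F z) j) z (n - z)%nat) (S n).
Proof.
  unfold fterm, zsum. rewrite <- csum_scal_r. apply csum_ext. intros z Hz.
  replace n with (z + (n - z))%nat at 2 by lia. rewrite pow_add, RtoC_mult. ring.
Qed.

Lemma zsum_rect F M :
  (forall z, fle xi (F z) M) ->
  forall I J, (rsum (fun z => rsum (fun j => Cmod (RtoC (xi ^ z) * fterm xi (F z) j)) J) I
    <= M / (1 - xi))%R.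
Proof.
  intros HF I J.
  assert (HM : (0 <= M)%R) by (apply (fle_pos (F O)), HF).
  apply Rle_trans with (rsum (fun z => M * xi ^ z)%R I).
  - apply rsum_le. intros z _.
    rewrite (rsum_ext _ (fun j => xi ^ z * Cmod (fterm xi (F z) j))%R).
    + rewrite rsum_scal, Rmult_comm. apply Rmult_le_compat_r; [apply pow_le; lra|apply HF].
    + intros j _. rewrite Cmod_mult, Cmod_R, Rabs_pos_eq by (apply pow_le; lra). reflexivity.
  - rewrite rsum_scal. apply Rmult_le_compat_l; [exact HM|].
    apply (rsum_geom_le xi I). lra.
Qed.

Lemma summable2_zsum F M :
  (forall z, fle xi (F z) M) -> summable2 (fun z j => RtoC (xi ^ z) * fterm xi (F z) j).
Proof. intros HF. exists (M / (1 - xi))%R. apply zsum_rect, HF. Qed.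

Lemma fle_zsum F M : (forall z, fle xi (F z) M) -> fle xi (zsum F) (M / (1 - xi)).
Proof.
  intros HF n. eapply Rle_trans; [|apply (zsum_rect F M HF n n)].
  rewrite (rsum_ext _ _ n (fun m _ => f_equal Cmod (fterm_zsum F m))).
  apply (rsum_diag_le (fun z j => RtoC (xi ^ z) * fterm xi (F z) j)).
Qed.

Lemma fev_zsum F M :
  (forall z, fle xi (F z) M) -> fev xi (zsum F) = CSum (fun z => RtoC (xi ^ z) * fev xi (F z)).
Proof.
  intros HF. unfold fev at 1. rewrite (CSum_ext _ _ (fterm_zsum F)).
  rewrite (CSum_diag (fun z j => RtoC (xi ^ z) * fterm xi (F z) j))
    by (apply (summable2_zsum _ M), HF).
  apply CSum_ext. intros z. apply CSum_scal. eapply fle_summable, HF.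
Qed.

Lemma fterm_mul f g n :
  fterm xi (fmul f g) n =
  csum (fun i => (fun i j => fterm xi f i * fterm xi g j) i (n - i)%nat) (S n).
Proof.
  unfold fterm, fmul. rewrite <- csum_scal_r. apply csum_ext. intros z Hz.
  replace n with (z + (n - z))%nat at 2 by lia. rewrite pow_add, RtoC_mult. ring.
Qed.

Lemma fev_mul f g M N :
  fle xi f M -> fle xi g N -> fev xi (fmul f g) = fev xi f * fev xi g.
Proof.
  intros Hf Hg. unfold fev at 1. rewrite (CSum_ext _ _ (fterm_mul f g)).
  rewrite (CSum_diag (fun i j => fterm xi f i * fterm xi g j)).
  - rewrite (CSum_ext _ (fun i => fev xi g * fterm xi f i)).
    + rewrite CSum_scal by (eapply fle_summable, Hf). apply Cmult_comm.
    + intros i. rewrite CSum_scal by (eapply fle_summable, Hg). apply Cmult_comm.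
  - apply summable2_prod; eapply fle_summable; eassumption.
Qed.

Lemma fle_mul f g M N : fle xi f M -> fle xi g N -> fle xi (fmul f g) (M * N).
Proof.
  intros Hf Hg n. rewrite (rsum_ext _ _ n (fun m _ => f_equal Cmod (fterm_mul f g m))).
  eapply Rle_trans; [apply (rsum_diag_le (fun i j => fterm xi f i * fterm xi g j))|].
  rewrite (rsum_ext _ (fun i => (rsum (fun j => Cmod (fterm xi g j)) n) * Cmod (fterm xi f i))%R).
  - rewrite rsum_scal, Rmult_comm. apply Rmult_le_compat;
      try (apply rsum_pos; intros; apply Cmod_ge_0); [apply Hf|apply Hg].
  - intros i _. rewrite Rmult_comm, <- rsum_scal. apply rsum_ext. intros j _. apply Cmod_mult.
Qed.

Lemma fle_fone : fle xi fone 1.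
Proof.
  intros [|n]; [simpl; lra|].
  induction n as [|n IH].
  - simpl. unfold fterm. simpl. rewrite Cmult_1_r, Cmod_1. lra.
  - assert (E : fterm xi fone (S n) = 0) by (unfold fterm, fone, fconst; ring).
    cbn [rsum] in *. rewrite E, Cmod_0. lra.
Qed.

Lemma fle_fX : fle xi fX 1.
Proof.
  intros [|[|n]]; [simpl; lra| |].
  - simpl. unfold fterm. simpl. rewrite Cmult_0_l, Cmod_0. lra.
  - induction n as [|n IH].
    + simpl. unfold fterm. simpl. rewrite Cmult_0_l, Cmult_1_l, Cmod_0, Cmod_R, Rmult_1_r.
      rewrite Rabs_pos_eq; lra.
    + assert (E : fterm xi fX (S (S n)) = 0) by (unfold fterm, fX; ring).
      cbn [rsum] in *. rewrite E, Cmod_0. lra.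
Qed.

Lemma fev_fone : fev xi fone = 1.
Proof.
  transitivity (csum (fterm xi fone) 1).
  - apply csums_CSum, csums_finite. intros [|n] Hn; [lia|].
    unfold fterm, fone, fconst. ring.
  - simpl. unfold fterm. simpl. ring.
Qed.

Lemma fev_fX : fev xi fX = RtoC xi.
Proof.
  transitivity (csum (fterm xi fX) 2).
  - apply csums_CSum, csums_finite. intros [|[|n]] Hn; try lia.
    unfold fterm, fX. ring.
  - simpl. unfold fterm. simpl. rewrite Rmult_1_r. ring.
Qed.

(** ** The kernel identity for numbers *)

Variables (c d : C) (Hcd : c + d = 1) (B : R).
Hypothesis Hc : forall n, (Cmod (binc c n) <= B)%R.
Hypothesis Hd : forall n, (Cmod (binc d n) <= B)%R.

Lemma fle_lcoef e x :
  (forall n, (Cmod (binc e n) <= B)%R) -> fle xi (lcoef e x) (B * B / (1 - xi)).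
Proof.
  intros He n.
  assert (HB : (0 <= B)%R) by (eapply Rle_trans; [apply Cmod_ge_0|apply (He O)]).
  apply Rle_trans with (rsum (fun k => (B * B) * xi ^ k)%R n).
  - apply rsum_le. intros k _. unfold fterm, lcoef. rewrite !Cmod_mult, Cmod_R.
    rewrite Rabs_pos_eq by (apply pow_le; lra).
    apply Rmult_le_compat_r; [apply pow_le; lra|].
    apply Rmult_le_compat; try apply Cmod_ge_0; apply He.
  - rewrite rsum_scal. unfold Rdiv. apply Rmult_le_compat_l; [nra|].
    apply (rsum_geom_le xi n). lra.
Qed.

Let M0 := (B * B / (1 - xi))%R.
Let M1 := (M0 + 1 * M0)%R.

Lemma fle_lcoef1 e x :
  (forall n, (Cmod (binc e n) <= B)%R) -> fle xi (lcoef1 e x) M1.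
Proof.
  intros He. unfold lcoef1. apply fle_sub; [apply fle_lcoef, He|].
  apply fle_mul; [apply fle_fX|apply fle_lcoef, He].
Qed.

Lemma fev_lcoef1 e x :
  (forall n, (Cmod (binc e n) <= B)%R) ->
  fev xi (lcoef1 e x) = fev xi (lcoef e x) - RtoC xi * fev xi (lcoef e (S x)).
Proof.
  intros He. unfold lcoef1.
  rewrite (fev_sub _ _ M0 (1 * M0)), (fev_mul _ _ 1 M0), fev_fX.
  - reflexivity.
  - apply fle_fX.
  - apply fle_lcoef, He.
  - apply fle_lcoef, He.
  - apply fle_mul; [apply fle_fX|apply fle_lcoef, He].
Qed.

Let MT := ((1 + 1) * (M1 * M1 / (1 - xi)) + (1 + 1) * (M0 * M0))%R.

Lemma fle_kerT x y : fle xi (kerT c d x y) MT.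
Proof.
  unfold kerT, MT. apply fle_sub; apply fle_mul.
  - apply fle_add; apply fle_fone.
  - apply fle_zsum. intros z. apply fle_mul; apply fle_lcoef1; assumption.
  - apply fle_sub; [apply fle_fone|apply fle_fX].
  - apply fle_mul; apply fle_lcoef; assumption.
Qed.

Lemma fev_kerT x y :
  fev xi (kerT c d x y) =
  2 * CSum (fun m => RtoC (xi ^ m) * (fev xi (lcoef1 c (x + m)) * fev xi (lcoef1 d (y + m)))) -
  (1 - RtoC xi) * (fev xi (lcoef c x) * fev xi (lcoef d y)).
Proof.
  assert (H2 : fle xi (fadd fone fone) (1 + 1)) by (apply fle_add; apply fle_fone).
  assert (HX : fle xi (fsub fone fX) (1 + 1))
    by (apply fle_sub; [apply fle_fone|apply fle_fX]).
  assert (Hz : forall m, fle xi (fmul (lcoef1 c (x + m)) (lcoef1 d (y + m))) (M1 * M1))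
    by (intros m; apply fle_mul; apply fle_lcoef1; assumption).
  assert (HA : forall k, fle xi (lcoef c k) M0) by (intros; apply fle_lcoef; assumption).
  assert (HB : forall k, fle xi (lcoef d k) M0) by (intros; apply fle_lcoef; assumption).
  unfold kerT.
  rewrite (fev_sub _ _ ((1 + 1) * (M1 * M1 / (1 - xi))) ((1 + 1) * (M0 * M0)));
    [|apply fle_mul; [exact H2|apply fle_zsum, Hz]
     |apply fle_mul; [exact HX|apply fle_mul; auto]].
  rewrite (fev_mul _ _ (1 + 1) (M1 * M1 / (1 - xi))) by (try apply fle_zsum; assumption).
  rewrite (fev_mul _ _ (1 + 1) (M0 * M0)) by (try apply fle_mul; auto).
  rewrite (fev_add _ _ 1 1), (fev_sub _ _ 1 1) by (apply fle_fone || apply fle_fX).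
  rewrite (fev_mul _ _ M0 M0) by auto.
  rewrite fev_fone, fev_fX, (fev_zsum _ (M1 * M1)) by exact Hz.
  rewrite (CSum_ext (fun z => RtoC (xi ^ z) * fev xi (fmul _ _))
    (fun m => RtoC (xi ^ m) * (fev xi (lcoef1 c (x + m)) * fev xi (lcoef1 d (y + m))))).
  - replace (RtoC 2) with (1 + 1) by (rewrite <- RtoC_plus; f_equal; ring). reflexivity.
  - intros m. rewrite (fev_mul _ _ M1 M1) by (apply fle_lcoef1; assumption). reflexivity.
Qed.

Lemma natC_inv_le n : (0 < n)%nat -> (Cmod (/ natC n) <= 1)%R.
Proof.
  intros H. rewrite Cmod_inv by (apply natC_neq; lia). unfold natC.
  rewrite Cmod_R, Rabs_pos_eq by apply pos_INR.
  rewrite <- Rinv_1. apply Rinv_le_contravar; [lra|].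
  change 1%R with (INR 1). apply le_INR. lia.
Qed.

Lemma fle_kerK x y : (0 < x + y)%nat -> fle xi (kerK c d x y) MT.
Proof.
  intros H. unfold kerK. eapply fle_weaken; [apply fle_scal, fle_kerT|].
  rewrite <- (Rmult_1_l MT) at 2. apply Rmult_le_compat_r.
  - apply (fle_pos (kerT c d x y)), fle_kerT.
  - apply natC_inv_le, H.
Qed.

Lemma fev_kerK x y :
  fev xi (kerK c d x y) = fev xi (kerT c d x y) / natC (x + y).
Proof.
  unfold kerK. rewrite (fev_scal _ _ MT) by apply fle_kerT. apply Cmult_comm.
Qed.

Lemma kerK_bounded : exists M, forall x y, (0 < x + y)%nat -> (Cmod (fev xi (kerK c d x y)) <= M)%R.
Proof. exists MT. intros x y H. apply fle_fev, fle_kerK, H. Qed.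

Lemma kernel_equation x y : (0 < x)%nat -> (0 < y)%nat ->
  binc c x * binc d y / natC (x + y) = fev xi (kerK c d x y) +
  binc c x * CSum (fun z => RtoC (xi ^ z) *
    (natC z * binc d z / natC (x + z) * fev xi (kerK c d z y))).
Proof.
  intros Hx Hy.
  pose proof (defect_zero c d Hcd x y Hx Hy) as E. unfold defect in E.
  set (Z := zsum (fun z => fscal (natC z * binc d z / natC (x + z)) (kerK c d z y))) in E.
  assert (HF : forall z, fle xi (fscal (natC z * binc d z / natC (x + z)) (kerK c d z y)) (B * MT)).
  { intros z. eapply fle_weaken; [apply fle_scal, fle_kerK; lia|].
    apply Rmult_le_compat_r; [apply (fle_pos (kerT c d x y)), fle_kerT|].
    assert (Hxz : natC (x + z) <> 0) by (apply natC_neq; lia).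
    replace (natC z * binc d z / natC (x + z)) with (binc d z * (natC z / natC (x + z)))
      by (field; assumption).
    rewrite Cmod_mult. rewrite <- (Rmult_1_r B).
    apply Rmult_le_compat; try apply Cmod_ge_0; [apply Hd|].
    rewrite Cmod_div by assumption. unfold natC. rewrite !Cmod_R, !Rabs_pos_eq by apply pos_INR.
    apply Rmult_le_reg_r with (INR (x + z)); [apply lt_0_INR; lia|].
    unfold Rdiv. rewrite Rmult_assoc, Rinv_l by (apply not_0_INR; lia).
    rewrite Rmult_1_r, Rmult_1_l. apply le_INR. lia. }
  assert (E2 : fscal (binc c x * binc d y / natC (x + y)) fone =
    fadd (kerK c d x y) (fscal (binc c x) Z)).
  { apply functional_extensionality. intros n. apply (f_equal (fun f => f n)) in E.
    unfold fsub, fadd, fzero in *. apply Ceq_minus. rewrite <- E. ring. }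
  apply (f_equal (fev xi)) in E2.
  rewrite (fev_scal _ _ 1) in E2 by apply fle_fone.
  rewrite fev_fone, Cmult_1_r in E2. rewrite E2.
  assert (HZ : fle xi Z (B * MT / (1 - xi))) by (apply fle_zsum, HF).
  rewrite (fev_add _ _ MT (Cmod (binc c x) * (B * MT / (1 - xi))))
    by (try apply fle_kerK; try apply fle_scal; try assumption; lia).
  rewrite (fev_scal _ _ _ HZ). unfold Z. rewrite (fev_zsum _ _ HF).
  do 2 f_equal. apply CSum_ext. intros z. rewrite (fev_scal _ _ MT) by (apply fle_kerK; lia).
  reflexivity.
Qed.

Definition kernel_term (n m z : nat) : C :=
  RtoC (xi ^ z) * (natC z * binc d z / natC (n + z) * fev xi (kerK c d z m)).

Lemma kernel_term_summable n m : (0 < n)%nat -> (0 < m)%nat -> summable (kernel_term n m).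
Proof.
  intros Hn Hm.
  assert (HB0 : (0 <= B)%R) by (eapply Rle_trans; [apply Cmod_ge_0|apply (Hc O)]).
  destruct kerK_bounded as [M HM].
  apply (summable_le _ (fun z => RtoC (B * Rabs M) * RtoC (xi ^ z)));
    [|apply summable_scal, summable_geom; lra].
  intros z. unfold kernel_term. rewrite !Cmod_mult, !Cmod_R, Rmult_comm.
  apply Rmult_le_compat_r; [apply Rabs_pos|].
  assert (Hnz : natC (n + z) <> 0) by (apply natC_neq; lia).
  rewrite (Rabs_pos_eq (B * Rabs M)) by (apply Rmult_le_pos; [exact HB0|apply Rabs_pos]).
  apply Rmult_le_compat; [apply Cmod_ge_0|apply Cmod_ge_0| |].
  - replace (natC z * binc d z / natC (n + z)) with (binc d z * (natC z / natC (n + z)))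
      by (field; exact Hnz).
    rewrite Cmod_mult, <- (Rmult_1_r B). apply Rmult_le_compat; try apply Cmod_ge_0; [apply Hd|].
    rewrite Cmod_div by exact Hnz. unfold natC. rewrite !Cmod_R, !Rabs_pos_eq by apply pos_INR.
    apply Rle_div_l; [apply lt_0_INR; lia|]. rewrite Rmult_1_l. apply le_INR. lia.
  - eapply Rle_trans; [apply HM; lia|apply Rle_abs].
Qed.

(** The term of index zero vanishes, so the sum may start at one. *)
Lemma kernel_row_equation n m : (0 < n)%nat -> (0 < m)%nat ->
  binc c n * binc d m / natC (n + m) = fev xi (kerK c d n m) +
  binc c n * CSum (fun i => kernel_term n m (S i)).
Proof.
  intros Hn Hm. rewrite (kernel_equation n m Hn Hm).
  change (CSum (fun z => RtoC (xi ^ z) *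
    (natC z * binc d z / natC (n + z) * fev xi (kerK c d z m)))) with (CSum (kernel_term n m)).
  do 2 f_equal. symmetry.
  transitivity (CSum (kernel_term n m) - csum (kernel_term n m) 1).
  - apply csums_CSum.
    exact (csums_shift _ _ 1 (summable_csums _ (kernel_term_summable n m Hn Hm))).
  - cbn [csum]. unfold kernel_term at 2. rewrite natC_0. unfold Cdiv. ring.
Qed.

End Evaluation.

(** For [0 <= Re c < 1] the factors [(c + n) / (n + 1)] are eventually at most [1] in modulus. *)
Lemma binc_bounded c : (0 <= Re c < 1)%R -> exists B, forall n, (Cmod (binc c n) <= B)%R.
Proof.
  intros Hc.
  assert (exists N, forall n, (N <= n)%nat -> (Cmod (c + natC n) <= INR (S n))%R) as [N HN].
  { destruct (nfloor_ex (Im c ^ 2 / (1 - Re c))) as [N HN].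
    { apply Rdiv_le_0_compat; [apply pow2_ge_0|lra]. }
    exists (S N). intros n Hn.
    apply Rsqr_incr_0_var; [|apply pos_INR]. rewrite !Rsqr_pow2, Cmod2_alt.
    replace (Re (c + natC n)) with (Re c + INR n)%R by reflexivity.
    replace (Im (c + natC n)) with (Im c) by (unfold natC, Im; simpl; ring).
    rewrite S_INR. apply le_INR in Hn. rewrite S_INR in Hn.
    assert (Im c ^ 2 <= INR n * (1 - Re c))%R.
    { apply Rmult_le_reg_r with (/ (1 - Re c))%R; [apply Rinv_0_lt_compat; lra|].
      rewrite Rmult_assoc, Rinv_r by lra. unfold Rdiv in HN. lra. }
    pose proof (pos_INR n). nra. }
  assert (M : exists B, forall n, (n <= N)%nat -> (Cmod (binc c n) <= B)%R).
  { clear HN. induction N as [|N [B HB]].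
    - exists (Cmod (binc c 0)). intros n Hn. replace n with O by lia. lra.
    - exists (Rmax B (Cmod (binc c (S N)))). intros n Hn.
      assert (n <= N \/ n = S N)%nat as [H| ->] by lia.
      + eapply Rle_trans; [apply HB, H|apply Rmax_l].
      + apply Rmax_r. }
  destruct M as [B HB]. exists B. intros n.
  destruct (Compare_dec.le_lt_dec n N) as [H|H]; [apply HB, H|].
  replace n with (N + (n - N))%nat by lia. induction (n - N)%nat as [|m IH].
  - rewrite Nat.add_0_r. apply HB. lia.
  - rewrite Nat.add_succ_r. cbn [binc]. rewrite Cmod_mult, Cmod_div by (apply natC_neq; lia).
    rewrite <- (Rmult_1_r B). apply Rmult_le_compat; [apply Cmod_ge_0| |exact IH|].
    + apply Rdiv_le_0_compat; [apply Cmod_ge_0|]. unfold natC.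
      rewrite Cmod_R, Rabs_pos_eq by apply pos_INR. apply lt_0_INR. lia.
    + unfold natC at 2. rewrite Cmod_R, Rabs_pos_eq by apply pos_INR.
      apply Rmult_le_reg_r with (INR (S (N + m))); [apply lt_0_INR; lia|].
      unfold Rdiv. rewrite Rmult_assoc, Rinv_l by (apply not_0_INR; lia).
      rewrite Rmult_1_r, Rmult_1_l. apply HN. lia.
Qed.

(** * Inverting [1 + L] on the Hilbert space *)

Lemma rsum_cauchy_schwarz (a b : nat -> R) n :
  (rsum (fun k => a k * b k) n ^ 2 <= rsum (fun k => a k ^ 2) n * rsum (fun k => b k ^ 2) n)%R.
Proof.
  set (A := rsum (fun k => a k ^ 2)%R n). set (B := rsum (fun k => b k ^ 2)%R n).
  set (P := rsum (fun k => a k * b k)%R n).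
  assert (Q : forall t, (0 <= A + 2 * t * P + t ^ 2 * B)%R).
  { intros t. unfold A, B, P. rewrite <- !rsum_scal, <- !rsum_plus.
    apply rsum_pos. intros k.
    replace (a k ^ 2 + 2 * t * (a k * b k) + t ^ 2 * b k ^ 2)%R with ((a k + t * b k) ^ 2)%R by ring.
    apply pow2_ge_0. }
  assert (HB : (0 <= B)%R) by (apply rsum_pos; intros; apply pow2_ge_0).
  destruct (Req_dec B 0) as [E|E].
  - rewrite E in *. assert (P = 0)%R; [|nra].
    assert (HA : (0 <= A)%R) by (apply rsum_pos; intros; apply pow2_ge_0).
    apply NNPP. intros N. specialize (Q (- (A + 1) / (2 * P))%R).
    replace (A + 2 * (- (A + 1) / (2 * P)) * P + (- (A + 1) / (2 * P)) ^ 2 * 0)%R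
      with (-1)%R in Q by (field; exact N). lra.
  - specialize (Q (- P / B)%R).
    replace (A + 2 * (- P / B) * P + (- P / B) ^ 2 * B)%R with (A - P ^ 2 / B)%R in Q
      by (field; exact E).
    apply Rmult_le_reg_r with (/ B)%R; [apply Rinv_0_lt_compat; lra|].
    rewrite Rmult_assoc, Rinv_r, Rmult_1_r by exact E. unfold Rdiv in Q. lra.
Qed.

Definition ix (n : nat) : positive := Pos.of_succ_nat n.

Lemma ix_inj n m : ix n = ix m -> n = m.
Proof. unfold ix. intros H. apply SuccNat2Pos.inj in H. exact H. Qed.

Lemma ix_surj x : exists n, x = ix n.
Proof.
  exists (pred (Pos.to_nat x)). unfold ix. rewrite Pos.of_nat_succ.
  rewrite Nat.succ_pred by (pose proof (Pos2Nat.is_pos x); lia). symmetry. apply Pos2Nat.id.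
Qed.

(** Membership in [ell2] with a bound for the squared norm, as bounds for partial sums. *)
Definition sq_le (u : positive -> C) (M : R) : Prop :=
  forall n, (rsum (fun k => Cmod (u (ix k)) ^ 2) n <= M)%R.

Lemma ell2_sq_le u : ell2 u -> sq_le u (ell2_norm u ^ 2).
Proof.
  intros H n.
  pose proof (proj1 (is_series_rsum _ _) (Series_correct _ H)) as S1.
  set (S := Series _) in S1.
  assert (Le : (rsum (fun k => Cmod (u (ix k)) ^ 2) n <= S)%R).
  { apply Rnot_lt_le. intros L.
    destruct (S1 (rsum (fun k => Cmod (u (ix k)) ^ 2) n - S)%R ltac:(lra)) as [N HN].
    specialize (HN (n + N)%nat ltac:(lia)). apply Rabs_def2 in HN.
    pose proof (rsum_mono (fun k => Cmod (u (ix k)) ^ 2)%R n (n + N)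
      (fun k => pow2_ge_0 _) ltac:(lia)). unfold ix in *. lra. }
  unfold ell2_norm. rewrite pow2_sqrt; [exact Le|].
  eapply Rle_trans; [|exact Le]. apply rsum_pos. intros. apply pow2_ge_0.
Qed.

Lemma sq_le_ell2 u M : sq_le u M -> ell2 u /\ (ell2_norm u <= sqrt M)%R.
Proof.
  intros H. assert (E : ell2 u).
  { apply (ex_series_bounded _ M); [intros; apply pow2_ge_0|exact H]. }
  split; [exact E|]. unfold ell2_norm. apply sqrt_le_1_alt.
  apply Series_correct in E. pose proof (proj1 (is_series_rsum _ _) E) as E'.
  apply Rnot_lt_le. intros L.
  destruct (E' (Series (fun n => Cmod (u (Pos.of_succ_nat n)) ^ 2) - M)%R ltac:(lra)) as [N HN].
  specialize (HN N (le_n _)). apply Rabs_def2 in HN. specialize (H N). unfold ix in H. lra.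
Qed.

Lemma ell2_norm_pos u : (0 <= ell2_norm u)%R.
Proof. apply sqrt_pos. Qed.

Lemma ell2_axpy a u v : ell2 u -> ell2 v -> ell2 (fun x => a * u x + v x).
Proof.
  intros Hu Hv.
  apply (sq_le_ell2 _ (2 * (Cmod a ^ 2 * ell2_norm u ^ 2 + ell2_norm v ^ 2))%R).
  intros n.
  apply Rle_trans with (rsum (fun k =>
    2 * (Cmod a ^ 2 * (Cmod (u (ix k)) ^ 2) + Cmod (v (ix k)) ^ 2))%R n).
  - apply rsum_le. intros k _.
    pose proof (Cmod_triangle (a * u (ix k)) (v (ix k))) as T. rewrite Cmod_mult in T.
    pose proof (Cmod_ge_0 (a * u (ix k) + v (ix k))).
    pose proof (pow2_ge_0 (Cmod a * Cmod (u (ix k)) - Cmod (v (ix k)))).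
    assert (Cmod (a * u (ix k) + v (ix k)) ^ 2 <= (Cmod a * Cmod (u (ix k)) + Cmod (v (ix k))) ^ 2)%R
      by (apply pow_incr; lra).
    nra.
  - rewrite rsum_scal, rsum_plus, rsum_scal.
    apply Rmult_le_compat_l; [lra|]. apply Rplus_le_compat; [|apply (ell2_sq_le v Hv)].
    apply Rmult_le_compat_l; [apply pow2_ge_0|]. apply (ell2_sq_le u Hu).
Qed.

Section DominatedMatrices.

Variables (h : positive -> R) (H : R).
Hypothesis h_pos : forall x, (0 <= h x)%R.
Hypothesis h_sq : forall n, (rsum (fun k => h (ix k) ^ 2) n <= H ^ 2)%R.
Hypothesis H_pos : (0 <= H)%R.

(** Domination by a square summable matrix of rank one makes the double series in the composition of
    two such operators converge absolutely. *)
Definition dominated (A : positive -> positive -> C) : Prop :=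
  forall x y, (Cmod (A x y) <= h x * h y)%R.

Lemma dominated_row A u x : dominated A -> ell2 u ->
  forall n, (rsum (fun k => Cmod (A x (ix k) * u (ix k))) n <= h x * (H * ell2_norm u))%R.
Proof.
  intros HA Hu n.
  apply Rle_trans with (h x * rsum (fun k => h (ix k) * Cmod (u (ix k))) n)%R.
  - rewrite <- rsum_scal. apply rsum_le. intros k _. rewrite Cmod_mult, <- Rmult_assoc.
    apply Rmult_le_compat_r; [apply Cmod_ge_0|apply HA].
  - apply Rmult_le_compat_l; [apply h_pos|].
    apply Rsqr_incr_0_var.
    + rewrite !Rsqr_pow2. eapply Rle_trans; [apply rsum_cauchy_schwarz|].
      rewrite Rpow_mult_distr. apply Rmult_le_compat.
      * apply rsum_pos. intros; apply pow2_ge_0.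
      * apply rsum_pos. intros; apply pow2_ge_0.
      * apply h_sq.
      * apply (ell2_sq_le u Hu).
    + apply Rmult_le_pos; [exact H_pos|apply ell2_norm_pos].
Qed.

Lemma dominated_summable A u x :
  dominated A -> ell2 u -> summable (fun k => A x (ix k) * u (ix k)).
Proof. intros HA Hu. eexists. apply dominated_row; eassumption. Qed.

Lemma dominated_entry A u x :
  dominated A -> ell2 u -> (Cmod (matrix_op A u x) <= h x * (H * ell2_norm u))%R.
Proof.
  intros HA Hu. exact (Cmod_CSum_le _ _ (dominated_row A u x HA Hu)).
Qed.

Lemma dominated_sq_le A u :
  dominated A -> ell2 u -> sq_le (matrix_op A u) (H ^ 2 * (H * ell2_norm u) ^ 2).
Proof.
  intros HA Hu n.
  apply Rle_trans with (rsum (fun k => (H * ell2_norm u) ^ 2 * h (ix k) ^ 2)%R n).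
  - apply rsum_le. intros k _. rewrite <- Rpow_mult_distr. apply pow_incr.
    split; [apply Cmod_ge_0|]. rewrite Rmult_comm. apply dominated_entry; assumption.
  - rewrite rsum_scal, Rmult_comm. apply Rmult_le_compat_r; [apply pow2_ge_0|apply h_sq].
Qed.

Lemma dominated_ell2 A u : dominated A -> ell2 u -> ell2 (matrix_op A u).
Proof. intros HA Hu. exact (proj1 (sq_le_ell2 _ _ (dominated_sq_le A u HA Hu))). Qed.

Lemma matrix_op_axpy A a u v x : dominated A -> ell2 u -> ell2 v ->
  matrix_op A (fun y => a * u y + v y) x = a * matrix_op A u x + matrix_op A v x.
Proof.
  intros HA Hu Hv.
  change (CSum (fun k => A x (ix k) * (a * u (ix k) + v (ix k))) =
    a * CSum (fun k => A x (ix k) * u (ix k)) + CSum (fun k => A x (ix k) * v (ix k))).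
  rewrite <- CSum_scal by (apply dominated_summable; assumption).
  rewrite <- CSum_plus; [|apply summable_scal|]; try (apply dominated_summable; assumption).
  apply CSum_ext. intros k. ring.
Qed.

Lemma matrix_op_comp A B u x : dominated A -> dominated B -> ell2 u ->
  matrix_op A (matrix_op B u) x =
  matrix_op (fun x y => CSum (fun k => A x (ix k) * B (ix k) y)) u x.
Proof.
  intros HA HB Hu.
  assert (S2 : summable2 (fun k m => A x (ix k) * (B (ix k) (ix m) * u (ix m)))).
  { apply (summable2_le _ (fun k m =>
      RtoC (h x * h (ix k) * h (ix k)) * RtoC (h (ix m) * Cmod (u (ix m))))).
    - intros k m. rewrite !Cmod_mult, !Cmod_R.
      rewrite !Rabs_pos_eq by (repeat apply Rmult_le_pos; apply h_pos || apply Cmod_ge_0).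
      replace (h x * h (ix k) * h (ix k) * (h (ix m) * Cmod (u (ix m))))%R
        with ((h x * h (ix k)) * ((h (ix k) * h (ix m)) * Cmod (u (ix m))))%R by ring.
      apply Rmult_le_compat; try apply Cmod_ge_0; [|apply HA|].
      + apply Rmult_le_pos; apply Cmod_ge_0.
      + apply Rmult_le_compat_r; [apply Cmod_ge_0|apply HB].
    - apply summable2_prod.
      + exists (h x * H ^ 2)%R. intros n. eapply Rle_trans; [|apply Rmult_le_compat_l;
          [apply h_pos|apply (h_sq n)]].
        rewrite <- rsum_scal. right. apply rsum_ext. intros k _.
        rewrite Cmod_R, Rabs_pos_eq by (repeat apply Rmult_le_pos; apply h_pos). ring.
      + exists (H * ell2_norm u)%R. intros n.
        apply Rsqr_incr_0_var; [|apply Rmult_le_pos; [exact H_pos|apply ell2_norm_pos]].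
        rewrite !Rsqr_pow2.
        rewrite (rsum_ext _ (fun k => h (ix k) * Cmod (u (ix k)))%R).
        * eapply Rle_trans; [apply rsum_cauchy_schwarz|]. rewrite Rpow_mult_distr.
          apply Rmult_le_compat; try (apply rsum_pos; intros; apply pow2_ge_0);
            [apply h_sq|apply (ell2_sq_le u Hu)].
        * intros k _. rewrite Cmod_R. apply Rabs_pos_eq, Rmult_le_pos;
            [apply h_pos|apply Cmod_ge_0]. }
  change (CSum (fun k => A x (ix k) * CSum (fun m => B (ix k) (ix m) * u (ix m))) =
    CSum (fun m => CSum (fun k => A x (ix k) * B (ix k) (ix m)) * u (ix m))).
  transitivity (CSum (fun k => CSum (fun m => A x (ix k) * (B (ix k) (ix m) * u (ix m))))).
  - apply CSum_ext. intros k. symmetry. apply CSum_scal.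
    apply (dominated_summable B); assumption.
  - rewrite (CSum_swap _ S2). apply CSum_ext. intros m.
    rewrite Cmult_comm, <- CSum_scal.
    + apply CSum_ext. intros k. ring.
    + exists (h x * (h (ix m) * H ^ 2))%R. intros n.
      eapply Rle_trans; [|apply Rmult_le_compat_l; [apply h_pos|apply Rmult_le_compat_l;
        [apply h_pos|apply (h_sq n)]]].
      rewrite <- !rsum_scal. apply rsum_le. intros k _. rewrite Cmod_mult.
      replace (h x * (h (ix m) * h (ix k) ^ 2))%R with ((h x * h (ix k)) * (h (ix k) * h (ix m)))%R
        by ring.
      apply Rmult_le_compat; try apply Cmod_ge_0; [apply HA|apply HB].
Qed.

Lemma delta_ell2 y : ell2 (delta y).
Proof.
  apply (sq_le_ell2 _ 1). destruct (ix_surj y) as [m ->].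
  assert (G : forall n, rsum (fun k => Cmod (delta (ix m) (ix k)) ^ 2)%R n =
    if Nat.ltb m n then 1%R else 0%R).
  { induction n as [|n IH]; [reflexivity|]. cbn [rsum]. rewrite IH. unfold delta.
    destruct (Pos.eqb_spec (ix n) (ix m)) as [E|E].
    - apply ix_inj in E. subst. rewrite Nat.ltb_irrefl.
      replace (Nat.ltb m (S m)) with true by (symmetry; apply Nat.ltb_lt; lia).
      rewrite Cmod_1. ring.
    - rewrite Cmod_0. assert (n <> m) by congruence.
      destruct (Nat.ltb_spec m n), (Nat.ltb_spec m (S n)); try lia; ring. }
  intros n. rewrite G. destruct (Nat.ltb m n); lra.
Qed.

Lemma matrix_op_delta A x y : matrix_op A (delta y) x = A x y.
Proof.
  destruct (ix_surj y) as [m ->].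
  change (CSum (fun k => A x (ix k) * delta (ix m) (ix k)) = A x (ix m)).
  transitivity (csum (fun k => A x (ix k) * delta (ix m) (ix k)) (S m)).
  - apply csums_CSum, csums_finite. intros n Hn. unfold delta.
    destruct (Pos.eqb_spec (ix n) (ix m)) as [E|E]; [apply ix_inj in E; lia|ring].
  - cbn [csum]. rewrite csum_zero.
    + unfold delta. rewrite Pos.eqb_refl. ring.
    + intros n Hn. unfold delta.
      destruct (Pos.eqb_spec (ix n) (ix m)) as [E|E]; [apply ix_inj in E; lia|ring].
Qed.

Lemma CSum_matrix_op A y x :
  CSum (fun k => A x (ix k) * y (ix k)) = matrix_op A y x.
Proof. reflexivity. Qed.

(** An identity between matrices passes to the operators. The entries of the product are not known
    to be dominated, but the identity itself makes their sum against [u] converge. *)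
Lemma matrix_op_equation L K A B u x :
  dominated L -> dominated K -> dominated A -> dominated B -> ell2 u ->
  (forall y, L x y = K x y + CSum (fun k => A x (ix k) * B (ix k) y)) ->
  matrix_op L u x = matrix_op K u x + matrix_op A (matrix_op B u) x.
Proof.
  intros HL HK HA HB Hu E. rewrite matrix_op_comp by assumption.
  rewrite <- !CSum_matrix_op, <- CSum_plus.
  - apply CSum_ext. intros m. rewrite (E (ix m)). ring.
  - apply dominated_summable; assumption.
  - apply (summable_le _ (fun m => L x (ix m) * u (ix m) + (- (1)) * (K x (ix m) * u (ix m)))).
    + intros m. right. f_equal. rewrite (E (ix m)). ring.
    + apply summable_plus; [|apply summable_scal]; apply dominated_summable; assumption.
Qed.

(** A dominated matrix [K] with [L = K + L K = K + K L] makes [1 - K] a bounded two-sided inverse of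
    [1 + L], hence the inverse that the choice operator selects. *)
Lemma matrix_entry_resolvent (L K : positive -> positive -> C) :
  dominated L -> dominated K ->
  (forall x y, L x y = K x y + CSum (fun k => L x (ix k) * K (ix k) y)) ->
  (forall x y, L x y = K x y + CSum (fun k => K x (ix k) * L (ix k) y)) ->
  forall x y,
  matrix_entry (fun u => matrix_op L (op_inverse (one_plus (matrix_op L)) u)) x y = K x y.
Proof.
  intros HL HK E1 E2 x y.
  set (R := fun (u : positive -> C) x => u x - matrix_op K u x).
  assert (R_axpy : forall u x, R u x = (- (1)) * matrix_op K u x + u x)
    by (intros; unfold R; ring).
  assert (R_ell2 : forall u, ell2 u -> ell2 (R u)).
  { intros u Hu. replace (R u) with (fun x => (- (1)) * matrix_op K u x + u x)
      by (apply functional_extensionality; intros; symmetry; apply R_axpy).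
    apply ell2_axpy; [apply dominated_ell2; assumption|exact Hu]. }
  assert (inv1 : forall u, ell2 u -> forall x, R (one_plus (matrix_op L) u) x = u x).
  { intros u Hu z. unfold R, one_plus.
    replace (fun x => u x + matrix_op L u x) with (fun x => 1 * matrix_op L u x + u x)
      by (apply functional_extensionality; intros; ring).
    rewrite matrix_op_axpy by (try apply dominated_ell2; assumption).
    rewrite (matrix_op_equation L K K L u z) by auto. ring. }
  assert (inv2 : forall u, ell2 u -> forall x, one_plus (matrix_op L) (R u) x = u x).
  { intros u Hu z. unfold one_plus.
    replace (R u) with (fun x => (- (1)) * matrix_op K u x + u x)
      by (apply functional_extensionality; intros; symmetry; apply R_axpy).
    rewrite matrix_op_axpy by (try apply dominated_ell2; assumption).
    rewrite (matrix_op_equation L K L K u z) by auto. ring. }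
  assert (Rinv : is_inverse (one_plus (matrix_op L)) R).
  { split; [|intros u Hu z; split; [apply inv1|apply inv2]; exact Hu].
    split; [exact R_ell2|]. split.
    - intros a u v Hu Hv z. unfold R. rewrite matrix_op_axpy by assumption. ring.
    - exists (sqrt (2 * (H ^ 4 + 1)))%R. intros u Hu.
      rewrite <- (sqrt_pow2 (ell2_norm u)) at 1 by apply ell2_norm_pos.
      rewrite <- sqrt_mult by (try apply pow2_ge_0; pose proof (pow2_ge_0 (H ^ 2)); nra).
      apply sq_le_ell2. intros n.
      apply Rle_trans with (rsum (fun k => 2 * (Cmod (matrix_op K u (ix k)) ^ 2 +
        Cmod (u (ix k)) ^ 2))%R n).
      + apply rsum_le. intros k _. unfold R.
        pose proof (Cmod_triangle (u (ix k)) (- matrix_op K u (ix k))) as T.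
        rewrite Cmod_opp in T. change (u (ix k) + - matrix_op K u (ix k)) with
          (u (ix k) - matrix_op K u (ix k)) in T.
        pose proof (Cmod_ge_0 (u (ix k) - matrix_op K u (ix k))).
        pose proof (pow2_ge_0 (Cmod (u (ix k)) - Cmod (matrix_op K u (ix k)))).
        assert (Cmod (u (ix k) - matrix_op K u (ix k)) ^ 2 <=
          (Cmod (u (ix k)) + Cmod (matrix_op K u (ix k))) ^ 2)%R by (apply pow_incr; lra).
        nra.
      + rewrite rsum_scal, rsum_plus. pose proof (dominated_sq_le K u HK Hu n).
        pose proof (ell2_sq_le u Hu n). nra. }
  assert (Sel : is_inverse (one_plus (matrix_op L)) (op_inverse (one_plus (matrix_op L)))).
  { unfold op_inverse. apply epsilon_spec. exists R. exact Rinv. }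
  assert (Eq : op_inverse (one_plus (matrix_op L)) (delta y) = R (delta y)).
  { apply functional_extensionality. intros z.
    destruct Sel as [_ Sel].
    rewrite <- (proj1 (Sel (R (delta y)) (R_ell2 _ (delta_ell2 y)) z)).
    f_equal. apply functional_extensionality. intros w. symmetry.
    apply inv2, delta_ell2. }
  unfold matrix_entry. rewrite Eq.
  replace (R (delta y)) with (fun x => (- (1)) * matrix_op K (delta y) x + delta y x)
    by (apply functional_extensionality; intros; symmetry; apply R_axpy).
  rewrite matrix_op_axpy by (try apply dominated_ell2; try assumption; apply delta_ell2).
  rewrite matrix_op_comp by (try assumption; apply delta_ell2).
  rewrite !matrix_op_delta, (E1 x y). ring.
Qed.

End DominatedMatrices.

(** * The reflection formula for the Gamma function *)

Section CosinePowers.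

Local Open Scope R_scope.

Variables (phi phi1 : R -> R) (k : R).
Hypothesis Hphi : forall t, is_derive phi t (phi1 t).
Hypothesis Hphi1 : forall t, is_derive phi1 t (- 4 * k * phi t).
Hypothesis phi_0 : phi 0 = 1.
Hypothesis phi1_0 : phi1 0 = 0.

(** For [phi t = cos (2 nu t)], with [k = nu^2], the integrals of [phi cos^m] obey a recursion in [m] of
    step two, which expresses them by the products that occur in the Euler-Gauss limits at
    [1/2 - nu] and [1/2 + nu]. *)
Definition cosint (f : R -> R) (m : nat) : R := RInt (fun t => f t * cos t ^ m) 0 (PI / 2).

Lemma phi_continuous t : continuous phi t.
Proof. apply (ex_derive_continuous phi). eexists. apply Hphi. Qed.

Lemma cosint_integrand_continuous (f : R -> R) m t :
  continuous f t -> continuous (fun t => f t * cos t ^ m) t.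
Proof.
  intros Hf. apply (continuous_mult f (fun t => cos t ^ m)); [exact Hf|].
  apply (ex_derive_continuous (fun t => cos t ^ m)). auto_derive. trivial.
Qed.

Lemma cosint_correct (f : R -> R) m : (forall t, continuous f t) ->
  is_RInt (fun t => f t * cos t ^ m) 0 (PI / 2) (cosint f m).
Proof.
  intros Hf. apply (RInt_correct (V := R_CompleteNormedModule)), ex_RInt_continuous.
  intros z _. apply cosint_integrand_continuous, Hf.
Qed.

(** With [n = m + 2], the function [phi1 cos^n + n phi cos^(n - 1) sin] vanishes at both end points, and
    its derivative is the difference of the two integrands. *)
Lemma cosint_rec m :
  (INR (S (S m)) ^ 2 - 4 * k) * cosint phi (S (S m)) =
  INR (S (S m)) * INR (S m) * cosint phi m.
Proof.
  set (N := INR (S (S m))). set (N1 := INR (S m)).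
  assert (HN : N = N1 + 1) by (unfold N, N1; rewrite (S_INR (S m)); reflexivity).
  pose (F := fun t => phi1 t * cos t ^ (S (S m)) + N * (phi t * (cos t ^ (S m) * sin t))).
  pose (f := fun t => (N ^ 2 - 4 * k) * (phi t * cos t ^ (S (S m))) -
     N * N1 * (phi t * cos t ^ m)).
  assert (H1 : is_RInt f 0 (PI / 2) (F (PI / 2) - F 0)).
  { apply (is_RInt_derive (V := R_CompleteNormedModule) F f).
    - intros t _. unfold F, f.
      assert (D1 : Derive (fun x : R => phi x) t = phi1 t) by (apply is_derive_unique, Hphi).
      assert (D2 : Derive (fun x : R => phi1 x) t = - 4 * k * phi t)
        by (apply is_derive_unique, Hphi1).
      auto_derive.
      + pose proof (ex_intro _ _ (Hphi t) : ex_derive phi t).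
        pose proof (ex_intro _ _ (Hphi1 t) : ex_derive phi1 t). repeat split; assumption.
      + rewrite D1, D2.
        change (match m with 0%nat => 1 | S _ => INR m + 1 end) with N1.
        rewrite <- HN.
        assert (S2 : sin t * sin t = 1 - cos t * cos t).
        { pose proof (sin2_cos2 t). unfold Rsqr in *. lra. }
        cbn [pow]. generalize (cos t ^ m). intros X. rewrite HN.
        replace (phi t * (1 * - sin t * (N1 * X) * sin t + cos t * X * (1 * cos t)))
          with (phi t * (cos t * X * cos t) - phi t * N1 * X * (sin t * sin t)) by ring.
        rewrite S2. ring.
    - intros t _. unfold f.
      apply (continuous_minus (V := R_NormedModule)); apply (continuous_scal_r (V := R_NormedModule));
        apply cosint_integrand_continuous, phi_continuous. }
  assert (H2 : is_RInt f 0 (PI / 2)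
    ((N ^ 2 - 4 * k) * cosint phi (S (S m)) - N * N1 * cosint phi m)).
  { apply (is_RInt_minus (V := R_NormedModule)); apply (is_RInt_scal (V := R_NormedModule));
      apply cosint_correct, phi_continuous. }
  apply (is_RInt_unique (V := R_CompleteNormedModule)) in H1.
  apply (is_RInt_unique (V := R_CompleteNormedModule)) in H2.
  rewrite H1 in H2.
  assert (E : F (PI / 2) - F 0 = 0).
  { unfold F. rewrite cos_PI2, sin_0, phi1_0. simpl. ring. }
  rewrite E in H2. lra.
Qed.

Lemma cosint_1 : (1 - 4 * k) * cosint phi 1 = phi (PI / 2).
Proof.
  pose (F := fun t => phi1 t * cos t + phi t * sin t).
  pose (f := fun t => (1 - 4 * k) * (phi t * cos t ^ 1)).
  assert (H1 : is_RInt f 0 (PI / 2) (F (PI / 2) - F 0)).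
  { apply (is_RInt_derive (V := R_CompleteNormedModule) F f).
    - intros t _. unfold F, f.
      assert (D1 : Derive (fun x : R => phi x) t = phi1 t) by (apply is_derive_unique, Hphi).
      assert (D2 : Derive (fun x : R => phi1 x) t = - 4 * k * phi t)
        by (apply is_derive_unique, Hphi1).
      auto_derive.
      + pose proof (ex_intro _ _ (Hphi t) : ex_derive phi t).
        pose proof (ex_intro _ _ (Hphi1 t) : ex_derive phi1 t). repeat split; assumption.
      + rewrite D1, D2. ring.
    - intros t _. unfold f. apply (continuous_scal_r (V := R_NormedModule)).
      apply cosint_integrand_continuous, phi_continuous. }
  assert (H2 : is_RInt f 0 (PI / 2) ((1 - 4 * k) * cosint phi 1)).
  { apply (is_RInt_scal (V := R_NormedModule)). apply cosint_correct, phi_continuous. }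
  apply (is_RInt_unique (V := R_CompleteNormedModule)) in H1.
  apply (is_RInt_unique (V := R_CompleteNormedModule)) in H2.
  rewrite <- H2, H1. unfold F. rewrite cos_PI2, sin_PI2, cos_0, sin_0, phi1_0. ring.
Qed.

Lemma phi_near_1 : exists M : R, 0 <= M /\
  forall t : R, 0 <= t <= PI / 2 -> Rabs (phi t - 1) <= M * t ^ 2.
Proof.
  destruct (continuity_ab_maj (fun t => Rabs (phi t)) 0 (PI / 2)) as [tm [Hm _]].
  - pose proof PI_RGT_0. lra.
  - intros t _. apply continuity_pt_filterlim.
    apply (continuous_comp phi Rabs); [apply phi_continuous|apply continuous_Rabs].
  - set (B := Rabs (phi tm)) in *. exists (4 * Rabs k * B).
    assert (HB : 0 <= B) by apply Rabs_pos.
    split; [pose proof (Rabs_pos k); nra|]. intros t Ht.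
    assert (D1 : forall u, 0 <= u <= PI / 2 -> Rabs (phi1 u) <= 4 * Rabs k * B * u).
    { intros u Hu.
      destruct (MVT_gen phi1 0 u (fun t => - 4 * k * phi t)) as [v [Hv Ev]].
      - intros; apply Hphi1.
      - intros w _. apply continuity_pt_filterlim, (ex_derive_continuous phi1).
        eexists. apply Hphi1.
      - rewrite phi1_0, !Rminus_0_r in Ev. rewrite Ev, !Rabs_mult, (Rabs_left (-4)) by lra.
        rewrite (Rabs_pos_eq u) by lra.
        rewrite Rmin_left, Rmax_right in Hv by lra.
        specialize (Hm v ltac:(lra)). cbv beta in Hm. fold B in Hm.
        apply Rmult_le_compat_r; [lra|]. pose proof (Rabs_pos k). nra. }
    destruct (MVT_gen phi 0 t phi1) as [v [Hv Ev]].
    + intros; apply Hphi.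
    + intros w _. apply continuity_pt_filterlim, phi_continuous.
    + rewrite phi_0, Rminus_0_r in Ev. rewrite Ev, Rabs_mult, (Rabs_pos_eq t) by lra.
      rewrite Rmin_left, Rmax_right in Hv by lra.
      specialize (D1 v ltac:(lra)).
      assert (4 * Rabs k * B * v <= 4 * Rabs k * B * t).
      { apply Rmult_le_compat_l; [pose proof (Rabs_pos k); nra|lra]. }
      replace (4 * Rabs k * B * t ^ 2) with (4 * Rabs k * B * t * t) by ring.
      apply Rmult_le_compat_r; lra.
Qed.

End CosinePowers.

Section Wallis.

Local Open Scope R_scope.

Lemma cos_nonneg t : 0 <= t <= PI / 2 -> 0 <= cos t.
Proof. intros H. apply cos_ge_0; pose proof PI_RGT_0; lra. Qed.

Lemma t_cos_le_sin t : 0 <= t <= PI / 2 -> t * cos t <= sin t.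
Proof.
  intros Ht.
  destruct (MVT_gen (fun t => sin t - t * cos t) 0 t (fun t => t * sin t)) as [v [Hv Ev]].
  - intros u _. auto_derive; [trivial|ring].
  - intros u _. apply continuity_pt_filterlim.
    apply (ex_derive_continuous (fun t => sin t - t * cos t)). auto_derive. trivial.
  - rewrite sin_0 in Ev. rewrite Rmin_left, Rmax_right in Hv by lra.
    assert (0 <= sin v) by (apply sin_ge_0; pose proof PI_RGT_0; lra).
    assert (0 <= v * sin v * (t - 0)) by (repeat apply Rmult_le_pos; lra). lra.
Qed.

(** The Wallis integrals. *)
Definition wal (m : nat) : R := cosint (fun _ => 1) m.

Lemma wal_correct m : is_RInt (fun t => 1 * cos t ^ m) 0 (PI / 2) (wal m).
Proof. apply cosint_correct. intros. apply continuous_const. Qed.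

Lemma wal_rec m : INR (S (S m)) * wal (S (S m)) = INR (S m) * wal m.
Proof.
  pose proof (cosint_rec (fun _ => 1) (fun _ => 0) 0) as H.
  specialize (H ltac:(intros; apply (is_derive_const (V := R_NormedModule)))).
  specialize (H ltac:(intros; evar_last; [apply (is_derive_const (V := R_NormedModule))|];
    simpl; unfold zero; simpl; ring) eq_refl m).
  fold (wal (S (S m))) (wal m) in H.
  apply Rmult_eq_reg_l with (INR (S (S m))); [|apply not_0_INR; lia].
  rewrite <- !Rmult_assoc. rewrite <- H. ring.
Qed.

Lemma wal_0 : wal 0 = PI / 2.
Proof.
  unfold wal, cosint. rewrite (RInt_ext _ (fun _ => 1)) by (intros; simpl; ring).
  rewrite RInt_const. unfold scal; simpl. unfold mult; simpl. lra.
Qed.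

Lemma wal_1 : wal 1 = 1.
Proof.
  pose proof (cosint_1 (fun _ => 1) (fun _ => 0) 0) as H.
  specialize (H ltac:(intros; apply (is_derive_const (V := R_NormedModule)))).
  specialize (H ltac:(intros; evar_last; [apply (is_derive_const (V := R_NormedModule))|];
    simpl; unfold zero; simpl; ring) eq_refl).
  fold (wal 1) in H. lra.
Qed.

Lemma wal_product m : INR (S m) * (wal (S m) * wal m) = PI / 2.
Proof.
  induction m as [|m IH].
  - rewrite wal_0, wal_1. simpl. lra.
  - rewrite <- IH. pose proof (wal_rec m) as E.
    replace (INR (S (S m)) * (wal (S (S m)) * wal (S m)))
      with (INR (S (S m)) * wal (S (S m)) * wal (S m)) by ring.
    rewrite E. ring.
Qed.

Lemma wal_decr m : wal (S m) <= wal m.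
Proof.
  apply (is_RInt_le (fun t => 1 * cos t ^ S m) (fun t => 1 * cos t ^ m) 0 (PI / 2));
    [pose proof PI_RGT_0; lra|apply wal_correct|apply wal_correct|].
  intros t Ht. simpl. pose proof (cos_nonneg t ltac:(lra)). pose proof (COS_bound t).
  pose proof (pow_le (cos t) m H). nra.
Qed.

Lemma wal_pos m : 0 < wal m.
Proof.
  assert (P : forall m, 0 <= wal m).
  { intros n. apply (is_RInt_le (fun t => 0) (fun t => 1 * cos t ^ n) 0 (PI / 2)).
    - pose proof PI_RGT_0; lra.
    - evar_last; [apply (is_RInt_const (V := R_NormedModule))|].
      unfold scal; simpl; unfold mult; simpl; ring.
    - apply wal_correct.
    - intros t Ht. pose proof (pow_le (cos t) n (cos_nonneg t ltac:(lra))). lra. }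
  pose proof (wal_product m) as E. pose proof PI_RGT_0.
  destruct (P m) as [H0|H0]; [exact H0|]. rewrite <- H0 in E. lra.
Qed.

(** Monotonicity squeezes the square between the products of neighbours given by [wal_product]. *)
Lemma wal_odd_bound n : Rabs (4 * INR n * wal (2 * n + 1) ^ 2 - PI) <= PI / INR (S n).
Proof.
  pose proof (wal_product (2 * n)) as E1. pose proof (wal_product (2 * n + 1)) as E2.
  replace (2 * n + 1)%nat with (S (2 * n)) in * by lia.
  pose proof (wal_decr (2 * n)). pose proof (wal_decr (S (2 * n))).
  pose proof (wal_pos (2 * n)). pose proof (wal_pos (S (2 * n))).
  pose proof (wal_pos (S (S (2 * n)))). pose proof PI_RGT_0.
  rewrite !S_INR, mult_INR in *. simpl (INR 2) in *. pose proof (pos_INR n) as Hn.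
  set (x := INR n) in *. set (a := wal (2 * n)) in *. set (b := wal (S (2 * n))) in *.
  set (e := wal (S (S (2 * n)))) in *.
  assert (U : (2 * x + 1) * b ^ 2 <= PI / 2).
  { rewrite <- E1. replace (b ^ 2) with (b * b) by ring.
    apply Rmult_le_compat_l; [lra|]. apply Rmult_le_compat_l; lra. }
  assert (Lo : PI / 2 <= (2 * x + 2) * b ^ 2).
  { rewrite <- E2. replace (b ^ 2) with (b * b) by ring.
    replace (2 * x + 2) with (2 * x + 1 + 1) by ring.
    apply Rmult_le_compat_l; [lra|]. apply Rmult_le_compat_r; lra. }
  apply Rabs_le. split.
  - apply Rmult_le_reg_r with (x + 1); [lra|].
    replace (- (PI / (x + 1)) * (x + 1)) with (- PI) by (field; lra). nra.
  - assert (0 <= PI / (x + 1)) by (apply Rdiv_le_0_compat; lra). nra.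
Qed.

End Wallis.

(** ** Convergence of the Euler-Gauss limit *)

Definition cconv (u : nat -> C) (l : C) : Prop :=
  forall eps : R, (0 < eps)%R -> exists N, forall n, (N <= n)%nat -> (Cmod (u n - l) < eps)%R.

Lemma cconv_lim u l : cconv u l ->
  (real (Lim_seq (fun n => Re (u n))), real (Lim_seq (fun n => Im (u n)))) = l.
Proof.
  intros H. rewrite (surjective_pairing l).
  assert (E : forall f : nat -> R, forall m : R,
    (forall n, (Rabs (f n - m) <= Cmod (u n - l))%R) -> real (Lim_seq f) = m).
  { intros f m Hf. rewrite (is_lim_seq_unique f m); [reflexivity|].
    apply is_lim_seq_spec. intros eps. destruct (H eps (cond_pos eps)) as [N HN].
    exists N. intros n Hn. eapply Rle_lt_trans; [apply Hf|apply HN, Hn]. }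
  f_equal; apply E; intros n.
  - apply (re_le_Cmod (u n - l)).
  - apply (im_le_Cmod (u n - l)).
Qed.

Lemma cconv_unique u l l' : cconv u l -> cconv u l' -> l = l'.
Proof. intros H H'. rewrite <- (cconv_lim u l H). apply cconv_lim, H'. Qed.

Lemma cconv_const l : cconv (fun _ => l) l.
Proof.
  intros eps He. exists O. intros n _. replace (l - l) with (RtoC 0) by ring.
  rewrite Cmod_0. exact He.
Qed.

Lemma cconv_ext_from u v l N : (forall n, (N <= n)%nat -> u n = v n) -> cconv u l -> cconv v l.
Proof.
  intros E H eps He. destruct (H eps He) as [K HK]. exists (N + K)%nat. intros n Hn.
  rewrite <- E by lia. apply HK. lia.
Qed.

Lemma cconv_bound u l :
  cconv u l -> exists N, forall n, (N <= n)%nat -> (Cmod (u n) <= Cmod l + 1)%R.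
Proof.
  intros H. destruct (H 1%R Rlt_0_1) as [N HN]. exists N. intros n Hn. specialize (HN n Hn).
  pose proof (Cmod_triangle (u n - l) l) as T. replace (u n - l + l) with (u n) in T by ring. lra.
Qed.

Lemma cconv_mult u v l m : cconv u l -> cconv v m -> cconv (fun n => u n * v n) (l * m).
Proof.
  intros Hu Hv eps He.
  pose proof (Cmod_ge_0 l). pose proof (Cmod_ge_0 m).
  destruct (cconv_bound _ _ Hu) as [N0 B].
  destruct (Hu (eps / 2 / (Cmod m + 1))%R) as [N1 H1]; [repeat apply Rdiv_lt_0_compat; lra|].
  destruct (Hv (eps / 2 / (Cmod l + 1))%R) as [N2 H2]; [repeat apply Rdiv_lt_0_compat; lra|].
  exists (N0 + N1 + N2)%nat. intros n Hn.
  specialize (B n ltac:(lia)). specialize (H1 n ltac:(lia)). specialize (H2 n ltac:(lia)).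
  replace (u n * v n - l * m) with (u n * (v n - m) + m * (u n - l)) by ring.
  eapply Rle_lt_trans; [apply Cmod_triangle|]. rewrite !Cmod_mult.
  pose proof (Cmod_ge_0 (u n)). pose proof (Cmod_ge_0 (v n - m)). pose proof (Cmod_ge_0 (u n - l)).
  apply Rlt_div_r in H1; [|lra]. apply Rlt_div_r in H2; [|lra].
  assert (Cmod (u n) * Cmod (v n - m) <= Cmod (v n - m) * (Cmod l + 1))%R by nra.
  assert (Cmod m * Cmod (u n - l) <= Cmod (u n - l) * (Cmod m + 1))%R by nra.
  lra.
Qed.

Lemma cconv_scal c u l : cconv u l -> cconv (fun n => c * u n) (c * l).
Proof. apply cconv_mult, cconv_const. Qed.

Lemma exp_mono x y : (x <= y)%R -> (exp x <= exp y)%R.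
Proof. intros [H|H]; [left; apply exp_increasing, H|right; f_equal; exact H]. Qed.

Lemma inv_sq_telescope n : (1 <= n)%nat ->
  (/ (INR n + 1) ^ 2 <= / INR n - / (INR n + 1))%R.
Proof.
  intros H. apply le_INR in H. simpl (INR 1) in H.
  replace (/ INR n - / (INR n + 1))%R with (/ (INR n * (INR n + 1)))%R by (field; lra).
  apply Rinv_le_contravar; nra.
Qed.

(** If the ratios of consecutive terms are [1 + O(1 / n^2)], then the sequence is bounded by a convergent
    product, and hence its increments are summable. *)
Lemma cconv_product (g : nat -> C) (K : R) : (0 <= K)%R ->
  (forall n, (1 <= n)%nat -> (Cmod (g (S n) - g n) <= K / (INR n + 1) ^ 2 * Cmod (g n))%R) ->
  exists l, cconv g l.
Proof.
  intros HK H.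
  assert (Bd : forall n, (1 <= n)%nat ->
    (Cmod (g n) <= Cmod (g 1%nat) * exp (K * (1 - / INR n)))%R).
  { intros n Hn. induction Hn as [|n Hn IH].
    - simpl. replace (K * (1 - / 1))%R with 0%R by field. rewrite exp_0. lra.
    - pose proof (H n Hn) as Hs. pose proof (inv_sq_telescope n Hn) as T.
      rewrite S_INR. set (x := INR n) in *.
      pose proof (Cmod_triangle (g (S n) - g n) (g n)) as Tr.
      replace (g (S n) - g n + g n) with (g (S n)) in Tr by ring.
      pose proof (Cmod_ge_0 (g n)). pose proof (Cmod_ge_0 (g 1%nat)).
      set (q := (/ (x + 1) ^ 2)%R) in *. unfold Rdiv in Hs. fold q in Hs.
      assert (E : (1 + K * q <= exp (K * q))%R) by apply exp_ineq1_le.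
      assert (E2 : (exp (K * (1 - / x)) * exp (K * q) <= exp (K * (1 - / (x + 1))))%R).
      { rewrite <- exp_plus. apply exp_mono. nra. }
      pose proof (exp_pos (K * (1 - / x))).
      apply Rle_trans with (Cmod (g n) * (1 + K * q))%R; [lra|].
      apply Rle_trans with (Cmod (g 1%nat) * exp (K * (1 - / x)) * exp (K * q))%R.
      + assert (0 <= q)%R.
        { unfold q. left. apply Rinv_0_lt_compat. apply pow_lt. unfold x.
          pose proof (pos_INR n). lra. }
        apply Rmult_le_compat; [lra|nra|exact IH|exact E].
      + rewrite Rmult_assoc. apply Rmult_le_compat_l; assumption. }
  set (G := (Cmod (g 1%nat) * exp K)%R).
  assert (HG : (0 <= G)%R).
  { apply Rmult_le_pos; [apply Cmod_ge_0|left; apply exp_pos]. }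
  assert (Bd2 : forall n, (1 <= n)%nat -> (Cmod (g n) <= G)%R).
  { intros n Hn. eapply Rle_trans; [apply Bd, Hn|]. apply Rmult_le_compat_l; [apply Cmod_ge_0|].
    apply exp_mono. apply le_INR in Hn. simpl (INR 1) in Hn.
    assert (0 < / INR n)%R by (apply Rinv_0_lt_compat; lra). nra. }
  set (e := fun n => g (S (S n)) - g (S n)).
  assert (S1 : summable e).
  { exists (K * G)%R. intros n.
    assert (A : (rsum (fun k => Cmod (e k)) n <= K * G * (1 - / INR (S n)))%R).
    { induction n as [|n IH].
      - simpl. replace (1 - / 1)%R with 0%R by field. lra.
      - cbn [rsum]. specialize (H (S n) ltac:(lia)). fold (e n) in H.
        pose proof (inv_sq_telescope (S n) ltac:(lia)) as T. specialize (Bd2 (S n) ltac:(lia)).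
        rewrite (S_INR (S n)). set (x := INR (S n)) in *. unfold Rdiv in H.
        assert (0 <= / (x + 1) ^ 2)%R.
        { left. apply Rinv_0_lt_compat, pow_lt. unfold x. pose proof (pos_INR (S n)). lra. }
        pose proof (Cmod_ge_0 (g (S n))).
        assert (K * / (x + 1) ^ 2 * Cmod (g (S n)) <= K * (/ x - / (x + 1)) * G)%R.
        { apply Rmult_le_compat; try nra. }
        nra. }
    assert (0 < / INR (S n))%R by (apply Rinv_0_lt_compat, lt_0_INR; lia).
    assert (0 <= K * G)%R by (apply Rmult_le_pos; assumption). nra. }
  exists (CSum e + g 1%nat).
  intros eps He. destruct (summable_csums _ S1 eps He) as [N HN].
  exists (S N). intros [|n] Hn; [lia|].
  assert (E : csum e n = g (S n) - g 1%nat).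
  { clear. induction n as [|n IH]; simpl; [ring|]. rewrite IH. unfold e. ring. }
  specialize (HN n ltac:(lia)). rewrite E in HN.
  replace (g (S n) - (CSum e + g 1%nat)) with (g (S n) - g 1%nat - CSum e) by ring. exact HN.
Qed.

Lemma Cexp_plus u v : Cexp (u + v) = Cexp u * Cexp v.
Proof.
  unfold Cexp. destruct u as [a b], v as [a' b']. simpl.
  rewrite exp_plus, cos_plus, sin_plus. unfold Cmult. simpl. f_equal; ring.
Qed.

Lemma Cexp_0 : Cexp 0 = 1.
Proof. unfold Cexp. simpl. rewrite exp_0, cos_0, sin_0. unfold RtoC. f_equal; ring. Qed.

Section ExpEstimate.
Local Open Scope R_scope.

Lemma exp_minus_1 a M : Rabs a <= M -> Rabs (exp a - 1) <= Rabs a * exp M.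
Proof.
  intros Ha.
  destruct (MVT_gen exp 0 a exp) as [v [Hv Ev]].
  - intros; apply is_derive_exp.
  - intros; apply continuity_pt_filterlim, continuous_exp.
  - rewrite exp_0, Rminus_0_r in Ev. rewrite Ev, Rabs_mult, Rmult_comm.
    apply Rmult_le_compat_l; [apply Rabs_pos|]. rewrite Rabs_pos_eq by (left; apply exp_pos).
    apply exp_mono. unfold Rabs, Rmin, Rmax in *. destruct (Rcase_abs a), (Rle_dec 0 a); lra.
Qed.

Lemma exp_minus_1_a a M : Rabs a <= M -> Rabs (exp a - 1 - a) <= a ^ 2 * exp M.
Proof.
  intros Ha.
  destruct (MVT_gen (fun a => exp a - a) 0 a (fun a => exp a - 1)) as [v [Hv Ev]].
  - intros. auto_derive; [trivial|ring].
  - intros. apply continuity_pt_filterlim, (ex_derive_continuous (fun a => exp a - a)).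
    auto_derive. trivial.
  - rewrite exp_0, !Rminus_0_r in Ev.
    replace (exp a - 1 - a) with ((exp v - 1) * a) by lra. rewrite Rabs_mult.
    assert (Hva : Rabs v <= Rabs a).
    { unfold Rabs, Rmin, Rmax in *. destruct (Rcase_abs a), (Rcase_abs v), (Rle_dec 0 a); lra. }
    pose proof (exp_minus_1 v M ltac:(lra)) as B.
    rewrite <- (pow2_abs a). simpl. rewrite Rmult_1_r.
    pose proof (exp_pos M). pose proof (Rabs_pos a). pose proof (Rabs_pos v).
    assert (Rabs v * exp M <= Rabs a * exp M) by (apply Rmult_le_compat_r; lra).
    nra.
Qed.

Lemma sin_abs b : Rabs (sin b) <= Rabs b.
Proof.
  destruct (MVT_gen sin 0 b cos) as [v [Hv Ev]].
  - intros; apply is_derive_sin.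
  - intros; apply continuity_pt_filterlim, continuous_sin.
  - rewrite sin_0, !Rminus_0_r in Ev. rewrite Ev, Rabs_mult.
    rewrite <- (Rmult_1_l (Rabs b)) at 2. apply Rmult_le_compat_r; [apply Rabs_pos|].
    apply Rabs_le. pose proof (COS_bound v). lra.
Qed.

Lemma cos_minus_1 b : Rabs (cos b - 1) <= b ^ 2.
Proof.
  replace (cos b) with (cos (2 * (b / 2))) by (f_equal; field).
  rewrite cos_2a_sin. replace (1 - 2 * sin (b / 2) * sin (b / 2) - 1)
    with (- (2 * (sin (b / 2) ^ 2))) by ring.
  rewrite Rabs_Ropp, Rabs_pos_eq by (pose proof (pow2_ge_0 (sin (b / 2))); lra).
  rewrite <- (pow2_abs (sin (b / 2))). pose proof (sin_abs (b / 2)).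
  assert (Rabs (sin (b / 2)) ^ 2 <= Rabs (b / 2) ^ 2)
    by (apply pow_incr; split; [apply Rabs_pos|assumption]).
  rewrite (pow2_abs (b / 2)) in H0. pose proof (pow2_ge_0 b).
  replace ((b / 2) ^ 2) with (b ^ 2 / 4) in H0 by field. lra.
Qed.

Lemma sin_minus_b b : Rabs (b - sin b) <= Rabs b * b ^ 2.
Proof.
  destruct (MVT_gen (fun b => b - sin b) 0 b (fun b => 1 - cos b)) as [v [Hv Ev]].
  - intros. auto_derive; [trivial|ring].
  - intros. apply continuity_pt_filterlim, (ex_derive_continuous (fun b => b - sin b)).
    auto_derive. trivial.
  - rewrite sin_0, !Rminus_0_r in Ev. rewrite Ev, Rabs_mult, Rmult_comm.
    apply Rmult_le_compat_l; [apply Rabs_pos|].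
    rewrite Rabs_minus_sym. eapply Rle_trans; [apply cos_minus_1|].
    rewrite <- (pow2_abs v), <- (pow2_abs b). apply pow_incr. split; [apply Rabs_pos|].
    unfold Rabs, Rmin, Rmax in *. destruct (Rcase_abs b), (Rcase_abs v), (Rle_dec 0 b); lra.
Qed.

End ExpEstimate.

Lemma Cexp_taylor u M : (Cmod u <= M)%R ->
  (Cmod (Cexp u - 1 - u) <= (4 + M) * exp M * Cmod u ^ 2)%R.
Proof.
  intros Hu. eapply Rle_trans; [apply Cmod_le_re_im|].
  pose proof (re_le_Cmod u) as Ha. pose proof (im_le_Cmod u) as Hb.
  pose proof (Cmod2_alt u) as E2. destruct u as [a b]. simpl in Ha, Hb. simpl (Re _) in E2.
  simpl (Im _) in E2. set (m := Cmod (a, b)) in *.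
  replace (Re (Cexp (a, b) - 1 - (a, b)))
    with ((exp a - 1 - a) + exp a * (cos b - 1))%R by (simpl; ring).
  replace (Im (Cexp (a, b) - 1 - (a, b)))
    with ((exp a - 1) * sin b + - (b - sin b))%R by (simpl; ring).
  pose proof (Rabs_triang (exp a - 1 - a) (exp a * (cos b - 1))) as T1.
  pose proof (Rabs_triang ((exp a - 1) * sin b) (- (b - sin b))) as T2.
  rewrite Rabs_Ropp in T2. rewrite Rabs_mult in T1, T2.
  pose proof (exp_minus_1 a M ltac:(lra)) as B1. pose proof (exp_minus_1_a a M ltac:(lra)) as B2.
  pose proof (sin_abs b) as B3. pose proof (cos_minus_1 b) as B4. pose proof (sin_minus_b b) as B5.
  assert (B6 : (Rabs (exp a) <= exp M)%R).
  { rewrite Rabs_pos_eq by (left; apply exp_pos). apply exp_mono.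
    pose proof (Rle_abs a). lra. }
  pose proof (Rabs_pos a). pose proof (Rabs_pos b). pose proof (Rabs_pos (sin b)).
  pose proof (Rabs_pos (exp a)). pose proof (Rabs_pos (cos b - 1)). pose proof (exp_pos M).
  pose proof (Rabs_pos (exp a - 1)).
  assert (1 <= exp M)%R.
  { rewrite <- exp_0. apply exp_mono. pose proof (Cmod_ge_0 (a, b)). unfold m in *. lra. }
  pose proof (pow2_ge_0 a). pose proof (pow2_ge_0 b).
  assert (C1 : (Rabs (exp a) * Rabs (cos b - 1) <= exp M * b ^ 2)%R)
    by (apply Rmult_le_compat; assumption).
  assert (C2 : (Rabs (exp a - 1) * Rabs (sin b) <= (Rabs a * exp M) * Rabs b)%R)
    by (apply Rmult_le_compat; assumption).
  assert (C3 : (Rabs b * b ^ 2 <= M * exp M * m ^ 2)%R).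
  { apply Rle_trans with (M * m ^ 2)%R; [|apply Rmult_le_compat_r; [nra|nra]].
    apply Rmult_le_compat; nra. }
  assert (C4 : (Rabs a * exp M * Rabs b <= exp M * m ^ 2)%R).
  { replace (Rabs a * exp M * Rabs b)%R with (exp M * (Rabs a * Rabs b))%R by ring.
    apply Rmult_le_compat_l; [lra|]. nra. }
  nra.
Qed.

Lemma Carg_pos_real (x : R) : (0 < x)%R -> Carg x = 0%R.
Proof.
  intros Hx. unfold Carg. simpl. destruct (Rle_dec 0 0) as [_|N]; [|lra].
  rewrite Cmod_R, Rabs_pos_eq by lra. unfold Rdiv. rewrite Rinv_r by lra. apply acos_1.
Qed.

Lemma Cpower_pos_real (x : R) (a : C) : (0 < x)%R -> Cpower x a = Cexp (a * RtoC (ln x)).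
Proof.
  intros Hx. unfold Cpower, Clog. rewrite Carg_pos_real by exact Hx.
  rewrite Cmod_R, Rabs_pos_eq by lra. reflexivity.
Qed.

Lemma rising_neq z n : (0 < Re z)%R -> rising z n <> 0.
Proof.
  intros Hz. induction n as [|n IH]; simpl.
  - intros E. rewrite E in Hz. simpl in Hz. lra.
  - apply Cmult_neq_0; [exact IH|]. intros E. apply (f_equal Re) in E.
    change (Re z + INR n = 0)%R in E || idtac.
    replace (Re (z + _)) with (Re z + INR (S n))%R in E by reflexivity.
    pose proof (pos_INR (S n)). simpl (Re 0) in E. lra.
Qed.

Lemma Re_plus_natC_pos z n : (0 < Re z)%R -> z + natC n <> 0.
Proof.
  intros Hz E. apply (f_equal Re) in E.
  replace (Re (z + natC n)) with (Re z + INR n)%R in E by reflexivity.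
  pose proof (pos_INR n). simpl (Re 0) in E. lra.
Qed.

Lemma Gauss_step z n : (0 < Re z)%R -> (1 <= n)%nat ->
  Gauss_seq z (S n) = Gauss_seq z n *
    (Cexp (z * RtoC (ln (INR n + 1) - ln (INR n))) / (1 + z / natC (S n))).
Proof.
  intros Hz Hn. unfold Gauss_seq. pose proof (rising_neq z n Hz) as Hr.
  assert (Hn' : (0 < INR n)%R) by (apply lt_0_INR; lia).
  rewrite !Cpower_pos_real by (try apply lt_0_INR; lia).
  change (rising z (S n)) with (rising z n * (z + natC (S n))).
  pose proof (Re_plus_natC_pos z (S n) Hz) as H1.
  assert (H2 : natC (S n) <> 0) by (apply natC_neq; lia).
  change (fact (S n)) with (S n * fact n)%nat. rewrite mult_INR, RtoC_mult.
  change (RtoC (INR (S n))) with (natC (S n)) at 1.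
  rewrite S_INR, RtoC_minus.
  replace (z * RtoC (ln (INR n + 1)))
    with (z * RtoC (ln (INR n)) + z * (RtoC (ln (INR n + 1)) - RtoC (ln (INR n)))) by ring.
  rewrite Cexp_plus.
  assert (H3 : 1 + z / natC (S n) <> 0).
  { intros E. apply H1. replace (z + natC (S n)) with (natC (S n) * (1 + z / natC (S n)))
      by (field; exact H2). rewrite E. ring. }
  replace (z + natC (S n)) with (natC (S n) * (1 + z / natC (S n))) by (field; exact H2).
  field. repeat split; try assumption.
  intros E. apply H1. rewrite <- E. ring.
Qed.

Lemma ln_step_bounds (x : R) : (0 < x)%R ->
  (/ (x + 1) <= ln (x + 1) - ln x <= / x)%R.
Proof.
  intros Hx.
  assert (A : forall u v, (0 < u)%R -> (0 < v)%R -> (ln u - ln v <= u / v - 1)%R).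
  { intros u v Hu Hv. rewrite <- (ln_div u v) by assumption.
    assert (0 < u / v)%R by (apply Rdiv_lt_0_compat; assumption).
    pose proof (exp_ineq1_le (ln (u / v))) as E. rewrite exp_ln in E by assumption. lra. }
  pose proof (A (x + 1)%R x ltac:(lra) Hx) as A1. pose proof (A x (x + 1)%R Hx ltac:(lra)) as A2.
  replace ((x + 1) / x - 1)%R with (/ x)%R in A1 by (field; lra).
  replace (x / (x + 1) - 1)%R with (- / (x + 1))%R in A2 by (field; lra). lra.
Qed.

(** The ratio [exp (z (ln (n + 1) - ln n)) / (1 + z / (n + 1))] of consecutive terms is
    [1 + O(1 / n^2)], since the logarithm is [1 / (n + 1) + O(1 / n^2)]. *)
Lemma Gauss_seq_converges z : (0 < Re z)%R -> cconv (Gauss_seq z) (CGamma z).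
Proof.
  intros Hz.
  assert (E : exists l, cconv (Gauss_seq z) l).
  { pose proof (Cmod_ge_0 z) as Hm. set (m := Cmod z) in *.
    set (T := ((4 + m) * exp m)%R).
    assert (HT : (0 <= T)%R) by (apply Rmult_le_pos; [lra|left; apply exp_pos]).
    apply (cconv_product _ (4 * T * m ^ 2 + 2 * m)%R).
    - pose proof (pow2_ge_0 m). nra.
    - intros n Hn. rewrite Gauss_step by assumption.
      set (L := (ln (INR n + 1) - ln (INR n))%R).
      assert (Hx : (1 <= INR n)%R) by (apply (le_INR 1), Hn).
      pose proof (ln_step_bounds (INR n) ltac:(lra)) as HL. fold L in HL.
      assert (EN : natC (S n) = RtoC (INR n + 1)) by (unfold natC; rewrite S_INR; reflexivity).
      rewrite EN. set (x := INR n) in *.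
      assert (Hd : (1 <= Cmod (1 + z / RtoC (x + 1)))%R).
      { replace (z / RtoC (x + 1)) with (z * RtoC (/ (x + 1)))
          by (unfold Cdiv; rewrite RtoC_inv by lra; reflexivity).
        eapply Rle_trans; [|apply re_le_Cmod].
        replace (Re (1 + z * RtoC (/ (x + 1)))) with (1 + Re z * / (x + 1))%R
          by (unfold Re; simpl; ring).
        assert (0 < / (x + 1))%R by (apply Rinv_0_lt_compat; lra).
        rewrite Rabs_pos_eq; nra. }
      set (D := 1 + z / RtoC (x + 1)) in *.
      assert (HD : D <> 0) by (intros Z; rewrite Z, Cmod_0 in Hd; lra).
      replace (Gauss_seq z n * (Cexp (z * RtoC L) / D) - Gauss_seq z n)
        with ((Cexp (z * RtoC L) - D) / D * Gauss_seq z n) by (field; exact HD).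
      rewrite Cmod_mult. apply Rmult_le_compat_r; [apply Cmod_ge_0|].
      rewrite Cmod_div by exact HD.
      apply Rle_trans with (Cmod (Cexp (z * RtoC L) - D)).
      { unfold Rdiv. rewrite <- (Rmult_1_r (Cmod (Cexp _ - D))) at 2.
        apply Rmult_le_compat_l; [apply Cmod_ge_0|]. rewrite <- Rinv_1.
        apply Rinv_le_contravar; lra. }
      assert (HL2 : (0 <= L <= 2 / (x + 1))%R).
      { assert (0 < / (x + 1))%R by (apply Rinv_0_lt_compat; lra). split; [lra|].
        eapply Rle_trans; [apply HL|]. apply Rmult_le_reg_r with (x * (x + 1))%R; [nra|].
        replace (/ x * (x * (x + 1)))%R with (x + 1)%R by (field; lra).
        replace (2 / (x + 1) * (x * (x + 1)))%R with (2 * x)%R by (field; lra). lra. }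
      assert (HL3 : (0 <= L - / (x + 1) <= 2 / (x + 1) ^ 2)%R).
      { split; [lra|]. apply Rle_trans with (/ x - / (x + 1))%R; [lra|].
        replace (/ x - / (x + 1))%R with (/ (x * (x + 1)))%R by (field; lra).
        apply Rmult_le_reg_r with (x * (x + 1) ^ 2)%R; [apply Rmult_lt_0_compat; [|apply pow_lt]; lra|].
        replace (/ (x * (x + 1)) * (x * (x + 1) ^ 2))%R with (x + 1)%R by (field; lra).
        replace (2 / (x + 1) ^ 2 * (x * (x + 1) ^ 2))%R with (2 * x)%R by (field; lra). lra. }
      assert (Hu : (Cmod (z * RtoC L) = m * L)%R).
      { rewrite Cmod_mult, Cmod_R, Rabs_pos_eq by lra. reflexivity. }
      assert (H2x : (2 / (x + 1) <= 1)%R).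
      { apply Rmult_le_reg_r with (x + 1)%R; [lra|].
        replace (2 / (x + 1) * (x + 1))%R with 2%R by (field; lra). lra. }
      pose proof (Cexp_taylor (z * RtoC L) m ltac:(rewrite Hu; nra)) as Ty.
      rewrite Hu in Ty. fold T in Ty.
      replace (Cexp (z * RtoC L) - D) with ((Cexp (z * RtoC L) - 1 - z * RtoC L) +
        z * RtoC (L - / (x + 1))).
      2:{ unfold D. rewrite RtoC_minus, RtoC_inv by lra. unfold Cdiv. ring. }
      eapply Rle_trans; [apply Cmod_triangle|].
      rewrite (Cmod_mult z), Cmod_R, (Rabs_pos_eq (L - _)) by lra. fold m.
      assert (Q : (L ^ 2 <= 4 / (x + 1) ^ 2)%R).
      { replace (4 / (x + 1) ^ 2)%R with ((2 / (x + 1)) ^ 2)%R by (field; lra).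
        apply pow_incr. lra. }
      assert (Q1 : (T * (m * L) ^ 2 <= 4 * T * m ^ 2 / (x + 1) ^ 2)%R).
      { rewrite Rpow_mult_distr. replace (4 * T * m ^ 2 / (x + 1) ^ 2)%R
          with ((T * m ^ 2) * (4 / (x + 1) ^ 2))%R by (field; lra).
        rewrite <- Rmult_assoc. apply Rmult_le_compat_l; [|exact Q].
        apply Rmult_le_pos; [exact HT|apply pow2_ge_0]. }
      assert (Q2 : (m * (L - / (x + 1)) <= 2 * m / (x + 1) ^ 2)%R).
      { replace (2 * m / (x + 1) ^ 2)%R with (m * (2 / (x + 1) ^ 2))%R by (field; lra).
        apply Rmult_le_compat_l; [exact Hm|apply HL3]. }
      replace ((4 * T * m ^ 2 + 2 * m) / (x + 1) ^ 2)%R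
        with (4 * T * m ^ 2 / (x + 1) ^ 2 + 2 * m / (x + 1) ^ 2)%R by (field; lra).
      lra. }
  destruct E as [l Hl]. unfold CGamma. rewrite (cconv_lim _ _ Hl). exact Hl.
Qed.

Lemma rising_shift z n : z * rising (z + 1) n = rising z n * (z + natC (S n)).
Proof.
  induction n as [|n IH].
  - simpl. unfold natC. simpl. ring.
  - change (rising (z + 1) (S n)) with (rising (z + 1) n * (z + 1 + natC (S n))).
    change (rising z (S n)) with (rising z n * (z + natC (S n))).
    rewrite (natC_S (S n)). rewrite <- IH. ring.
Qed.

Lemma inv_natC_shift_conv z : (0 < Re z)%R ->
  cconv (fun n => natC n / (z + natC (S n))) 1.
Proof.
  intros Hz eps He.
  destruct (nfloor_ex ((Cmod z + 1) / eps)%R) as [N HN].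
  { apply Rdiv_le_0_compat; [pose proof (Cmod_ge_0 z); lra|exact He]. }
  exists (S N). intros n Hn. pose proof (Re_plus_natC_pos z (S n) Hz) as H1.
  replace (natC n / (z + natC (S n)) - 1) with (- (z + 1) / (z + natC (S n)))
    by (rewrite natC_S in *; field; exact H1).
  rewrite Cmod_div, Cmod_opp by exact H1.
  assert (Hb : (INR n + 1 <= Cmod (z + natC (S n)))%R).
  { eapply Rle_trans; [|apply re_le_Cmod].
    replace (Re (z + natC (S n))) with (Re z + (INR n + 1))%R
      by (unfold natC; rewrite S_INR; reflexivity).
    pose proof (pos_INR n). rewrite Rabs_pos_eq; lra. }
  pose proof (Cmod_triangle z 1) as T. rewrite Cmod_1 in T.
  assert (Hn2 : (INR N + 1 <= INR n)%R) by (rewrite <- S_INR; apply le_INR, Hn).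
  pose proof (pos_INR N).
  apply Rlt_div_l; [lra|]. apply Rle_lt_trans with (Cmod z + 1)%R; [exact T|].
  destruct HN as [_ HN]. apply Rlt_div_l in HN; [|exact He].
  pose proof (Cmod_ge_0 z). nra.
Qed.

Lemma CGamma_succ z : (0 < Re z)%R -> CGamma (z + 1) = z * CGamma z.
Proof.
  intros Hz.
  assert (Hz1 : (0 < Re (z + 1))%R) by (simpl; unfold Re in Hz; lra).
  apply (cconv_unique (Gauss_seq (z + 1))); [apply Gauss_seq_converges, Hz1|].
  replace (z * CGamma z) with (z * (CGamma z * 1)) by ring.
  apply (cconv_ext_from (fun n => z * (Gauss_seq z n * (natC n / (z + natC (S n))))) _ _ 1).
  - intros n Hn. unfold Gauss_seq.
    pose proof (rising_neq z n Hz). pose proof (rising_neq (z + 1) n Hz1).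
    pose proof (Re_plus_natC_pos z (S n) Hz).
    assert (0 < INR n)%R by (apply lt_0_INR; lia).
    rewrite !Cpower_pos_real by assumption.
    replace ((z + 1) * RtoC (ln (INR n))) with (z * RtoC (ln (INR n)) + RtoC (ln (INR n))) by ring.
    rewrite Cexp_plus.
    replace (Cexp (RtoC (ln (INR n)))) with (natC n).
    2:{ unfold Cexp. simpl. rewrite exp_ln, cos_0, sin_0 by assumption.
        unfold natC, RtoC. f_equal; ring. }
    pose proof (rising_shift z n) as Rs.
    assert (z <> 0) by (intros Z; rewrite Z in Hz; simpl in Hz; lra).
    replace (rising (z + 1) n) with (rising z n * (z + natC (S n)) / z)
      by (rewrite <- Rs; field; assumption).
    field. repeat split; assumption.
  - apply cconv_scal, cconv_mult; [apply Gauss_seq_converges, Hz|apply inv_natC_shift_conv, Hz].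
Qed.

Lemma CGamma_shift z n : (0 < Re z)%R ->
  CGamma (z + natC n) = CGamma z * binc z n * RtoC (INR (fact n)).
Proof.
  intros Hz. induction n as [|n IH].
  - rewrite natC_0, Cplus_0_r. simpl. ring.
  - rewrite natC_S. replace (z + (natC n + 1)) with (z + natC n + 1) by ring.
    rewrite CGamma_succ.
    + rewrite IH. change (fact (S n)) with (S n * fact n)%nat. rewrite mult_INR, RtoC_mult.
      change (RtoC (INR (S n))) with (natC (S n)). cbn [binc].
      field. apply natC_neq. lia.
    + replace (Re (z + natC n)) with (Re z + INR n)%R by reflexivity.
      pose proof (pos_INR n). lra.
Qed.

(** ** Reflection *)

Section Reflection.

Variables (phi phi1 : R -> R) (k : R).
Hypothesis Hphi : forall t : R, is_derive phi t (phi1 t).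
Hypothesis Hphi1 : forall t : R, is_derive phi1 t (- 4 * k * phi t)%R.
Hypothesis phi_0 : phi 0%R = 1%R.
Hypothesis phi1_0 : phi1 0%R = 0%R.

Local Open Scope R_scope.

(** As [|phi t - 1| <= M t^2] and [t cos t <= sin t], the difference is at most [M] times the integral of
    [sin^2 cos^m], which is a difference of two Wallis integrals. *)
Lemma cosint_vs_wal : exists M, 0 <= M /\
  forall m, Rabs (cosint phi (S (S m)) - wal (S (S m))) <= M * wal (S (S m)) / INR (S m).
Proof.
  destruct (phi_near_1 phi phi1 k Hphi Hphi1 phi_0 phi1_0) as [M [HM B]].
  exists M. split; [exact HM|]. intros m.
  assert (I1 : is_RInt (fun t => (phi t - 1) * cos t ^ S (S m)) 0 (PI / 2)
    (cosint phi (S (S m)) - wal (S (S m)))).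
  { apply (is_RInt_ext (fun t => minus (phi t * cos t ^ S (S m)) (1 * cos t ^ S (S m)))).
    - intros t _. unfold minus, plus, opp. simpl. ring.
    - apply (is_RInt_minus (V := R_NormedModule)); [|apply wal_correct].
      apply cosint_correct. intros t. apply (phi_continuous phi phi1 Hphi). }
  assert (I2 : is_RInt (fun t => M * (1 * cos t ^ m - 1 * cos t ^ S (S m))) 0 (PI / 2)
    (M * (wal m - wal (S (S m))))).
  { apply (is_RInt_scal (V := R_NormedModule)), (is_RInt_minus (V := R_NormedModule));
      apply wal_correct. }
  assert (Pt : forall t, 0 < t < PI / 2 ->
    Rabs ((phi t - 1) * cos t ^ S (S m)) <= M * (1 * cos t ^ m - 1 * cos t ^ S (S m))).
  { intros t Ht. rewrite Rabs_mult. pose proof (cos_nonneg t ltac:(lra)) as Hc.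
    pose proof (pow_le (cos t) m Hc) as Hp.
    rewrite (Rabs_pos_eq (cos t ^ _)) by (apply pow_le, Hc).
    specialize (B t ltac:(lra)). pose proof (t_cos_le_sin t ltac:(lra)) as Hs.
    simpl. pose proof (sin2_cos2 t) as SC. unfold Rsqr in SC.
    assert (S2 : (t * cos t) * (t * cos t) <= sin t * sin t).
    { apply Rmult_le_compat; try exact Hs; apply Rmult_le_pos; lra. }
    apply Rle_trans with (M * t ^ 2 * (cos t * (cos t * cos t ^ m))).
    - apply Rmult_le_compat_r; [|exact B]. repeat apply Rmult_le_pos; assumption.
    - replace (M * t ^ 2 * (cos t * (cos t * cos t ^ m)))
        with (M * cos t ^ m * ((t * cos t) * (t * cos t))) by ring.
      replace (M * (1 * cos t ^ m - 1 * (cos t * (cos t * cos t ^ m))))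
        with (M * cos t ^ m * (1 - cos t * cos t)) by ring.
      apply Rmult_le_compat_l; [apply Rmult_le_pos; assumption|lra]. }
  assert (HP : 0 <= PI / 2) by (pose proof PI_RGT_0; lra).
  assert (L1 : cosint phi (S (S m)) - wal (S (S m)) <= M * (wal m - wal (S (S m)))).
  { apply (is_RInt_le _ _ 0 (PI / 2) _ _ HP I1 I2). intros t Ht.
    eapply Rle_trans; [apply Rle_abs|apply Pt, Ht]. }
  assert (L2 : - (cosint phi (S (S m)) - wal (S (S m))) <= M * (wal m - wal (S (S m)))).
  { apply (is_RInt_le (fun t => opp ((phi t - 1) * cos t ^ S (S m)))
      (fun t => M * (1 * cos t ^ m - 1 * cos t ^ S (S m))) 0 (PI / 2) _ _ HP).
    - apply (is_RInt_opp (V := R_NormedModule)). exact I1.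
    - exact I2.
    - intros t Ht. unfold opp; simpl. eapply Rle_trans; [|apply Pt, Ht].
      rewrite <- Rabs_Ropp. apply Rle_abs. }
  assert (E : M * (wal m - wal (S (S m))) = M * wal (S (S m)) / INR (S m)).
  { pose proof (wal_rec m) as W. assert (INR (S m) <> 0) by (apply not_0_INR; lia).
    apply Rmult_eq_reg_l with (INR (S m)); [|assumption].
    replace (INR (S m) * (M * (wal m - wal (S (S m)))))
      with (M * (INR (S m) * wal m - INR (S m) * wal (S (S m)))) by ring.
    rewrite <- W. rewrite (S_INR (S m)). field. assumption. }
  rewrite <- E. apply Rabs_le. lra.
Qed.

Fixpoint qprod (k : R) (n : nat) : R :=
  match n with
  | O => / 4 - k
  | S m => qprod k m * ((INR (S m) + / 2) ^ 2 - k)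
  end.

Fixpoint hprod (n : nat) : R :=
  match n with
  | O => / 2
  | S m => hprod m * (INR (S m) + / 2)
  end.

Lemma cosint_qprod n :
  cosint phi (2 * n + 1) * qprod k n = phi (PI / 2) * (INR (fact n) * hprod n / 2).
Proof.
  induction n as [|n IH].
  - simpl. pose proof (cosint_1 phi phi1 k Hphi Hphi1 phi1_0). lra.
  - replace (2 * S n + 1)%nat with (S (S (2 * n + 1))) by lia.
    pose proof (cosint_rec phi phi1 k Hphi Hphi1 phi1_0 (2 * n + 1)) as R1.
    cbn [qprod hprod]. change (fact (S n)) with (S n * fact n)%nat. rewrite mult_INR.
    replace (INR (S (S (2 * n + 1)))) with (2 * (INR (S n) + / 2)) in R1
      by (rewrite !S_INR, plus_INR, mult_INR; simpl; field).
    replace (INR (S (2 * n + 1))) with (2 * INR (S n)) in R1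
      by (rewrite !S_INR, plus_INR, mult_INR; simpl; ring).
    set (J := cosint phi (S (S (2 * n + 1)))) in *. set (J0 := cosint phi (2 * n + 1)) in *.
    set (a := INR (S n)) in *.
    transitivity ((/ 4 * (((2 * (a + / 2)) ^ 2 - 4 * k) * J)) * qprod k n); [field|].
    rewrite R1.
    transitivity ((a + / 2) * a * (J0 * qprod k n)); [field|]. rewrite IH. field.
Qed.

End Reflection.

Lemma hprod_pos n : (0 < hprod n)%R.
Proof.
  induction n as [|n IH]; simpl; [lra|].
  apply Rmult_lt_0_compat; [exact IH|]. pose proof (pos_INR n). destruct n; simpl in *; lra.
Qed.

Lemma qprod_0 n : qprod 0 n = (hprod n ^ 2)%R.
Proof. induction n as [|n IH]; cbn [qprod hprod]; [lra|]. rewrite IH. ring. Qed.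

Lemma wal_hprod n : (wal (2 * n + 1) * hprod n = INR (fact n) / 2)%R.
Proof.
  pose proof (cosint_qprod (fun _ => 1%R) (fun _ => 0%R) 0) as H.
  specialize (H ltac:(intros; apply (is_derive_const (V := R_NormedModule)))).
  specialize (H ltac:(intros; evar_last; [apply (is_derive_const (V := R_NormedModule))|];
    simpl; unfold zero; simpl; ring) eq_refl n).
  change (cosint (fun _ => 1%R) (2 * n + 1)) with (wal (2 * n + 1)) in H.
  rewrite qprod_0 in H. pose proof (hprod_pos n).
  apply Rmult_eq_reg_r with (hprod n); [|lra]. rewrite Rmult_assoc.
  replace (hprod n * hprod n)%R with (hprod n ^ 2)%R by ring. rewrite H. field.
Qed.

Lemma rising_product c d k n : c + d = 1 -> c * d = / 4 - RtoC k ->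
  rising c n * rising d n = RtoC (qprod k n).
Proof.
  intros H1 H2. induction n as [|n IH].
  - simpl. rewrite H2, RtoC_minus, RtoC_inv by lra. reflexivity.
  - change (rising c (S n)) with (rising c n * (c + natC (S n))).
    change (rising d (S n)) with (rising d n * (d + natC (S n))).
    cbn [qprod]. rewrite RtoC_mult, <- IH.
    rewrite RtoC_minus, RtoC_pow, RtoC_plus, RtoC_inv by lra.
    change (RtoC (INR (S n))) with (natC (S n)).
    transitivity (rising c n * rising d n *
      (c * d + (c + d) * natC (S n) + natC (S n) * natC (S n))); [ring|].
    rewrite H1, H2. f_equal. simpl. field.
Qed.

(** The product of the two Euler-Gauss quotients with [phi (PI / 2)] is exactly
    [4 n wal (2 n + 1) cosint phi (2 n + 1)], and in the limit both integrals may be replaced by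
    Wallis integrals. *)
Lemma gamma_reflection (c d : C) (phi phi1 : R -> R) (k : R) :
  (forall t : R, is_derive phi t (phi1 t)) ->
  (forall t : R, is_derive phi1 t (- 4 * k * phi t)%R) ->
  phi 0%R = 1%R -> phi1 0%R = 0%R ->
  c + d = 1 -> c * d = / 4 - RtoC k -> (0 < Re c)%R -> (0 < Re d)%R ->
  CGamma c * CGamma d * RtoC (phi (PI / 2)%R) = RtoC PI.
Proof.
  intros D1 D2 P0 P1 Hs Hp Hc Hd.
  destruct (cosint_vs_wal phi phi1 k D1 D2 P0 P1) as [M [HM B]].
  apply (cconv_unique (fun n => Gauss_seq c n * Gauss_seq d n * RtoC (phi (PI / 2)%R))).
  { apply cconv_mult; [|apply cconv_const]. apply cconv_mult; apply Gauss_seq_converges; assumption. }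
  apply (cconv_ext_from (fun n => RtoC (4 * INR n * wal (2 * n + 1) * cosint phi (2 * n + 1)))
    _ _ 1).
  - intros n Hn.
    assert (Hn' : (0 < INR n)%R) by (apply lt_0_INR; lia).
    pose proof (rising_product c d k n Hs Hp) as RP.
    pose proof (rising_neq c n Hc) as N1. pose proof (rising_neq d n Hd) as N2.
    assert (NQ : RtoC (qprod k n) <> 0) by (rewrite <- RP; apply Cmult_neq_0; assumption).
    assert (NQ' : qprod k n <> 0%R) by (intros E; apply NQ; rewrite E; reflexivity).
    assert (EC : Cpower (INR n) c * Cpower (INR n) d = RtoC (INR n)).
    { rewrite !Cpower_pos_real, <- Cexp_plus by assumption.
      replace (c * RtoC (ln (INR n)) + d * RtoC (ln (INR n))) with (RtoC (ln (INR n))).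
      - unfold Cexp. simpl. rewrite exp_ln, cos_0, sin_0 by assumption.
        unfold RtoC. f_equal; ring.
      - rewrite <- (Cmult_1_l (RtoC (ln (INR n)))) at 1. rewrite <- Hs. ring. }
    transitivity (RtoC (INR (fact n)) * RtoC (INR (fact n)) *
      (Cpower (INR n) c * Cpower (INR n) d) / (rising c n * rising d n) * RtoC (phi (PI / 2)%R)).
    2:{ unfold Gauss_seq. field. split; assumption. }
    rewrite EC, RP.
    pose proof (cosint_qprod phi phi1 k D1 D2 P1 n) as CQ.
    pose proof (wal_hprod n) as WH. pose proof (hprod_pos n) as HP.
    rewrite <- !RtoC_mult, <- RtoC_div, <- RtoC_mult by exact NQ'. f_equal.
    replace (wal (2 * n + 1)) with (INR (fact n) / (2 * hprod n))%R
      by (apply Rmult_eq_reg_r with (hprod n); [rewrite WH; field|]; lra).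
    apply Rmult_eq_reg_r with (qprod k n); [|exact NQ'].
    rewrite Rmult_assoc, CQ. field. split; [exact NQ'|lra].
  - intros eps He. pose proof PI_RGT_0 as HPI.
    destruct (nfloor_ex ((PI + 2 * PI * M) / eps)%R) as [N [_ HN]].
    { apply Rdiv_le_0_compat; [nra|exact He]. }
    exists (S N). intros n Hn. rewrite <- RtoC_minus, Cmod_R.
    destruct n as [|n]; [lia|].
    pose proof (wal_odd_bound (S n)) as W.
    replace (2 * S n + 1)%nat with (S (S (2 * n + 1))) in * by lia.
    specialize (B (2 * n + 1)%nat).
    set (w := wal (S (S (2 * n + 1)))) in *. set (J := cosint phi (S (S (2 * n + 1)))) in *.
    pose proof (wal_pos (S (S (2 * n + 1)))) as Hw. fold w in Hw.
    assert (E1 : INR (S (2 * n + 1)) = (2 * INR (S n))%R)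
      by (rewrite !S_INR, plus_INR, mult_INR; simpl; ring).
    rewrite E1 in B. set (x := INR (S n)) in *.
    assert (Hx : (1 <= x)%R) by (unfold x; rewrite S_INR; pose proof (pos_INR n); lra).
    rewrite S_INR in W. fold x in W.
    replace (4 * x * w * J - PI)%R with ((4 * x * w ^ 2 - PI) + 4 * x * w * (J - w))%R by ring.
    eapply Rle_lt_trans; [apply Rabs_triang|].
    rewrite (Rabs_mult (4 * x * w)), (Rabs_pos_eq (4 * x * w)) by nra.
    assert (Up : (4 * x * w ^ 2 <= 2 * PI)%R).
    { apply Rabs_le_between in W. assert (PI / (x + 1) <= PI)%R; [|lra].
      apply Rmult_le_reg_r with (x + 1)%R; [lra|].
      replace (PI / (x + 1) * (x + 1))%R with PI by (field; lra). nra. }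
    assert (B2 : (4 * x * w * Rabs (J - w) <= PI * M / x)%R).
    { apply Rle_trans with (4 * x * w * (M * w / (2 * x)))%R; [apply Rmult_le_compat_l; nra|].
      replace (4 * x * w * (M * w / (2 * x)))%R with ((4 * x * w ^ 2) * (M / (2 * x)))%R by (field; lra).
      replace (PI * M / x)%R with (2 * PI * (M / (2 * x)))%R by (field; lra).
      apply Rmult_le_compat_r; [apply Rdiv_le_0_compat; lra|exact Up]. }
    assert (B3 : (PI / (x + 1) <= PI / x)%R).
    { apply Rmult_le_compat_l; [lra|]. apply Rinv_le_contravar; lra. }
    apply Rle_lt_trans with ((PI + PI * M) / x)%R.
    { replace ((PI + PI * M) / x)%R with (PI / x + PI * M / x)%R by (field; lra). lra. }
    apply Rlt_div_l; [lra|]. apply Rlt_div_l in HN; [|exact He].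
    assert (INR N + 1 <= x)%R by (rewrite <- S_INR; apply le_INR, Hn).
    pose proof (Rmult_le_pos PI M ltac:(lra) HM). nra.
Qed.

(** * Complex differentiation *)

Definition cnear (z : C) (P : C -> Prop) : Prop :=
  exists r : R, (0 < r)%R /\ forall w, (Cmod (w - z) < r)%R -> P w.

Lemma cnear_and z P Q : cnear z P -> cnear z Q -> cnear z (fun w => P w /\ Q w).
Proof.
  intros (r & Hr & HP) (s & Hs & HQ). exists (Rmin r s). split; [apply Rmin_glb_lt; assumption|].
  intros w Hw. split; [apply HP|apply HQ]; eapply Rlt_le_trans; try apply Hw;
    [apply Rmin_l|apply Rmin_r].
Qed.

Lemma cnear_impl z (P Q : C -> Prop) : (forall w, P w -> Q w) -> cnear z P -> cnear z Q.
Proof. intros H (r & Hr & HP). exists r. split; [exact Hr|]. intros w Hw. apply H, HP, Hw. Qed.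

Lemma cnear_point z P : cnear z P -> P z.
Proof.
  intros (r & Hr & HP). apply HP. replace (z - z) with (RtoC 0) by ring. rewrite Cmod_0. exact Hr.
Qed.

Lemma cnear_all z (P : C -> Prop) : (forall w, P w) -> cnear z P.
Proof. intros H. exists 1%R. split; [lra|auto]. Qed.

Lemma cnear_open z P : cnear z P -> cnear z (fun w => cnear w P).
Proof.
  intros (r & Hr & HP). exists r. split; [exact Hr|]. intros w Hw.
  exists (r - Cmod (w - z))%R. split; [lra|]. intros v Hv. apply HP.
  pose proof (Cmod_triangle (v - w) (w - z)) as T.
  replace (v - w + (w - z)) with (v - z) in T by ring. lra.
Qed.

Lemma cnear_neq z u : z <> u -> cnear z (fun w => w <> u).
Proof.
  intros H. exists (Cmod (z - u)). split.
  - apply Cmod_gt_0. intros E. apply H. apply Ceq_minus. exact E.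
  - intros w Hw E. subst w. replace (u - z) with (- (z - u)) in Hw by ring.
    rewrite Cmod_opp in Hw. lra.
Qed.

Definition ccont (f : C -> C) (z : C) : Prop :=
  forall eps : R, (0 < eps)%R -> cnear z (fun w => (Cmod (f w - f z) < eps)%R).

Lemma ccont_const c z : ccont (fun _ => c) z.
Proof.
  intros eps He. apply cnear_all. intros w. replace (c - c) with (RtoC 0) by ring.
  rewrite Cmod_0. exact He.
Qed.

Lemma ccont_id z : ccont (fun w => w) z.
Proof. intros eps He. exists eps. auto. Qed.

Lemma ccont_plus f g z : ccont f z -> ccont g z -> ccont (fun w => f w + g w) z.
Proof.
  intros Hf Hg eps He.
  eapply cnear_impl; [|apply cnear_and; [apply (Hf (eps / 2)%R)|apply (Hg (eps / 2)%R)]; lra].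
  intros w [A B]. cbv beta in *.
  replace (f w + g w - (f z + g z)) with ((f w - f z) + (g w - g z)) by ring.
  eapply Rle_lt_trans; [apply Cmod_triangle|]. lra.
Qed.

Lemma ccont_mult f g z : ccont f z -> ccont g z -> ccont (fun w => f w * g w) z.
Proof.
  intros Hf Hg eps He.
  pose proof (Cmod_ge_0 (f z)) as A0. pose proof (Cmod_ge_0 (g z)) as B0.
  set (a := Cmod (f z)) in *. set (b := Cmod (g z)) in *.
  set (e := Rmin 1 (eps / (a + b + 2))).
  assert (He0 : (0 < eps / (a + b + 2))%R) by (apply Rdiv_lt_0_compat; lra).
  assert (He1 : (0 < e)%R) by (apply Rmin_glb_lt; lra).
  eapply cnear_impl; [|apply cnear_and; [apply (Hf e)|apply (Hg e)]; exact He1].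
  intros w [A B]. cbv beta in *.
  replace (f w * g w - f z * g z)
    with ((f w - f z) * (g w - g z) + (f w - f z) * g z + f z * (g w - g z)) by ring.
  pose proof (Cmod_triangle ((f w - f z) * (g w - g z) + (f w - f z) * g z) (f z * (g w - g z))).
  pose proof (Cmod_triangle ((f w - f z) * (g w - g z)) ((f w - f z) * g z)).
  rewrite !Cmod_mult in *. fold a b in H, H0.
  pose proof (Cmod_ge_0 (f w - f z)). pose proof (Cmod_ge_0 (g w - g z)).
  assert (e <= 1)%R by apply Rmin_l.
  assert (e * (a + b + 2) <= eps)%R.
  { apply Rle_div_r; [lra|apply Rmin_r]. }
  nra.
Qed.

Lemma ccont_comp f g z : ccont f (g z) -> ccont g z -> ccont (fun w => f (g w)) z.
Proof.
  intros Hf Hg eps He. destruct (Hf eps He) as (r & Hr & H).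
  eapply cnear_impl; [|apply (Hg r Hr)]. intros w Hw. apply H, Hw.
Qed.

Lemma cnear_comp g z P : ccont g z -> cnear (g z) P -> cnear z (fun w => P (g w)).
Proof.
  intros Hg (r & Hr & H). eapply cnear_impl; [|apply (Hg r Hr)]. intros w Hw. apply H, Hw.
Qed.

Lemma ccont_inv (z : C) : z <> 0 -> ccont (fun w => / w) z.
Proof.
  intros Hz eps He. assert (Hm : (0 < Cmod z)%R) by (apply Cmod_gt_0, Hz).
  set (m := Cmod z) in *.
  exists (Rmin (m / 2) (eps * m ^ 2 / 2)).
  assert (0 < eps * m ^ 2 / 2)%R by (pose proof (pow_lt m 2 Hm); nra).
  split; [apply Rmin_glb_lt; lra|].
  intros w Hw.
  assert (A : (Cmod (w - z) < m / 2)%R) by (eapply Rlt_le_trans; [apply Hw|apply Rmin_l]).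
  assert (B : (Cmod (w - z) < eps * m ^ 2 / 2)%R)
    by (eapply Rlt_le_trans; [apply Hw|apply Rmin_r]).
  assert (W : (m / 2 < Cmod w)%R).
  { pose proof (Cmod_triangle w (- (w - z))) as T. rewrite Cmod_opp in T.
    replace (w + - (w - z)) with z in T by ring. fold m in T. lra. }
  assert (Hw0 : w <> 0) by (apply Cmod_gt_0; lra).
  replace (/ w - / z) with (- (w - z) / (w * z)) by (field; split; assumption).
  rewrite Cmod_div, Cmod_opp, Cmod_mult by (apply Cmult_neq_0; assumption). fold m.
  apply Rlt_div_l; [nra|]. nra.
Qed.

Lemma ccont_ext_near f g z : cnear z (fun w => f w = g w) -> ccont f z -> ccont g z.
Proof.
  intros E Hf eps He. pose proof (cnear_point _ _ E) as Ez.
  eapply cnear_impl; [|apply cnear_and; [apply E|apply (Hf eps He)]].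
  intros w [A B]. rewrite <- A, <- Ez. exact B.
Qed.

(** Differentiability in the form of Caratheodory: [f w - f z = phi w * (w - z)] near [z] with [phi]
    continuous at [z]. The rules of calculus become identities for [phi]. *)
Definition cderiv (f : C -> C) (z l : C) : Prop :=
  exists phi, ccont phi z /\ phi z = l /\ cnear z (fun w => f w = f z + phi w * (w - z)).

Lemma cderiv_eq f z l l' : cderiv f z l -> l = l' -> cderiv f z l'.
Proof. intros H <-. exact H. Qed.

Lemma cderiv_ccont f z l : cderiv f z l -> ccont f z.
Proof.
  intros (phi & Hp & _ & E).
  apply (ccont_ext_near (fun w => f z + phi w * (w + - z))).
  - eapply cnear_impl; [|apply E]. intros w H. symmetry. exact H.
  - apply ccont_plus; [apply ccont_const|]. apply ccont_mult; [exact Hp|].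
    apply ccont_plus; [apply ccont_id|apply ccont_const].
Qed.

Lemma cderiv_const c z : cderiv (fun _ => c) z 0.
Proof.
  exists (fun _ => RtoC 0). split; [apply ccont_const|]. split; [reflexivity|].
  apply cnear_all. intros; ring.
Qed.

Lemma cderiv_id z : cderiv (fun w => w) z 1.
Proof.
  exists (fun _ => RtoC 1). split; [apply ccont_const|]. split; [reflexivity|].
  apply cnear_all. intros; ring.
Qed.

Lemma cderiv_plus f g z l m : cderiv f z l -> cderiv g z m ->
  cderiv (fun w => f w + g w) z (l + m).
Proof.
  intros (p & Hp & Ep & Np) (q & Hq & Eq & Nq). exists (fun w => p w + q w).
  split; [apply ccont_plus; assumption|]. split; [congruence|].
  eapply cnear_impl; [|apply cnear_and; [apply Np|apply Nq]].
  intros w [A B]. rewrite A, B. ring.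
Qed.

Lemma cderiv_mult f g z l m : cderiv f z l -> cderiv g z m ->
  cderiv (fun w => f w * g w) z (l * g z + f z * m).
Proof.
  intros Hf Hg. pose proof (cderiv_ccont _ _ _ Hg) as Cg.
  destruct Hf as (p & Hp & Ep & Np). destruct Hg as (q & Hq & Eq & Nq).
  exists (fun w => p w * g w + f z * q w).
  split; [apply ccont_plus; apply ccont_mult; try assumption; apply ccont_const|].
  split; [congruence|].
  eapply cnear_impl; [|apply cnear_and; [apply Np|apply Nq]].
  intros w [A B]. rewrite A.
  replace (f z * g z) with (f z * (g w - q w * (w - z))) by (rewrite B; ring). ring.
Qed.

Lemma cderiv_comp f g z l m : cderiv f (g z) l -> cderiv g z m ->
  cderiv (fun w => f (g w)) z (l * m).
Proof.
  intros Hf Hg. pose proof (cderiv_ccont _ _ _ Hg) as Cg.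
  destruct Hf as (p & Hp & Ep & Np). destruct Hg as (q & Hq & Eq & Nq).
  exists (fun w => p (g w) * q w).
  split; [apply ccont_mult; [apply ccont_comp|]; assumption|]. split; [congruence|].
  eapply cnear_impl; [|apply cnear_and; [apply (cnear_comp g z _ Cg Np)|apply Nq]].
  intros w [A B]. rewrite A. replace (g w - g z) with (q w * (w - z)) by (rewrite B; ring). ring.
Qed.

Lemma cderiv_inv (z : C) : z <> 0 -> cderiv (fun w => / w) z (- (/ z * / z)).
Proof.
  intros Hz. exists (fun w => - (1) * (/ w * / z)).
  split; [|split].
  - apply ccont_mult; [apply ccont_const|].
    apply ccont_mult; [apply ccont_inv, Hz|apply ccont_const].
  - ring.
  - eapply cnear_impl; [|apply (cnear_neq z 0 Hz)]. intros w Hw. field. split; assumption.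
Qed.

Lemma cderiv_ext_near f g z l : cnear z (fun w => f w = g w) -> cderiv f z l -> cderiv g z l.
Proof.
  intros E (p & Hp & Ep & Np). exists p. split; [exact Hp|]. split; [exact Ep|].
  pose proof (cnear_point _ _ E) as Ez.
  eapply cnear_impl; [|apply cnear_and; [apply E|apply Np]].
  intros w [A B]. rewrite <- A, <- Ez. exact B.
Qed.

Lemma cderiv_scal c f z l : cderiv f z l -> cderiv (fun w => c * f w) z (c * l).
Proof.
  intros H. eapply cderiv_eq; [apply cderiv_mult; [apply cderiv_const|exact H]|]. cbv beta. ring.
Qed.

Lemma cderiv_of_eps f z l :
  (forall eps : R, (0 < eps)%R ->
    cnear z (fun w => (Cmod (f w - f z - l * (w - z)) <= eps * Cmod (w - z))%R)) ->
  cderiv f z l.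
Proof.
  intros H.
  exists (fun w => if excluded_middle_informative (w = z) then l else (f w - f z) / (w - z)).
  split; [|split].
  - intros eps He. eapply cnear_impl; [|apply (H (eps / 2)%R); lra]. intros w Hw. cbv beta.
    destruct (excluded_middle_informative (z = z)) as [_|N]; [|contradiction].
    destruct (excluded_middle_informative (w = z)) as [->|N].
    + replace (l - l) with (RtoC 0) by ring. rewrite Cmod_0. exact He.
    + assert (N' : w - z <> 0) by (intros E; apply N, Ceq_minus, E).
      replace ((f w - f z) / (w - z) - l) with ((f w - f z - l * (w - z)) / (w - z))
        by (field; exact N').
      rewrite Cmod_div by exact N'. apply Rlt_div_l; [apply Cmod_gt_0, N'|].
      apply Cmod_gt_0 in N'. nra.
  - destruct (excluded_middle_informative (z = z)) as [_|N]; [reflexivity|contradiction].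
  - apply cnear_all. intros w. destruct (excluded_middle_informative (w = z)) as [->|N].
    + ring.
    + field. intros E. apply N, Ceq_minus, E.
Qed.

Lemma cderiv_eps f z l : cderiv f z l -> forall eps : R, (0 < eps)%R ->
  cnear z (fun w => (Cmod (f w - f z - l * (w - z)) <= eps * Cmod (w - z))%R).
Proof.
  intros (p & Hp & Ep & Np) eps He.
  eapply cnear_impl; [|apply cnear_and; [apply (Hp eps He)|apply Np]].
  intros w [A B]. rewrite B, <- Ep.
  replace (f z + p w * (w - z) - f z - p z * (w - z)) with ((p w - p z) * (w - z)) by ring.
  rewrite Cmod_mult. apply Rmult_le_compat_r; [apply Cmod_ge_0|lra].
Qed.

(** ** Iterated differentiability at a point *)

(** [Dn n f z]: near [z] the function [f] has [n] successive derivatives, the last of which is continuous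
    at [z]. Being a condition at one point, it passes to functions that are glued from pieces. *)
Fixpoint Dn (n : nat) (f : C -> C) (z : C) : Prop :=
  match n with
  | O => ccont f z
  | S m => exists g, cnear z (fun w => cderiv f w (g w)) /\ Dn m g z
  end.

Definition smooth (f : C -> C) (z : C) : Prop := forall n, Dn n f z.

Lemma Dn_ext_near n f g z : cnear z (fun w => f w = g w) -> Dn n f z -> Dn n g z.
Proof.
  intros E. destruct n as [|n]; simpl; [apply ccont_ext_near, E|].
  intros (h & A & B). exists h. split; [|exact B].
  eapply cnear_impl; [|apply cnear_and; [apply (cnear_open _ _ E)|apply A]].
  intros w [U V]. apply (cderiv_ext_near f); assumption.
Qed.

Lemma Dn_pred n f z : Dn (S n) f z -> Dn n f z.
Proof.
  revert f. induction n as [|n IH]; intros f (g & A & B).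
  - apply (cderiv_ccont _ _ _ (cnear_point _ _ A)).
  - exists g. split; [exact A|]. apply IH, B.
Qed.

Lemma Dn_ccont n f z : Dn n f z -> ccont f z.
Proof. induction n as [|n IH]; [auto|]. intros H. apply IH, Dn_pred, H. Qed.

Lemma Dn_const n c z : Dn n (fun _ => c) z.
Proof.
  revert c. induction n as [|n IH]; intros c; [apply ccont_const|].
  exists (fun _ => RtoC 0). split; [|apply IH]. apply cnear_all. intros; apply cderiv_const.
Qed.

Lemma Dn_id n z : Dn n (fun w => w) z.
Proof.
  destruct n as [|n]; [apply ccont_id|]. exists (fun _ => RtoC 1). split; [|apply Dn_const].
  apply cnear_all. intros; apply cderiv_id.
Qed.

Lemma Dn_plus n f g z : Dn n f z -> Dn n g z -> Dn n (fun w => f w + g w) z.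
Proof.
  revert f g. induction n as [|n IH]; intros f g; [apply ccont_plus|].
  intros (f' & A & B) (g' & A' & B'). exists (fun w => f' w + g' w). split; [|apply IH; assumption].
  eapply cnear_impl; [|apply cnear_and; [apply A|apply A']]. intros w [U V].
  apply cderiv_plus; assumption.
Qed.

Lemma Dn_mult n f g z : Dn n f z -> Dn n g z -> Dn n (fun w => f w * g w) z.
Proof.
  revert f g. induction n as [|n IH]; intros f g; [apply ccont_mult|].
  intros F G. pose proof (Dn_pred _ _ _ F) as F0. pose proof (Dn_pred _ _ _ G) as G0.
  destruct F as (f' & A & B). destruct G as (g' & A' & B').
  exists (fun w => f' w * g w + f w * g' w).
  split; [|apply Dn_plus; apply IH; assumption].
  eapply cnear_impl; [|apply cnear_and; [apply A|apply A']]. intros w [U V].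
  apply cderiv_mult; assumption.
Qed.

Lemma Dn_comp n f g z : Dn n f (g z) -> Dn n g z -> Dn n (fun w => f (g w)) z.
Proof.
  revert f g. induction n as [|n IH]; intros f g; [apply ccont_comp|].
  intros F G. pose proof (Dn_pred _ _ _ F) as F0. pose proof (Dn_pred _ _ _ G) as G0.
  pose proof (Dn_ccont _ _ _ G) as Gc.
  destruct F as (f' & A & B). destruct G as (g' & A' & B').
  exists (fun w => f' (g w) * g' w).
  split; [|apply Dn_mult; [apply IH|]; assumption].
  eapply cnear_impl; [|apply cnear_and; [apply (cnear_comp g z _ Gc A)|apply A']]. intros w [U V].
  apply cderiv_comp; assumption.
Qed.

Lemma Dn_inv n (z : C) : z <> 0 -> Dn n (fun w => / w) z.
Proof.
  intros Hz. induction n as [|n IH]; [apply ccont_inv, Hz|].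
  exists (fun w => - (1) * (/ w * / w)). split.
  - eapply cnear_impl; [|apply (cnear_neq z 0 Hz)]. intros w Hw.
    eapply cderiv_eq; [apply cderiv_inv, Hw|]. ring.
  - apply Dn_mult; [apply Dn_const|]. apply Dn_mult; exact IH.
Qed.

Lemma smooth_const c z : smooth (fun _ => c) z.
Proof. intros n. apply Dn_const. Qed.
Lemma smooth_id z : smooth (fun w => w) z.
Proof. intros n. apply Dn_id. Qed.
Lemma smooth_plus f g z : smooth f z -> smooth g z -> smooth (fun w => f w + g w) z.
Proof. intros F G n. apply Dn_plus; auto. Qed.
Lemma smooth_mult f g z : smooth f z -> smooth g z -> smooth (fun w => f w * g w) z.
Proof. intros F G n. apply Dn_mult; auto. Qed.
Lemma smooth_comp f g z : smooth f (g z) -> smooth g z -> smooth (fun w => f (g w)) z.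
Proof. intros F G n. apply Dn_comp; auto. Qed.
Lemma smooth_inv (z : C) : z <> 0 -> smooth (fun w => / w) z.
Proof. intros H n. apply Dn_inv, H. Qed.
Lemma smooth_ext_near f g z : cnear z (fun w => f w = g w) -> smooth f z -> smooth g z.
Proof. intros E F n. eapply Dn_ext_near; eauto. Qed.
Lemma smooth_minus f g z : smooth f z -> smooth g z -> smooth (fun w => f w - g w) z.
Proof.
  intros F G. apply (smooth_ext_near (fun w => f w + (- (1)) * g w)).
  - apply cnear_all. intros; ring.
  - apply smooth_plus; [exact F|]. apply smooth_mult; [apply smooth_const|exact G].
Qed.
Lemma smooth_pow k z : smooth (fun w => w ^ k) z.
Proof.
  induction k as [|k IH]; [apply (smooth_const 1)|].
  apply (smooth_mult (fun w => w) (fun w => w ^ k)); [apply smooth_id|exact IH].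
Qed.

(** ** The mean value inequality *)

Definition rcont (u : R -> C) (t : R) : Prop :=
  forall eps : R, (0 < eps)%R -> exists r : R, (0 < r)%R /\
  forall s : R, (Rabs (s - t) < r)%R -> (Cmod (u s - u t) < eps)%R.

(** The same form of differentiability for curves. The identity is required for all [s], since away
    from [t] it may serve to define [eta]. *)
Definition rderiv (u : R -> C) (t : R) (l : C) : Prop :=
  exists eta, rcont eta t /\ eta t = l /\ forall s, u s = u t + RtoC (s - t) * eta s.

Lemma rcont_mult u v t : rcont u t -> rcont v t -> rcont (fun s => u s * v s) t.
Proof.
  intros Hu Hv eps He.
  pose proof (Cmod_ge_0 (u t)). pose proof (Cmod_ge_0 (v t)).
  set (a := Cmod (u t)) in *. set (b := Cmod (v t)) in *.
  set (e := Rmin 1 (eps / (a + b + 2))).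
  assert (He0 : (0 < eps / (a + b + 2))%R) by (apply Rdiv_lt_0_compat; lra).
  assert (He1 : (0 < e)%R) by (apply Rmin_glb_lt; lra).
  destruct (Hu e He1) as (r1 & Hr1 & H1). destruct (Hv e He1) as (r2 & Hr2 & H2).
  exists (Rmin r1 r2). split; [apply Rmin_glb_lt; assumption|]. intros s Hs.
  specialize (H1 s ltac:(eapply Rlt_le_trans; [apply Hs|apply Rmin_l])).
  specialize (H2 s ltac:(eapply Rlt_le_trans; [apply Hs|apply Rmin_r])).
  replace (u s * v s - u t * v t)
    with ((u s - u t) * (v s - v t) + (u s - u t) * v t + u t * (v s - v t)) by ring.
  pose proof (Cmod_triangle ((u s - u t) * (v s - v t) + (u s - u t) * v t) (u t * (v s - v t))).
  pose proof (Cmod_triangle ((u s - u t) * (v s - v t)) ((u s - u t) * v t)).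
  rewrite !Cmod_mult in *. fold a b in H3, H4.
  pose proof (Cmod_ge_0 (u s - u t)). pose proof (Cmod_ge_0 (v s - v t)).
  assert (e <= 1)%R by apply Rmin_l.
  assert (e * (a + b + 2) <= eps)%R by (apply Rle_div_r; [lra|apply Rmin_r]).
  nra.
Qed.

Lemma rcont_const c t : rcont (fun _ => c) t.
Proof.
  intros eps He. exists 1%R. split; [lra|]. intros s _.
  replace (c - c) with (RtoC 0) by ring. rewrite Cmod_0. exact He.
Qed.

Lemma rcont_plus u v t : rcont u t -> rcont v t -> rcont (fun s => u s + v s) t.
Proof.
  intros Hu Hv eps He.
  destruct (Hu (eps / 2)%R ltac:(lra)) as (r1 & Hr1 & H1).
  destruct (Hv (eps / 2)%R ltac:(lra)) as (r2 & Hr2 & H2).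
  exists (Rmin r1 r2). split; [apply Rmin_glb_lt; assumption|]. intros s Hs.
  specialize (H1 s ltac:(eapply Rlt_le_trans; [apply Hs|apply Rmin_l])).
  specialize (H2 s ltac:(eapply Rlt_le_trans; [apply Hs|apply Rmin_r])).
  replace (u s + v s - (u t + v t)) with ((u s - u t) + (v s - v t)) by ring.
  eapply Rle_lt_trans; [apply Cmod_triangle|]. lra.
Qed.

Lemma rcont_RtoC t : rcont RtoC t.
Proof.
  intros eps He. exists eps. split; [exact He|]. intros s Hs.
  rewrite <- RtoC_minus, Cmod_R. exact Hs.
Qed.

Lemma rcont_comp f u t : ccont f (u t) -> rcont u t -> rcont (fun s => f (u s)) t.
Proof.
  intros Hf Hu eps He. destruct (Hf eps He) as (r & Hr & H).
  destruct (Hu r Hr) as (r' & Hr' & H'). exists r'. split; [exact Hr'|].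
  intros s Hs. apply H, H', Hs.
Qed.

Lemma rderiv_rcont u t l : rderiv u t l -> rcont u t.
Proof.
  intros (eta & He & _ & E).
  assert (A : rcont (fun s => u t + (RtoC s + RtoC (- t)) * eta s) t).
  { apply rcont_plus; [apply rcont_const|]. apply rcont_mult; [|exact He].
    apply rcont_plus; [apply rcont_RtoC|apply rcont_const]. }
  intros eps Hp. destruct (A eps Hp) as (r & Hr & H). exists r. split; [exact Hr|].
  intros s Hs. specialize (H s Hs). rewrite (E s).
  replace (u t + RtoC (s - t) * eta s - u t) with
    (u t + (RtoC s + RtoC (- t)) * eta s - (u t + (RtoC t + RtoC (- t)) * eta t)); [exact H|].
  rewrite RtoC_minus, RtoC_opp. ring.
Qed.

Lemma rderiv_Re u t l : rderiv u t l -> is_derive (fun s => Re (u s)) t (Re l).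
Proof.
  intros (eta & He & El & E). apply is_derive_Reals. intros eps Hp.
  destruct (He eps Hp) as (r & Hr & H). exists (mkposreal _ Hr). intros h Hh Hlt.
  simpl in Hlt. specialize (H (t + h)%R).
  replace (t + h - t)%R with h in H by ring. specialize (H Hlt).
  specialize (E (t + h)%R). replace (t + h - t)%R with h in E by ring.
  rewrite E. replace (Re (u t + RtoC h * eta (t + h)%R) - Re (u t))%R
    with (h * Re (eta (t + h)%R))%R by (unfold Re; simpl; ring).
  replace (h * Re (eta (t + h)%R) / h - Re l)%R with (Re (eta (t + h)%R - eta t)).
  - eapply Rle_lt_trans; [apply re_le_Cmod|exact H].
  - rewrite El. unfold Re; simpl. field. exact Hh.
Qed.

Lemma rderiv_scal c u t l : rderiv u t l -> rderiv (fun s => c * u s) t (c * l).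
Proof.
  intros (eta & He & El & E). exists (fun s => c * eta s).
  split; [apply rcont_mult; [apply rcont_const|exact He]|]. split; [congruence|].
  intros s. rewrite (E s). ring.
Qed.

Lemma rderiv_Im u t l : rderiv u t l -> is_derive (fun s => Im (u s)) t (Im l).
Proof.
  intros H. apply (rderiv_scal (- Ci)) in H. apply rderiv_Re in H.
  assert (E : forall z, Re (- Ci * z) = Im z) by (intros [a b]; simpl; ring).
  rewrite E in H. eapply is_derive_ext; [|exact H]. intros s. apply E.
Qed.

Lemma rderiv_chain f u t l m : cderiv f (u t) l -> rderiv u t m -> rderiv (fun s => f (u s)) t (l * m).
Proof.
  intros Hf Hu. pose proof (rderiv_rcont _ _ _ Hu) as Cu.
  destruct Hf as (p & Hp & Ep & (r & Hr & Np)). destruct Hu as (eta & He & El & E).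
  (* away from the neighbourhood on which f is controlled, the difference quotient is used *)
  exists (fun s => if Rlt_dec (Cmod (u s - u t)) r then p (u s) * eta s
    else (f (u s) - f (u t)) / RtoC (s - t)).
  destruct (Cu r Hr) as (r' & Hr' & H').
  assert (Z : (Cmod (u t - u t) < r)%R).
  { replace (u t - u t) with (RtoC 0) by ring. rewrite Cmod_0. exact Hr. }
  split; [|split].
  - assert (A : rcont (fun s => p (u s) * eta s) t)
      by (apply rcont_mult; [apply rcont_comp|]; assumption).
    intros eps Hpos. destruct (A eps Hpos) as (r2 & Hr2 & H2).
    exists (Rmin r' r2). split; [apply Rmin_glb_lt; assumption|]. intros s Hs.
    destruct (Rlt_dec (Cmod (u t - u t)) r) as [_|N]; [|contradiction].
    destruct (Rlt_dec (Cmod (u s - u t)) r) as [_|N].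
    + apply H2. eapply Rlt_le_trans; [apply Hs|apply Rmin_r].
    + exfalso. apply N, H'. eapply Rlt_le_trans; [apply Hs|apply Rmin_l].
  - destruct (Rlt_dec (Cmod (u t - u t)) r) as [_|N]; [congruence|contradiction].
  - intros s. destruct (Rlt_dec (Cmod (u s - u t)) r) as [L|N].
    + rewrite (Np _ L).
      replace (u s - u t) with (RtoC (s - t) * eta s) by (rewrite (E s); ring). ring.
    + destruct (Req_dec s t) as [->|D]; [contradiction|]. field.
      intros E0. apply RtoC_inj in E0. lra.
Qed.

Lemma rderiv_segment z w t : rderiv (fun s => z + RtoC s * (w - z)) t (w - z).
Proof.
  exists (fun _ => w - z). split; [apply rcont_const|]. split; [reflexivity|].
  intros s. rewrite RtoC_minus. ring.
Qed.

(** The mean value theorem for the real part of [conj D * u], where [D = u 1 - u 0]. *)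
Lemma rderiv_bound u u' M :
  (forall t, (0 <= t <= 1)%R -> rderiv u t (u' t)) ->
  (forall t, (0 <= t <= 1)%R -> (Cmod (u' t) <= M)%R) ->
  (Cmod (u 1%R - u 0%R) <= M)%R.
Proof.
  intros H B. set (D := u 1%R - u 0%R).
  destruct (MVT_gen (fun t => Re (Cconj D * u t)) 0 1 (fun t => Re (Cconj D * u' t)))
    as [v [Hv Ev]].
  - intros t Ht. rewrite Rmin_left, Rmax_right in Ht by lra.
    apply rderiv_Re, rderiv_scal, H. lra.
  - intros t Ht. rewrite Rmin_left, Rmax_right in Ht by lra.
    apply continuity_pt_filterlim, (ex_derive_continuous (fun t => Re (Cconj D * u t))).
    eexists. apply rderiv_Re, rderiv_scal, H. lra.
  - rewrite Rmin_left, Rmax_right in Hv by lra.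
    assert (E1 : (Re (Cconj D * u 1%R) - Re (Cconj D * u 0%R) = Cmod D ^ 2)%R).
    { rewrite Cmod2_alt. unfold D, Cconj, Re, Im. simpl. ring. }
    rewrite E1 in Ev.
    assert (E2 : (Re (Cconj D * u' v) <= Cmod D * M)%R).
    { eapply Rle_trans; [apply Rle_abs|]. eapply Rle_trans; [apply re_le_Cmod|].
      rewrite Cmod_mult, Cmod_conj. apply Rmult_le_compat_l; [apply Cmod_ge_0|apply B, Hv]. }
    pose proof (Cmod_ge_0 D). pose proof (B 0%R ltac:(lra)) as B0.
    pose proof (Cmod_ge_0 (u' 0%R)).
    destruct (Req_dec (Cmod D) 0) as [Z|Z]; [lra|].
    apply Rmult_le_reg_l with (Cmod D); nra.
Qed.

Lemma mean_value_segment f f' z w M :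
  (forall t, (0 <= t <= 1)%R -> cderiv f (z + RtoC t * (w - z)) (f' (z + RtoC t * (w - z)))) ->
  (forall t, (0 <= t <= 1)%R -> (Cmod (f' (z + RtoC t * (w - z))%C) <= M)%R) ->
  (Cmod (f w - f z) <= M * Cmod (w - z))%R.
Proof.
  intros H B.
  pose proof (rderiv_bound (fun t => f (z + RtoC t * (w - z)))
    (fun t => f' (z + RtoC t * (w - z)) * (w - z)) (M * Cmod (w - z))) as G. cbv beta in G.
  replace (z + 1 * (w - z)) with w in G by ring.
  replace (z + 0 * (w - z)) with z in G by ring. apply G.
  - intros t Ht. apply (rderiv_chain f (fun t => z + RtoC t * (w - z))); [apply H, Ht|].
    apply rderiv_segment.
  - intros t Ht. rewrite Cmod_mult. apply Rmult_le_compat_r; [apply Cmod_ge_0|apply B, Ht].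
Qed.

Lemma mean_value_ball f f' z0 r M :
  (forall w, (Cmod (w - z0) < r)%R -> cderiv f w (f' w)) ->
  (forall w, (Cmod (w - z0) < r)%R -> (Cmod (f' w) <= M)%R) ->
  forall z w, (Cmod (z - z0) < r)%R -> (Cmod (w - z0) < r)%R ->
  (Cmod (f w - f z) <= M * Cmod (w - z))%R.
Proof.
  intros H B z w Hz Hw.
  assert (I : forall t, (0 <= t <= 1)%R -> (Cmod (z + RtoC t * (w - z) - z0) < r)%R).
  { intros t Ht.
    replace (z + RtoC t * (w - z) - z0) with (RtoC (1 - t) * (z - z0) + RtoC t * (w - z0))
      by (rewrite RtoC_minus; ring).
    eapply Rle_lt_trans; [apply Cmod_triangle|]. rewrite !Cmod_mult, !Cmod_R, !Rabs_pos_eq by lra.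
    destruct (Rle_dec t (1 / 2)); nra. }
  apply (mean_value_segment f f'); intros t Ht; [apply H|apply B]; apply I, Ht.
Qed.

(** ** Removable singularities *)

Definition quot (f : C -> C) (u l : C) (w : C) : C :=
  if excluded_middle_informative (w = u) then l else (f w - f u) / (w - u).

Lemma quot_away f u l z : z <> u -> cnear z (fun w => (f w - f u) * / (w - u) = quot f u l w).
Proof.
  intros H. eapply cnear_impl; [|apply (cnear_neq z u H)]. intros w Hw. unfold quot.
  destruct (excluded_middle_informative (w = u)); [contradiction|reflexivity].
Qed.

Lemma quot_smooth_away f u l z : z <> u -> smooth f z -> smooth (quot f u l) z.
Proof.
  intros H Hf. apply (smooth_ext_near (fun w => (f w - f u) * / (w - u))).
  - apply quot_away, H.
  - apply smooth_mult; [apply smooth_minus; [exact Hf|apply smooth_const]|].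
    apply (smooth_comp (fun w => / w) (fun w => w - u)).
    + apply smooth_inv. intros E. apply H, Ceq_minus, E.
    + apply smooth_minus; [apply smooth_id|apply smooth_const].
Qed.

(** The difference quotient is continuously differentiable at [u]: its derivative tends to half the
    second derivative of [f] there, by the second order Taylor formula. *)
Lemma quot_Dn1 f u : smooth f u -> exists l, cderiv f u l /\ Dn 1 (quot f u l) u.
Proof.
  intros Hf. destruct (Hf 2%nat) as (f1 & A1 & f2 & A2 & _).
  pose proof (cnear_point _ _ A1) as D1. pose proof (cnear_point _ _ A2) as D2.
  set (h := f2 u / 2). exists (f1 u). split; [exact D1|].
  set (Rq := quot f u (f1 u)).
  set (R' := fun w => if excluded_middle_informative (w = u) then h
    else (f1 w - Rq w) / (w - u)).
  assert (R'u : R' u = h).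
  { unfold R'. destruct (excluded_middle_informative (u = u)); [reflexivity|contradiction]. }
  assert (Ru : Rq u = f1 u).
  { unfold Rq, quot. destruct (excluded_middle_informative (u = u)); [reflexivity|contradiction]. }
  assert (Hh : RtoC 2 * h = f2 u) by (unfold h; field; intros E; apply RtoC_inj in E; lra).
  set (q := fun w => f w - f u - f1 u * (w - u) - h * ((w - u) * (w - u))).
  set (q' := fun w => f1 w - f1 u - f2 u * (w - u)).
  assert (Q' : forall w, cderiv f w (f1 w) -> cderiv q w (q' w)).
  { intros w Hw.
    apply (cderiv_ext_near (fun w => f w + ((- f1 u) * w + ((- h) * ((w + - u) * (w + - u)) +
      (- f u + f1 u * u))))).
    - apply cnear_all. intros v. unfold q. ring.
    - assert (Dm : cderiv (fun w => w + - u) w 1).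
      { eapply cderiv_eq; [apply cderiv_plus; [apply cderiv_id|apply cderiv_const]|]. ring. }
      eapply cderiv_eq.
      + apply cderiv_plus; [exact Hw|]. apply cderiv_plus; [apply cderiv_scal, cderiv_id|].
        apply cderiv_plus; [apply cderiv_scal, cderiv_mult; exact Dm|apply cderiv_const].
      + unfold q'. rewrite <- Hh. cbv beta.
        replace (RtoC 2) with (1 + 1) by (rewrite <- RtoC_plus; f_equal; ring). ring. }
  assert (Qb : forall eps : R, (0 < eps)%R -> cnear u (fun w =>
     (Cmod (q' w) <= eps * Cmod (w - u))%R /\ (Cmod (q w) <= eps * Cmod (w - u) ^ 2)%R)).
  { intros eps He.
    destruct (cnear_and _ _ _ A1 (cderiv_eps _ _ _ D2 eps He)) as (r & Hr & H).
    exists r. split; [exact Hr|]. intros w Hw. split; [apply (H w Hw)|].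
    assert (Eq : q u = 0) by (unfold q; ring).
    replace (q w) with (q w - q u) by (rewrite Eq; ring).
    replace (eps * Cmod (w - u) ^ 2)%R with ((eps * Cmod (w - u)) * Cmod (w - u))%R by ring.
    assert (I : forall t, (0 <= t <= 1)%R ->
      Cmod (u + RtoC t * (w - u) - u) = (t * Cmod (w - u))%R).
    { intros t Ht. replace (u + RtoC t * (w - u) - u) with (RtoC t * (w - u)) by ring.
      rewrite Cmod_mult, Cmod_R, Rabs_pos_eq by lra. reflexivity. }
    pose proof (Cmod_ge_0 (w - u)).
    apply (mean_value_segment q q').
    - intros t Ht. apply Q', (H (u + RtoC t * (w - u))). rewrite I by exact Ht. nra.
    - intros t Ht. eapply Rle_trans; [apply (H (u + RtoC t * (w - u)))|].
      + rewrite I by exact Ht. nra.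
      + rewrite I by exact Ht. apply Rmult_le_compat_l; nra. }
  exists R'. split.
  - destruct A1 as (r & Hr & A1). exists r. split; [exact Hr|]. intros w Hw.
    destruct (excluded_middle_informative (w = u)) as [->|N].
    + rewrite R'u. apply cderiv_of_eps. intros eps He.
      eapply cnear_impl; [|apply (Qb eps He)]. intros v [_ B]. rewrite Ru.
      unfold Rq, quot. destruct (excluded_middle_informative (v = u)) as [->|Nv].
      * replace (f1 u - f1 u - h * (u - u)) with (RtoC 0) by ring. rewrite Cmod_0.
        apply Rmult_le_pos; [lra|apply Cmod_ge_0].
      * assert (Nv' : v - u <> 0) by (intros E; apply Nv, Ceq_minus, E).
        replace ((f v - f u) / (v - u) - f1 u - h * (v - u)) with (q v / (v - u))
          by (unfold q; field; exact Nv').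
        rewrite Cmod_div by exact Nv'. apply Cmod_gt_0 in Nv'. apply Rle_div_l; [exact Nv'|].
        replace (eps * Cmod (v - u) * Cmod (v - u))%R with (eps * Cmod (v - u) ^ 2)%R by ring.
        exact B.
    + assert (N' : w - u <> 0) by (intros E; apply N, Ceq_minus, E).
      apply (cderiv_ext_near (fun w => (f w + - f u) * / (w + - u))).
      * eapply cnear_impl; [|apply (quot_away f u (f1 u) w N)]. intros v Hv. exact Hv.
      * eapply cderiv_eq.
        -- apply cderiv_mult.
           ++ apply cderiv_plus; [apply A1, Hw|apply cderiv_const].
           ++ apply (cderiv_comp (fun w => / w) (fun w => w + - u)).
              ** apply cderiv_inv, N'.
              ** apply cderiv_plus; [apply cderiv_id|apply cderiv_const].
        -- unfold R', Rq, quot.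
           destruct (excluded_middle_informative (w = u)) as [E|_]; [contradiction|].
           field. exact N'.
  - intros eps He. eapply cnear_impl; [|apply (Qb (eps / 4)%R); lra].
    intros w [B1 B2]. rewrite R'u. unfold R', Rq, quot.
    destruct (excluded_middle_informative (w = u)) as [->|N].
    + replace (h - h) with (RtoC 0) by ring. rewrite Cmod_0. exact He.
    + assert (N' : w - u <> 0) by (intros E; apply N, Ceq_minus, E).
      replace ((f1 w - (f w - f u) / (w - u)) / (w - u) - h)
        with ((q' w * (w - u) - q w) / ((w - u) * (w - u))).
      * rewrite Cmod_div, Cmod_mult by (apply Cmult_neq_0; exact N').
        apply Cmod_gt_0 in N'. apply Rlt_div_l; [nra|].
        pose proof (Cmod_triangle (q' w * (w - u)) (- q w)) as T.
        rewrite Cmod_opp, Cmod_mult in T.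
        change (q' w * (w - u) + - q w) with (q' w * (w - u) - q w) in T.
        apply Rmult_le_compat_r with (r := Cmod (w - u)) in B1; [|lra].
        assert (0 < eps * (Cmod (w - u) * Cmod (w - u)))%R by (repeat apply Rmult_lt_0_compat; lra).
        simpl in B2. lra.
      * unfold q, q'. rewrite <- Hh.
        replace (RtoC 2) with (1 + 1) by (rewrite <- RtoC_plus; f_equal; ring).
        field. exact N'.
Qed.

(** ** Power series *)

(** The Weierstrass test. *)
Lemma CSum_ccont (F : nat -> C -> C) (M : nat -> R) (z : C) (r B : R) :
  (0 < r)%R -> (forall n, ccont (F n) z) ->
  (forall n w, (Cmod (w - z) < r)%R -> (Cmod (F n w) <= M n)%R) ->
  (forall n, (rsum M n <= B)%R) ->
  ccont (fun w => CSum (fun n => F n w)) z.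
Proof.
  intros Hr HF HM HB eps He.
  assert (M0 : forall n, (0 <= M n)%R).
  { intros n. eapply Rle_trans; [|apply (HM n z)]; [apply Cmod_ge_0|].
    replace (z - z) with (RtoC 0) by ring. rewrite Cmod_0. exact Hr. }
  assert (exists N, forall m, (rsum (fun k => M (N + k)%nat) m <= eps / 4)%R) as [N HN].
  { assert (S : ex_series M) by (apply (ex_series_bounded M B); assumption).
    pose proof (proj1 (is_series_rsum _ _) (Series_correct _ S)) as L. set (s := Series M) in L.
    destruct (L (eps / 8)%R ltac:(lra)) as [N HN]. exists N. intros m.
    pose proof (HN N ltac:(lia)) as L1. pose proof (HN (N + m)%nat ltac:(lia)) as L2.
    rewrite rsum_app in L2. apply Rabs_def2 in L1. apply Rabs_def2 in L2. lra. }
  assert (Sm : forall w, (Cmod (w - z) < r)%R -> summable (fun n => F n w)).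
  { intros w Hw. exists B. intros n. eapply Rle_trans; [|apply (HB n)].
    apply rsum_le. intros; apply HM, Hw. }
  assert (T : forall w, (Cmod (w - z) < r)%R ->
    (Cmod (CSum (fun n => F n w) - csum (fun n => F n w) N) <= eps / 4)%R).
  { intros w Hw.
    rewrite <- (csums_CSum _ _ (csums_shift _ _ N (summable_csums _ (Sm w Hw)))).
    apply Cmod_CSum_le. intros n. eapply Rle_trans; [|apply (HN n)].
    apply rsum_le. intros; apply HM, Hw. }
  assert (Cf : ccont (fun w => csum (fun n => F n w) N) z).
  { clear - HF. induction N as [|n IH]; [apply (ccont_const 0)|].
    apply (ccont_plus (fun w => csum (fun n => F n w) n) (F n)); [exact IH|apply HF]. }
  eapply cnear_impl; [|apply cnear_and; [apply (Cf (eps / 4)%R); lra|exists r; split; [exact Hr|]]].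
  2:{ intros w Hw. exact Hw. }
  intros w [A Hw]. cbv beta in A.
  pose proof (T w Hw) as T1. pose proof (T z) as T2.
  specialize (T2 ltac:(replace (z - z) with (RtoC 0) by ring; rewrite Cmod_0; exact Hr)).
  set (a := CSum (fun n => F n w)) in *. set (b := CSum (fun n => F n z)) in *.
  set (c := csum (fun n => F n w) N) in *. set (d := csum (fun n => F n z) N) in *.
  pose proof (Cmod_triangle (a - c) ((c - d) + - (b - d))) as X1.
  pose proof (Cmod_triangle (c - d) (- (b - d))) as X2. rewrite Cmod_opp in X2.
  replace (a - c + (c - d + - (b - d))) with (a - b) in X1 by ring. lra.
Qed.

Definition PSC (a : nat -> C) (z : C) : C := CSum (fun n => a n * z ^ n).

Definition psr (a : nat -> C) (rho : R) : Prop :=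
  forall r : R, (0 <= r < rho)%R -> summable (fun n => a n * RtoC (r ^ n)).

Lemma summable_PSC a rho z : psr a rho -> (Cmod z < rho)%R -> summable (fun n => a n * z ^ n).
Proof.
  intros H Hz. apply (summable_le _ (fun n => a n * RtoC (Cmod z ^ n))).
  - intros k. rewrite !Cmod_mult, Cmod_pow, Cmod_R. right. f_equal. symmetry.
    apply Rabs_pos_eq, pow_le, Cmod_ge_0.
  - apply H. split; [apply Cmod_ge_0|exact Hz].
Qed.

(** [hpow n w z] is [(w^n - z^n) / (w - z)]. *)
Fixpoint hpow (n : nat) (w z : C) : C :=
  match n with O => 0 | S m => w * hpow m w z + z ^ m end.

Lemma hpow_spec n w z : w ^ n - z ^ n = hpow n w z * (w - z).
Proof.
  induction n as [|n IH]; simpl; [ring|].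
  transitivity (w * (w ^ n - z ^ n) + z ^ n * (w - z)); [ring|]. rewrite IH. ring.
Qed.

Lemma hpow_bound n w z r : (0 <= r)%R -> (Cmod w <= r)%R -> (Cmod z <= r)%R ->
  (Cmod (hpow (S n) w z) <= INR (S n) * r ^ n)%R.
Proof.
  intros Hr Hw Hz. induction n as [|n IH].
  - simpl. rewrite Cmult_0_r, Cplus_0_l, Cmod_1. lra.
  - change (hpow (S (S n)) w z) with (w * hpow (S n) w z + z ^ (S n)).
    eapply Rle_trans; [apply Cmod_triangle|]. rewrite Cmod_mult, Cmod_pow.
    assert (Cmod z ^ S n <= r ^ S n)%R by (apply pow_incr; split; [apply Cmod_ge_0|exact Hz]).
    assert (Cmod w * Cmod (hpow (S n) w z) <= r * (INR (S n) * r ^ n))%R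
      by (apply Rmult_le_compat; try apply Cmod_ge_0; assumption).
    rewrite (S_INR (S n)). simpl (r ^ S n)%R in *. nra.
Qed.

Lemma hpow_diag n z : hpow (S n) z z = natC (S n) * z ^ n.
Proof.
  induction n as [|n IH].
  - simpl. unfold natC. simpl. ring.
  - change (hpow (S (S n)) z z) with (z * hpow (S n) z z + z ^ (S n)). rewrite IH.
    rewrite (natC_S (S n)). simpl. ring.
Qed.

Lemma hpow_ccont n z : ccont (fun w => hpow n w z) z.
Proof.
  induction n as [|n IH]; [apply (ccont_const 0)|].
  apply (ccont_plus (fun w => w * hpow n w z) (fun _ => z ^ n)); [|apply ccont_const].
  apply (ccont_mult (fun w => w) (fun w => hpow n w z)); [apply ccont_id|exact IH].
Qed.

Definition dcoef (a : nat -> C) (n : nat) : C := natC (S n) * a (S n).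

Lemma nat_pow_bound (q : R) n : (0 <= q < 1)%R -> (INR (S n) * q ^ n <= / (1 - q))%R.
Proof.
  intros Hq. eapply Rle_trans; [|apply (rsum_geom_le q (S n) Hq)].
  assert (A : forall m, (m <= S n)%nat -> (INR m * q ^ n <= rsum (fun k => q ^ k) m)%R).
  { induction m as [|m IH]; intros Hm; [simpl; lra|].
    rewrite S_INR. cbn [rsum]. specialize (IH ltac:(lia)).
    assert (q ^ n <= q ^ m)%R.
    { replace n with (m + (n - m))%nat by lia. rewrite pow_add.
      rewrite <- (Rmult_1_r (q ^ m)) at 2. apply Rmult_le_compat_l; [apply pow_le; lra|].
      rewrite <- (pow1 (n - m)). apply pow_incr. lra. }
    lra. }
  apply A. lia.
Qed.

Lemma psr_dcoef a rho : psr a rho -> psr (dcoef a) rho.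
Proof.
  intros H r Hr.
  set (s := ((r + rho) / 2)%R). assert (Hs : (r < s < rho)%R) by (unfold s; lra).
  destruct (H s ltac:(lra)) as [M HM].
  set (q := (r / s)%R).
  assert (Hq : (0 <= q < 1)%R).
  { split; [apply Rdiv_le_0_compat; lra|]. apply Rlt_div_l; lra. }
  exists (/ s * / (1 - q) * M)%R. intros n.
  apply Rle_trans with (/ s * / (1 - q) * rsum (fun k => Cmod (a (S k) * RtoC (s ^ S k))) n)%R.
  - rewrite <- rsum_scal. apply rsum_le. intros k _. unfold dcoef.
    rewrite !Cmod_mult, !Cmod_R. unfold natC. rewrite Cmod_R.
    rewrite !Rabs_pos_eq by (apply pos_INR || (apply pow_le; lra)).
    pose proof (nat_pow_bound q k Hq) as B.
    assert (E : (r ^ k = q ^ k * s ^ k)%R).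
    { rewrite <- Rpow_mult_distr. f_equal. unfold q. field. lra. }
    rewrite E. simpl (s ^ S k)%R.
    replace (/ s * / (1 - q) * (Cmod (a (S k)) * (s * s ^ k)))%R
      with (/ (1 - q) * (Cmod (a (S k)) * s ^ k))%R by (field; lra).
    replace (INR (S k) * Cmod (a (S k)) * (q ^ k * s ^ k))%R
      with ((INR (S k) * q ^ k) * (Cmod (a (S k)) * s ^ k))%R by ring.
    apply Rmult_le_compat_r; [|exact B].
    apply Rmult_le_pos; [apply Cmod_ge_0|apply pow_le; lra].
  - apply Rmult_le_compat_l.
    + apply Rmult_le_pos; left; apply Rinv_0_lt_compat; lra.
    + specialize (HM (S n)).
      assert (Sh : (rsum (fun k => Cmod (a k * RtoC (s ^ k))) (S n) =
        Cmod (a 0%nat * RtoC (s ^ 0)) + rsum (fun k => Cmod (a (S k) * RtoC (s ^ S k))) n)%R).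
      { change (S n) with (1 + n)%nat. rewrite rsum_app. simpl. ring. }
      rewrite Sh in HM. pose proof (Cmod_ge_0 (a 0%nat * RtoC (s ^ 0))). lra.
Qed.

(** The difference quotient of a power series is the series with [hpow n w z] in place of the powers,
    which is continuous in [w] by the Weierstrass test. *)
Lemma PSC_cderiv a rho z : psr a rho -> (Cmod z < rho)%R -> cderiv (PSC a) z (PSC (dcoef a) z).
Proof.
  intros H Hz. pose proof (Cmod_ge_0 z) as Hz0.
  set (r := ((Cmod z + rho) / 2)%R).
  assert (Hr : (Cmod z < r < rho)%R) by (unfold r; lra).
  assert (W : forall w, (Cmod (w - z) < r - Cmod z)%R -> (Cmod w < r)%R).
  { intros w Hw. pose proof (Cmod_triangle (w - z) z) as T.
    replace (w - z + z) with w in T by ring. lra. }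
  destruct (psr_dcoef a rho H r ltac:(lra)) as [M HM].
  exists (fun w => CSum (fun n => a n * hpow n w z)). split; [|split].
  - apply (CSum_ccont (fun n w => a n * hpow n w z)
      (fun n => match n with O => 0%R | S m => Cmod (dcoef a m * RtoC (r ^ m)) end) z (r - Cmod z) M).
    + lra.
    + intros n. apply ccont_mult; [apply ccont_const|apply hpow_ccont].
    + intros [|n] w Hw.
      * simpl. rewrite Cmult_0_r, Cmod_0. lra.
      * rewrite Cmod_mult. unfold dcoef. rewrite !Cmod_mult, Cmod_R.
        unfold natC. rewrite Cmod_R, !Rabs_pos_eq by (apply pos_INR || (apply pow_le; lra)).
        pose proof (W w Hw). pose proof (hpow_bound n w z r ltac:(lra) ltac:(lra) ltac:(lra)).
        replace (INR (S n) * Cmod (a (S n)) * r ^ n)%R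
          with (Cmod (a (S n)) * (INR (S n) * r ^ n))%R by ring.
        apply Rmult_le_compat_l; [apply Cmod_ge_0|assumption].
    + intros [|n]; [simpl; eapply Rle_trans; [|apply (HM O)]; simpl; lra|].
      change (S n) with (1 + n)%nat. rewrite rsum_app. simpl rsum at 1. rewrite Rplus_0_l, Rplus_0_l.
      apply HM.
  - assert (S0 : csums (fun n => a n * hpow n z z) (0 + PSC (dcoef a) z)).
    { intros eps He.
      destruct (summable_csums _ (summable_PSC _ _ z (psr_dcoef a rho H) Hz) eps He) as [N HN].
      exists (S N). intros [|n] Hn; [lia|]. rewrite csum_S_l.
      replace (a 0%nat * hpow 0 z z) with (RtoC 0) by (simpl; ring).
      rewrite (csum_ext _ (fun n => dcoef a n * z ^ n)).
      - replace (0 + csum (fun n => dcoef a n * z ^ n) n - (0 + PSC (dcoef a) z))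
          with (csum (fun n => dcoef a n * z ^ n) n - PSC (dcoef a) z) by ring.
        apply HN. lia.
      - intros k _. rewrite hpow_diag. unfold dcoef. ring. }
    rewrite (csums_CSum _ _ S0). ring.
  - exists (r - Cmod z)%R. split; [lra|]. intros w Hw. pose proof (W w Hw) as Hw'.
    pose proof (summable_csums _ (summable_PSC a rho w H ltac:(lra))) as S1.
    pose proof (summable_csums _ (summable_PSC a rho z H Hz)) as S2.
    assert (Sh : summable (fun n => a n * hpow n w z)).
    { exists M. intros [|n]; [simpl; eapply Rle_trans; [|apply (HM O)]; simpl; lra|].
      change (S n) with (1 + n)%nat. rewrite rsum_app. simpl rsum at 1.
      rewrite Cmult_0_r, Cmod_0, !Rplus_0_l. eapply Rle_trans; [|apply (HM n)].
      apply rsum_le. intros k _. rewrite Cmod_mult. unfold dcoef. rewrite !Cmod_mult, Cmod_R.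
      unfold natC. rewrite Cmod_R, !Rabs_pos_eq by (apply pos_INR || (apply pow_le; lra)).
      pose proof (hpow_bound k w z r ltac:(lra) ltac:(lra) ltac:(lra)).
      replace (INR (S k) * Cmod (a (S k)) * r ^ k)%R
        with (Cmod (a (S k)) * (INR (S k) * r ^ k))%R by ring.
      apply Rmult_le_compat_l; [apply Cmod_ge_0|]. exact H0. }
    apply (csums_unique (fun n => a n * w ^ n)); [exact S1|].
    apply summable_csums in Sh.
    pose proof (csums_plus _ _ _ _ S2 (csums_scal (w - z) _ _ Sh)) as S3.
    intros eps He. destruct (S3 eps He) as [N HN]. exists N. intros n Hn. specialize (HN n Hn).
    rewrite (csum_ext _ (fun n => a n * w ^ n)) in HN.
    + fold (PSC a z) in HN.
      rewrite (Cmult_comm (CSum (fun n => a n * hpow n w z)) (w - z)). exact HN.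
    + intros k _. transitivity (a k * (z ^ k + hpow k w z * (w - z))); [ring|].
      rewrite <- hpow_spec. ring.
Qed.

Lemma PSC_smooth a rho z : psr a rho -> (Cmod z < rho)%R -> smooth (PSC a) z.
Proof.
  intros H Hz n. revert a H. induction n as [|n IH]; intros a H.
  - apply (cderiv_ccont _ _ _ (PSC_cderiv a rho z H Hz)).
  - exists (PSC (dcoef a)). split; [|apply IH, psr_dcoef, H].
    exists (rho - Cmod z)%R. split; [lra|]. intros w Hw. apply (PSC_cderiv a rho); [exact H|].
    pose proof (Cmod_triangle (w - z) z) as T. replace (w - z + z) with w in T by ring. lra.
Qed.

Lemma PSC_mul a b rho z : psr a rho -> psr b rho -> (Cmod z < rho)%R ->
  PSC (fmul a b) z = PSC a z * PSC b z.
Proof.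
  intros Ha Hb Hz.
  pose proof (summable_PSC a rho z Ha Hz) as Sa. pose proof (summable_PSC b rho z Hb Hz) as Sb.
  unfold PSC.
  rewrite (CSum_ext _ (fun n => csum (fun i => (a i * z ^ i) * (b (n - i)%nat * z ^ (n - i))) (S n))).
  - rewrite (CSum_diag (fun i j => (a i * z ^ i) * (b j * z ^ j))) by (apply summable2_prod; assumption).
    rewrite (CSum_ext _ (fun i => CSum (fun j => b j * z ^ j) * (a i * z ^ i))).
    + rewrite CSum_scal by exact Sa. apply Cmult_comm.
    + intros i. rewrite CSum_scal by exact Sb. apply Cmult_comm.
  - intros n. unfold fmul. rewrite <- csum_scal_r. apply csum_ext. intros i Hi.
    replace n with (i + (n - i))%nat at 2 by lia. rewrite Cpow_add_r. ring.
Qed.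

Lemma psr_mul a b rho : psr a rho -> psr b rho -> psr (fmul a b) rho.
Proof.
  intros Ha Hb r Hr. destruct (Ha r Hr) as [M HM]. destruct (Hb r Hr) as [N HN].
  exists (M * N)%R. apply (fle_mul r a b M N HM HN).
Qed.

(** ** The logarithm and complex powers *)

Lemma Cexp_cderiv z : cderiv Cexp z (Cexp z).
Proof.
  apply cderiv_of_eps. intros eps He.
  set (K := ((4 + 1) * exp 1 * (Cmod (Cexp z) + 1))%R).
  assert (HK : (0 < K)%R).
  { pose proof (exp_pos 1). pose proof (Cmod_ge_0 (Cexp z)). unfold K.
    apply Rmult_lt_0_compat; lra. }
  exists (Rmin 1 (eps / K)). split.
  { apply Rmin_glb_lt; [lra|]. apply Rdiv_lt_0_compat; assumption. }
  intros w Hw.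
  assert (A : (Cmod (w - z) < 1)%R) by (eapply Rlt_le_trans; [apply Hw|apply Rmin_l]).
  assert (B : (Cmod (w - z) < eps / K)%R) by (eapply Rlt_le_trans; [apply Hw|apply Rmin_r]).
  apply Rlt_div_r in B; [|exact HK].
  pose proof (Cexp_taylor (w - z) 1 ltac:(lra)) as T.
  replace (Cexp w - Cexp z - Cexp z * (w - z)) with (Cexp z * (Cexp (w - z) - 1 - (w - z))).
  - rewrite Cmod_mult. pose proof (Cmod_ge_0 (Cexp z)). pose proof (Cmod_ge_0 (w - z)).
    set (d := Cmod (w - z)) in *. set (e := Cmod (Cexp z)) in *.
    apply Rle_trans with (e * ((4 + 1) * exp 1 * d ^ 2))%R; [apply Rmult_le_compat_l; assumption|].
    apply Rle_trans with (d * K * d)%R.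
    + unfold K. pose proof (exp_pos 1). assert (0 <= d ^ 2 * exp 1)%R by (apply Rmult_le_pos; [nra|lra]). nra.
    + apply Rmult_le_compat_r; lra.
  - assert (E : Cexp w = Cexp z * Cexp (w - z)) by (rewrite <- Cexp_plus; f_equal; ring).
    rewrite E. ring.
Qed.

Lemma Cexp_smooth z : smooth Cexp z.
Proof.
  intros n. induction n as [|n IH]; [apply (cderiv_ccont _ _ _ (Cexp_cderiv z))|].
  exists Cexp. split; [|exact IH]. apply cnear_all. apply Cexp_cderiv.
Qed.

Definition slit (z : C) : Prop := ~ (Im z = 0%R /\ (Re z <= 0)%R).

Lemma slit_neq z : slit z -> z <> 0.
Proof. intros H E. apply H. rewrite E. simpl. lra. Qed.

Lemma Re_over_Cmod (z : C) : z <> 0 -> (-1 <= Re z / Cmod z <= 1)%R.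
Proof.
  intros H. apply Cmod_gt_0 in H. pose proof (re_le_Cmod z) as A.
  apply Rabs_le_between in A. split.
  - apply Rle_div_r; lra.
  - apply Rle_div_l; lra.
Qed.

Lemma Cexp_Clog (z : C) : z <> 0 -> Cexp (Clog z) = z.
Proof.
  intros H. pose proof (Re_over_Cmod z H) as B. apply Cmod_gt_0 in H as M.
  pose proof (Cmod2_alt z) as E2.
  assert (Cs : cos (Carg z) = (Re z / Cmod z)%R).
  { unfold Carg. destruct (Rle_dec 0 (Im z)); [|rewrite cos_neg]; apply cos_acos; lra. }
  assert (Sn : sin (Carg z) = (Im z / Cmod z)%R).
  { assert (Q : sqrt (1 - (Re z / Cmod z)²) = (Rabs (Im z) / Cmod z)%R).
    { replace (1 - (Re z / Cmod z)²)%R with ((Rabs (Im z) / Cmod z) ^ 2)%R.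
      - apply sqrt_pow2. apply Rdiv_le_0_compat; [apply Rabs_pos|exact M].
      - unfold Rdiv. rewrite Rpow_mult_distr, pow2_abs. unfold Rsqr.
        replace (Im z ^ 2)%R with (Cmod z ^ 2 - Re z ^ 2)%R by lra. field. lra. }
    unfold Carg. destruct (Rle_dec 0 (Im z)) as [L|L].
    - rewrite sin_acos by lra. rewrite Q, Rabs_pos_eq by exact L. reflexivity.
    - rewrite sin_neg, sin_acos by lra. rewrite Q, Rabs_left by lra. field. lra. }
  unfold Cexp, Clog. cbn [Re Im fst snd]. change (fst (ln (Cmod z), Carg z)) with (ln (Cmod z)).
  change (snd (ln (Cmod z), Carg z)) with (Carg z).
  rewrite exp_ln, Cs, Sn by exact M. rewrite (surjective_pairing z) at 5.
  unfold Re, Im. apply injective_projections; cbn [fst snd]; field; lra.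
Qed.

(** Continuity of a real-valued function on the plane. *)
Definition rc (f : C -> R) (z : C) : Prop := ccont (fun w => RtoC (f w)) z.

Lemma rc_iff f z : rc f z <->
  (forall eps : R, (0 < eps)%R -> cnear z (fun w => (Rabs (f w - f z) < eps)%R)).
Proof.
  split; intros H eps He; (eapply cnear_impl; [|apply (H eps He)]); intros w Hw; cbv beta in *.
  - rewrite <- RtoC_minus, Cmod_R in Hw. exact Hw.
  - rewrite <- RtoC_minus, Cmod_R. exact Hw.
Qed.

Lemma rc_Re z : rc Re z.
Proof.
  apply rc_iff. intros eps He. exists eps. split; [exact He|]. intros w Hw.
  eapply Rle_lt_trans; [apply (re_le_Cmod (w - z))|exact Hw].
Qed.

Lemma rc_Im z : rc Im z.
Proof.
  apply rc_iff. intros eps He. exists eps. split; [exact He|]. intros w Hw.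
  eapply Rle_lt_trans; [apply (im_le_Cmod (w - z))|exact Hw].
Qed.

Lemma rc_Cmod z : rc Cmod z.
Proof.
  apply rc_iff. intros eps He. exists eps. split; [exact He|]. intros w Hw.
  pose proof (Cmod_triangle (w - z) z) as T1. pose proof (Cmod_triangle w (- (w - z))) as T2.
  replace (w - z + z) with w in T1 by ring. replace (w + - (w - z)) with z in T2 by ring.
  rewrite Cmod_opp in T2. apply Rabs_def1; lra.
Qed.

Lemma rc_comp (g : R -> R) f z : continuity_pt g (f z) -> rc f z -> rc (fun w => g (f w)) z.
Proof.
  intros Hg Hf. apply rc_iff. rewrite rc_iff in Hf. intros eps He.
  destruct (Hg eps He) as (d & Hd & H).
  eapply cnear_impl; [|apply (Hf d Hd)]. intros w Hw. cbv beta in *.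
  destruct (Req_dec (f z) (f w)) as [E|E].
  - rewrite E, Rminus_diag, Rabs_R0. exact He.
  - apply (H (f w)). split; [split; [exact I|exact E]|exact Hw].
Qed.

Lemma rc_div f g z : g z <> 0%R -> rc f z -> rc g z -> rc (fun w => f w / g w)%R z.
Proof.
  intros H Hf Hg.
  apply (ccont_ext_near (fun w => RtoC (f w) * RtoC (/ g w))).
  - apply cnear_all. intros w. rewrite <- RtoC_mult. reflexivity.
  - apply ccont_mult; [exact Hf|]. apply (rc_comp Rinv g); [|exact Hg].
    apply (continuity_pt_inv (fun x => x)); [apply derivable_continuous_pt, derivable_pt_id|exact H].
Qed.

Lemma rc_ext_near f g z : cnear z (fun w => f w = g w) -> rc f z -> rc g z.
Proof.
  intros E. apply ccont_ext_near. eapply cnear_impl; [|apply E]. intros w Hw.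
  cbv beta. rewrite Hw. reflexivity.
Qed.

Lemma rc_pos f z : rc f z -> (0 < f z)%R -> cnear z (fun w => (0 < f w)%R).
Proof.
  rewrite rc_iff. intros H Hz. eapply cnear_impl; [|apply (H (f z) Hz)].
  intros w Hw. cbv beta in Hw. apply Rabs_def2 in Hw. lra.
Qed.

Lemma rc_neg f z : rc f z -> (f z < 0)%R -> cnear z (fun w => (f w < 0)%R).
Proof.
  rewrite rc_iff. intros H Hz. eapply cnear_impl; [|apply (H (- f z)%R); lra].
  intros w Hw. cbv beta in Hw. apply Rabs_def2 in Hw. lra.
Qed.

Lemma slit_open z : slit z -> cnear z slit.
Proof.
  intros H. destruct (Req_dec (Im z) 0) as [E|E].
  - assert (R : (0 < Re z)%R) by (apply Rnot_le_lt; intros L; apply H; split; assumption).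
    eapply cnear_impl; [|apply (rc_pos Re z (rc_Re z) R)]. intros w Hw [_ L]. lra.
  - destruct (Rtotal_order (Im z) 0) as [L|[L|L]]; [|contradiction|].
    + eapply cnear_impl; [|apply (rc_neg Im z (rc_Im z) L)]. intros w Hw [L' _]. lra.
    + eapply cnear_impl; [|apply (rc_pos Im z (rc_Im z) L)]. intros w Hw [L' _]. lra.
Qed.

Lemma Carg_right_half z : (0 < Re z)%R -> Carg z = atan (Im z / Re z).
Proof.
  intros H. assert (M : (0 < Cmod z)%R).
  { pose proof (re_le_Cmod z). rewrite Rabs_pos_eq in H0; lra. }
  assert (P : (0 < Re z / Cmod z)%R) by (apply Rdiv_lt_0_compat; assumption).
  pose proof (Cmod2_alt z) as E2.
  assert (A : acos (Re z / Cmod z) = atan (Rabs (Im z) / Re z)).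
  { rewrite acos_atan by exact P. f_equal.
    replace (1 - (Re z / Cmod z)²)%R with ((Rabs (Im z) / Cmod z) ^ 2)%R.
    - rewrite sqrt_pow2; [field; lra|]. apply Rdiv_le_0_compat; [apply Rabs_pos|exact M].
    - unfold Rdiv. rewrite Rpow_mult_distr, pow2_abs. unfold Rsqr.
      replace (Im z ^ 2)%R with (Cmod z ^ 2 - Re z ^ 2)%R by lra. field. lra. }
  unfold Carg. rewrite A. destruct (Rle_dec 0 (Im z)) as [L|L].
  - rewrite Rabs_pos_eq by exact L. reflexivity.
  - rewrite Rabs_left by lra. rewrite <- atan_opp. f_equal. field. lra.
Qed.

Lemma Re_over_Cmod_strict z : Im z <> 0%R -> (-1 < Re z / Cmod z < 1)%R.
Proof.
  intros H. pose proof (Cmod2_alt z) as E2. pose proof (Cmod_ge_0 z).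
  assert (0 < Im z ^ 2)%R by (apply pow2_gt_0, H).
  assert (M : (0 < Cmod z)%R) by (pose proof (pow2_ge_0 (Re z)); nra).
  assert (Rabs (Re z) < Cmod z)%R.
  { apply Rsqr_incrst_0; [|apply Rabs_pos|lra]. rewrite <- Rsqr_abs. rewrite !Rsqr_pow2. lra. }
  apply Rabs_def2 in H2. split; [apply Rlt_div_r|apply Rlt_div_l]; lra.
Qed.

Lemma rc_Carg z : slit z -> rc Carg z.
Proof.
  intros H.
  assert (Ac : Im z <> 0%R -> rc (fun w => acos (Re w / Cmod w)) z).
  { intros E. apply (rc_comp acos (fun w => Re w / Cmod w)%R).
    - apply derivable_continuous_pt, derivable_pt_acos, Re_over_Cmod_strict, E.
    - apply rc_div; [|apply rc_Re|apply rc_Cmod].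
      intros E0. apply Cmod_eq_0 in E0. rewrite E0 in E. apply E. reflexivity. }
  destruct (Req_dec (Im z) 0) as [E|E].
  - assert (R : (0 < Re z)%R) by (apply Rnot_le_lt; intros L; apply H; split; assumption).
    apply (rc_ext_near (fun w => atan (Im w / Re w))).
    + eapply cnear_impl; [|apply (rc_pos Re z (rc_Re z) R)].
      intros w Hw. symmetry. apply Carg_right_half, Hw.
    + apply (rc_comp atan (fun w => Im w / Re w)%R).
      * apply derivable_continuous_pt, derivable_pt_atan.
      * apply rc_div; [lra|apply rc_Im|apply rc_Re].
  - destruct (Rtotal_order (Im z) 0) as [L|[L|L]]; [|contradiction|].
    + apply (rc_ext_near (fun w => - acos (Re w / Cmod w))%R).
      * eapply cnear_impl; [|apply (rc_neg Im z (rc_Im z) L)]. intros w Hw. unfold Carg.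
        destruct (Rle_dec 0 (Im w)); [lra|reflexivity].
      * apply (rc_comp Ropp (fun w => acos (Re w / Cmod w))); [|apply Ac, E].
        apply (continuity_pt_opp (fun x => x)), derivable_continuous_pt, derivable_pt_id.
    + apply (rc_ext_near (fun w => acos (Re w / Cmod w))); [|apply Ac, E].
      eapply cnear_impl; [|apply (rc_pos Im z (rc_Im z) L)]. intros w Hw. unfold Carg.
      destruct (Rle_dec 0 (Im w)); [reflexivity|lra].
Qed.

Lemma Clog_ccont z : slit z -> ccont Clog z.
Proof.
  intros H. pose proof (slit_neq z H) as H0. apply Cmod_gt_0 in H0.
  apply (ccont_ext_near (fun w => RtoC (ln (Cmod w)) + Ci * RtoC (Carg w))).
  - apply cnear_all. intros w. unfold Clog, Cplus, Cmult, Ci, RtoC; simpl. f_equal; ring.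
  - apply ccont_plus.
    + apply (rc_comp ln Cmod); [|apply rc_Cmod].
      apply derivable_continuous_pt. exists (/ Cmod z)%R. apply derivable_pt_lim_ln, H0.
    + apply ccont_mult; [apply ccont_const|apply rc_Carg, H].
Qed.

(** The logarithm is a continuous right inverse of the exponential, so its difference quotient is the
    inverse of the one of the exponential. *)
Lemma Clog_cderiv z : slit z -> cderiv Clog z (/ z).
Proof.
  intros H. pose proof (slit_neq z H) as H0. pose proof (Clog_ccont z H) as Cl.
  destruct (Cexp_cderiv (Clog z)) as (p & Hp & Ep & Np).
  rewrite Cexp_Clog in Ep by exact H0.
  assert (Cp : ccont (fun w => p (Clog w)) z) by (apply ccont_comp; assumption).
  exists (fun w => / p (Clog w)). split; [|split].
  - apply (ccont_comp (fun w => / w) (fun w => p (Clog w))); [|exact Cp].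
    apply ccont_inv. rewrite Ep. exact H0.
  - rewrite Ep. reflexivity.
  - eapply cnear_impl; [|apply cnear_and; [apply (cnear_comp Clog z _ Cl Np)|
      apply cnear_and; [apply (cnear_comp _ z (fun v => v <> RtoC 0) Cp), (cnear_neq _ 0)|
        apply (cnear_neq z 0 H0)]]].
    + intros w (A & B & W). rewrite (Cexp_Clog z H0), (Cexp_Clog w W) in A.
      replace (w - z) with (p (Clog w) * (Clog w - Clog z)) by (rewrite A at 3; ring).
      field. exact B.
    + rewrite Ep. exact H0.
Qed.

Lemma Clog_smooth z : slit z -> smooth Clog z.
Proof.
  intros H [|n]; [apply Clog_ccont, H|].
  exists (fun w => / w). split.
  - eapply cnear_impl; [|apply (slit_open z H)]. apply Clog_cderiv.
  - apply Dn_inv, slit_neq, H.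
Qed.

Lemma Cpower_smooth a z : slit z -> smooth (fun w => Cpower w a) z.
Proof.
  intros H. apply (smooth_comp Cexp (fun w => a * Clog w)); [apply Cexp_smooth|].
  apply smooth_mult; [apply smooth_const|apply Clog_smooth, H].
Qed.

Lemma Cpower_cderiv a z : slit z -> cderiv (fun w => Cpower w a) z (a * Cpower z a / z).
Proof.
  intros H. eapply cderiv_eq.
  - apply (cderiv_comp Cexp (fun w => a * Clog w)); [apply Cexp_cderiv|].
    apply cderiv_scal, Clog_cderiv, H.
  - unfold Cpower, Cdiv. ring.
Qed.

Lemma Cpower_plus z a b : Cpower z (a + b) = Cpower z a * Cpower z b.
Proof. unfold Cpower. rewrite <- Cexp_plus. f_equal. ring. Qed.

Lemma Cpower_0 z : Cpower z 0 = 1.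
Proof. unfold Cpower. rewrite Cmult_0_l. apply Cexp_0. Qed.

Lemma Cpower_1 (z : C) : z <> 0 -> Cpower z 1 = z.
Proof. intros H. unfold Cpower. rewrite Cmult_1_l. apply Cexp_Clog, H. Qed.

Lemma Cpower_base_1 a : Cpower 1 a = 1.
Proof.
  rewrite Cpower_pos_real by lra. rewrite ln_1, Cmult_0_r. apply Cexp_0.
Qed.

(** ** The binomial series *)

Lemma psr_bounded a B : (forall n, (Cmod (a n) <= B)%R) -> psr a 1.
Proof.
  intros H r Hr. exists (B * / (1 - r))%R. intros n.
  assert (HB : (0 <= B)%R) by (eapply Rle_trans; [apply Cmod_ge_0|apply (H O)]).
  apply Rle_trans with (B * rsum (fun k => r ^ k)%R n)%R.
  - rewrite <- rsum_scal. apply rsum_le. intros k _. rewrite Cmod_mult, Cmod_R.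
    rewrite Rabs_pos_eq by (apply pow_le; lra).
    apply Rmult_le_compat_r; [apply pow_le; lra|apply H].
  - apply Rmult_le_compat_l; [exact HB|apply rsum_geom_le, Hr].
Qed.

Lemma psr_finite a N rho : (forall n, (N <= n)%nat -> a n = RtoC 0) -> psr a rho.
Proof.
  intros H r Hr. exists (rsum (fun k => Cmod (a k * RtoC (r ^ k))) N). intros n.
  destruct (Compare_dec.le_lt_dec n N) as [L|L].
  - apply rsum_mono; [intros; apply Cmod_ge_0|exact L].
  - replace n with (N + (n - N))%nat by lia. rewrite rsum_app.
    rewrite (rsum_ext (fun k => Cmod (a (N + k)%nat * _)) (fun _ => 0 * 0)%R).
    + rewrite rsum_scal. lra.
    + intros k _. rewrite H by lia. rewrite Cmult_0_l, Cmod_0. ring.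
Qed.

Lemma PSC_finite a N z : (forall n, (N <= n)%nat -> a n = RtoC 0) ->
  PSC a z = csum (fun n => a n * z ^ n) N.
Proof.
  intros H. apply csums_CSum, csums_finite. intros n Hn. rewrite H by exact Hn. ring.
Qed.

Lemma PSC_0 a : PSC a 0 = a 0%nat.
Proof.
  transitivity (csum (fun n => a n * 0 ^ n) 1).
  - apply csums_CSum, csums_finite. intros [|n] Hn; [lia|]. simpl. ring.
  - simpl. ring.
Qed.

Lemma binc_ode c : fmul (fsub fone fX) (dcoef (binc c)) = fscal c (binc c).
Proof.
  transitivity (fsub (dcoef (binc c)) (fmul fX (dcoef (binc c)))); [ring|].
  apply functional_extensionality. intros [|n]; unfold fsub, fscal.
  - rewrite fX_0. unfold dcoef. rewrite binc_S, natC_0. ring.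
  - rewrite fX_S. unfold dcoef. rewrite (binc_S c (S n)). ring.
Qed.

Lemma one_minus_slit z : (Cmod z < 1)%R -> slit (1 - z).
Proof.
  intros H [_ L]. pose proof (re_le_Cmod z) as A. apply Rabs_le_between in A.
  replace (Re (1 - z)) with (1 - Re z)%R in L by reflexivity. lra.
Qed.

(** The product of the series with [(1 - z)^c] has derivative zero, because both factors satisfy first
    order differential equations with opposite coefficients. *)
Lemma binomial_series c z : (exists B, forall n, (Cmod (binc c n) <= B)%R) -> (Cmod z < 1)%R ->
  Cpower (1 - z) (- c) = PSC (binc c) z.
Proof.
  intros [B HB] Hz. pose proof (psr_bounded _ B HB) as Ps.
  set (H := fun z => PSC (binc c) z * Cpower (1 - z) c).
  assert (D : forall w, (Cmod (w - 0) < 1)%R -> cderiv H w 0).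
  { intros w Hw0. assert (Hw : (Cmod w < 1)%R) by (replace w with (w - 0) by ring; exact Hw0).
    pose proof (one_minus_slit w Hw) as Sl. pose proof (slit_neq _ Sl) as N.
    eapply cderiv_eq.
    - apply cderiv_mult; [apply (PSC_cderiv _ 1); assumption|].
      apply (cderiv_comp (fun v => Cpower v c) (fun v => 1 - v)); [apply Cpower_cderiv, Sl|].
      apply (cderiv_ext_near (fun v => 1 + (- (1)) * v)); [apply cnear_all; intros; ring|].
      apply cderiv_plus; [apply cderiv_const|apply cderiv_scal, cderiv_id].
    - assert (E : (1 - w) * PSC (dcoef (binc c)) w = c * PSC (binc c) w).
      { transitivity (PSC (fsub fone fX) w * PSC (dcoef (binc c)) w).
        - f_equal. rewrite (PSC_finite _ 2).
          + simpl. unfold fsub, fone, fconst, fX. ring.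
          + intros [|[|n]] Hn; try lia. unfold fsub, fone, fconst, fX. ring.
        - rewrite <- (PSC_mul _ _ 1); [|apply (psr_finite _ 2)|apply psr_dcoef, Ps|exact Hw].
          + rewrite binc_ode. unfold PSC. rewrite <- CSum_scal by (apply (summable_PSC _ 1); assumption).
            apply CSum_ext. intros n. unfold fscal. ring.
          + intros [|[|n]] Hn; try lia. unfold fsub, fone, fconst, fX. ring. }
      replace (PSC (dcoef (binc c)) w) with (c * PSC (binc c) w / (1 - w))
        by (rewrite <- E; field; exact N).
      field. exact N. }
  assert (K : (Cmod (H z - H 0) <= 0 * Cmod (z - 0))%R).
  { apply (mean_value_ball H (fun _ => RtoC 0) 0 1 0).
    - exact D.
    - intros w _. rewrite Cmod_0. lra.
    - replace (0 - 0) with (RtoC 0) by ring. rewrite Cmod_0. lra.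
    - replace (z - 0) with z by ring. exact Hz. }
  rewrite Rmult_0_l in K. pose proof (Cmod_ge_0 (H z - H 0)) as K0.
  assert (K1 : Cmod (H z - H 0) = 0%R) by lra. apply Cmod_eq_0 in K1.
  apply (Ceq_minus (H z) (H 0)) in K1.
  assert (H0 : H 0 = 1).
  { unfold H. rewrite PSC_0. replace (1 - 0) with (RtoC 1) by ring. rewrite Cpower_base_1.
    simpl. ring. }
  rewrite H0 in K1. unfold H in K1.
  assert (Inv : Cpower (1 - z) c * Cpower (1 - z) (- c) = 1).
  { rewrite <- Cpower_plus. replace (c + - c) with (RtoC 0) by ring. apply Cpower_0. }
  transitivity (PSC (binc c) z * Cpower (1 - z) c * Cpower (1 - z) (- c)).
  - rewrite K1. ring.
  - rewrite <- Cmult_assoc, Inv. ring.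
Qed.

(** ** Functions that are holomorphic off a half line *)

Definition off_ray (rho : R) (z : C) : Prop := ~ (Im z = 0%R /\ (rho <= Re z)%R).

(** Holomorphy off the ray, with the Taylor expansion at [0] as part of the data: the contour integrals
    are computed from the coefficients. *)
Definition hol (rho : R) (f : C -> C) (a : nat -> C) : Prop :=
  psr a rho /\ (forall z, (Cmod z < rho)%R -> f z = PSC a z) /\
  (forall z, off_ray rho z -> smooth f z).

Lemma off_ray_disc rho z : (Cmod z < rho)%R -> off_ray rho z.
Proof.
  intros H [_ L]. pose proof (re_le_Cmod z) as A. apply Rabs_le_between in A. lra.
Qed.

Lemma off_ray_open rho z : off_ray rho z -> cnear z (off_ray rho).
Proof.
  intros H. destruct (Req_dec (Im z) 0) as [E|E].
  - assert (R : (Re z < rho)%R) by (apply Rnot_le_lt; intros L; apply H; split; assumption).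
    exists (rho - Re z)%R. split; [lra|]. intros w Hw [_ L].
    pose proof (re_le_Cmod (w - z)) as A. apply Rabs_le_between in A.
    replace (Re (w - z)) with (Re w - Re z)%R in A by reflexivity. lra.
  - exists (Rabs (Im z)). split; [apply Rabs_pos_lt, E|]. intros w Hw [L _].
    pose proof (im_le_Cmod (w - z)) as A.
    replace (Im (w - z)) with (Im w - Im z)%R in A by reflexivity.
    rewrite L, Rminus_0_l, Rabs_Ropp in A. lra.
Qed.

Lemma hol_mul rho f g a b : hol rho f a -> hol rho g b -> hol rho (fun z => f z * g z) (fmul a b).
Proof.
  intros (A1 & A2 & A3) (B1 & B2 & B3). split; [apply psr_mul; assumption|]. split.
  - intros z Hz. rewrite A2, B2 by exact Hz. symmetry. apply (PSC_mul _ _ rho); assumption.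
  - intros z Hz. apply smooth_mult; auto.
Qed.

Definition fmono (m : nat) : fps := fun n => if Nat.eqb n m then 1 else 0.

Lemma hol_pow rho m : hol rho (fun z => z ^ m) (fmono m).
Proof.
  assert (F : forall n, (S m <= n)%nat -> fmono m n = RtoC 0).
  { intros n Hn. unfold fmono. destruct (Nat.eqb_spec n m); [lia|reflexivity]. }
  split; [apply (psr_finite _ (S m)), F|]. split.
  - intros z _. rewrite (PSC_finite _ (S m)) by exact F. cbn [csum]. rewrite csum_zero.
    + unfold fmono. rewrite Nat.eqb_refl. ring.
    + intros k Hk. unfold fmono. destruct (Nat.eqb_spec k m); [lia|]. ring.
  - intros z _. apply smooth_pow.
Qed.

Lemma hol_binomial s c : (0 < s)%R -> (exists B, forall n, (Cmod (binc c n) <= B)%R) ->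
  hol (/ s) (fun z => Cpower (1 - z * RtoC s) (- c)) (fun n => binc c n * RtoC (s ^ n)).
Proof.
  intros Hs HB. split; [|split].
  - destruct HB as [B HB]. intros r Hr.
    assert (Hrs : (0 <= s * r < 1)%R).
    { split; [nra|]. replace 1%R with (s * / s)%R by (field; lra). apply Rmult_lt_compat_l; lra. }
    apply (summable_le _ (fun n => binc c n * RtoC ((s * r) ^ n))).
    + intros n. right. f_equal. rewrite Rpow_mult_distr, RtoC_mult. ring.
    + apply (psr_bounded _ B HB), Hrs.
  - intros z Hz.
    assert (Hz' : (Cmod (z * RtoC s) < 1)%R).
    { rewrite Cmod_mult, Cmod_R, Rabs_pos_eq by lra.
      replace 1%R with (/ s * s)%R by (field; lra). apply Rmult_lt_compat_r; lra. }
    rewrite binomial_series by assumption. apply CSum_ext. intros n.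
    rewrite Cpow_mult_l, RtoC_pow. ring.
  - intros z Hz. apply (smooth_comp (fun w => Cpower w (- c)) (fun z => 1 - z * RtoC s)).
    + apply Cpower_smooth. intros [E L]. apply Hz.
      replace (Im (1 - z * RtoC s)) with (- (Im z * s))%R in E by (unfold Im; simpl; ring).
      replace (Re (1 - z * RtoC s)) with (1 - Re z * s)%R in L by (unfold Re; simpl; ring).
      split; [nra|]. apply Rmult_le_reg_r with s; [exact Hs|]. rewrite Rinv_l by lra. lra.
    + apply smooth_minus; [apply smooth_const|].
      apply (smooth_mult (fun z => z) (fun _ => RtoC s)); [apply smooth_id|apply smooth_const].
Qed.

(** * Contour integrals *)

Definition cRint (u : R -> C) (a b : R) (l : C) : Prop :=
  is_RInt (fun t => Re (u t)) a b (Re l) /\ is_RInt (fun t => Im (u t)) a b (Im l).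

Lemma cRint_RInt u a b l : cRint u a b l -> RInt (V := C_R_CompleteNormedModule) u a b = l.
Proof.
  intros [H1 H2]. apply is_RInt_unique. rewrite (surjective_pairing l).
  apply (is_RInt_fct_extend_pair (U := R_NormedModule) (V := R_NormedModule)); assumption.
Qed.

Lemma cRint_ext u v a b l : (forall t, (Rmin a b < t < Rmax a b)%R -> u t = v t) ->
  cRint u a b l -> cRint v a b l.
Proof.
  intros E [H1 H2]. split; [apply (is_RInt_ext (fun t => Re (u t)))|
    apply (is_RInt_ext (fun t => Im (u t)))]; try assumption; intros t Ht; rewrite E by exact Ht;
    reflexivity.
Qed.

Lemma cRint_plus u v a b l m : cRint u a b l -> cRint v a b m ->
  cRint (fun t => u t + v t) a b (l + m).
Proof.
  intros [A1 A2] [B1 B2]. split.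
  - apply (is_RInt_plus (V := R_NormedModule) (fun t => Re (u t)) (fun t => Re (v t))); assumption.
  - apply (is_RInt_plus (V := R_NormedModule) (fun t => Im (u t)) (fun t => Im (v t))); assumption.
Qed.

Lemma cRint_scal c u a b l : cRint u a b l -> cRint (fun t => c * u t) a b (c * l).
Proof.
  intros [A1 A2]. split.
  - apply (is_RInt_ext (fun t => minus (scal (Re c) (Re (u t))) (scal (Im c) (Im (u t))))).
    + intros t _. unfold minus, plus, opp, scal; simpl. unfold mult; simpl. unfold Re, Im. ring.
    + replace (Re (c * l)) with (minus (scal (Re c) (Re l)) (scal (Im c) (Im l))).
      * apply (is_RInt_minus (V := R_NormedModule)); apply (is_RInt_scal (V := R_NormedModule));
          assumption.
      * unfold minus, plus, opp, scal; simpl. unfold mult; simpl. unfold Re, Im. ring.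
  - apply (is_RInt_ext (fun t => plus (scal (Re c) (Im (u t))) (scal (Im c) (Re (u t))))).
    + intros t _. unfold plus, scal; simpl. unfold mult; simpl. unfold Re, Im. ring.
    + replace (Im (c * l)) with (plus (scal (Re c) (Im l)) (scal (Im c) (Re l))).
      * apply (is_RInt_plus (V := R_NormedModule)); apply (is_RInt_scal (V := R_NormedModule));
          assumption.
      * unfold plus, scal; simpl. unfold mult; simpl. unfold Re, Im. ring.
Qed.

Lemma cRint_Chasles u a b c l m : cRint u a b l -> cRint u b c m -> cRint u a c (l + m).
Proof.
  intros [A1 A2] [B1 B2]. split.
  - apply (is_RInt_Chasles (V := R_NormedModule) _ a b c (Re l) (Re m)); assumption.
  - apply (is_RInt_Chasles (V := R_NormedModule) _ a b c (Im l) (Im m)); assumption.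
Qed.

Lemma cRint_point u a : cRint u a a 0.
Proof. split; apply (is_RInt_point (V := R_NormedModule)). Qed.

Lemma is_RInt_abs_le (f : R -> R) l M :
  (forall t, (0 <= t <= 1)%R -> (Rabs (f t) <= M)%R) -> is_RInt f 0 1 l -> (Rabs l <= M)%R.
Proof.
  intros B H.
  assert (Cn : forall k : R, is_RInt (fun _ => k) 0 1 k).
  { intros k. evar_last; [apply (is_RInt_const (V := R_NormedModule))|].
    unfold scal; simpl; unfold mult; simpl; ring. }
  apply Rabs_le. split.
  - apply (is_RInt_le (fun _ => - M)%R f 0 1); [lra|apply Cn|exact H|].
    intros t Ht. pose proof (B t ltac:(lra)) as Bt. apply Rabs_le_between in Bt. lra.
  - apply (is_RInt_le f (fun _ => M) 0 1); [lra|exact H|apply Cn|].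
    intros t Ht. pose proof (B t ltac:(lra)) as Bt. apply Rabs_le_between in Bt. lra.
Qed.

Lemma cRint_bound u l M :
  (forall t, (0 <= t <= 1)%R -> (Cmod (u t) <= M)%R) -> cRint u 0 1 l -> (Cmod l <= 2 * M)%R.
Proof.
  intros B [H1 H2]. eapply Rle_trans; [apply Cmod_le_re_im|].
  assert (Rabs (Re l) <= M)%R.
  { apply (is_RInt_abs_le (fun t => Re (u t))); [|exact H1].
    intros t Ht. eapply Rle_trans; [apply re_le_Cmod|apply B, Ht]. }
  assert (Rabs (Im l) <= M)%R.
  { apply (is_RInt_abs_le (fun t => Im (u t))); [|exact H2].
    intros t Ht. eapply Rle_trans; [apply im_le_Cmod|apply B, Ht]. }
  lra.
Qed.

Lemma rcont_continuous_Re u t : rcont u t -> continuous (fun s => Re (u s)) t.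
Proof.
  intros H. apply continuity_pt_filterlim. intros eps He.
  destruct (H eps He) as (r & Hr & B). exists r. split; [exact Hr|]. intros s [_ Hs].
  eapply Rle_lt_trans; [apply (re_le_Cmod (u s - u t))|apply B, Hs].
Qed.

Lemma rcont_continuous_Im u t : rcont u t -> continuous (fun s => Im (u s)) t.
Proof.
  intros H. apply continuity_pt_filterlim. intros eps He.
  destruct (H eps He) as (r & Hr & B). exists r. split; [exact Hr|]. intros s [_ Hs].
  eapply Rle_lt_trans; [apply (im_le_Cmod (u s - u t))|apply B, Hs].
Qed.

Lemma cRint_exists u a b : (a <= b)%R -> (forall t, (a <= t <= b)%R -> rcont u t) ->
  exists l, cRint u a b l.
Proof.
  intros Hab H.
  assert (E : forall f : R -> R, (forall t, (a <= t <= b)%R -> continuous f t) ->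
    is_RInt f a b (RInt f a b)).
  { intros f Hf. apply (RInt_correct (V := R_CompleteNormedModule)), ex_RInt_continuous.
    rewrite Rmin_left, Rmax_right by exact Hab. exact Hf. }
  exists (RInt (fun t => Re (u t)) a b, RInt (fun t => Im (u t)) a b).
  split; apply E; intros t Ht; [apply rcont_continuous_Re|apply rcont_continuous_Im]; apply H, Ht.
Qed.

Lemma cRint_ftc u u' a b : (a <= b)%R -> (forall t, (a <= t <= b)%R -> rderiv u t (u' t)) ->
  (forall t, (a <= t <= b)%R -> rcont u' t) -> cRint u' a b (u b - u a).
Proof.
  intros Hab D Cn. split.
  - apply (is_RInt_derive (V := R_CompleteNormedModule) (fun t => Re (u t))).
    + intros t Ht. rewrite Rmin_left, Rmax_right in Ht by exact Hab. apply rderiv_Re, D, Ht.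
    + intros t Ht. rewrite Rmin_left, Rmax_right in Ht by exact Hab.
      apply rcont_continuous_Re, Cn, Ht.
  - apply (is_RInt_derive (V := R_CompleteNormedModule) (fun t => Im (u t))).
    + intros t Ht. rewrite Rmin_left, Rmax_right in Ht by exact Hab. apply rderiv_Im, D, Ht.
    + intros t Ht. rewrite Rmin_left, Rmax_right in Ht by exact Hab.
      apply rcont_continuous_Im, Cn, Ht.
Qed.

(** ** Piecewise smooth paths *)

Definition cint (gam : R -> C) (f : C -> C) (l : C) : Prop :=
  cRint (fun t => f (gam t) * path_velocity gam t) 0 1 l.

Lemma cint_contour_int gam f l : cint gam f l -> contour_int gam f = l.
Proof. apply cRint_RInt. Qed.

Lemma cint_ext gam f g l : (forall t, (0 <= t <= 1)%R -> f (gam t) = g (gam t)) ->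
  cint gam f l -> cint gam g l.
Proof.
  intros E. apply cRint_ext. intros t Ht. rewrite Rmin_left, Rmax_right in Ht by lra.
  rewrite E by lra. reflexivity.
Qed.

Lemma cint_plus gam f g l m : cint gam f l -> cint gam g m -> cint gam (fun w => f w + g w) (l + m).
Proof.
  intros A B. pose proof (cRint_plus _ _ _ _ _ _ A B) as H. eapply cRint_ext; [|exact H].
  intros t _. cbv beta. ring.
Qed.

Lemma cint_scal gam c f l : cint gam f l -> cint gam (fun w => c * f w) (c * l).
Proof.
  intros A. pose proof (cRint_scal c _ _ _ _ A) as H. eapply cRint_ext; [|exact H].
  intros t _. cbv beta. ring.
Qed.

Lemma real_caratheodory (f : R -> R) t l : is_derive f t l ->
  exists psi : R -> R, psi t = l /\ (forall s, f s = f t + (s - t) * psi s)%R /\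
  (forall eps : R, (0 < eps)%R -> exists r : R, (0 < r)%R /\
    forall s : R, (Rabs (s - t) < r)%R -> (Rabs (psi s - psi t) < eps)%R).
Proof.
  intros H. apply is_derive_Reals in H.
  set (psi := fun s => if Req_EM_T s t then l else ((f s - f t) / (s - t))%R).
  assert (Pt : psi t = l).
  { unfold psi. destruct (Req_EM_T t t); [reflexivity|contradiction]. }
  exists psi. split; [exact Pt|]. split.
  - intros s. unfold psi. destruct (Req_EM_T s t) as [->|N]; [ring|]. field. lra.
  - intros eps He. destruct (H eps He) as [r Hr]. exists r. split; [apply cond_pos|].
    intros s Hs. rewrite Pt. unfold psi. destruct (Req_EM_T s t) as [->|N].
    + rewrite Rminus_diag, Rabs_R0. exact He.
    + specialize (Hr (s - t)%R ltac:(lra) Hs). replace (t + (s - t))%R with s in Hr by ring.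
      exact Hr.
Qed.

Lemma C1_path_rderiv h t : C1_path h -> rderiv h t (path_velocity h t).
Proof.
  intros H. destruct (H t) as [[[l1 H1] _] [[l2 H2] _]].
  destruct (real_caratheodory _ _ _ H1) as (p & Ep & Fp & Cp).
  destruct (real_caratheodory _ _ _ H2) as (q & Eq & Fq & Cq).
  assert (D1 : Derive (fun s => Re (h s)) t = l1) by apply (is_derive_unique _ _ _ H1).
  assert (D2 : Derive (fun s => Im (h s)) t = l2) by apply (is_derive_unique _ _ _ H2).
  unfold path_velocity. rewrite D1, D2.
  exists (fun s => (p s, q s)). split; [|split].
  - intros eps He.
    destruct (Cp (eps / 2)%R ltac:(lra)) as (r1 & Hr1 & B1).
    destruct (Cq (eps / 2)%R ltac:(lra)) as (r2 & Hr2 & B2).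
    exists (Rmin r1 r2). split; [apply Rmin_glb_lt; assumption|]. intros s Hs.
    specialize (B1 s ltac:(eapply Rlt_le_trans; [apply Hs|apply Rmin_l])).
    specialize (B2 s ltac:(eapply Rlt_le_trans; [apply Hs|apply Rmin_r])).
    eapply Rle_lt_trans; [apply Cmod_le_re_im|].
    change (Rabs (p s - p t) + Rabs (q s - q t) < eps)%R. lra.
  - rewrite Ep, Eq. reflexivity.
  - intros s. specialize (Fp s). specialize (Fq s).
    rewrite (surjective_pairing (h s)), (surjective_pairing (h t)).
    unfold Re, Im in Fp, Fq. rewrite Fp, Fq. unfold Cplus, Cmult, RtoC; simpl. f_equal; ring.
Qed.

Lemma C1_path_velocity_rcont h t : C1_path h -> rcont (path_velocity h) t.
Proof.
  intros H. destruct (H t) as [[_ H1] [_ H2]].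
  apply continuity_pt_filterlim in H1. apply continuity_pt_filterlim in H2.
  intros eps He.
  destruct (H1 (eps / 2)%R ltac:(lra)) as (r1 & Hr1 & B1).
  destruct (H2 (eps / 2)%R ltac:(lra)) as (r2 & Hr2 & B2).
  exists (Rmin r1 r2). split; [apply Rmin_glb_lt; assumption|]. intros s Hs.
  destruct (Req_dec t s) as [E|E].
  { subst s. replace (path_velocity h t - path_velocity h t) with (RtoC 0) by ring.
    rewrite Cmod_0. exact He. }
  specialize (B1 s (conj (conj I E) ltac:(eapply Rlt_le_trans; [apply Hs|apply Rmin_l]))).
  specialize (B2 s (conj (conj I E) ltac:(eapply Rlt_le_trans; [apply Hs|apply Rmin_r]))).
  eapply Rle_lt_trans; [apply Cmod_le_re_im|].
  unfold path_velocity.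
  match goal with |- (Rabs ?x + Rabs ?y < eps)%R =>
    change (Rabs x) with (Rabs (Derive (fun s => Re (h s)) s - Derive (fun s => Re (h s)) t));
    change (Rabs y) with (Rabs (Derive (fun s => Im (h s)) s - Derive (fun s => Im (h s)) t)) end.
  simpl in B1, B2. unfold R_dist in B1, B2. lra.
Qed.

Lemma path_velocity_ext gam h a b t :
  (forall s, (a <= s <= b)%R -> gam s = h s) -> (a < t < b)%R ->
  path_velocity gam t = path_velocity h t.
Proof.
  intros E Ht.
  assert (L : locally t (fun s => gam s = h s)).
  { exists (mkposreal (Rmin (t - a) (b - t)) ltac:(apply Rmin_glb_lt; lra)). intros s Hs.
    apply E. unfold ball in Hs; simpl in Hs. unfold AbsRing_ball, abs, minus, plus, opp in Hs.
    simpl in Hs. apply Rabs_def2 in Hs.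
    pose proof (Rmin_l (t - a) (b - t)). pose proof (Rmin_r (t - a) (b - t)). lra. }
  unfold path_velocity. f_equal; apply Derive_ext_loc; (eapply filter_imp; [|exact L]);
    intros s Hs; cbv beta in Hs; rewrite Hs; reflexivity.
Qed.

Lemma mesh_bounds (n : nat) (t : nat -> R) :
  (forall i, (i < n)%nat -> (t i < t (S i))%R) ->
  forall i, (i <= n)%nat -> (t 0%nat <= t i <= t n)%R.
Proof.
  intros H.
  assert (A : forall i j, (i <= j)%nat -> (j <= n)%nat -> (t i <= t j)%R).
  { intros i j Hij. induction Hij as [|j Hij IH]; intros Hj; [lra|].
    specialize (IH ltac:(lia)). specialize (H j ltac:(lia)). lra. }
  intros i Hi. split; apply A; lia.
Qed.

(** The increments of [F] along the pieces add up. A piece determines the velocity in its interior,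
    which is enough for the integral. *)
Lemma cint_ftc gam F f : piecewise_C1 gam ->
  (forall t, (0 <= t <= 1)%R -> cderiv F (gam t) (f (gam t)) /\ ccont f (gam t)) ->
  cint gam f (F (gam 1%R) - F (gam 0%R)).
Proof.
  intros (n & t & T0 & Tn & Tm & Tp) H.
  pose proof (mesh_bounds n t Tm) as Tb. rewrite T0, Tn in Tb.
  assert (A : forall i, (i <= n)%nat ->
    cRint (fun t => f (gam t) * path_velocity gam t) 0 (t i) (F (gam (t i)) - F (gam 0%R))).
  { induction i as [|i IH]; intros Hi.
    - rewrite T0. replace (F (gam 0%R) - F (gam 0%R)) with (RtoC 0) by ring. apply cRint_point.
    - replace (F (gam (t (S i))) - F (gam 0%R)) with
        ((F (gam (t i)) - F (gam 0%R)) + (F (gam (t (S i))) - F (gam (t i)))) by ring.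
      apply (cRint_Chasles _ _ (t i)); [apply IH; lia|].
      destruct (Tp i ltac:(lia)) as (h & Hh & E).
      pose proof (Tm i ltac:(lia)). pose proof (Tb i ltac:(lia)). pose proof (Tb (S i) Hi).
      rewrite (E (t i)), (E (t (S i))) by lra.
      apply (cRint_ext (fun t => f (h t) * path_velocity h t)).
      + intros s Hs. rewrite Rmin_left, Rmax_right in Hs by lra.
        rewrite (E s) by lra. rewrite (path_velocity_ext gam h (t i) (t (S i)) s E) by lra.
        reflexivity.
      + apply (cRint_ftc (fun s => F (h s))); [lra| |].
        * intros s Hs. apply (rderiv_chain F h); [|apply C1_path_rderiv, Hh].
          rewrite <- (E s) by exact Hs. apply H. lra.
        * intros s Hs. apply rcont_mult; [|apply C1_path_velocity_rcont, Hh].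
          apply rcont_comp; [|apply (rderiv_rcont _ _ _ (C1_path_rderiv h s Hh))].
          rewrite <- (E s) by exact Hs. apply H. lra. }
  specialize (A n (le_n n)). rewrite Tn in A. exact A.
Qed.

Lemma cint_exists gam f : piecewise_C1 gam ->
  (forall t, (0 <= t <= 1)%R -> ccont f (gam t)) -> exists l, cint gam f l.
Proof.
  intros (n & t & T0 & Tn & Tm & Tp) H.
  pose proof (mesh_bounds n t Tm) as Tb. rewrite T0, Tn in Tb.
  assert (A : forall i, (i <= n)%nat -> exists l,
    cRint (fun t => f (gam t) * path_velocity gam t) 0 (t i) l).
  { induction i as [|i IH]; intros Hi.
    - rewrite T0. exists 0. apply cRint_point.
    - destruct (IH ltac:(lia)) as [l Hl].
      destruct (Tp i ltac:(lia)) as (h & Hh & E).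
      pose proof (Tm i ltac:(lia)). pose proof (Tb i ltac:(lia)). pose proof (Tb (S i) Hi).
      destruct (cRint_exists (fun t => f (h t) * path_velocity h t) (t i) (t (S i))) as [m Hm].
      + lra.
      + intros s Hs. apply rcont_mult; [|apply C1_path_velocity_rcont, Hh].
        apply rcont_comp; [|apply (rderiv_rcont _ _ _ (C1_path_rderiv h s Hh))].
        rewrite <- (E s) by exact Hs. apply H. lra.
      + exists (l + m). apply (cRint_Chasles _ _ (t i)); [exact Hl|].
        apply (cRint_ext (fun t => f (h t) * path_velocity h t)); [|exact Hm].
        intros s Hs. rewrite Rmin_left, Rmax_right in Hs by lra.
        rewrite (E s) by lra. rewrite (path_velocity_ext gam h (t i) (t (S i)) s E) by lra.
        reflexivity. }
  destruct (A n (le_n n)) as [l Hl]. rewrite Tn in Hl. exists l. exact Hl.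
Qed.

(** ** Primitives on a domain that is star-shaped about [0] *)

(** The interval is covered by a neighbourhood of each of its points; the supremum of the reachable
    points is an interior point of one of them. *)
Lemma interval_compactness (Q : R -> R -> Prop) :
  (forall t d d' : R, (0 < d' <= d)%R -> Q t d -> Q t d') ->
  (forall t0 : R, (0 <= t0 <= 1)%R -> exists d : R, (0 < d)%R /\
    forall t : R, (0 <= t <= 1)%R -> (Rabs (t - t0) < d)%R -> Q t d) ->
  exists d : R, (0 < d)%R /\ forall t : R, (0 <= t <= 1)%R -> Q t d.
Proof.
  intros Mono Loc.
  set (S := fun x => (0 <= x <= 1)%R /\ exists d : R, (0 < d)%R /\
    forall t : R, (0 <= t <= x)%R -> Q t d).
  assert (S0 : S 0%R).
  { split; [lra|]. destruct (Loc 0%R ltac:(lra)) as (d & Hd & H). exists d. split; [exact Hd|].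
    intros t Ht. apply H; [lra|]. replace (t - 0)%R with 0%R by lra. rewrite Rabs_R0. exact Hd. }
  destruct (completeness S) as [m [Hm1 Hm2]].
  { exists 1%R. intros x [Hx _]. lra. }
  { exists 0%R. exact S0. }
  assert (Hm : (0 <= m <= 1)%R).
  { split; [apply Hm1, S0|]. apply Hm2. intros x [Hx _]. lra. }
  destruct (Loc m Hm) as (d & Hd & H).
  assert (exists x, S x /\ (m - d < x)%R) as (x & Sx & Hx).
  { apply NNPP. intros N. assert (m <= m - d)%R; [|lra]. apply Hm2. intros x Sx.
    apply Rnot_lt_le. intros L. apply N. exists x. split; assumption. }
  pose proof (Hm1 x Sx) as Hxm. destruct Sx as (Hx01 & e & He & Hq).
  set (y := Rmin 1 (m + d / 2)).
  assert (Sy : S y).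
  { assert (y <= 1)%R by apply Rmin_l. assert (y <= m + d / 2)%R by apply Rmin_r.
    assert (0 <= y)%R by (apply Rmin_glb; lra).
    split; [lra|]. exists (Rmin d e). assert (0 < Rmin d e)%R by (apply Rmin_glb_lt; assumption).
    split; [assumption|]. intros t Ht. destruct (Rle_dec t x) as [L|L].
    - apply (Mono t e); [split; [assumption|apply Rmin_r]|]. apply Hq. lra.
    - apply (Mono t d); [split; [assumption|apply Rmin_l]|]. apply H; [lra|].
      apply Rabs_def1; lra. }
  assert (Y : y = 1%R).
  { pose proof (Hm1 y Sy) as Hy. unfold y, Rmin in *. destruct (Rle_dec 1 (m + d / 2)); lra. }
  destruct Sy as (_ & f & Hf & Hall). exists f. split; [exact Hf|]. intros t Ht. apply Hall. lra.
Qed.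

Lemma cderiv_unique f z l l' : cderiv f z l -> cderiv f z l' -> l = l'.
Proof.
  intros (p & Hp & Ep & Np) (q & Hq & Eq & Nq).
  apply Ceq_minus. apply Cmod_eq_0. apply Rle_antisym; [|apply Cmod_ge_0].
  apply Rnot_lt_le. intros L. set (e := Cmod (l - l')) in *.
  destruct (cnear_and _ _ _ (Hp (e / 2)%R ltac:(lra)) (cnear_and _ _ _ (Hq (e / 2)%R ltac:(lra))
    (cnear_and _ _ _ Np Nq))) as (r & Hr & H).
  destruct (H (z + RtoC (r / 2))) as (A & B & C1 & C2).
  { replace (z + RtoC (r / 2) - z) with (RtoC (r / 2)) by ring.
    rewrite Cmod_R, Rabs_pos_eq; lra. }
  set (w := z + RtoC (r / 2)) in *.
  assert (N : w - z <> 0).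
  { unfold w. replace (z + RtoC (r / 2) - z) with (RtoC (r / 2)) by ring.
    intros E. apply RtoC_inj in E. lra. }
  assert (E : p w = q w).
  { apply (Cmult_cancel (w - z)); [|exact N]. rewrite C1 in C2.
    replace ((w - z) * p w) with (f z + p w * (w - z) - f z) by ring. rewrite C2. ring. }
  rewrite Ep in A. rewrite Eq in B. rewrite E in A.
  pose proof (Cmod_triangle (- (q w - l)) (q w - l')) as T. rewrite Cmod_opp in T.
  replace (- (q w - l) + (q w - l')) with (l - l') in T by ring. fold e in T. lra.
Qed.

(** A choice of derivatives that is independent of the point near which they exist. *)
Definition dfun (f : C -> C) (z : C) : C := epsilon (inhabits (RtoC 0)) (cderiv f z).

Lemma Dn1_dfun f z : Dn 1 f z -> cnear z (fun w => cderiv f w (dfun f w)) /\ ccont (dfun f) z.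
Proof.
  intros (g & A & B).
  assert (E : cnear z (fun w => cderiv f w (dfun f w))).
  { eapply cnear_impl; [|apply A]. intros w Hw. unfold dfun. apply epsilon_spec. exists (g w). exact Hw. }
  split; [exact E|]. apply (ccont_ext_near g); [|exact B].
  eapply cnear_impl; [|apply cnear_and; [apply A|apply E]]. intros w [U V].
  apply (cderiv_unique f w); assumption.
Qed.

Lemma strict_differentiability f z (eps : R) : Dn 1 f z -> (0 < eps)%R ->
  exists r : R, (0 < r)%R /\ forall v w, (Cmod (v - z) < r)%R -> (Cmod (w - z) < r)%R ->
  (Cmod (f w - f v - dfun f v * (w - v)) <= eps * Cmod (w - v))%R /\
  (Cmod (f w - f v) <= eps)%R.
Proof.
  intros H He. destruct (Dn1_dfun f z H) as [D Cd].
  destruct (cnear_and _ _ _ D (cnear_and _ _ _ (Cd (eps / 2)%R ltac:(lra))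
    (Dn_ccont _ _ _ H (eps / 2)%R ltac:(lra)))) as (r & Hr & B).
  exists r. split; [exact Hr|]. intros v w Hv Hw. split.
  - set (q := fun u => f u + (- dfun f v) * u).
    replace (f w - f v - dfun f v * (w - v)) with (q w - q v) by (unfold q; ring).
    apply (mean_value_ball q (fun u => dfun f u + - dfun f v) z r); try assumption.
    + intros u Hu. unfold q. apply cderiv_plus; [apply (B u Hu)|].
      eapply cderiv_eq; [apply cderiv_scal, cderiv_id|]. ring.
    + intros u Hu. destruct (B u Hu) as (_ & B1 & _). destruct (B v Hv) as (_ & B2 & _).
      pose proof (Cmod_triangle (dfun f u - dfun f z) (- (dfun f v - dfun f z))) as T.
      rewrite Cmod_opp in T.
      replace (dfun f u - dfun f z + - (dfun f v - dfun f z)) with (dfun f u + - dfun f v) in T by ring.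
      lra.
  - destruct (B w Hw) as (_ & _ & B1). destruct (B v Hv) as (_ & _ & B2).
    pose proof (Cmod_triangle (f w - f z) (- (f v - f z))) as T. rewrite Cmod_opp in T.
    replace (f w - f z + - (f v - f z)) with (f w - f v) in T by ring. lra.
Qed.

Lemma off_ray_star rho w t : (0 < rho)%R -> off_ray rho w -> (0 <= t <= 1)%R ->
  off_ray rho (RtoC t * w).
Proof.
  intros Hr H Ht [E L].
  replace (Im (RtoC t * w)) with (t * Im w)%R in E by (unfold Im; simpl; ring).
  replace (Re (RtoC t * w)) with (t * Re w)%R in L by (unfold Re; simpl; ring).
  destruct (Req_dec t 0) as [Z|Z]; [rewrite Z in L; lra|].
  apply H. split; [nra|]. assert (0 < t)%R by lra.
  assert (0 < Re w)%R by nra. nra.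
Qed.

Definition star_primitive (f : C -> C) (w : C) : C :=
  (RInt (fun t => Re (f (RtoC t * w) * w)) 0 1, RInt (fun t => Im (f (RtoC t * w) * w)) 0 1).

Lemma rcont_ray w t : rcont (fun t => RtoC t * w) t.
Proof. apply rcont_mult; [apply rcont_RtoC|apply rcont_const]. Qed.

(** Cauchy's theorem for a star-shaped domain: differentiating [int_0^1 f(t w) w dt] under the
    integral sign gives the integral of the [t]-derivative of [t f(t w)]. *)
Lemma star_primitive_cderiv rho f w : (0 < rho)%R ->
  (forall z, off_ray rho z -> Dn 1 f z) -> off_ray rho w -> cderiv (star_primitive f) w (f w).
Proof.
  intros Hrho Hf Hw. apply cderiv_of_eps. intros eps0 He0.
  set (K := (Cmod w + 1)%R). assert (HK : (0 < K)%R) by (pose proof (Cmod_ge_0 w); unfold K; lra).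
  set (eps := (eps0 / (2 * K))%R).
  assert (He : (0 < eps)%R) by (apply Rdiv_lt_0_compat; lra).
  assert (EK : (2 * (eps * K) = eps0)%R) by (unfold eps; field; lra).
  (* the estimates hold near every point of the segment, hence uniformly on it *)
  assert (U : exists d : R, (0 < d)%R /\ forall t : R, (0 <= t <= 1)%R -> forall v,
    (Cmod (v - w) < d)%R ->
    (Cmod (f (RtoC t * v)%C - f (RtoC t * w)%C - dfun f (RtoC t * w)%C * (RtoC t * v - RtoC t * w))
      <= eps * Cmod (RtoC t * v - RtoC t * w))%R /\
    (Cmod (f (RtoC t * v)%C - f (RtoC t * w)%C)%C <= eps)%R).
  { apply (interval_compactness (fun t d => forall v, (Cmod (v - w) < d)%R ->
      (Cmod (f (RtoC t * v)%C - f (RtoC t * w)%C - dfun f (RtoC t * w)%C * (RtoC t * v - RtoC t * w))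
        <= eps * Cmod (RtoC t * v - RtoC t * w))%R /\
      (Cmod (f (RtoC t * v)%C - f (RtoC t * w)%C)%C <= eps)%R)).
    - intros t d d' Hd H v Hv. apply H. lra.
    - intros t0 Ht0.
      destruct (strict_differentiability f (RtoC t0 * w) eps
        (Hf _ (off_ray_star rho w t0 Hrho Hw Ht0)) He) as (r & Hr & B).
      exists (Rmin (r / 2) (r / 2 / K)).
      assert (0 < r / 2 / K)%R by (apply Rdiv_lt_0_compat; lra).
      split; [apply Rmin_glb_lt; lra|]. intros t Ht Htt v Hv.
      assert (A1 : (Cmod (v - w) < r / 2)%R) by (eapply Rlt_le_trans; [apply Hv|apply Rmin_l]).
      assert (A2 : (Rabs (t - t0) < r / 2 / K)%R) by (eapply Rlt_le_trans; [apply Htt|apply Rmin_r]).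
      assert (A3 : (Cmod (RtoC t * w - RtoC t0 * w) < r / 2)%R).
      { replace (RtoC t * w - RtoC t0 * w) with (RtoC (t - t0) * w) by (rewrite RtoC_minus; ring).
        rewrite Cmod_mult, Cmod_R. apply Rlt_div_r in A2; [|exact HK].
        pose proof (Rabs_pos (t - t0)). unfold K in A2. nra. }
      apply B; [lra|].
      replace (RtoC t * v - RtoC t0 * w) with (RtoC t * (v - w) + (RtoC t * w - RtoC t0 * w)) by ring.
      eapply Rle_lt_trans; [apply Cmod_triangle|].
      rewrite Cmod_mult, Cmod_R, Rabs_pos_eq by lra.
      pose proof (Cmod_ge_0 (v - w)). nra. }
  destruct U as (d & Hd & U).
  assert (Int : forall v, off_ray rho v -> cRint (fun t => f (RtoC t * v)%C * v) 0 1 (star_primitive f v)).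
  { intros v Hv. destruct (cRint_exists (fun t => f (RtoC t * v)%C * v) 0 1) as [l Hl]; [lra| |].
    - intros t Ht. apply rcont_mult; [|apply rcont_const]. apply rcont_comp; [|apply rcont_ray].
      apply (Dn_ccont 1), Hf, off_ray_star; assumption.
    - replace (star_primitive f v) with l; [exact Hl|]. destruct Hl as [H1 H2].
      symmetry. apply injective_projections; apply is_RInt_unique; assumption. }
  (* the integrand is the derivative of t f(t w) *)
  assert (Ftc : cRint (fun t => f (RtoC t * w)%C + RtoC t * (dfun f (RtoC t * w)%C * w)) 0 1 (f w)).
  { replace (f w) with (RtoC 1 * f (RtoC 1 * w) - RtoC 0 * f (RtoC 0 * w))
      by (rewrite Cmult_1_l, Cmult_1_l; ring).
    apply (cRint_ftc (fun t => RtoC t * f (RtoC t * w)%C)); [lra| |].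
    - intros t Ht.
      pose proof (Dn1_dfun f _ (Hf _ (off_ray_star rho w t Hrho Hw Ht))) as [D _].
      apply cnear_point in D.
      assert (Rd : rderiv (fun s => RtoC s * w) t w).
      { pose proof (rderiv_segment 0 w t) as S.
        exists (fun _ => w). split; [apply rcont_const|]. split; [reflexivity|].
        intros s. rewrite RtoC_minus. ring. }
      destruct (rderiv_chain f (fun s => RtoC s * w) t _ _ D Rd) as (eta & Ce & Ee & Fe).
      exists (fun s => f (RtoC s * w) + RtoC t * eta s). split; [|split].
      + apply rcont_plus; [|apply rcont_mult; [apply rcont_const|exact Ce]].
        apply rcont_comp; [|apply rcont_ray].
        apply (Dn_ccont 1), Hf, off_ray_star; assumption.
      + rewrite Ee. reflexivity.
      + intros s. rewrite (Fe s). rewrite RtoC_minus. ring.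
    - intros t Ht.
      pose proof (Dn1_dfun f _ (Hf _ (off_ray_star rho w t Hrho Hw Ht))) as [_ Cd].
      apply rcont_plus.
      + apply rcont_comp; [|apply rcont_ray]. apply (Dn_ccont 1), Hf, off_ray_star; assumption.
      + apply rcont_mult; [apply rcont_RtoC|]. apply rcont_mult; [|apply rcont_const].
        apply (rcont_comp (dfun f)); [exact Cd|apply rcont_ray]. }
  destruct (cnear_and _ _ _ (off_ray_open rho w Hw) (ex_intro _ d (conj Hd (fun v H => H))))
    as (r & Hr & Near).
  exists r. split; [exact Hr|]. intros v Hv. destruct (Near v Hv) as [Ov Dv].
  pose proof (cRint_plus _ _ _ _ _ _ (Int v Ov) (cRint_plus _ _ _ _ _ _
    (cRint_scal (- (1)) _ _ _ _ (Int w Hw)) (cRint_scal (- (v - w)) _ _ _ _ Ftc))) as Tot.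
  replace (star_primitive f v - star_primitive f w - f w * (v - w)) with
    (star_primitive f v + (- (1) * star_primitive f w + - (v - w) * f w)) by ring.
  rewrite <- EK. replace (2 * (eps * K) * Cmod (v - w))%R with (2 * (eps * K * Cmod (v - w)))%R by ring.
  apply (cRint_bound _ _ _ ) with (2 := Tot). intros t Ht.
  destruct (U t Ht v Dv) as [U1 U2].
  match goal with |- (Cmod ?X <= _)%R => replace X with
    ((f (RtoC t * v)%C - f (RtoC t * w)%C - dfun f (RtoC t * w)%C * (RtoC t * v - RtoC t * w)) * w +
     (f (RtoC t * v)%C - f (RtoC t * w)%C) * (v - w)) by ring end.
  eapply Rle_trans; [apply Cmod_triangle|]. rewrite !Cmod_mult.
  assert (U3 : (Cmod (RtoC t * v - RtoC t * w) <= Cmod (v - w))%R).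
  { replace (RtoC t * v - RtoC t * w) with (RtoC t * (v - w)) by ring.
    rewrite Cmod_mult, Cmod_R, Rabs_pos_eq by lra. pose proof (Cmod_ge_0 (v - w)). nra. }
  pose proof (Cmod_ge_0 w). pose proof (Cmod_ge_0 (v - w)).
  set (X1 := Cmod (f (RtoC t * v)%C - f (RtoC t * w)%C - _)) in *.
  set (X2 := Cmod (f (RtoC t * v)%C - f (RtoC t * w)%C)) in *.
  assert (X1 * Cmod w <= eps * Cmod (v - w) * Cmod w)%R.
  { apply Rmult_le_compat_r; [assumption|]. eapply Rle_trans; [apply U1|].
    apply Rmult_le_compat_l; lra. }
  assert (X2 * Cmod (v - w) <= eps * Cmod (v - w))%R by (apply Rmult_le_compat_r; assumption).
  unfold K. lra.
Qed.

(** * Laurent decomposition *)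

(** Coefficient of [w^n], for [n >= 0], in [(sum a_k w^k) (sum b_i w^(-i))]. *)
Definition corr (a b : nat -> C) (n : nat) : C := CSum (fun i => a (n + i)%nat * b i).

Lemma CSum_drop g k : (forall i, (i < k)%nat -> g i = RtoC 0) -> summable g ->
  CSum g = CSum (fun n => g (k + n)%nat).
Proof.
  intros H S. symmetry. apply csums_CSum.
  replace (CSum g) with (CSum g - csum g k) by (rewrite csum_zero by exact H; ring).
  apply csums_shift, summable_csums, S.
Qed.

Lemma summable2_corr A B : summable A -> summable B -> summable2 (fun n i => A (n + i)%nat * B i).
Proof.
  intros [M HM] [N HN]. exists (M * N)%R. intros I J. rewrite rsum_swap.
  apply Rle_trans with (rsum (fun i => M * Cmod (B i))%R J).
  - apply rsum_le. intros i _.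
    rewrite (rsum_ext _ (fun n => Cmod (B i) * Cmod (A (n + i)%nat))%R)
      by (intros; rewrite Cmod_mult; ring).
    rewrite rsum_scal, Rmult_comm. apply Rmult_le_compat_r; [apply Cmod_ge_0|].
    eapply Rle_trans; [|apply (HM (i + I)%nat)]. rewrite rsum_app.
    pose proof (rsum_pos (fun k => Cmod (A k)) i (fun k => Cmod_ge_0 _)).
    rewrite (rsum_ext (fun n => Cmod (A (n + i)%nat)) (fun k => Cmod (A (i + k)%nat)))
      by (intros; do 2 f_equal; lia). lra.
  - rewrite rsum_scal. apply Rmult_le_compat_l; [|apply HN].
    exact (HM O).
Qed.

Lemma summable_row_corr A B n : summable A -> summable B ->
  summable (fun i => A (n + i)%nat * B i).
Proof. intros HA HB. apply (summable2_row (fun n i => A (n + i)%nat * B i)), summable2_corr; assumption. Qed.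

(** The terms [A k * B i] with [i <= k] form the first double series, those with [k < i] the second. *)
Lemma CSum_mul_split A B : summable A -> summable B ->
  CSum A * CSum B = CSum (fun n => CSum (fun i => A (n + i)%nat * B i)) +
    CSum (fun n => CSum (fun i => B (S n + i)%nat * A i)).
Proof.
  intros HA HB.
  pose proof (summable2_prod A B HA HB) as S2.
  set (L := fun k i => if Nat.leb i k then A k * B i else 0).
  set (U := fun k i => if Nat.leb i k then RtoC 0 else A k * B i).
  assert (SL : summable2 L).
  { apply (summable2_le _ (fun i j => A i * B j)); [|exact S2]. intros k i. unfold L.
    destruct (Nat.leb i k); [lra|]. rewrite Cmod_0. apply Cmod_ge_0. }
  assert (SU : summable2 U).
  { apply (summable2_le _ (fun i j => A i * B j)); [|exact S2]. intros k i. unfold U.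
    destruct (Nat.leb i k); [|lra]. rewrite Cmod_0. apply Cmod_ge_0. }
  transitivity (CSum (fun k => CSum (L k)) + CSum (fun k => CSum (U k))).
  - rewrite <- CSum_plus by (apply summable2_sums; assumption).
    rewrite Cmult_comm, <- CSum_scal by exact HA. apply CSum_ext. intros k.
    rewrite <- CSum_plus by (apply summable2_row; assumption).
    rewrite Cmult_comm, <- CSum_scal by exact HB. apply CSum_ext. intros i.
    unfold L, U. destruct (Nat.leb i k); ring.
  - f_equal.
    + change (CSum (fun k => CSum (fun i => L k i)) = CSum (fun n => CSum (fun i => A (n + i)%nat * B i))).
      rewrite (CSum_swap L SL), (CSum_swap (fun n i => A (n + i)%nat * B i))
        by (apply summable2_corr; assumption).
      apply CSum_ext. intros i. rewrite (CSum_drop _ i).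
      * apply CSum_ext. intros n. unfold L.
        replace (Nat.leb i (i + n)) with true by (symmetry; apply Nat.leb_le; lia).
        rewrite (Nat.add_comm i n). reflexivity.
      * intros k Hk. unfold L. replace (Nat.leb i k) with false; [reflexivity|].
        symmetry. apply Nat.leb_gt. lia.
      * apply summable2_col, SL.
    + assert (SB : summable2 (fun n i => B (S n + i)%nat * A i)).
      { pose proof (summable2_corr B A HB HA) as [M HM]. exists M. intros I J.
        eapply Rle_trans; [|apply (HM (S I) J)].
        change (S I) with (1 + I)%nat. rewrite rsum_app. cbn [rsum].
        pose proof (rsum_pos (fun j => Cmod (B (0 + j)%nat * A j)) J (fun j => Cmod_ge_0 _)).
        simpl (_ + _)%nat in *. lra. }
      rewrite (CSum_swap _ SB). apply CSum_ext. intros k. rewrite (CSum_drop _ (S k)).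
      * apply CSum_ext. intros n. unfold U.
        replace (Nat.leb (S k + n) k) with false by (symmetry; apply Nat.leb_gt; lia).
        rewrite Cmult_comm. do 2 f_equal. lia.
      * intros i Hi. unfold U. replace (Nat.leb i k) with true; [reflexivity|].
        symmetry. apply Nat.leb_le. lia.
      * apply summable2_row, SU.
Qed.

Section Laurent.

Variable (rho : R).
Hypothesis Hrho : (1 < rho)%R.

Lemma psr_summable a : psr a rho -> summable a.
Proof.
  intros H. apply (summable_le _ (fun n => a n * RtoC (1 ^ n))); [|apply H; lra].
  intros n. rewrite pow1, Cmult_1_r. lra.
Qed.

Lemma psr_corr a b : psr a rho -> psr b rho -> psr (corr a b) rho.
Proof.
  intros Ha Hb r Hr. set (r' := Rmax r 1).
  assert (Hr' : (1 <= r' < rho)%R) by (split; [apply Rmax_r|apply Rmax_lub_lt; lra]).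
  pose proof (Ha r' ltac:(lra)) as SA. pose proof (psr_summable b Hb) as SB.
  assert (S2 : summable2 (fun n i => RtoC (r ^ n) * (a (n + i)%nat * b i))).
  { apply (summable2_le _ (fun n i => (a (n + i)%nat * RtoC (r' ^ (n + i))) * b i)).
    - intros n i. rewrite !Cmod_mult, !Cmod_R, !Rabs_pos_eq by (apply pow_le; lra).
      assert (r ^ n <= r' ^ (n + i))%R.
      { apply Rle_trans with (r' ^ n)%R; [apply pow_incr; split; [lra|apply Rmax_l]|].
        apply Rle_pow; [lra|lia]. }
      replace (Cmod (a (n + i)%nat) * r' ^ (n + i) * Cmod (b i))%R
        with (r' ^ (n + i) * (Cmod (a (n + i)%nat) * Cmod (b i)))%R by ring.
      apply Rmult_le_compat_r; [apply Rmult_le_pos; apply Cmod_ge_0|assumption].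
    - apply (summable2_corr (fun n => a n * RtoC (r' ^ n)) b SA SB). }
  pose proof (summable2_sums _ S2) as S3.
  eapply summable_le; [|exact S3]. intros n. right. f_equal. unfold corr.
  rewrite CSum_scal; [ring|]. apply summable_row_corr; [apply psr_summable, Ha|exact SB].
Qed.

Lemma psr_shift a : psr a rho -> psr (fun n => a (S n)) rho.
Proof.
  intros Ha r Hr. set (r' := Rmax r 1).
  assert (Hr' : (1 <= r' < rho)%R) by (split; [apply Rmax_r|apply Rmax_lub_lt; lra]).
  destruct (Ha r' ltac:(lra)) as [M HM]. exists M. intros n.
  eapply Rle_trans; [|apply (HM (1 + n)%nat)]. rewrite rsum_app.
  match goal with |- (?x <= ?y + ?z)%R => assert (0 <= y)%R; [|assert (x <= z)%R; [|lra]] end.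
  { apply rsum_pos. intros; apply Cmod_ge_0. }
  apply rsum_le. intros k _. rewrite !Cmod_mult, !Cmod_R, !Rabs_pos_eq by (apply pow_le; lra).
  apply Rmult_le_compat_l; [apply Cmod_ge_0|].
  apply Rle_trans with (r' ^ k)%R; [apply pow_incr; split; [lra|apply Rmax_l]|].
  apply Rle_pow; [lra|lia].
Qed.

Lemma laurent_expansion a b (w : C) : psr a rho -> psr b rho -> w <> 0 ->
  (Cmod w < rho)%R -> (Cmod (/ w) < rho)%R ->
  PSC a w * PSC b (/ w) = PSC (corr a b) w + / w * PSC (fun n => corr b a (S n)) (/ w).
Proof.
  intros Ha Hb H0 H1 H2.
  pose proof (psr_summable a Ha) as Sa. pose proof (psr_summable b Hb) as Sb.
  unfold PSC at 1 2.
  rewrite CSum_mul_split by (eapply summable_PSC; eassumption).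
  assert (Q : forall i, w ^ i * (/ w) ^ i = 1).
  { intros i. rewrite <- Cpow_mult_l. replace (w * / w) with (RtoC 1) by (field; exact H0).
    apply Cpow_1_l. }
  f_equal.
  - apply CSum_ext. intros n. unfold corr. rewrite Cmult_comm, <- CSum_scal.
    + apply CSum_ext. intros i. rewrite Cpow_add_r.
      transitivity (w ^ n * (a (n + i)%nat * b i) * (w ^ i * (/ w) ^ i)); [ring|].
      rewrite Q. ring.
    + apply summable_row_corr; assumption.
  - unfold PSC. rewrite <- CSum_scal.
    + apply CSum_ext. intros n. unfold corr.
      transitivity ((/ w) ^ S n * CSum (fun i => b (S n + i)%nat * a i)); [|simpl; ring].
      rewrite <- CSum_scal by (apply summable_row_corr; assumption).
      apply CSum_ext. intros i. rewrite Cpow_add_r.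
      transitivity ((/ w) ^ S n * (b (S n + i)%nat * a i) * (w ^ i * (/ w) ^ i)); [ring|].
      rewrite Q. ring.
    + apply (summable_PSC _ rho); [|exact H2].
      apply (psr_shift (corr b a)), psr_corr; assumption.
Qed.

(** A power series continues holomorphically along a function with which it agrees on an annulus. *)
Lemma hol_glue c g : psr c rho ->
  (forall u, (1 < Cmod u < rho)%R -> PSC c u = g u) ->
  (forall u, off_ray rho u -> (1 < Cmod u)%R -> smooth g u) ->
  hol rho (fun u => if Rlt_dec (Cmod u) rho then PSC c u else g u) c.
Proof.
  intros Hc E G. split; [exact Hc|]. split.
  - intros z Hz. destruct (Rlt_dec (Cmod z) rho); [reflexivity|contradiction].
  - intros z Hz. destruct (Rlt_dec (Cmod z) rho) as [L|L].
    + apply (smooth_ext_near (PSC c)); [|apply (PSC_smooth c rho); assumption].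
      exists (rho - Cmod z)%R. split; [lra|]. intros w Hw.
      pose proof (Cmod_triangle (w - z) z) as T. replace (w - z + z) with w in T by ring.
      destruct (Rlt_dec (Cmod w) rho); [reflexivity|lra].
    + apply (smooth_ext_near g); [|apply G; [exact Hz|lra]].
      exists (Cmod z - 1)%R. split; [lra|]. intros w Hw.
      assert (W : (1 < Cmod w)%R).
      { pose proof (Cmod_triangle w (- (w - z))) as T. rewrite Cmod_opp in T.
        replace (w + - (w - z)) with z in T by ring. lra. }
      destruct (Rlt_dec (Cmod w) rho) as [L2|L2]; [|reflexivity]. symmetry. apply E. lra.
Qed.

Lemma Cmod_inv_lt_1 (u : C) : (1 < Cmod u)%R -> u <> 0 /\ (Cmod (/ u) < 1)%R.
Proof.
  intros H. assert (N : u <> 0) by (apply Cmod_gt_0; lra). split; [exact N|].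
  rewrite Cmod_inv by exact N. rewrite <- Rinv_1. apply Rinv_lt_contravar; lra.
Qed.

(** [phi(w) psi(1/w) = P(w) + N(1/w)/w], with [P] and [N] holomorphic off the ray: the Laurent series
    defines both in the disc, and outside of it each is the product minus the other. *)
Lemma laurent_decomposition phi psi a b : hol rho phi a -> hol rho psi b ->
  exists P N, hol rho P (corr a b) /\ hol rho N (fun n => corr b a (S n)) /\
  forall w : C, w <> 0 -> phi w * psi (/ w) = P w + / w * N (/ w).
Proof.
  intros (A1 & A2 & A3) (B1 & B2 & B3).
  set (p := corr a b). set (q := fun n => corr b a (S n)).
  assert (Hp : psr p rho) by (apply psr_corr; assumption).
  assert (Hq : psr q rho) by (apply (psr_shift (corr b a)), psr_corr; assumption).
  assert (La : forall w : C, w <> 0 -> (Cmod w < rho)%R -> (Cmod (/ w) < rho)%R ->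
    phi w * psi (/ w) = PSC p w + / w * PSC q (/ w)).
  { intros w H0 H1 H2. rewrite A2, B2 by assumption. apply laurent_expansion; assumption. }
  assert (Inv : forall f u, (1 < Cmod u)%R -> smooth f (/ u) -> smooth (fun u => f (/ u)) u).
  { intros f u Hu Hf. apply (smooth_comp f (fun u => / u)); [exact Hf|].
    apply smooth_inv, Cmod_inv_lt_1, Hu. }
  set (gP := fun u => phi u * psi (/ u) - / u * PSC q (/ u)).
  set (gN := fun v => (phi (/ v) * psi v - PSC p (/ v)) * / v).
  exists (fun u => if Rlt_dec (Cmod u) rho then PSC p u else gP u).
  exists (fun v => if Rlt_dec (Cmod v) rho then PSC q v else gN v).
  split; [|split].
  - apply hol_glue; [exact Hp| |].
    + intros u Hu. destruct (Cmod_inv_lt_1 u ltac:(lra)) as [N0 L]. unfold gP.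
      rewrite La by (assumption || lra). ring.
    + intros u Ou Hu. destruct (Cmod_inv_lt_1 u Hu) as [N0 L]. unfold gP.
      apply smooth_minus; apply smooth_mult.
      * apply A3, Ou.
      * apply Inv; [exact Hu|]. apply B3, off_ray_disc. lra.
      * apply smooth_inv, N0.
      * apply Inv; [exact Hu|]. apply (PSC_smooth q rho); [exact Hq|lra].
  - apply hol_glue; [exact Hq| |].
    + intros v Hv. destruct (Cmod_inv_lt_1 v ltac:(lra)) as [N0 L]. unfold gN.
      assert (N1 : / v <> 0).
      { intros E. assert (E2 : v * / v = 1) by (field; exact N0). rewrite E, Cmult_0_r in E2.
        apply RtoC_inj in E2. lra. }
      assert (VV : / / v = v) by (field; exact N0).
      pose proof (La (/ v) N1 ltac:(lra) ltac:(rewrite VV; lra)) as X. rewrite VV in X.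
      rewrite X. field. exact N0.
    + intros v Ov Hv. destruct (Cmod_inv_lt_1 v Hv) as [N0 L]. unfold gN.
      apply smooth_mult; [apply smooth_minus; [apply smooth_mult|]|].
      * apply Inv; [exact Hv|]. apply A3, off_ray_disc. lra.
      * apply B3, Ov.
      * apply Inv; [exact Hv|]. apply (PSC_smooth p rho); [exact Hp|lra].
      * apply smooth_inv, N0.
  - intros w Hw. assert (M : (0 < Cmod w)%R) by (apply Cmod_gt_0, Hw).
    assert (Mi : (Cmod w * Cmod (/ w) = 1)%R).
    { rewrite Cmod_inv by exact Hw. field. lra. }
    destruct (Rlt_dec (Cmod w) rho) as [L1|L1], (Rlt_dec (Cmod (/ w)) rho) as [L2|L2].
    + apply La; assumption.
    + unfold gN. replace (/ / w) with w by (field; exact Hw). field. exact Hw.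
    + unfold gP. ring.
    + exfalso. nra.
Qed.

(** ** Contour integrals of the two parts *)

Lemma hol_Dn1 f a z : hol rho f a -> off_ray rho z -> Dn 1 f z.
Proof. intros (_ & _ & H) Hz. apply (H z Hz). Qed.

Lemma quot_hol f a u : hol rho f a -> off_ray rho u ->
  exists l, forall z, off_ray rho z -> Dn 1 (quot f u l) z.
Proof.
  intros (_ & _ & H) Hu. destruct (quot_Dn1 f u (H u Hu)) as (l & _ & D). exists l.
  intros z Hz. destruct (classic (z = u)) as [->|N]; [exact D|].
  apply quot_smooth_away; [exact N|apply H, Hz].
Qed.

(** The cut [[0, 1 / rho]] is avoided in the form that [1 / w] stays off the ray. *)
Definition loop (gam : R -> C) : Prop :=
  piecewise_C1 gam /\ gam 0%R = gam 1%R /\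
  (forall t, (0 <= t <= 1)%R ->
     gam t <> 0 /\ off_ray rho (gam t) /\ off_ray rho (/ gam t)) /\
  cint gam (fun w => / w) (2 * PI * Ci).

Lemma cint_star gam f : loop gam -> (forall z, off_ray rho z -> Dn 1 f z) -> cint gam f 0.
Proof.
  intros (Hp & Hc & Ho & _) Hf.
  replace (RtoC 0) with (star_primitive f (gam 1%R) - star_primitive f (gam 0%R))
    by (rewrite Hc; ring).
  apply cint_ftc; [exact Hp|]. intros t Ht. destruct (Ho t Ht) as (_ & O & _). split.
  - apply (star_primitive_cderiv rho); [lra|exact Hf|exact O].
  - apply (Dn_ccont 1), Hf, O.
Qed.

(** The primitive on the other side is [- star_primitive f (1 / w)]. *)
Lemma cint_star_inv gam f : loop gam -> (forall z, off_ray rho z -> Dn 1 f z) ->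
  cint gam (fun w => / w * / w * f (/ w)) 0.
Proof.
  intros (Hp & Hc & Ho & _) Hf.
  set (F := fun w => (- (1)) * star_primitive f (/ w)).
  replace (RtoC 0) with (F (gam 1%R) - F (gam 0%R)) by (rewrite Hc; ring).
  apply cint_ftc; [exact Hp|]. intros t Ht. destruct (Ho t Ht) as (N & _ & O). split.
  - eapply cderiv_eq.
    + apply cderiv_scal, (cderiv_comp (star_primitive f) (fun w => / w)); [|apply cderiv_inv, N].
      apply (star_primitive_cderiv rho); [lra|exact Hf|exact O].
    + cbv beta. ring.
  - apply ccont_mult; [apply ccont_mult; apply ccont_inv, N|].
    apply (ccont_comp f (fun w => / w)); [apply (Dn_ccont 1), Hf, O|apply ccont_inv, N].
Qed.

Lemma off_ray_0 : off_ray rho 0.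
Proof. intros [_ L]. simpl in L. lra. Qed.

(** Subtracting the constant [N 0] leaves [1 / w^2] times the difference quotient of [N], evaluated at
    [1 / w], which has a primitive. *)
Lemma cint_neg_part gam N q : loop gam -> hol rho N q ->
  cint gam (fun w => / w * N (/ w)) (2 * PI * Ci * N 0).
Proof.
  intros Hg HN. destruct (quot_hol N q 0 HN off_ray_0) as [l Hl].
  pose proof (cint_star_inv gam _ Hg Hl) as I1.
  destruct Hg as (_ & _ & Ho & W).
  pose proof (cint_plus _ _ _ _ _ I1 (cint_scal _ (N 0) _ _ W)) as I2.
  replace (2 * PI * Ci * N 0) with (0 + N 0 * (2 * PI * Ci)) by ring.
  eapply cint_ext; [|exact I2]. intros t Ht. destruct (Ho t Ht) as (N0 & _). cbv beta.
  unfold quot. destruct (excluded_middle_informative (/ gam t = 0)) as [E|E].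
  - exfalso. assert (E2 : gam t * / gam t = 1) by (field; exact N0).
    rewrite E, Cmult_0_r in E2. apply RtoC_inj in E2. lra.
  - field. exact N0.
Qed.

Lemma cint_pos_cauchy gam P p u : loop gam -> hol rho P p -> off_ray rho u ->
  (forall t, (0 <= t <= 1)%R -> gam t <> u) ->
  cint gam (fun w => / (w - u)) (2 * PI * Ci) ->
  cint gam (fun w => P w * / (w - u)) (2 * PI * Ci * P u).
Proof.
  intros Hg HP Hu Hn W. destruct (quot_hol P p u HP Hu) as [l Hl].
  pose proof (cint_star gam _ Hg Hl) as I1.
  pose proof (cint_plus _ _ _ _ _ I1 (cint_scal _ (P u) _ _ W)) as I2.
  replace (2 * PI * Ci * P u) with (0 + P u * (2 * PI * Ci)) by ring.
  eapply cint_ext; [|exact I2]. intros t Ht. specialize (Hn t Ht). cbv beta.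
  unfold quot. destruct (excluded_middle_informative (gam t = u)) as [E|E]; [contradiction|].
  field. intros Z. apply E, Ceq_minus, Z.
Qed.

(** In partial fractions the terms without a primitive are multiples of [1 / (w - u)] and [1 / w]; they
    cancel because both winding numbers are one. *)
Lemma cint_neg_cauchy gam N q (u : C) : loop gam -> hol rho N q -> u <> 0 -> off_ray rho (/ u) ->
  (forall t, (0 <= t <= 1)%R -> gam t <> u) ->
  cint gam (fun w => / (w - u)) (2 * PI * Ci) ->
  cint gam (fun w => / w * N (/ w) * / (w - u)) 0.
Proof.
  intros Hg HN Hu0 Hu Hn W. destruct (quot_hol N q (/ u) HN Hu) as [l Hl].
  pose proof (cint_star_inv gam _ Hg Hl) as I1.
  destruct Hg as (_ & _ & Ho & W0).
  pose proof (cint_plus _ _ _ _ _ (cint_scal _ (- / u) _ _ I1)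
    (cint_plus _ _ _ _ _ (cint_scal _ (N (/ u) * / u) _ _ W)
      (cint_scal _ (- (N (/ u) * / u)) _ _ W0))) as I2.
  replace (RtoC 0) with (- / u * 0 + (N (/ u) * / u * (2 * PI * Ci) +
    - (N (/ u) * / u) * (2 * PI * Ci))) by ring.
  eapply cint_ext; [|exact I2]. intros t Ht. destruct (Ho t Ht) as (N0 & _).
  specialize (Hn t Ht). cbv beta. set (w := gam t) in *.
  assert (Nw : w - u <> 0) by (intros Z; apply Hn, Ceq_minus, Z).
  assert (Nw' : u - w <> 0) by (intros Z; apply Hn; symmetry; apply Ceq_minus, Z).
  unfold quot. destruct (excluded_middle_informative (/ w = / u)) as [E|E].
  - exfalso. apply Hn. replace w with (/ / w) by (field; exact N0). rewrite E. field. exact Hu0.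
  - replace (/ w - / u) with ((u - w) / (u * w)) by (field; split; assumption).
    field. repeat split; try assumption.
Qed.

(** Only the part [N (1 / w) / w] contributes, and [N 0] is the coefficient of [1 / w]. *)
Theorem cint_residue gam phi psi a b : loop gam -> hol rho phi a -> hol rho psi b ->
  cint gam (fun w => phi w * psi (/ w)) (2 * PI * Ci * corr b a 1).
Proof.
  intros Hg Ha Hb.
  destruct (laurent_decomposition phi psi a b Ha Hb) as (P & N & HP & HN & E).
  pose proof (cint_plus _ _ _ _ _ (cint_star gam P Hg (fun z => hol_Dn1 P _ z HP))
    (cint_neg_part gam N _ Hg HN)) as I.
  assert (E0 : N 0 = corr b a 1).
  { destruct HN as (_ & HN2 & _). rewrite HN2 by (rewrite Cmod_0; lra). apply PSC_0. }
  rewrite E0, Cplus_0_l in I. eapply cint_ext; [|exact I]. intros t Ht.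
  destruct Hg as (_ & _ & Ho & _). destruct (Ho t Ht) as (N0 & _). cbv beta. symmetry.
  apply E, N0.
Qed.

(** The part [P] is reproduced, and the part with negative powers integrates to zero. *)
Theorem cint_cauchy phi psi a b : hol rho phi a -> hol rho psi b ->
  exists P, hol rho P (corr a b) /\
  forall (gam : R -> C) (u : C), loop gam -> u <> 0 -> off_ray rho u -> off_ray rho (/ u) ->
  (forall t, (0 <= t <= 1)%R -> gam t <> u) ->
  cint gam (fun w => / (w - u)) (2 * PI * Ci) ->
  cint gam (fun w => phi w * psi (/ w) * / (w - u)) (2 * PI * Ci * P u).
Proof.
  intros Ha Hb.
  destruct (laurent_decomposition phi psi a b Ha Hb) as (P & N & HP & HN & E).
  exists P. split; [exact HP|]. intros gam u Hg H0 Hu Hu' Hn W.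
  pose proof (cint_plus _ _ _ _ _ (cint_pos_cauchy gam P _ u Hg HP Hu Hn W)
    (cint_neg_cauchy gam N _ u Hg HN H0 Hu' Hn W)) as I.
  rewrite Cplus_0_r in I. eapply cint_ext; [|exact I]. intros t Ht.
  destruct Hg as (_ & _ & Ho & _). destruct (Ho t Ht) as (N0 & _). cbv beta.
  rewrite E by exact N0. ring.
Qed.

(** ** Correlations of coefficient sequences *)

Lemma fmul_fmono m b n : fmul (fmono m) b n = if Nat.leb m n then b (n - m)%nat else 0.
Proof.
  unfold fmul. destruct (Nat.leb_spec m n) as [L|L].
  - replace (S n) with (m + (1 + (n - m)))%nat by lia. rewrite !csum_app.
    rewrite csum_zero, (csum_zero (fun k => fmono m (m + (1 + k))%nat * b (n - (m + (1 + k)))%nat)).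
    + cbn [csum]. rewrite Nat.add_0_r. unfold fmono. rewrite Nat.eqb_refl. ring.
    + intros k Hk. unfold fmono. destruct (Nat.eqb_spec (m + (1 + k)) m); [lia|]. ring.
    + intros k Hk. unfold fmono. destruct (Nat.eqb_spec k m); [lia|]. ring.
  - apply csum_zero. intros k Hk. unfold fmono. destruct (Nat.eqb_spec k m); [lia|]. ring.
Qed.

Lemma corr_fmono_l a b x : psr a rho -> psr b rho ->
  corr (fmul (fmono (S x)) b) a 1 = corr a b x.
Proof.
  intros Ha Hb. unfold corr. pose proof (psr_summable a Ha) as Sa. pose proof (psr_summable b Hb) as Sb.
  rewrite (CSum_drop _ x).
  - apply CSum_ext. intros n. rewrite fmul_fmono.
    replace (Nat.leb (S x) (1 + (x + n))) with true by (symmetry; apply Nat.leb_le; lia).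
    rewrite Cmult_comm. do 2 f_equal. lia.
  - intros i Hi. rewrite fmul_fmono.
    replace (Nat.leb (S x) (1 + i)) with false by (symmetry; apply Nat.leb_gt; lia). ring.
  - apply summable_row_corr; [|exact Sa].
    apply psr_summable, psr_mul; [|exact Hb]. apply (hol_pow rho (S x)).
Qed.

Lemma corr_fmono_r a b y n : psr a rho -> psr b rho ->
  corr a (fmul (fmono y) b) n = corr a b (n + y).
Proof.
  intros Ha Hb. unfold corr. pose proof (psr_summable a Ha) as Sa. pose proof (psr_summable b Hb) as Sb.
  rewrite (CSum_drop _ y).
  - apply CSum_ext. intros k. rewrite fmul_fmono.
    replace (Nat.leb y (y + k)) with true by (symmetry; apply Nat.leb_le; lia).
    f_equal; f_equal; lia.
  - intros i Hi. rewrite fmul_fmono.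
    replace (Nat.leb y i) with false by (symmetry; apply Nat.leb_gt; lia). ring.
  - apply summable_row_corr; [exact Sa|].
    apply psr_summable, psr_mul; [|exact Hb]. apply (hol_pow rho y).
Qed.

Lemma corr_fmul a b p x : psr a rho -> psr b rho -> psr p rho ->
  corr a (fmul b p) x = CSum (fun k => p k * corr a b (x + k)).
Proof.
  intros Ha Hb Hp. pose proof (psr_summable a Ha) as Sa. pose proof (psr_summable b Hb) as Sb.
  pose proof (psr_summable p Hp) as Sp.
  set (F := fun j k => a (x + (j + k))%nat * (b j * p k)).
  assert (S2 : summable2 F).
  { destruct Sa as [M HM].
    apply (summable2_le _ (fun j k => (RtoC M * b j) * p k)).
    - intros j k. unfold F. rewrite !Cmod_mult, Cmod_R, Rmult_assoc.
      assert (HM1 : (Cmod (a (x + (j + k))%nat) <= M)%R).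
      { eapply Rle_trans; [|apply (HM (S (x + (j + k))))]. cbn [rsum].
        pose proof (rsum_pos (fun k => Cmod (a k)) (x + (j + k)) (fun k => Cmod_ge_0 _)). lra. }
      apply Rmult_le_compat_r; [apply Rmult_le_pos; apply Cmod_ge_0|].
      eapply Rle_trans; [exact HM1|apply Rle_abs].
    - apply summable2_prod; [apply summable_scal, Sb|exact Sp]. }
  transitivity (CSum (fun i => csum (fun j => F j (i - j)%nat) (S i))).
  - apply CSum_ext. intros i. unfold fmul. rewrite <- csum_scal. apply csum_ext. intros j Hj.
    unfold F. do 3 f_equal. lia.
  - rewrite (CSum_diag F S2). change (CSum (fun i => CSum (fun j => F i j)) =
      CSum (fun k => p k * corr a b (x + k))). rewrite (CSum_swap F S2).
    apply CSum_ext. intros k. unfold corr. rewrite <- CSum_scal by (apply summable_row_corr; assumption).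
    apply CSum_ext. intros j. unfold F. replace (x + (j + k))%nat with (x + k + j)%nat by lia. ring.
Qed.

End Laurent.

(** * The operator of the process in terms of binomial coefficients *)

Definition admissible_parameter (nu : C) : Prop :=
  (Im nu = 0%R /\ (0 <= Re nu < / 2)%R) \/ Re nu = 0%R.

(** The function in [gamma_reflection] is [cos (2 nu t)] for real [nu], and for [nu = i m] it is
    [cosh (2 m t)]. *)
Lemma reflection_parameter nu : admissible_parameter nu ->
  exists k g0 : R, (k < / 4)%R /\ (0 < g0)%R /\
  (/ 2 - nu) * (/ 2 + nu) = / 4 - RtoC k /\
  CGamma (/ 2 - nu) * CGamma (/ 2 + nu) = RtoC g0 /\
  RtoC g0 * Ccos (PI * nu) = RtoC PI.
Proof.
  intros H.
  assert (Hs : (/ 2 - nu) + (/ 2 + nu) = 1) by field.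
  assert (Hh : / RtoC 2 = RtoC (/ 2)) by (rewrite RtoC_inv by lra; reflexivity).
  assert (Hq : / RtoC 4 = RtoC (/ 4)) by (rewrite RtoC_inv by lra; reflexivity).
  assert (Fin : forall (phi phi1 : R -> R) (k : R),
    (forall t : R, is_derive phi t (phi1 t)) ->
    (forall t : R, is_derive phi1 t (- 4 * k * phi t)%R) ->
    phi 0%R = 1%R -> phi1 0%R = 0%R -> (k < / 4)%R -> (0 < Re (/ 2 - nu))%R ->
    (0 < Re (/ 2 + nu))%R -> (/ 2 - nu) * (/ 2 + nu) = / 4 - RtoC k -> (0 < phi (PI / 2))%R ->
    Ccos (PI * nu) = RtoC (phi (PI / 2)%R) ->
    exists k g0 : R, (k < / 4)%R /\ (0 < g0)%R /\
    (/ 2 - nu) * (/ 2 + nu) = / 4 - RtoC k /\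
    CGamma (/ 2 - nu) * CGamma (/ 2 + nu) = RtoC g0 /\
    RtoC g0 * Ccos (PI * nu) = RtoC PI).
  { intros phi phi1 k D1 D2 P0 P1 Hk Hc Hd Hp Hpos HC.
    pose proof (gamma_reflection _ _ phi phi1 k D1 D2 P0 P1 Hs Hp Hc Hd) as G.
    assert (N : RtoC (phi (PI / 2)%R) <> 0) by (intros E; apply RtoC_inj in E; lra).
    exists k, (PI / phi (PI / 2))%R. pose proof PI_RGT_0.
    assert (E : CGamma (/ 2 - nu) * CGamma (/ 2 + nu) = RtoC (PI / phi (PI / 2)%R)%R).
    { rewrite RtoC_div by lra. rewrite <- G. field. exact N. }
    split; [exact Hk|]. split; [apply Rdiv_lt_0_compat; assumption|].
    split; [exact Hp|]. split; [exact E|]. rewrite HC, <- E. exact G. }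
  rewrite (surjective_pairing nu) in *. set (r := fst nu) in *. set (m := snd nu) in *.
  unfold admissible_parameter in H. unfold Re, Im in H. simpl in H.
  destruct H as [[Hm Hr]|Hr].
  - rewrite Hm in *.
    apply (Fin (fun t => cos (2 * r * t)) (fun t => - 2 * r * sin (2 * r * t))%R (r ^ 2)%R).
    + intros t. auto_derive; [trivial|ring].
    + intros t. auto_derive; [trivial|ring].
    + rewrite Rmult_0_r. apply cos_0.
    + rewrite Rmult_0_r, sin_0. ring.
    + nra.
    + rewrite Hh. simpl. lra.
    + rewrite Hh. simpl. lra.
    + rewrite Hh, Hq. apply injective_projections; simpl; field.
    + apply cos_gt_0; pose proof PI_RGT_0; nra.
    + replace (2 * r * (PI / 2))%R with (PI * r)%R by field.
      assert (E1 : Ci * (RtoC PI * (r, 0%R)) = (0%R, (PI * r)%R))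
        by (unfold Cmult, Ci, RtoC; simpl; f_equal; ring).
      unfold Ccos. rewrite E1. unfold Cexp, Copp. simpl.
      rewrite Ropp_0, exp_0, cos_neg, sin_neg. unfold Cdiv. rewrite Hh.
      apply injective_projections; simpl; field.
  - rewrite Hr in *.
    apply (Fin (fun t => cosh (2 * m * t)) (fun t => 2 * m * sinh (2 * m * t))%R (- m ^ 2)%R).
    + intros t. unfold cosh, sinh. auto_derive; [trivial|field].
    + intros t. unfold cosh, sinh. auto_derive; [trivial|field].
    + rewrite Rmult_0_r. apply cosh_0.
    + rewrite Rmult_0_r, sinh_0. ring.
    + nra.
    + rewrite Hh. simpl. lra.
    + rewrite Hh. simpl. lra.
    + rewrite Hh, Hq. apply injective_projections; simpl; field.
    + unfold cosh. pose proof (exp_pos (2 * m * (PI / 2))). pose proof (exp_pos (- (2 * m * (PI / 2)))).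
      lra.
    + replace (2 * m * (PI / 2))%R with (PI * m)%R by field.
      assert (E1 : Ci * (RtoC PI * (0%R, m)) = ((- (PI * m))%R, 0%R))
        by (unfold Cmult, Ci, RtoC; simpl; f_equal; ring).
      unfold Ccos. rewrite E1. unfold Cexp, Copp. simpl.
      rewrite Ropp_0, Ropp_involutive, cos_0, sin_0. unfold Cdiv, cosh. rewrite Hh.
      apply injective_projections; simpl; field.
Qed.

(** [wt k n] is [binc c n * binc d n] when [c + d = 1] and [c * d = 1/4 - k]. *)
Fixpoint wt (k : R) (n : nat) : R :=
  match n with
  | O => 1%R
  | S m => (wt k m * (((INR m + / 2) ^ 2 - k) / INR (S m) ^ 2))%R
  end.

Lemma wt_pos k n : (k < / 4)%R -> (0 < wt k n)%R.
Proof.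
  intros Hk. induction n as [|n IH]; [simpl; lra|]. cbn [wt].
  apply Rmult_lt_0_compat; [exact IH|]. pose proof (pos_INR n).
  apply Rdiv_lt_0_compat; [nra|]. apply pow_lt, lt_0_INR. lia.
Qed.

Lemma wt_binc c d k n : c + d = 1 -> c * d = / 4 - RtoC k ->
  binc c n * binc d n = RtoC (wt k n).
Proof.
  intros Hs Hp. induction n as [|n IH]; [simpl; ring|].
  cbn [binc wt].
  assert (N : INR (S n) <> 0%R) by (apply not_0_INR; lia).
  rewrite RtoC_mult, <- IH, RtoC_div by (apply pow_nonzero, N).
  rewrite RtoC_minus, !RtoC_pow, RtoC_plus, RtoC_inv by lra.
  change (RtoC (INR n)) with (natC n). change (RtoC (INR (S n))) with (natC (S n)).
  replace ((natC n + / 2) ^ 2 - RtoC k) with ((c + natC n) * (d + natC n)).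
  - field. apply natC_neq. lia.
  - transitivity (c * d + (c + d) * natC n + natC n * natC n); [ring|]. rewrite Hs, Hp.
    simpl. field.
Qed.

Lemma IZR_pos_natC (x : positive) : RtoC (IZR (Zpos x)) = natC (Pos.to_nat x).
Proof. unfold natC. rewrite INR_IPR. reflexivity. Qed.

Lemma sqrt_unit (xi : R) : (0 < xi < 1)%R -> (0 < sqrt xi < 1)%R.
Proof.
  intros H. split; [apply sqrt_lt_R0; lra|]. rewrite <- sqrt_1. apply sqrt_lt_1_alt. lra.
Qed.

Lemma sqrt_unit_sq (xi : R) : (0 < xi < 1)%R -> (sqrt xi * sqrt xi = xi)%R.
Proof. intros H. apply sqrt_sqrt. lra. Qed.

Section Weights.

Variable (nu : C).
Hypothesis Hnu : admissible_parameter nu.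

Let c := / 2 - nu.
Let d := / 2 + nu.

Lemma half_sum : c + d = 1.
Proof. unfold c, d. field. Qed.

Lemma Re_cd : ((0 < Re c < 1) /\ (0 < Re d < 1) /\ Re c <= Re d)%R.
Proof.
  assert (Hh : / RtoC 2 = RtoC (/ 2)) by (rewrite RtoC_inv by lra; reflexivity).
  unfold c, d. rewrite Hh. destruct nu as [r m].
  unfold admissible_parameter in Hnu. simpl in *.
  destruct Hnu as [[_ H]|H]; repeat split; lra.
Qed.

Lemma binc_cd_bounded : exists B, (0 <= B)%R /\
  (forall n, (Cmod (binc c n) <= B)%R) /\ (forall n, (Cmod (binc d n) <= B)%R).
Proof.
  destruct Re_cd as (H1 & H2 & _).
  destruct (binc_bounded c ltac:(lra)) as [B1 HB1]. destruct (binc_bounded d ltac:(lra)) as [B2 HB2].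
  exists (Rmax B1 B2). split; [|split].
  - eapply Rle_trans; [|apply Rmax_l]. eapply Rle_trans; [apply Cmod_ge_0|apply (HB1 O)].
  - intros n. eapply Rle_trans; [apply HB1|apply Rmax_l].
  - intros n. eapply Rle_trans; [apply HB2|apply Rmax_r].
Qed.

(** Conjugation by [gauge] turns the symmetric matrix of the process into one whose entries are
    holomorphic in the parameter; the ratios of its values are those of [g_factor]. *)
Definition gauge (k : R) (n : nat) : C := RtoC (sqrt (wt k n)) / binc d n.

Variables (k g0 : R).
Hypothesis Hk : (k < / 4)%R.
Hypothesis Hg0 : (0 < g0)%R.
Hypothesis Hcd : c * d = / 4 - RtoC k.
Hypothesis HG : CGamma c * CGamma d = RtoC g0.
Hypothesis HGcos : RtoC g0 * Ccos (PI * nu) = RtoC PI.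

Lemma binc_cd_wt n : binc c n * binc d n = RtoC (wt k n).
Proof. apply wt_binc; [apply half_sum|exact Hcd]. Qed.

Lemma binc_d_neq n : binc d n <> 0.
Proof.
  intros E. pose proof (binc_cd_wt n) as W. rewrite E, Cmult_0_r in W. apply RtoC_inj in W.
  pose proof (wt_pos k n Hk). lra.
Qed.

Lemma sqrt_wt_neq n : RtoC (sqrt (wt k n)) <> 0.
Proof.
  intros E. apply RtoC_inj in E. pose proof (sqrt_lt_R0 _ (wt_pos k n Hk)). lra.
Qed.

Lemma sqrt_wt_sq n : RtoC (sqrt (wt k n)) * RtoC (sqrt (wt k n)) = binc c n * binc d n.
Proof. rewrite binc_cd_wt, <- RtoC_mult, sqrt_sqrt; [reflexivity|]. left. apply wt_pos, Hk. Qed.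

Lemma gauge_neq n : gauge k n <> 0.
Proof.
  intros E. apply (sqrt_wt_neq n).
  replace (RtoC (sqrt (wt k n))) with (gauge k n * binc d n)
    by (unfold gauge; field; apply binc_d_neq).
  rewrite E. ring.
Qed.

Lemma Re_c_pos : (0 < Re c)%R. Proof. apply Re_cd. Qed.
Lemma Re_d_pos : (0 < Re d)%R. Proof. apply Re_cd. Qed.

Lemma CGamma_d_neq : CGamma d <> 0.
Proof.
  intros E. rewrite E, Cmult_0_r in HG. apply RtoC_inj in HG. lra.
Qed.

Lemma g_factor_value x :
  g_factor nu (Zpos x) = gauge k (Pos.to_nat x) * (RtoC (sqrt g0) / CGamma d).
Proof.
  unfold g_factor. rewrite (IZR_pos_natC x). fold c d. set (n := Pos.to_nat x).
  rewrite !CGamma_shift by (apply Re_c_pos || apply Re_d_pos).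
  replace (CGamma d * binc d n * RtoC (INR (fact n)) * (CGamma c * binc c n * RtoC (INR (fact n))))
    with (RtoC (g0 * (INR (fact n) ^ 2 * wt k n))).
  - change (Re (RtoC (g0 * (INR (fact n) ^ 2 * wt k n)))) with (g0 * (INR (fact n) ^ 2 * wt k n))%R.
    rewrite sqrt_mult_alt by lra. rewrite sqrt_mult_alt by apply pow2_ge_0.
    rewrite sqrt_pow2 by apply pos_INR. rewrite !RtoC_mult. unfold gauge.
    pose proof CGamma_d_neq. pose proof (binc_d_neq n).
    assert (Nf : RtoC (INR (fact n)) <> 0) by (intros E; apply RtoC_inj in E; apply (INR_fact_neq_0 n E)).
    field. repeat split; assumption.
  - rewrite !RtoC_mult, RtoC_pow, <- binc_cd_wt, <- HG. ring.
Qed.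

Lemma g_factor_ratio x y :
  g_factor nu (Zpos x) / g_factor nu (Zpos y) = gauge k (Pos.to_nat x) / gauge k (Pos.to_nat y).
Proof.
  rewrite !g_factor_value.
  assert (RtoC (sqrt g0) <> 0).
  { intros E. apply RtoC_inj in E. pose proof (sqrt_lt_R0 _ Hg0). lra. }
  pose proof CGamma_d_neq. pose proof (gauge_neq (Pos.to_nat y)). field. repeat split; assumption.
Qed.

(** ** Growth of the gauge *)

Lemma binc_c_le_d n : (Cmod (binc c n) <= Cmod (binc d n))%R.
Proof.
  induction n as [|n IH]; [simpl; lra|]. cbn [binc]. rewrite !Cmod_mult.
  apply Rmult_le_compat; try apply Cmod_ge_0; [exact IH|].
  assert (N : natC (S n) <> 0) by (apply natC_neq; lia).
  rewrite !Cmod_div by exact N. apply Rmult_le_compat_r.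
  { left. apply Rinv_0_lt_compat, Cmod_gt_0, N. }
  apply Rsqr_incr_0_var; [|apply Cmod_ge_0]. rewrite !Rsqr_pow2, !Cmod2_alt.
  destruct Re_cd as ((H1 & _) & _ & H3).
  assert (Ei : ((Im (c + natC n)) ^ 2 = (Im (d + natC n)) ^ 2)%R).
  { assert (Hh : / RtoC 2 = RtoC (/ 2)) by (rewrite RtoC_inv by lra; reflexivity).
    unfold c, d, natC. rewrite Hh. unfold Im. simpl. ring. }
  rewrite Ei. apply Rplus_le_compat_r.
  replace (Re (c + natC n)) with (Re c + INR n)%R by reflexivity.
  replace (Re (d + natC n)) with (Re d + INR n)%R by reflexivity.
  pose proof (pos_INR n). apply pow_incr. lra.
Qed.

(** As [Re (d - c) < 1], the ratio of the coefficients grows at most linearly. *)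
Lemma binc_d_le_c : exists G, (1 <= G)%R /\
  forall n, (Cmod (binc d (S n)) <= G * INR (S n) * Cmod (binc c (S n)))%R.
Proof.
  assert (Hc0 : (0 < Cmod c)%R).
  { pose proof Re_c_pos. pose proof (re_le_Cmod c). rewrite Rabs_pos_eq in *; lra. }
  exists (1 + Cmod d / Cmod c)%R. set (q := (Cmod d / Cmod c)%R).
  assert (Hq : (0 <= q)%R) by (apply Rdiv_le_0_compat; [apply Cmod_ge_0|exact Hc0]).
  split; [lra|]. induction n as [|n IH].
  - cbn [binc]. rewrite natC_0, !Cplus_0_r, !Cmult_1_l. simpl (natC 1).
    assert (N : natC 1 <> 0) by (apply natC_neq; lia).
    rewrite !Cmod_div by exact N. simpl (INR 1).
    unfold natC. simpl (INR 1). rewrite Cmod_R, Rabs_R1.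
    replace (Cmod d / 1)%R with (q * Cmod c)%R by (unfold q; field; lra).
    unfold Rdiv. rewrite Rinv_1. nra.
  - change (binc d (S (S n))) with (binc d (S n) * ((d + natC (S n)) / natC (S (S n)))).
    change (binc c (S (S n))) with (binc c (S n) * ((c + natC (S n)) / natC (S (S n)))).
    assert (N : natC (S (S n)) <> 0) by (apply natC_neq; lia).
    rewrite !Cmod_mult, !Cmod_div by exact N.
    assert (Step : (Cmod (d + natC (S n)) * INR (S n) <= Cmod (c + natC (S n)) * INR (S (S n)))%R).
    { rewrite (S_INR (S n)). set (x := INR (S n)).
      assert (Hx : (0 < x)%R) by (apply lt_0_INR; lia).
      assert (Hh : / RtoC 2 = RtoC (/ 2)) by (rewrite RtoC_inv by lra; reflexivity).
      unfold c, d, natC. fold x. rewrite Hh.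
      unfold admissible_parameter in Hnu. destruct Hnu as [[Hm Hr]|Hr].
      - rewrite (surjective_pairing nu). unfold Im, Re in Hm, Hr. rewrite Hm.
        set (r := fst nu) in *.
        replace (RtoC (/ 2) + (r, 0%R) + RtoC x) with (RtoC (/ 2 + r + x))
          by (unfold Cplus, RtoC; simpl; f_equal; ring).
        replace (RtoC (/ 2) - (r, 0%R) + RtoC x) with (RtoC (/ 2 - r + x))
          by (unfold Cminus, Copp, Cplus, RtoC; simpl; f_equal; ring).
        rewrite !Cmod_R, !Rabs_pos_eq by lra. nra.
      - assert (E : Cmod (RtoC (/ 2) + nu + RtoC x) = Cmod (RtoC (/ 2) - nu + RtoC x)).
        { rewrite (surjective_pairing nu). unfold Re in Hr. rewrite Hr.
          rewrite <- Cmod_conj. f_equal. unfold Cconj, Cminus, Copp, Cplus, RtoC; simpl.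
          f_equal; ring. }
        rewrite E. apply Rmult_le_compat_l; [apply Cmod_ge_0|lra]. }
    set (u := Cmod (binc d (S n))) in *. set (v := Cmod (binc c (S n))) in *.
    set (D := Cmod (d + natC (S n))) in *. set (K := Cmod (c + natC (S n))) in *.
    assert (Hz : (0 < Cmod (natC (S (S n))))%R) by (apply Cmod_gt_0, N).
    set (z := Cmod (natC (S (S n)))) in *.
    assert (0 <= D)%R by apply Cmod_ge_0. assert (0 <= K)%R by apply Cmod_ge_0.
    assert (0 <= v)%R by apply Cmod_ge_0.
    apply Rmult_le_reg_r with z; [exact Hz|].
    replace (u * (D / z) * z)%R with (u * D)%R by (field; lra).
    replace ((1 + q) * INR (S (S n)) * (v * (K / z)) * z)%R
      with ((1 + q) * v * (K * INR (S (S n))))%R by (field; lra).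
    apply Rle_trans with ((1 + q) * INR (S n) * v * D)%R; [apply Rmult_le_compat_r; assumption|].
    replace ((1 + q) * INR (S n) * v * D)%R with ((1 + q) * v * (D * INR (S n)))%R by ring.
    apply Rmult_le_compat_l; [apply Rmult_le_pos; lra|exact Step].
Qed.

Lemma Cmod_gauge_sq n : (Cmod (gauge k n) ^ 2 * Cmod (binc d n) = Cmod (binc c n))%R.
Proof.
  unfold gauge. pose proof (binc_d_neq n) as N. rewrite Cmod_div by exact N.
  apply Cmod_gt_0 in N.
  assert (Q : (Cmod (RtoC (sqrt (wt k n))) ^ 2 = Cmod (binc c n) * Cmod (binc d n))%R).
  { rewrite <- Cmod_mult, <- sqrt_wt_sq, Cmod_mult. ring. }
  unfold Rdiv. rewrite Rpow_mult_distr, Q. field. lra.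
Qed.

Lemma gauge_le n : (Cmod (gauge k n) <= 1)%R.
Proof.
  pose proof (Cmod_gauge_sq n) as E. pose proof (binc_c_le_d n) as L.
  pose proof (binc_d_neq n) as N. apply Cmod_gt_0 in N. pose proof (Cmod_ge_0 (gauge k n)).
  apply Rnot_lt_le. intros Hlt. assert (1 < Cmod (gauge k n) ^ 2)%R by nra. nra.
Qed.

Lemma gauge_inv_le : exists G, (1 <= G)%R /\
  forall n, (Cmod (/ gauge k (S n)) <= G * INR (S n))%R.
Proof.
  destruct binc_d_le_c as (G & HG1 & HB). exists G. split; [exact HG1|]. intros n.
  pose proof (Cmod_gauge_sq (S n)) as E. specialize (HB n).
  pose proof (binc_d_neq (S n)) as N. apply Cmod_gt_0 in N.
  pose proof (gauge_neq (S n)) as Ng. rewrite Cmod_inv by exact Ng. apply Cmod_gt_0 in Ng.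
  set (g := Cmod (gauge k (S n))) in *. set (u := Cmod (binc d (S n))) in *.
  rewrite <- E in HB.
  assert (Hx : (1 <= INR (S n))%R) by (rewrite S_INR; pose proof (pos_INR n); lra).
  set (z := (G * INR (S n))%R) in *. assert (Hz : (1 <= z)%R) by (unfold z; nra).
  assert (A : (1 <= z * g ^ 2)%R).
  { apply Rmult_le_reg_r with u; [exact N|]. lra. }
  apply Rmult_le_reg_r with g; [exact Ng|]. rewrite Rinv_l by lra.
  apply Rnot_lt_le. intros Hlt. assert (z * g * (z * g) < 1 * 1)%R by (apply Rmult_le_0_lt_compat; nra).
  assert (z * g ^ 2 <= z * g * (z * g))%R.
  { replace (z * g * (z * g))%R with (z * (z * g ^ 2))%R by ring.
    rewrite <- (Rmult_1_l (z * g ^ 2)) at 1. apply Rmult_le_compat_r; [nra|exact Hz]. }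
  lra.
Qed.

(** ** The matrix of the process *)

Variable (xi : R).
Hypothesis Hxi : (0 < xi < 1)%R.
Let s := sqrt xi.

Lemma psi_value x : psi nu xi x = RtoC (xi ^ Pos.to_nat x * wt k (Pos.to_nat x) / 2).
Proof.
  unfold psi. rewrite (IZR_pos_natC x). fold c d. set (n := Pos.to_nat x).
  rewrite !CGamma_shift by (apply Re_c_pos || apply Re_d_pos).
  assert (Nf : RtoC (INR (fact n)) <> 0) by (intros E; apply RtoC_inj in E; apply (INR_fact_neq_0 n E)).
  assert (NPI : RtoC PI <> 0) by (intros E; apply RtoC_inj in E; pose proof PI_RGT_0; lra).
  assert (N2 : RtoC 2 <> 0) by (intros E; apply RtoC_inj in E; lra).
  rewrite RtoC_div, RtoC_mult, <- binc_cd_wt, RtoC_pow by lra.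
  transitivity (RtoC xi ^ n * (binc c n * binc d n) / 2 *
    ((CGamma c * CGamma d) * Ccos (PI * nu) / PI)).
  - field. repeat split; assumption.
  - rewrite HG, HGcos. field. repeat split; assumption.
Qed.

Lemma L_kernel_value x y :
  RtoC (L_kernel nu xi x y) = gauge k (Pos.to_nat y) / gauge k (Pos.to_nat x) *
    (RtoC (sqrt (IZR (Zpos x) * IZR (Zpos y))) * RtoC (s ^ (Pos.to_nat x + Pos.to_nat y)) *
     (binc c (Pos.to_nat x) * binc d (Pos.to_nat y) / natC (Pos.to_nat x + Pos.to_nat y))).
Proof.
  unfold L_kernel. rewrite !psi_value, !re_RtoC || unfold Re; simpl fst.
  set (n := Pos.to_nat x). set (m := Pos.to_nat y).
  pose proof (wt_pos k n Hk) as Wn. pose proof (wt_pos k m Hk) as Wm.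
  assert (Px : (0 <= IZR (Zpos x))%R) by (apply IZR_le; lia).
  assert (Py : (0 <= IZR (Zpos y))%R) by (apply IZR_le; lia).
  assert (E : (sqrt (IZR (Zpos x) * IZR (Zpos y) * (xi ^ n * wt k n / 2) * (xi ^ m * wt k m / 2)) =
    sqrt (IZR (Zpos x) * IZR (Zpos y)) * s ^ (n + m) * (sqrt (wt k n) * sqrt (wt k m)) / 2)%R).
  { pose proof (sqrt_unit xi Hxi) as Hs0. pose proof (sqrt_unit_sq xi Hxi) as Hs2. fold s in Hs0, Hs2.
    replace (IZR (Zpos x) * IZR (Zpos y) * (xi ^ n * wt k n / 2) * (xi ^ m * wt k m / 2))%R
      with ((IZR (Zpos x) * IZR (Zpos y)) * ((s ^ (n + m) / 2) ^ 2 * (wt k n * wt k m)))%R.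
    - rewrite (sqrt_mult_alt (IZR (Zpos x) * IZR (Zpos y))) by (apply Rmult_le_pos; assumption).
      rewrite (sqrt_mult_alt ((s ^ (n + m) / 2) ^ 2)) by apply pow2_ge_0.
      rewrite (sqrt_mult_alt (wt k n)) by lra.
      rewrite sqrt_pow2 by (apply Rdiv_le_0_compat; [apply pow_le|]; lra). field.
    - rewrite <- Hs2, pow_add, !Rpow_mult_distr. field. }
  rewrite E. unfold gauge.
  pose proof (binc_d_neq n) as B1. pose proof (binc_d_neq m) as B2.
  pose proof (sqrt_wt_neq n) as S1. pose proof (sqrt_wt_neq m) as S2.
  assert (Nz : natC (n + m) <> 0).
  { apply natC_neq. pose proof (Pos2Nat.is_pos x). unfold n. lia. }
  assert (Ez : (IZR (Zpos x) + IZR (Zpos y))%R = INR (n + m)).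
  { rewrite plus_INR. unfold n, m. rewrite !INR_IPR. reflexivity. }
  rewrite Ez.
  replace (2 * (sqrt (IZR (Zpos x) * IZR (Zpos y)) * s ^ (n + m) * (sqrt (wt k n) * sqrt (wt k m)) / 2)
    / INR (n + m))%R with (sqrt (IZR (Zpos x) * IZR (Zpos y)) * s ^ (n + m) *
    (sqrt (wt k n) * sqrt (wt k m)) / INR (n + m))%R.
  2:{ field. intros Z. apply Nz. unfold natC. rewrite Z. reflexivity. }
  rewrite RtoC_div by (intros Z; apply Nz; unfold natC; rewrite Z; reflexivity).
  rewrite !RtoC_mult. change (RtoC (INR (n + m))) with (natC (n + m)).
  set (A := RtoC (sqrt (IZR (Zpos x) * IZR (Zpos y)))). set (P := RtoC (s ^ (n + m))).
  pose proof (sqrt_wt_sq n) as Q.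
  set (a := RtoC (sqrt (wt k n))) in *. set (b := RtoC (sqrt (wt k m))) in *.
  transitivity (A * P * b / natC (n + m) * ((binc c n * binc d n) / a)).
  - rewrite <- Q. field. split; assumption.
  - field. repeat split; assumption.
Qed.

End Weights.

(** ** The correlation kernel *)

Section CorrelationKernel.

Variables (xi : R) (nu : C).
Hypothesis Hxi : (0 < xi < 1)%R.
Hypothesis Hnu : admissible_parameter nu.

Let c := / 2 - nu.
Let d := / 2 + nu.
Let s := sqrt xi.

Definition ker (n m : nat) : C := fev xi (kerK c d n m).

Lemma ker_row_equation n m : (0 < n)%nat -> (0 < m)%nat ->
  summable (fun i => kernel_term xi c d n m (S i)) /\
  binc c n * binc d m / natC (n + m) = ker n m +
  binc c n * CSum (fun i => kernel_term xi c d n m (S i)).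
Proof.
  intros Hn Hm. destruct (binc_cd_bounded nu Hnu) as (B & _ & HB1 & HB2). split.
  - apply (summable_S (kernel_term xi c d n m)). apply (kernel_term_summable xi Hxi c d B); assumption.
  - apply (kernel_row_equation xi Hxi c d (half_sum nu) B HB1 HB2 n m Hn Hm).
Qed.

(** The transposed equation is the same one with [nu] replaced by [- nu]. *)
Lemma ker_col_equation n m : (0 < n)%nat -> (0 < m)%nat ->
  summable (fun i => kernel_term xi d c m n (S i)) /\
  binc c n * binc d m / natC (n + m) = ker n m +
  binc d m * CSum (fun i => kernel_term xi d c m n (S i)).
Proof.
  intros Hn Hm. destruct (binc_cd_bounded nu Hnu) as (B & _ & HB1 & HB2).
  assert (Hdc : d + c = 1) by (rewrite Cplus_comm; apply half_sum). split.
  - apply (summable_S (kernel_term xi d c m n)). apply (kernel_term_summable xi Hxi d c B); assumption.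
  - pose proof (kernel_row_equation xi Hxi d c Hdc B HB2 HB1 m n Hm Hn) as E.
    rewrite kerK_sym in E. rewrite (Nat.add_comm n m), (Cmult_comm (binc c n)). exact E.
Qed.

(** The fourth formal derivative of the geometric series converges absolutely. *)
Lemma quartic_geometric_bound : exists M : R,
  forall n, (rsum (fun i => INR (S i) ^ 4 * xi ^ S i) n <= M)%R.
Proof.
  assert (P : psr (dcoef (dcoef (dcoef (dcoef (fun _ => RtoC 1))))) 1).
  { do 4 apply psr_dcoef. apply (psr_bounded _ 1). intros n. rewrite Cmod_1. lra. }
  destruct (P xi ltac:(lra)) as [M HM]. exists M. intros n. eapply Rle_trans; [|apply (HM n)].
  apply rsum_le. intros i _. unfold dcoef. rewrite !Cmod_mult, Cmod_1, Cmod_R. unfold natC.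
  rewrite !Cmod_R, !Rabs_pos_eq by (apply pos_INR || (apply pow_le; lra)).
  rewrite !S_INR. pose proof (pos_INR i) as Hi. set (x := INR i) in *.
  assert (Hp : (0 <= xi ^ i)%R) by (apply pow_le; lra).
  replace (xi ^ S i)%R with (xi * xi ^ i)%R by reflexivity.
  assert (A : ((x + 1) ^ 4 <= (x + 1) * ((x + 1 + 1) * ((x + 1 + 1 + 1) * ((x + 1 + 1 + 1 + 1) * 1))))%R).
  { simpl. apply Rmult_le_compat_l; [lra|]. repeat apply Rmult_le_compat; try lra; nra. }
  assert (A0 : (0 <= (x + 1) ^ 4)%R) by (apply pow_le; lra).
  apply Rle_trans with ((x + 1) ^ 4 * xi ^ i)%R.
  - apply Rmult_le_compat_l; [exact A0|]. nra.
  - apply Rmult_le_compat_r; assumption.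
Qed.

(** The gauge and its inverse grow at most linearly, so both conjugated matrices are dominated by a multiple of
    [x^2 s^x y^2 s^y], and the row and column equations identify [K] by [matrix_entry_resolvent]. *)
Lemma K_kernel_value x y :
  g_factor nu (Zpos x) / g_factor nu (Zpos y) * K_kernel nu xi x y =
  RtoC (sqrt (IZR (Zpos x) * IZR (Zpos y))) * RtoC (s ^ (Pos.to_nat x + Pos.to_nat y)) *
    ker (Pos.to_nat x) (Pos.to_nat y).
Proof.
  destruct (reflection_parameter nu Hnu) as (k & g0 & Hk & Hg0 & Hcd & HG & HGc).
  pose proof (gauge_neq nu k Hk Hcd) as Ng.
  rewrite (g_factor_ratio nu Hnu k g0 Hk Hg0 Hcd HG).
  set (ga := gauge nu k).
  set (root := fun x y : positive => RtoC (sqrt (IZR (Zpos x) * IZR (Zpos y)))).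
  set (Lm := fun x y => ga (Pos.to_nat y) / ga (Pos.to_nat x) *
    (root x y * RtoC (s ^ (Pos.to_nat x + Pos.to_nat y)) *
     (binc c (Pos.to_nat x) * binc d (Pos.to_nat y) / natC (Pos.to_nat x + Pos.to_nat y)))).
  set (Km := fun x y => ga (Pos.to_nat y) / ga (Pos.to_nat x) *
    (root x y * RtoC (s ^ (Pos.to_nat x + Pos.to_nat y)) * ker (Pos.to_nat x) (Pos.to_nat y))).
  assert (EL : (fun x y => RtoC (L_kernel nu xi x y)) = Lm).
  { apply functional_extensionality. intros a. apply functional_extensionality. intros b.
    apply (L_kernel_value nu Hnu k g0 Hk Hcd HG HGc xi Hxi). }
  assert (root_split : forall a b z, root a z * root z b = root a b * natC (Pos.to_nat z)).
  { intros a b z. unfold root. rewrite <- IZR_pos_natC, <- !RtoC_mult. f_equal.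
    assert (Pa : (0 <= IZR (Zpos a))%R) by (apply IZR_le; lia).
    assert (Pb : (0 <= IZR (Zpos b))%R) by (apply IZR_le; lia).
    assert (Pz : (0 <= IZR (Zpos z))%R) by (apply IZR_le; lia).
    rewrite !sqrt_mult by assumption.
    transitivity (sqrt (IZR (Zpos a)) * sqrt (IZR (Zpos b)) *
      (sqrt (IZR (Zpos z)) * sqrt (IZR (Zpos z))))%R; [ring|].
    rewrite sqrt_sqrt by exact Pz. reflexivity. }
  assert (pow_split : forall i n m, RtoC (s ^ (n + i)) * RtoC (s ^ (i + m)) =
    RtoC (s ^ (n + m)) * RtoC (xi ^ i)).
  { intros i n m. rewrite <- !RtoC_mult. f_equal.
    rewrite <- (sqrt_unit_sq xi Hxi). fold s. rewrite !pow_add, Rpow_mult_distr. ring. }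
  assert (ix_nat : forall i, Pos.to_nat (ix i) = S i) by (intros; apply SuccNat2Pos.id_succ).
  assert (posn : forall z, (0 < Pos.to_nat z)%nat) by (intros; apply Pos2Nat.is_pos).
  assert (key1 : forall a b, Lm a b = Km a b + CSum (fun i => Lm a (ix i) * Km (ix i) b)).
  { intros a b. set (n := Pos.to_nat a). set (m := Pos.to_nat b).
    destruct (ker_row_equation n m (posn a) (posn b)) as [Sm E].
    set (pre := ga m / ga n * (root a b * RtoC (s ^ (n + m)))).
    rewrite (CSum_ext _ (fun i => (pre * binc c n) * kernel_term xi c d n m (S i))).
    - rewrite CSum_scal by exact Sm. unfold Lm, Km. fold n m. rewrite E. unfold pre. ring.
    - intros i. unfold Lm, Km. rewrite ix_nat. fold n m.
      assert (Nn : natC (n + S i) <> 0) by (apply natC_neq; lia).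
      pose proof (root_split a b (ix i)) as RS. rewrite ix_nat in RS.
      pose proof (pow_split (S i) n m) as PS.
      transitivity (ga m / ga n * ((root a (ix i) * root (ix i) b) *
        (RtoC (s ^ (n + S i)) * RtoC (s ^ (S i + m)))) * binc c n *
        (binc d (S i) / natC (n + S i) * ker (S i) m)).
      + field. repeat split; solve [apply Ng|exact Nn].
      + rewrite RS, PS. unfold pre, kernel_term. fold (ker (S i) m).
        field. repeat split; solve [apply Ng|exact Nn]. }
  assert (key2 : forall a b, Lm a b = Km a b + CSum (fun i => Km a (ix i) * Lm (ix i) b)).
  { intros a b. set (n := Pos.to_nat a). set (m := Pos.to_nat b).
    destruct (ker_col_equation n m (posn a) (posn b)) as [Sm E].
    set (pre := ga m / ga n * (root a b * RtoC (s ^ (n + m)))).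
    rewrite (CSum_ext _ (fun i => (pre * binc d m) * kernel_term xi d c m n (S i))).
    - rewrite CSum_scal by exact Sm. unfold Lm, Km. fold n m. rewrite E. unfold pre. ring.
    - intros i. unfold Lm, Km. rewrite ix_nat. fold n m.
      assert (Nn : natC (m + S i) <> 0) by (apply natC_neq; lia).
      pose proof (root_split a b (ix i)) as RS. rewrite ix_nat in RS.
      pose proof (pow_split (S i) n m) as PS.
      rewrite (Nat.add_comm (S i) m). rewrite (Nat.add_comm (S i) m) in PS.
      transitivity (ga m / ga n * ((root a (ix i) * root (ix i) b) *
        (RtoC (s ^ (n + S i)) * RtoC (s ^ (m + S i)))) * binc d m *
        (binc c (S i) / natC (m + S i) * ker n (S i))).
      + field. repeat split; solve [apply Ng|exact Nn].
      + rewrite RS, PS. unfold pre, kernel_term. rewrite kerK_sym. fold (ker n (S i)).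
        field. repeat split; solve [apply Ng|exact Nn]. }
  destruct quartic_geometric_bound as [M4 HM4].
  destruct (binc_cd_bounded nu Hnu) as (B & HB0 & HB1 & HB2).
  destruct (kerK_bounded xi Hxi c d B HB1 HB2) as [M HM].
  destruct (gauge_inv_le nu Hnu k Hk Hcd) as (G & HG1 & HGi). fold ga in HGi.
  pose proof (gauge_le nu Hnu k Hk Hcd) as Gl. fold ga in Gl.
  pose proof (sqrt_unit xi Hxi) as Hs. fold s in Hs.
  set (C0 := (1 + B * B * G + G * Rabs M)%R).
  assert (HC0 : (1 <= C0)%R).
  { unfold C0. assert (0 <= B * B * G)%R by (repeat apply Rmult_le_pos; lra).
    pose proof (Rabs_pos M). assert (0 <= G * Rabs M)%R by (apply Rmult_le_pos; lra). lra. }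
  set (h := fun x : positive => (C0 * (INR (Pos.to_nat x) ^ 2 * s ^ Pos.to_nat x))%R).
  assert (h_pos : forall z, (0 <= h z)%R).
  { intros z. unfold h. apply Rmult_le_pos; [lra|].
    apply Rmult_le_pos; [apply pow2_ge_0|apply pow_le; lra]. }
  assert (h_sq : forall n, (rsum (fun i => h (ix i) ^ 2) n <= (C0 * sqrt M4) ^ 2)%R).
  { intros n. assert (0 <= M4)%R by (apply (HM4 O)).
    rewrite Rpow_mult_distr, pow2_sqrt by assumption.
    eapply Rle_trans; [|apply Rmult_le_compat_l; [apply pow2_ge_0|apply (HM4 n)]].
    rewrite <- rsum_scal. right. apply rsum_ext. intros i _. unfold h. rewrite ix_nat.
    rewrite <- (sqrt_unit_sq xi Hxi). fold s. rewrite !Rpow_mult_distr. ring. }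
  (* one factor x comes from the gauge and one from sqrt (x y) <= x y *)
  assert (bound : forall a b v, (Cmod v <= B * B + Rabs M)%R ->
    (Cmod (ga (Pos.to_nat b) / ga (Pos.to_nat a) *
      (root a b * RtoC (s ^ (Pos.to_nat a + Pos.to_nat b)) * v)) <= h a * h b)%R).
  { intros a b v Hv. unfold Cdiv. rewrite !Cmod_mult.
    assert (Ia : (Cmod (/ ga (Pos.to_nat a)) <= G * INR (Pos.to_nat a))%R).
    { destruct (Pos.to_nat a) as [|n] eqn:En; [pose proof (posn a); lia|]. apply HGi. }
    assert (Rab : (Cmod (root a b) <= INR (Pos.to_nat a) * INR (Pos.to_nat b))%R).
    { unfold root. rewrite Cmod_R, Rabs_pos_eq by apply sqrt_pos.
      assert (Ea : IZR (Zpos a) = INR (Pos.to_nat a)) by (rewrite INR_IPR; reflexivity).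
      assert (Eb : IZR (Zpos b) = INR (Pos.to_nat b)) by (rewrite INR_IPR; reflexivity).
      rewrite Ea, Eb.
      assert (1 <= INR (Pos.to_nat a))%R by (apply (le_INR 1), posn).
      assert (1 <= INR (Pos.to_nat b))%R by (apply (le_INR 1), posn).
      set (p := (INR (Pos.to_nat a) * INR (Pos.to_nat b))%R).
      assert (1 <= p)%R by (unfold p; nra).
      rewrite <- (sqrt_pow2 p) at 2 by lra. apply sqrt_le_1_alt. nra. }
    assert (Pa : (1 <= INR (Pos.to_nat a))%R) by (apply (le_INR 1), posn).
    assert (Pb : (1 <= INR (Pos.to_nat b))%R) by (apply (le_INR 1), posn).
    set (n := Pos.to_nat a) in *. set (m := Pos.to_nat b) in *.
    rewrite (Cmod_R (s ^ (n + m))), Rabs_pos_eq by (apply pow_le; lra).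
    unfold h. fold n m. rewrite pow_add.
    assert (Sn : (0 <= s ^ n)%R) by (apply pow_le; lra).
    assert (Sm : (0 <= s ^ m)%R) by (apply pow_le; lra).
    apply Rle_trans with (1 * (G * INR n) * ((INR n * INR m) * (s ^ n * s ^ m) * (B * B + Rabs M)))%R.
    - assert (Sq : (0 <= s ^ n * s ^ m)%R) by (apply Rmult_le_pos; assumption).
      apply Rmult_le_compat.
      + apply Rmult_le_pos; apply Cmod_ge_0.
      + apply Rmult_le_pos; [apply Rmult_le_pos; [apply Cmod_ge_0|exact Sq]|apply Cmod_ge_0].
      + apply Rmult_le_compat; [apply Cmod_ge_0|apply Cmod_ge_0|apply Gl|exact Ia].
      + apply Rmult_le_compat; [apply Rmult_le_pos; [apply Cmod_ge_0|exact Sq]|apply Cmod_ge_0| |exact Hv].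
        apply Rmult_le_compat_r; [exact Sq|exact Rab].
    - set (X := INR n) in *. set (Y := INR m) in *. set (q := (s ^ n * s ^ m)%R).
      assert (Hq : (0 <= q)%R) by (apply Rmult_le_pos; assumption).
      replace (C0 * (X ^ 2 * s ^ n) * (C0 * (Y ^ 2 * s ^ m)))%R
        with (q * ((X ^ 2 * Y ^ 2) * (C0 * C0)))%R by (unfold q; ring).
      replace (1 * (G * X) * (X * Y * q * (B * B + Rabs M)))%R
        with (q * ((X ^ 2 * Y) * (B * B * G + G * Rabs M)))%R by ring.
      apply Rmult_le_compat_l; [exact Hq|].
      assert (0 <= B * B * G)%R by (repeat apply Rmult_le_pos; lra).
      assert (0 <= G * Rabs M)%R by (apply Rmult_le_pos; [lra|apply Rabs_pos]).
      apply Rmult_le_compat; [nra|lra| |].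
      + apply Rmult_le_compat_l; [apply pow2_ge_0|]. nra.
      + apply Rle_trans with C0; [unfold C0; lra|]. nra. }
  assert (domL : dominated h Lm).
  { intros a b. apply bound. rewrite <- (Rplus_0_r (Cmod _)).
    apply Rplus_le_compat; [|apply Rabs_pos].
    unfold Cdiv. rewrite !Cmod_mult. rewrite <- (Rmult_1_r (B * B)).
    apply Rmult_le_compat; [apply Rmult_le_pos; apply Cmod_ge_0|apply Cmod_ge_0| |].
    - apply Rmult_le_compat; try apply Cmod_ge_0; [apply HB1|apply HB2].
    - apply natC_inv_le. pose proof (posn a). lia. }
  assert (domK : dominated h Km).
  { intros a b. apply bound. rewrite <- (Rplus_0_l (Cmod _)).
    apply Rplus_le_compat; [apply Rmult_le_pos; exact HB0|].
    eapply Rle_trans; [apply HM; pose proof (posn a); lia|apply Rle_abs]. }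
  assert (Entry : K_kernel nu xi x y = Km x y).
  { unfold K_kernel, K_op, L_op. rewrite EL.
    apply (matrix_entry_resolvent h (C0 * sqrt M4)); try assumption.
    apply Rmult_le_pos; [lra|apply sqrt_pos]. }
  rewrite Entry. unfold Km, root. fold ga. field. split; apply Ng.
Qed.

End CorrelationKernel.

(** * The contour integrals of the theorem *)

Lemma two_pi_i_neq : 2 * PI * Ci <> 0.
Proof.
  pose proof PI_RGT_0. repeat apply Cmult_neq_0.
  - intros E. apply RtoC_inj in E. lra.
  - intros E. apply RtoC_inj in E. lra.
  - intros E. apply (f_equal Im) in E. simpl in E. lra.
Qed.

Lemma cint_winding gam z : piecewise_C1 gam -> off_curve gam z -> winding_number gam z = 1 ->
  cint gam (fun w => / (w - z)) (2 * PI * Ci).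
Proof.
  intros Hp Ho Hw. destruct (cint_exists gam (fun w => / (w - z)) Hp) as [l Hl].
  - intros t Ht. apply (ccont_comp (fun w => / w) (fun w => w - z)).
    + apply ccont_inv. intros E. apply (Ho t Ht), Ceq_minus, E.
    + apply (ccont_ext_near (fun w => w + - z)); [apply cnear_all; reflexivity|].
      apply ccont_plus; [apply ccont_id|apply ccont_const].
  - unfold winding_number in Hw. rewrite (cint_contour_int _ _ _ Hl) in Hw.
    replace (2 * PI * Ci) with l; [exact Hl|].
    rewrite <- (Cmult_1_l (2 * PI * Ci)), <- Hw. field.
    pose proof two_pi_i_neq as N. repeat split; intros E; apply N; rewrite E; ring.
Qed.

Section Contours.

Variable (xi : R).
Hypothesis Hxi : (0 < xi < 1)%R.

Let s := sqrt xi.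
Let rho := (/ s)%R.

Lemma rho_gt_1 : (1 < rho)%R.
Proof.
  pose proof (sqrt_unit xi Hxi) as Hs. fold s in Hs. unfold rho. rewrite <- Rinv_1.
  apply Rinv_lt_contravar; lra.
Qed.

(** A point [a] of the cut [(0, sqrt xi]] is avoided exactly when [1 / w] avoids the ray at [1 / a]. *)
Lemma admissible_loop gam : admissible_contour xi gam -> loop rho gam.
Proof.
  intros (Hp & (Hc & _) & Hor & Hav & H0 & _).
  pose proof (sqrt_unit xi Hxi) as Hs. fold s in Hs. pose proof rho_gt_1 as Hr.
  split; [exact Hp|]. split; [exact Hc|]. split.
  - intros t Ht.
    assert (N0 : gam t <> 0).
    { apply (Hav 0%R); [left; fold s; lra|exact Ht]. }
    assert (Rl : forall z : C, Im z = 0%R -> z = RtoC (Re z)).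
    { intros [a b] E. simpl in E. rewrite E. reflexivity. }
    split; [exact N0|]. split.
    + intros [E L]. apply (Hav (Re (gam t))) with (s := t); [right|exact Ht|apply Rl, E].
      fold s. unfold rho in L. unfold Rdiv. lra.
    + intros [E L]. set (q := Re (/ gam t)) in *. pose proof (Rl _ E) as Eq. fold q in Eq.
      assert (Hq : (0 < q)%R) by lra.
      apply (Hav (/ q)%R) with (s := t); [left|exact Ht|].
      * fold s. split; [left; apply Rinv_0_lt_compat, Hq|].
        rewrite <- (Rinv_inv s). apply Rinv_le_contravar; [apply Rinv_0_lt_compat; lra|exact L].
      * rewrite RtoC_inv by lra. rewrite <- Eq. field. exact N0.
  - apply (cint_ext _ (fun w => / (w - 0))); [intros; f_equal; ring|].
    apply cint_winding; [exact Hp|apply H0|apply Hor, H0].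
Qed.

Lemma hol_ext f g a : (forall z, off_ray rho z -> f z = g z) -> hol rho f a -> hol rho g a.
Proof.
  intros E (H1 & H2 & H3). split; [exact H1|]. split.
  - intros z Hz. rewrite <- E by (apply off_ray_disc, Hz). apply H2, Hz.
  - intros z Hz. apply (smooth_ext_near f); [|apply H3, Hz].
    eapply cnear_impl; [|apply (off_ray_open rho z Hz)]. exact E.
Qed.

Section Exponent.

Variables (e : C) (B : R).
Hypothesis He : forall n, (Cmod (binc e n) <= B)%R.

Definition bcoef (n : nat) : C := binc e n * RtoC (s ^ n).
Definition bcoef1 : fps := fmul bcoef (fsub fone (fscal (RtoC s) fX)).

Lemma hol_bcoef : hol rho (fun z => Cpower (1 - z * RtoC s) (- e)) bcoef.
Proof. apply hol_binomial; [apply (sqrt_unit xi Hxi)|exists B; exact He]. Qed.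

Lemma linear_finite n : (2 <= n)%nat -> fsub fone (fscal (RtoC s) fX) n = RtoC 0.
Proof. intros H. destruct n as [|[|n]]; try lia. unfold fsub, fone, fconst, fscal, fX. ring. Qed.

Lemma hol_bcoef1 : hol rho (fun z => Cpower (1 - z * RtoC s) (1 - e)) bcoef1.
Proof.
  apply (hol_ext (fun z => Cpower (1 - z * RtoC s) (- e) * (1 - z * RtoC s))).
  - intros z Hz. replace (1 - e) with (- e + 1) by ring. rewrite Cpower_plus. f_equal. symmetry.
    apply Cpower_1. intros E. pose proof (sqrt_unit xi Hxi) as Hs. fold s in Hs.
    apply Hz. assert (Ez : z = RtoC rho).
    { unfold rho. rewrite RtoC_inv by lra.
      assert (Ns : RtoC s <> 0) by (intros Z; apply RtoC_inj in Z; lra).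
      replace z with ((1 - (1 - z * RtoC s)) / RtoC s) by (field; exact Ns).
      rewrite E. field. exact Ns. }
    rewrite Ez. simpl. lra.
  - apply hol_mul; [apply hol_bcoef|]. split; [apply (psr_finite _ 2), linear_finite|]. split.
    + intros z _. rewrite (PSC_finite _ 2) by apply linear_finite. simpl.
      unfold fsub, fone, fconst, fscal, fX. ring.
    + intros z _. apply smooth_minus; [apply smooth_const|].
      apply (smooth_mult (fun z => z) (fun _ => RtoC s)); [apply smooth_id|apply smooth_const].
Qed.

Lemma corr_bcoef n : corr bcoef bcoef n = RtoC (s ^ n) * fev xi (lcoef e n).
Proof.
  unfold corr, fev. rewrite <- CSum_scal.
  - apply CSum_ext. intros i. unfold bcoef, fterm, lcoef.
    rewrite <- (sqrt_unit_sq xi Hxi). fold s. rewrite pow_add, Rpow_mult_distr, !RtoC_mult. ring.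
  - eapply fle_summable, (fle_lcoef xi Hxi B), He.
Qed.

Lemma corr_bcoef1 n : corr bcoef bcoef1 n = RtoC (s ^ n) * fev xi (lcoef1 e n).
Proof.
  pose proof (proj1 hol_bcoef) as Pb. unfold bcoef1.
  rewrite (corr_fmul rho rho_gt_1) by (try exact Pb; apply (psr_finite _ 2), linear_finite).
  transitivity (csum (fun k => fsub fone (fscal (RtoC s) fX) k * corr bcoef bcoef (n + k)) 2).
  - apply csums_CSum, csums_finite. intros k Hk. rewrite linear_finite by exact Hk. ring.
  - rewrite (fev_lcoef1 xi Hxi B e n He). cbn [csum]. rewrite !corr_bcoef.
    unfold fsub, fone, fconst, fscal, fX. rewrite Nat.add_0_r, Nat.add_1_r.
    replace (RtoC xi) with (RtoC s * RtoC s)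
      by (rewrite <- RtoC_mult; f_equal; apply (sqrt_unit_sq xi Hxi)).
    simpl (s ^ S n)%R. rewrite RtoC_mult. ring.
Qed.

End Exponent.

Lemma inv_pow (w : C) n : w <> 0 -> / w ^ n = (/ w) ^ n.
Proof. intros H. symmetry. apply Cpow_inv, H. Qed.

(** A contour integral of the second type: a Fourier coefficient of a symmetric symbol. *)
Lemma single_integral gam e B n : (forall n, (Cmod (binc e n) <= B)%R) -> loop rho gam ->
  cint gam (fun w => Cpower (1 - w * RtoC s) (- e) * Cpower (1 - RtoC s / w) (- e) * / w ^ S n)
    (2 * PI * Ci * (RtoC (s ^ n) * fev xi (lcoef e n))).
Proof.
  intros He Hg. pose proof (hol_bcoef e B He) as Hb.
  pose proof (cint_residue rho rho_gt_1 gam _ _ _ _ Hg Hb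
    (hol_mul _ _ _ _ _ (hol_pow rho (S n)) Hb)) as I. cbv beta in I.
  rewrite (corr_fmono_l rho rho_gt_1), (corr_bcoef e B He) in I by apply Hb.
  eapply cint_ext; [|exact I]. intros t Ht. destruct Hg as (_ & _ & Ho & _).
  destruct (Ho t Ht) as (N0 & _). cbv beta. rewrite inv_pow by exact N0.
  unfold Cdiv. rewrite (Cmult_comm (RtoC s)). ring.
Qed.

Section DoubleIntegral.

Variables (c d : C) (B : R).
Hypothesis Hc : forall n, (Cmod (binc c n) <= B)%R.
Hypothesis Hd : forall n, (Cmod (binc d n) <= B)%R.

Definition double_integrand (x y : nat) (w1 w2 : C) : C :=
  Cpower (1 - w1 * RtoC s) (- c) * Cpower (1 - RtoC s / w1) (1 - c) *
  Cpower (1 - w2 * RtoC s) (- d) * Cpower (1 - RtoC s / w2) (1 - d) *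
  ((/ w1 ^ x) * (/ w2 ^ y) / (w1 * w2 - 1)).

(** The inner integral is a Cauchy integral at [1 / w1]; it leaves the part of the second symbol
    that is holomorphic at [0], evaluated at [1 / w1], and the outer integral is then a residue. *)
Lemma double_integral gam1 gam2 x y : admissible_contour xi gam1 -> admissible_contour xi gam2 ->
  inverse_inside gam1 gam2 ->
  contour_int gam1 (fun w1 => contour_int gam2 (double_integrand x y w1)) =
  (2 * PI * Ci) * (2 * PI * Ci) * (RtoC (s ^ (x + y)) *
    CSum (fun m => RtoC (xi ^ m) * (fev xi (lcoef1 c (x + m)) * fev xi (lcoef1 d (y + m))))).
Proof.
  intros A1 A2 Hin.
  pose proof (admissible_loop gam1 A1) as G1. pose proof (admissible_loop gam2 A2) as G2.
  pose proof rho_gt_1 as Hr.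
  pose proof (hol_bcoef c B Hc) as Hc0. pose proof (hol_bcoef1 c B Hc) as Hc1.
  pose proof (hol_bcoef d B Hd) as Hd0. pose proof (hol_bcoef1 d B Hd) as Hd1.
  pose proof (hol_mul _ _ _ _ _ (hol_pow rho y) Hd1) as Hd2.
  destruct (cint_cauchy rho Hr _ _ _ _ Hd0 Hd2) as (P & HP & Cau).
  set (p := corr (bcoef d) (fmul (fmono y) (bcoef1 d))) in *.
  pose proof (hol_mul _ _ _ _ _ (hol_pow rho (S x)) (hol_mul _ _ _ _ _ Hc1 HP)) as Hpsi.
  pose proof (cint_residue rho Hr gam1 _ _ _ _ G1 Hc0 Hpsi) as I. cbv beta in I.
  rewrite (corr_fmono_l rho Hr) in I; [|apply Hc0|apply (hol_mul _ _ _ _ _ Hc1 HP)].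
  rewrite (corr_fmul rho Hr) in I; [|apply Hc0|apply Hc1|apply HP].
  assert (E : CSum (fun k => p k * corr (bcoef c) (bcoef1 c) (x + k)) = RtoC (s ^ (x + y)) *
    CSum (fun m => RtoC (xi ^ m) * (fev xi (lcoef1 c (x + m)) * fev xi (lcoef1 d (y + m))))).
  { rewrite <- CSum_scal.
    - apply CSum_ext. intros m. unfold p. rewrite (corr_fmono_r rho Hr) by (apply Hd0 || apply Hd1).
      rewrite (corr_bcoef1 c B Hc), (corr_bcoef1 d B Hd).
      replace (xi ^ m)%R with (s ^ m * s ^ m)%R
        by (rewrite <- Rpow_mult_distr; f_equal; apply (sqrt_unit_sq xi Hxi)).
      rewrite (Nat.add_comm m y), !pow_add, !RtoC_mult. ring.
    - set (M := (B * B / (1 - xi) + 1 * (B * B / (1 - xi)))%R).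
      assert (HM : (0 <= M)%R) by (apply (fle_pos xi _ _ (fle_lcoef1 xi Hxi B c 0 Hc))).
      apply (summable_le _ (fun m => RtoC (M * M) * RtoC (xi ^ m)));
        [|apply summable_scal, summable_geom; lra].
      intros m. rewrite !Cmod_mult, !Cmod_R, Rmult_comm. apply Rmult_le_compat_r; [apply Rabs_pos|].
      rewrite Rabs_pos_eq by (apply Rmult_le_pos; exact HM).
      apply Rmult_le_compat; try apply Cmod_ge_0; apply fle_fev, fle_lcoef1; assumption. }
  rewrite E in I. apply cint_contour_int.
  set (V := RtoC (s ^ (x + y)) * CSum _) in *.
  replace (2 * PI * Ci * (2 * PI * Ci) * V) with ((2 * PI * Ci) * (2 * PI * Ci * V)) by ring.
  eapply cint_ext; [|apply (cint_scal _ (2 * PI * Ci) _ _ I)]. intros t Ht. cbv beta.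
  pose proof G1 as (_ & _ & Ho1 & _). destruct (Ho1 t Ht) as (N1 & O1 & O1').
  set (w1 := gam1 t) in *. symmetry. apply cint_contour_int.
  assert (Nu : / w1 <> 0).
  { intros Z. assert (Z2 : w1 * / w1 = 1) by (field; exact N1). rewrite Z, Cmult_0_r in Z2.
    apply RtoC_inj in Z2. lra. }
  assert (Iu : inside gam2 (/ w1)) by (apply Hin, Ht).
  assert (O2 : off_ray rho (/ / w1)) by (replace (/ / w1) with w1 by (field; exact N1); exact O1).
  pose proof (Cau gam2 (/ w1) G2 Nu O1' O2 (fun t2 Ht2 => proj1 Iu t2 Ht2)
    (cint_winding gam2 (/ w1) (proj1 A2) (proj1 Iu) (proj1 (proj2 (proj2 A2)) _ Iu))) as J.
  pose proof (cint_scal _ (Cpower (1 - w1 * RtoC s) (- c) * Cpower (1 - / w1 * RtoC s) (1 - c) *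
    (/ w1) ^ S x) _ _ J) as J2. cbv beta in J2.
  replace (2 * PI * Ci * (Cpower (1 - w1 * RtoC s) (- c) *
    ((/ w1) ^ S x * (Cpower (1 - / w1 * RtoC s) (1 - c) * P (/ w1)))))
    with (Cpower (1 - w1 * RtoC s) (- c) * Cpower (1 - / w1 * RtoC s) (1 - c) *
    (/ w1) ^ S x * (2 * PI * Ci * P (/ w1))) by ring.
  eapply cint_ext; [|exact J2]. intros t2 Ht2. cbv beta.
  pose proof G2 as (_ & _ & Ho2 & _). destruct (Ho2 t2 Ht2) as (N2 & _).
  assert (Nw : gam2 t2 <> / w1) by (apply (proj1 Iu t2 Ht2)).
  set (w2 := gam2 t2) in *. unfold double_integrand. rewrite !inv_pow by assumption.
  unfold Cdiv. rewrite !(Cmult_comm (RtoC s)).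
  assert (Nd : w2 - / w1 <> 0) by (intros Z; apply Nw, Ceq_minus, Z).
  assert (Nd' : w1 * w2 - 1 <> 0).
  { intros Z. apply Nd. replace (w2 - / w1) with ((w1 * w2 - 1) / w1) by (field; exact N1).
    rewrite Z. field. exact N1. }
  replace (/ (w1 * w2 - 1)) with (/ w1 * / (w2 - / w1)).
  - simpl ((/ w1) ^ S x). ring.
  - field. split; [exact Nd'|exact N1].
Qed.

End DoubleIntegral.

End Contours.

Theorem proposition3 :
  forall (xi : R) (nu : C),
    (0 < xi < 1)%R ->
    (Im nu = 0%R /\ (0 <= Re nu < / 2)%R) \/ Re nu = 0%R ->
    forall (gam1 gam2 gam3 gam4 : R -> C),
      admissible_contour xi gam1 -> admissible_contour xi gam2 ->
      inverse_inside gam1 gam2 ->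
      admissible_contour xi gam3 -> admissible_contour xi gam4 ->
      forall x y : positive,
        g_factor nu (Zpos x) / g_factor nu (Zpos y) * K_kernel nu xi x y =
        2 * sqrt (IZR (Zpos x) * IZR (Zpos y)) / (IZR (Zpos x) + IZR (Zpos y)) *
        (1 / (2 * PI * Ci) ^ 2) *
        contour_int gam1 (fun w1 => contour_int gam2 (fun w2 =>
          Cpower (1 - w1 * sqrt xi) (- / 2 + nu) *
          Cpower (1 - sqrt xi / w1) (/ 2 + nu) *
          Cpower (1 - w2 * sqrt xi) (- / 2 - nu) *
          Cpower (1 - sqrt xi / w2) (/ 2 - nu) *
          ((/ w1 ^ Pos.to_nat x) * (/ w2 ^ Pos.to_nat y) / (w1 * w2 - 1))))
        - sqrt (IZR (Zpos x) * IZR (Zpos y)) / (IZR (Zpos x) + IZR (Zpos y)) *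
        ((1 - xi) / (2 * PI * Ci) ^ 2) *
        contour_int gam3 (fun w1 => contour_int gam4 (fun w2 =>
          Cpower (1 - w1 * sqrt xi) (- / 2 + nu) *
          Cpower (1 - sqrt xi / w1) (- / 2 + nu) *
          Cpower (1 - w2 * sqrt xi) (- / 2 - nu) *
          Cpower (1 - sqrt xi / w2) (- / 2 - nu) *
          (1 / (w1 ^ (Pos.to_nat x + 1) * w2 ^ (Pos.to_nat y + 1))))).
Proof.
  intros xi nu Hxi Hnu gam1 gam2 gam3 gam4 A1 A2 Hin A3 A4 x y.
  rewrite (K_kernel_value xi nu Hxi Hnu). unfold ker.
  destruct (binc_cd_bounded nu Hnu) as (B & _ & HBc & HBd).
  rewrite (fev_kerK xi Hxi _ _ B HBc HBd), (fev_kerT xi Hxi _ _ B HBc HBd).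
  set (n := Pos.to_nat x). set (m := Pos.to_nat y).
  assert (e1 : forall z, Cpower z (- / 2 + nu) = Cpower z (- (/ 2 - nu))) by (intros; f_equal; ring).
  assert (e2 : forall z, Cpower z (- / 2 - nu) = Cpower z (- (/ 2 + nu))) by (intros; f_equal; ring).
  assert (e3 : forall z, Cpower z (/ 2 + nu) = Cpower z (1 - (/ 2 - nu))) by (intros; f_equal; field).
  assert (e4 : forall z, Cpower z (/ 2 - nu) = Cpower z (1 - (/ 2 + nu))) by (intros; f_equal; field).
  pose proof (double_integral xi Hxi _ _ B HBc HBd gam1 gam2 n m A1 A2 Hin) as I1.
  assert (I2 : contour_int gam3 (fun w1 => contour_int gam4 (fun w2 =>
      Cpower (1 - w1 * sqrt xi) (- (/ 2 - nu)) * Cpower (1 - sqrt xi / w1) (- (/ 2 - nu)) *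
      Cpower (1 - w2 * sqrt xi) (- (/ 2 + nu)) * Cpower (1 - sqrt xi / w2) (- (/ 2 + nu)) *
      (1 / (w1 ^ (n + 1) * w2 ^ (m + 1))))) =
    2 * PI * Ci * (RtoC (sqrt xi ^ m) * fev xi (lcoef (/ 2 + nu) m)) *
    (2 * PI * Ci * (RtoC (sqrt xi ^ n) * fev xi (lcoef (/ 2 - nu) n)))).
  { pose proof (admissible_loop xi Hxi gam3 A3) as G3.
    pose proof (admissible_loop xi Hxi gam4 A4) as G4.
    apply cint_contour_int. eapply cint_ext;
      [|apply cint_scal, (single_integral xi Hxi gam3 _ B n HBc G3)].
    intros t Ht. cbv beta. set (w1 := gam3 t). symmetry. apply cint_contour_int.
    rewrite (Cmult_comm (2 * PI * Ci * _)). eapply cint_ext;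
      [|apply cint_scal, (single_integral xi Hxi gam4 _ B m HBd G4)].
    intros t2 Ht2. cbv beta. set (w2 := gam4 t2). rewrite !Nat.add_1_r.
    assert (N1 : w1 ^ S n <> 0) by (apply Cpow_nz, (proj1 (proj2 (proj2 G3)) t Ht)).
    assert (N2 : w2 ^ S m <> 0) by (apply Cpow_nz, (proj1 (proj2 (proj2 G4)) t2 Ht2)).
    set (u1 := w1 ^ S n) in *. set (u2 := w2 ^ S m) in *.
    replace (1 / (u1 * u2)) with (/ u1 * / u2) by (field; split; assumption). ring. }
  match goal with |- context [contour_int gam1 ?f] =>
    replace (contour_int gam1 f) with (contour_int gam1 (fun w1 => contour_int gam2
      (double_integrand xi (/ 2 - nu) (/ 2 + nu) n m w1)))
      by (apply (f_equal (contour_int gam1)); extensionality w1;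
          apply (f_equal (contour_int gam2)); extensionality w2;
          unfold double_integrand; rewrite e1, e2, e3, e4; reflexivity)
  end.
  rewrite I1.
  match goal with |- context [contour_int gam3 ?f] =>
    match type of I2 with contour_int gam3 ?g = _ =>
      replace (contour_int gam3 f) with (contour_int gam3 g)
        by (apply (f_equal (contour_int gam3)); extensionality w1;
            apply (f_equal (contour_int gam4)); extensionality w2;
            rewrite !e1, !e2; reflexivity)
    end
  end.
  rewrite I2, (IZR_pos_natC x), (IZR_pos_natC y). fold n m. rewrite <- natC_plus.
  assert (N : natC (n + m) <> 0) by (apply natC_neq; unfold n; lia).
  pose proof two_pi_i_neq as Np. set (w := 2 * PI * Ci) in *.
  rewrite pow_add, RtoC_mult. simpl (w ^ 2). field. split; assumption.
Qed.
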